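(* The metric of revolution $$g_0=\frac{9+(1+8\cos^2 v)^2}{1+8\cos^2 v}\left(du^2+\frac{dv^2}{1+8\cos^2 v}\right),\qquad 0\le u<\pi/2,\ 0\le v<\pi,$$ is an extremal metric for the first eigenvalue on the Klein bottle $\mathbb{K}$. The surface $(\mathbb{K},g_0)$ admits a minimal isometric embedding into a sphere $\mathbb{S}^4$ by the first eigenfunctions. The first eigenvalue $\lambda_1$ of the Laplacian for this metric has multiplicity $5$ and satisfies the equality $$\lambda_1\,\mathrm{Area}(\mathbb{K},g_0)=12\pi\,E(2\sqrt2/3),$$ where $E(\cdot)$ is the complete elliptic integral of the second kind.
   Context: For a Riemannian metric $g$ on a closed surface, $\lambda_1(g)$ denotes the smallest positive eigenvalue of the (nonnegative) Laplace–Beltrami operator; the corresponding eigenfunctions are called the first eigenfunctions. Extremal metric: a metric $g_0$ on a surface is extremal for the first eigenvalue if for any analytic deformation $g_t$ of $g_0$ in the class of metrics of fixed area one has $\lambda_1(g_t)\le\lambda_1(g_0)+o(t)$ as $t\to0$. Immersion or embedding by the first eigenfunctions: a map into a round sphere $\mathbb{S}^4\subset\mathbb{R}^5$ centered at the origin, all of whose coordinate functions are first eigenfunctions. Elliptic integral: $E(k)=\int_0^{\pi/2}\sqrt{1-k^2\sin^2\theta}\,d\theta$ (so $k$ is the modulus). The Klein bottle: $\mathbb{K}$ is the quotient of the $(u,v)$-plane by the group generated by $(u,v)\mapsto(u,v+\pi)$ and $(u,v)\mapsto(u+\pi/2,\sigma(v))$. Here $\sigma:\mathbb{R}\to\mathbb{R}$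 is the decreasing smooth involution with $\sigma(0)=\pi/2$, $\cos\sigma(v)=\dfrac{\sin v}{\sqrt{1+8\cos^2v}}$ and $\sin\sigma(v)=\dfrac{3\cos v}{\sqrt{1+8\cos^2 v}}$. The displayed metric is invariant under this group and hence defines a metric on $\mathbb{K}$; a fundamental domain is $0\le u<\pi/2$, $0\le v<\pi$. Equivalently, set $x=2u$ and $y=2z(v)+K(1/2)/2$, where $z(v)=\int_0^v\frac{ds}{\sqrt{1+8\cos^2 s}}$ and $K(k)=\int_0^{\pi/2}\frac{d\theta}{\sqrt{1-k^2\sin^2\theta}}$. Then $\mathbb{K}$ is the quotient of the $(x,y)$-plane by the group generated by $(x,y)\mapsto(x+\pi,-y)$ and $(x,y)\mapsto(x,y+2K(1/2))$. *)

(* Defs.v *)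
(* Real analysis over Stdlib's R, with Coquelicot. *)
From Stdlib Require Import Reals Relations List Lra Lia.
From Coquelicot Require Import Coquelicot.
Open Scope R_scope.

Definition pdu (f : R -> R -> R) (u v : R) : R := Derive (fun z => f z v) u.
Definition pdv (f : R -> R -> R) (u v : R) : R := Derive (fun z => f u z) v.

Definition smooth2 (f : R -> R -> R) : Prop :=
  forall (n : nat) (u v : R), ex_diff_n f n u v.

Definition klein_involution (sigma : R -> R) : Prop :=
  (forall (n : nat) (v : R), ex_derive_n sigma n v) /\
  (forall v w : R, v < w -> sigma w < sigma v) /\
  (forall v : R, sigma (sigma v) = v) /\
  sigma 0 = PI / 2 /\
  (forall v : R, cos (sigma v) = sin v / sqrt (1 + 8 * cos v ^ 2)) /\
  (forall v : R, sin (sigma v) = 3 * cos v / sqrt (1 + 8 * cos v ^ 2)).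

(* The closure of sin, cos and 1 / (1 + 8 cos^2) under ring operations. *)
Inductive trig_fun : (R -> R) -> Prop :=
| trig_const c : trig_fun (fun _ => c)
| trig_sin : trig_fun sin
| trig_cos : trig_fun cos
| trig_inv : trig_fun (fun v => / (1 + 8 * cos v ^ 2))
| trig_plus f g : trig_fun f -> trig_fun g -> trig_fun (fun v => f v + g v)
| trig_mult f g : trig_fun f -> trig_fun g -> trig_fun (fun v => f v * g v).

Lemma w_pos v : 0 < 1 + 8 * cos v ^ 2.
Proof. nra. Qed.

Lemma trig_fun_derive f : trig_fun f ->
  exists f', trig_fun f' /\ forall v, is_derive f v (f' v).
Proof.
induction 1 as [c| | | |f g Hf [f' [Tf Df]] Hg [g' [Tg Dg]]|f g Hf [f' [Tf Df]] Hg [g' [Tg Dg]]].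
- exists (fun _ => 0); split; [constructor|intro v; auto_derive; auto].
- exists cos; split; [constructor|intro v; auto_derive; auto; ring].
- exists (fun v => -1 * sin v); split; [repeat constructor|intro v; auto_derive; auto; ring].
- exists (fun v => (16 * (cos v * sin v)) *
      (/ (1 + 8 * cos v ^ 2) * / (1 + 8 * cos v ^ 2))).
  split; [apply trig_mult; [apply (trig_mult (fun _ => 16) (fun v => cos v * sin v)) | apply trig_mult]; repeat constructor|].
  intro v; pose proof (w_pos v); auto_derive; [lra|field; lra].
- exists (fun v => f' v + g' v); split; [now constructor|].
  intro v; apply (is_derive_plus (V := R_NormedModule)); auto.
- exists (fun v => f' v * g v + f v * g' v); split; [repeat constructor; auto|].
  intro v; apply (is_derive_mult (K := R_AbsRing) f g v (f' v) (g' v)); auto; intros; apply Rmult_comm.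
Qed.

Lemma trig_fun_derive_n f n : trig_fun f ->
  exists f', trig_fun f' /\ forall v, Derive_n f n v = f' v.
Proof.
intro Hf; induction n as [|n [f' [Tf Df]]]; [now exists f|].
destruct (trig_fun_derive f' Tf) as [f'' [Tf' Df']].
exists f''; split; [easy|]; intro v; simpl.
rewrite (Derive_ext _ f' v Df); apply is_derive_unique, Df'.
Qed.

(* The conditions determine sigma, by continuity; this is the witness
   sigma v = PI / 2 - int_0^v 3 / (1 + 8 cos^2). *)
Lemma klein_involution_exists : exists sigma : R -> R, klein_involution sigma.
Proof.
set (d := fun x : R => 3 * / (1 + 8 * cos x ^ 2)).
set (s := fun v => PI / 2 - RInt d 0 v).
assert (Td : trig_fun (fun v => -1 * d v)).
{ apply (trig_mult (fun _ => -1) d); [constructor|]. apply (trig_mult (fun _ => 3)); constructor. }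
assert (Cd : forall v, continuous d v).
{ intro v; apply (ex_derive_continuous (V := R_NormedModule) d); unfold d; pose proof (w_pos v); auto_derive; lra. }
assert (Ds : forall v, is_derive s v (-1 * d v)).
{ intro v. unfold s.
  replace (-1 * d v) with (minus 0 (d v)) by (unfold minus, plus, opp; simpl; ring).
  apply (is_derive_minus (V := R_NormedModule) (fun _ => PI / 2) (fun v => RInt d 0 v)).
  - apply (is_derive_const (V := R_NormedModule)).
  - apply (is_derive_RInt (V := R_NormedModule) d (fun v => RInt d 0 v) 0).
    + apply filter_forall; intro b; apply (RInt_correct (V := R_CompleteNormedModule)), (ex_RInt_continuous (V := R_CompleteNormedModule)); intros; apply Cd.
    + apply Cd. }
assert (s0 : s 0 = PI / 2).
{ unfold s; rewrite (RInt_point (V := R_CompleteNormedModule)). unfold zero; simpl; ring. }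
assert (dpos : forall v, 0 < d v).
{ intro v; unfold d; pose proof (Rinv_0_lt_compat _ (w_pos v)); lra. }
assert (const : forall f : R -> R, (forall v, is_derive f v 0) -> forall v, f v = f 0).
{ intros f Hf v. destruct (MVT_gen f 0 v (fun _ => 0)) as [c [_ Hc]].
  - intros; apply Hf.
  - intros x _. apply continuity_pt_filterlim, (ex_derive_continuous (V := R_NormedModule) f); exists 0; apply Hf.
  - lra. }
assert (mv : forall a b, exists c, s b - s a = -1 * d c * (b - a)).
{ intros a b. destruct (MVT_gen s a b (fun v => -1 * d v)) as [c [_ Hc]].
  - intros; apply Ds.
  - intros x _. apply continuity_pt_filterlim, (ex_derive_continuous (V := R_NormedModule) s); eexists; apply Ds.
  - now exists c. }
assert (dec : forall v w, v < w -> s w < s v).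
{ intros v w H; destruct (mv v w) as [c Hc]; pose proof (dpos c); nra. }
assert (SC : forall v, sin v ^ 2 = 1 - cos v ^ 2).
{ intro v; pose proof (sin2_cos2 v) as H; unfold Rsqr in H; nra. }
(* cos sigma and sin sigma, up to the factor sqrt *)
assert (K : forall v, sin v * cos (s v) + 3 * cos v * sin (s v) = sqrt (1 + 8 * cos v ^ 2)).
{ intro v.
  assert (Q : (sin v * cos (s v) + 3 * cos v * sin (s v)) / sqrt (1 + 8 * cos v ^ 2)
    = (sin 0 * cos (s 0) + 3 * cos 0 * sin (s 0)) / sqrt (1 + 8 * cos 0 ^ 2)).
  { apply (const (fun v => (sin v * cos (s v) + 3 * cos v * sin (s v)) / sqrt (1 + 8 * cos v ^ 2))).
    intro x. pose proof (w_pos x) as Hw. pose proof (sqrt_lt_R0 _ Hw) as Hr.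
    pose proof (sqrt_sqrt _ (Rlt_le _ _ Hw)) as Hrr.
    pose proof (is_derive_unique _ _ _ (Ds x)) as Us.
    auto_derive.
    - repeat split; try (eexists; apply Ds); simpl in *; lra.
    - change (Derive (fun x0 => s x0) x) with (Derive s x). rewrite Us; unfold d.
      apply Rmult_eq_reg_r with (sqrt (1 + 8 * cos x ^ 2) * sqrt (1 + 8 * cos x ^ 2) * sqrt (1 + 8 * cos x ^ 2));
        [|apply Rgt_not_eq; repeat apply Rmult_lt_0_compat; lra].
      simpl in *.
      set (r := sqrt (1 + 8 * (cos x * (cos x * 1)))) in *.
      set (c := cos x) in *. set (z := sin x) in *.
      set (C := cos (s x)). set (S := sin (s x)).
      assert (zz : z * z = 1 - c * c) by (pose proof (SC x) as H; fold c z in H; nra).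
      transitivity ((c * C - 3 * z * S + (z * S - 3 * c * C) * (3 / (r * r))) * (r * r) +
                    8 * c * z * (z * C + 3 * c * S)).
      + rewrite <- Hrr. field. lra.
      + replace ((c * C - 3 * z * S + (z * S - 3 * c * C) * (3 / (r * r))) * (r * r))
          with ((c * C - 3 * z * S) * (r * r) + 3 * (z * S - 3 * c * C)) by (field; lra).
        rewrite Hrr.
        transitivity (8 * c * C * (z * z + c * c - 1)).
        * ring.
        * rewrite zz; ring. }
  rewrite s0, sin_0, cos_0, cos_PI2, sin_PI2 in Q.
  replace (1 + 8 * 1 ^ 2) with (3 * 3) in Q by ring.
  rewrite sqrt_square in Q by lra.
  pose proof (sqrt_lt_R0 _ (w_pos v)) as Hr.
  apply Rmult_eq_reg_r with (/ sqrt (1 + 8 * cos v ^ 2)); [|apply Rinv_neq_0_compat; lra].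
  rewrite Rinv_r by lra. unfold Rdiv in Q; rewrite Q; field. }
(* K is an equality case of Cauchy-Schwarz *)
assert (CSs : forall v, cos (s v) = sin v / sqrt (1 + 8 * cos v ^ 2) /\
                      sin (s v) = 3 * cos v / sqrt (1 + 8 * cos v ^ 2)).
{ intro v. pose proof (w_pos v) as Hw. pose proof (sqrt_lt_R0 _ Hw) as Hr.
  pose proof (sqrt_sqrt _ (Rlt_le _ _ Hw)) as Hrr.
  pose proof (K v) as Kv. pose proof (SC v) as H1. pose proof (SC (s v)) as H2.
  set (r := sqrt (1 + 8 * cos v ^ 2)) in *.
  assert (P : (r * cos (s v) - sin v) ^ 2 + (r * sin (s v) - 3 * cos v) ^ 2 = 0).
  { replace ((r * cos (s v) - sin v) ^ 2 + (r * sin (s v) - 3 * cos v) ^ 2)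
      with (r * r * (cos (s v) ^ 2 + sin (s v) ^ 2)
            - 2 * r * (sin v * cos (s v) + 3 * cos v * sin (s v)) + (sin v ^ 2 + 9 * cos v ^ 2)) by ring.
    rewrite Kv, H1, H2. replace (2 * r * r) with (2 * (r * r)) by ring. rewrite Hrr. ring. }
  pose proof (pow2_ge_0 (r * cos (s v) - sin v)).
  pose proof (pow2_ge_0 (r * sin (s v) - 3 * cos v)).
  assert (r * cos (s v) - sin v = 0) by (apply Rsqr_0_uniq; unfold Rsqr; lra).
  assert (r * sin (s v) - 3 * cos v = 0) by (apply Rsqr_0_uniq; unfold Rsqr; lra).
  split; apply Rmult_eq_reg_l with r; try lra.
  - replace (r * (sin v / r)) with (sin v) by (field; lra). lra.
  - replace (r * (3 * cos v / r)) with (3 * cos v) by (field; lra). lra. }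
assert (sh : s (PI / 2) = 0).
{ destruct (CSs (PI / 2)) as [Hc Hs]. rewrite cos_PI2, ?sin_PI2 in Hc, Hs.
  replace (1 + 8 * 0 ^ 2) with 1 in Hc, Hs by ring. rewrite sqrt_1 in Hc, Hs.
  destruct (mv 0 (PI / 2)) as [c Hc']. rewrite s0 in Hc'.
  pose proof PI_RGT_0.
  assert (d c <= 3).
  { unfold d. pose proof (w_pos c). assert (/ (1 + 8 * cos c ^ 2) <= / 1) by (apply Rinv_le_contravar; nra). lra. }
  pose proof (dpos c).
  assert (L : - PI <= s (PI / 2) <= PI / 2) by nra.
  assert (sin (s (PI / 2)) = 0) by (rewrite Hs; field).
  destruct (Rtotal_order (s (PI / 2)) 0) as [N|[N|N]]; [|exact N|].
  - destruct (Req_dec (s (PI / 2)) (- PI)) as [E|E].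
    + rewrite E, cos_neg, cos_PI in Hc. rewrite sin_PI2 in Hc. lra.
    + assert (sin (- s (PI / 2)) > 0) by (apply sin_gt_0; lra). rewrite sin_neg in *. lra.
  - assert (sin (s (PI / 2)) > 0) by (apply sin_gt_0; lra). lra. }
exists s; repeat split.
- intros [|n] v; [easy|].
  assert (forall m x, Derive_n s (S m) x = Derive_n (fun v => -1 * d v) m x) as E.
  { intros m x. rewrite <- Nat.add_1_r, <- Derive_n_comp. apply Derive_n_ext.
    intro y; simpl. apply is_derive_unique, Ds. }
  destruct n as [|n]; simpl.
  + eexists; apply Ds.
  + destruct (trig_fun_derive_n _ n Td) as [f [Tf Ef]].
    destruct (trig_fun_derive f Tf) as [f' [_ Df]].
    apply ex_derive_ext with f; [|eexists; apply Df].
    intro x; rewrite <- Ef. symmetry; apply E.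
- exact dec.
- intro v. assert (Q : s (s v) - v = s (s 0) - 0).
  { apply (const (fun v => s (s v) - v)). intro x.
    assert (D : is_derive (fun v => s (s v)) x ((-1 * d x) * (-1 * d (s x)))).
    { apply (is_derive_comp (V := R_NormedModule) s s x); apply Ds. }
    replace 0 with (minus ((-1 * d x) * (-1 * d (s x))) 1).
    - apply (is_derive_minus (V := R_NormedModule) (fun v => s (s v)) (fun v => v)); [exact D|].
      apply (is_derive_id (K := R_AbsRing)).
    - unfold minus, plus, opp; simpl. unfold d.
      destruct (CSs x) as [Hc _]. rewrite Hc.
      pose proof (w_pos x) as Hw. pose proof (sqrt_lt_R0 _ Hw) as Hr.
      pose proof (sqrt_sqrt _ (Rlt_le _ _ Hw)) as Hrr.
      set (r := sqrt (1 + 8 * cos x ^ 2)) in *.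
      replace (1 + 8 * (sin x / r) ^ 2) with (9 / (1 + 8 * cos x ^ 2)).
      + field; lra.
      + replace ((sin x / r) ^ 2) with (sin x ^ 2 / (r * r)) by (field; lra).
        rewrite Hrr, SC. field; lra. }
  rewrite s0, sh in Q; lra.
- exact s0.
- intro v; apply CSs.
- intro v; apply CSs.
Qed.

Definition translation (u v : R) : R * R := (u, v + PI).
Definition glide (sigma : R -> R) (u v : R) : R * R := (u + PI / 2, sigma v).

Definition klein_step (sigma : R -> R) (p q : R * R) : Prop :=
  q = translation (fst p) (snd p) \/ q = glide sigma (fst p) (snd p).

(* Two points of the plane lie in one orbit of the group generated by the two
   maps iff they are joined by a chain of generators and their inverses. *)
Definition same_point (sigma : R -> R) : R * R -> R * R -> Prop :=
  clos_refl_sym_trans (R * R) (klein_step sigma).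

(* Functions and tensors on the Klein bottle are those on the plane that are
   invariant under the group; invariance under the generators suffices. *)
Definition invariant_fun (phi : R -> R -> R * R) (f : R -> R -> R) : Prop :=
  forall u v : R, f (fst (phi u v)) (snd (phi u v)) = f u v.

Definition klein_fun (sigma : R -> R) (f : R -> R -> R) : Prop :=
  smooth2 f /\ invariant_fun translation f /\ invariant_fun (glide sigma) f.

(* The symmetric 2-tensor gE du^2 + 2 gF du dv + gG dv^2. *)
Record sym2 : Type := Sym2 {
  gE : R -> R -> R;
  gF : R -> R -> R;
  gG : R -> R -> R
}.

Definition smooth_sym2 (g : sym2) : Prop :=
  smooth2 (gE g) /\ smooth2 (gF g) /\ smooth2 (gG g).

Definition gdet (g : sym2) (u v : R) : R :=
  gE g u v * gG g u v - gF g u v ^ 2.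

(* [eval_at phi g u v a b a' b'] is g at phi (u, v) evaluated on the vectors
   (a, b) and (a', b'). *)
Definition eval_at (phi : R -> R -> R * R) (g : sym2) (u v a b a' b' : R) : R :=
  let x := fst (phi u v) in
  let y := snd (phi u v) in
  gE g x y * a * a' + gF g x y * (a * b' + a' * b) + gG g x y * b * b'.

Definition pullback (phi : R -> R -> R * R) (g : sym2) : sym2 :=
  let x := fun u v => fst (phi u v) in
  let y := fun u v => snd (phi u v) in
  Sym2
    (fun u v => eval_at phi g u v (pdu x u v) (pdu y u v) (pdu x u v) (pdu y u v))
    (fun u v => eval_at phi g u v (pdu x u v) (pdu y u v) (pdv x u v) (pdv y u v))
    (fun u v => eval_at phi g u v (pdv x u v) (pdv y u v) (pdv x u v) (pdv y u v)).

Definition eq_sym2 (g h : sym2) : Prop :=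
  forall u v : R, gE g u v = gE h u v /\ gF g u v = gF h u v /\ gG g u v = gG h u v.

Definition klein_metric (sigma : R -> R) (g : sym2) : Prop :=
  smooth_sym2 g /\
  (forall u v : R, 0 < gE g u v /\ 0 < gdet g u v) /\
  eq_sym2 (pullback translation g) g /\
  eq_sym2 (pullback (glide sigma) g) g.

(* The rectangle [0, PI/2) x [0, PI) is a fundamental domain of the group. *)
Definition area (g : sym2) : R :=
  RInt (fun u => RInt (fun v => sqrt (gdet g u v)) 0 PI) 0 (PI / 2).

(* - (det g)^(-1/2) d_i ((det g)^(1/2) g^(ij) d_j f) *)
Definition laplacian (g : sym2) (f : R -> R -> R) (u v : R) : R :=
  - / sqrt (gdet g u v) *
  (pdu (fun a b => (gG g a b * pdu f a b - gF g a b * pdv f a b) / sqrt (gdet g a b)) u v +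
   pdv (fun a b => (gE g a b * pdv f a b - gF g a b * pdu f a b) / sqrt (gdet g a b)) u v).

Definition in_eigenspace (sigma : R -> R) (g : sym2) (l : R) (f : R -> R -> R) : Prop :=
  klein_fun sigma f /\ forall u v : R, laplacian g f u v = l * f u v.

Definition eigenfunction (sigma : R -> R) (g : sym2) (l : R) (f : R -> R -> R) : Prop :=
  in_eigenspace sigma g l f /\ exists u v : R, f u v <> 0.

Definition eigenvalue (sigma : R -> R) (g : sym2) (l : R) : Prop :=
  exists f : R -> R -> R, eigenfunction sigma g l f.

Definition is_lambda1 (sigma : R -> R) (g : sym2) (l : R) : Prop :=
  0 < l /\ eigenvalue sigma g l /\
  forall m : R, 0 < m -> eigenvalue sigma g m -> l <= m.

(* a 0 + ... + a (n - 1) *)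
Definition sum_lt (n : nat) (a : nat -> R) : R :=
  fold_right Rplus 0 (map a (seq 0 n)).

Definition has_multiplicity (sigma : R -> R) (g : sym2) (l : R) (n : nat) : Prop :=
  exists phi : nat -> R -> R -> R,
    (forall i : nat, (i < n)%nat -> in_eigenspace sigma g l (phi i)) /\
    (forall c : nat -> R,
       (forall u v : R, sum_lt n (fun i => c i * phi i u v) = 0) ->
       forall i : nat, (i < n)%nat -> c i = 0) /\
    (forall f : R -> R -> R, in_eigenspace sigma g l f ->
       exists c : nat -> R,
         forall u v : R, f u v = sum_lt n (fun i => c i * phi i u v)).

(* Uniform convergence of the series on bounded rectangles. *)
Definition series_cvu_loc (a : nat -> R -> R -> R) (f : R -> R -> R) : Prop :=
  forall M eta : R, 0 < eta ->
    exists N : nat, forall n : nat, (N <= n)%nat ->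
      forall u v : R, Rabs u <= M -> Rabs v <= M ->
        Rabs (sum_n (fun j => a j u v) n - f u v) < eta.

(* f t = sum_j t^j h_j for |t| < eps, with convergence in the C^infinity
   topology. *)
Definition cinf_power_series (eps : R) (h : nat -> R -> R -> R)
    (f : R -> R -> R -> R) : Prop :=
  forall t : R, Rabs t < eps ->
    forall m k : nat,
      series_cvu_loc (fun j u v => t ^ j * partial_derive m k (h j) u v)
                     (partial_derive m k (f t)).

(* An analytic deformation of g0 through metrics on the Klein bottle, defined
   for |t| < eps: t |-> g t is a real-analytic curve in the Frechet space of
   smooth symmetric 2-tensors, given near t = 0 by a power series. *)
Definition analytic_deformation (sigma : R -> R) (g0 : sym2) (eps : R)
    (g : R -> sym2) : Prop :=
  0 < eps /\
  eq_sym2 (g 0) g0 /\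
  (forall t : R, Rabs t < eps -> klein_metric sigma (g t)) /\
  exists h : nat -> sym2,
    (forall j : nat, smooth_sym2 (h j)) /\
    cinf_power_series eps (fun j => gE (h j)) (fun t => gE (g t)) /\
    cinf_power_series eps (fun j => gF (h j)) (fun t => gF (g t)) /\
    cinf_power_series eps (fun j => gG (h j)) (fun t => gG (g t)).

Definition extremal (sigma : R -> R) (g0 : sym2) : Prop :=
  klein_metric sigma g0 /\
  exists l0 : R, is_lambda1 sigma g0 l0 /\
  forall (eps : R) (g : R -> sym2),
    analytic_deformation sigma g0 eps g ->
    (forall t : R, Rabs t < eps -> area (g t) = area g0) ->
    exists r : R -> R,
      is_domin (locally 0) (fun t : R => t) r /\
      forall t l : R, Rabs t < eps -> is_lambda1 sigma (g t) l -> l <= l0 + r t.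

(* Vectors of R^5, and maps into R^5, are families indexed by nat of which only
   the components 0, ..., 4 are used. *)
Definition dot5 (x y : nat -> R) : R := sum_lt 5 (fun i => x i * y i).

Definition at_pt (X : nat -> R -> R -> R) (u v : R) : nat -> R := fun i => X i u v.
Definition Xu (X : nat -> R -> R -> R) : nat -> R -> R -> R := fun i => pdu (X i).
Definition Xv (X : nat -> R -> R -> R) : nat -> R -> R -> R := fun i => pdv (X i).

Definition induced_metric (X : nat -> R -> R -> R) : sym2 :=
  Sym2 (fun u v => dot5 (at_pt (Xu X) u v) (at_pt (Xu X) u v))
       (fun u v => dot5 (at_pt (Xu X) u v) (at_pt (Xv X) u v))
       (fun u v => dot5 (at_pt (Xv X) u v) (at_pt (Xv X) u v)).

Definition in_sphere (r : R) (X : nat -> R -> R -> R) : Prop :=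
  forall u v : R, dot5 (at_pt X u v) (at_pt X u v) = r ^ 2.

(* A smooth map of the Klein bottle into R^5 with F(p) = F(q) only for p = q,
   and with continuous inverse on its image. *)
Definition topological_embedding (sigma : R -> R) (X : nat -> R -> R -> R) : Prop :=
  (forall i : nat, (i < 5)%nat -> klein_fun sigma (X i)) /\
  (forall u v u' v' : R,
     (forall i : nat, (i < 5)%nat -> X i u v = X i u' v') ->
     same_point sigma (u, v) (u', v')) /\
  (forall u v eps : R, 0 < eps ->
     exists delta : R, 0 < delta /\
       forall u' v' : R,
         (forall i : nat, (i < 5)%nat -> Rabs (X i u' v' - X i u v) < delta) ->
         exists u'' v'' : R,
           same_point sigma (u', v') (u'', v'') /\
           Rabs (u'' - u) < eps /\ Rabs (v'' - v) < eps).

(* Isometric: the induced metric is g, which makes X an immersion since g is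
   positive definite. *)
Definition isometric (g : sym2) (X : nat -> R -> R -> R) : Prop :=
  eq_sym2 (induced_metric X) g.

(* Trace, with respect to the induced metric, of the second fundamental form in
   the direction of n, that is of the form (X_i, X_j) |-> <X_ij, n>. *)
Definition mean_curvature (X : nat -> R -> R -> R) (n : nat -> R) (u v : R) : R :=
  let g := induced_metric X in
  (gG g u v * dot5 (at_pt (Xu (Xu X)) u v) n
   - 2 * gF g u v * dot5 (at_pt (Xu (Xv X)) u v) n
   + gE g u v * dot5 (at_pt (Xv (Xv X)) u v) n) / gdet g u v.

(* The mean curvature vector in the sphere vanishes: its component along every
   n tangent to the sphere (n orthogonal to X) and normal to the surface is 0. *)
Definition minimal_in_sphere (X : nat -> R -> R -> R) : Prop :=
  forall (u v : R) (n : nat -> R),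
    dot5 (at_pt X u v) n = 0 ->
    dot5 (at_pt (Xu X) u v) n = 0 ->
    dot5 (at_pt (Xv X) u v) n = 0 ->
    mean_curvature X n u v = 0.

Definition minimal_isometric_embedding_by_eigenfunctions
    (sigma : R -> R) (g : sym2) (l : R) (X : nat -> R -> R -> R) : Prop :=
  (exists r : R, 0 < r /\ in_sphere r X) /\
  topological_embedding sigma X /\
  isometric g X /\
  minimal_in_sphere X /\
  (forall i : nat, (i < 5)%nat -> eigenfunction sigma g l (X i)).

Definition g_0 : sym2 :=
  let w := fun v => 1 + 8 * cos v ^ 2 in
  let f := fun v => (9 + w v ^ 2) / w v in
  Sym2 (fun _ v => f v) (fun _ _ => 0) (fun _ v => f v * / w v).

(* Complete elliptic integral of the second kind, k being the modulus. *)
Definition ellipticE (k : R) : R :=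
  RInt (fun theta => sqrt (1 - k ^ 2 * sin theta ^ 2)) 0 (PI / 2).

(* Main.v *)
(* The coordinates (x, y) = (u, (v - sigma v) / 2) turn the deck group into the
   one generated by (x, y) -> (x + pi/2, -y) and y -> y + pi. For an arbitrary metric on K, the variational principle for
   lambda_1 is obtained by minimizing the Rayleigh quotient over trigonometric
   polynomials invariant under the group: testing the Galerkin equation against
   (-1)^s d^(2s) u bounds every Sobolev norm of the minimizers uniformly in the
   dimension, so a subsequence converges with all derivatives to a smooth first
   eigenfunction, and density of the trigonometric polynomials gives the
   inequality for every smooth function.

   For g_0, with w = 1 + 8 cos^2 v, the five functions sqrt 10 sin v cos v / sqrt w,
   (3 cos^2 v - sin^2 v) / sqrt (2 w) times cos 2u or sin 2u, and
   (3 cos^2 v + sin^2 v) / sqrt (2 w) times cos 4u or sin 4u have eigenvalue 2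
   and sum of squares 1, and they induce g_0. Separation of variables and
   comparison with these functions through Picone's identity show that every
   eigenfunction with eigenvalue in (0, 2] is a combination of them.

   If g_t is a deformation with fixed area, the coordinates of the embedding,
   recentred for g_t, are admissible for lambda_1(g_t). The sum of their g_t-masses
   is the area up to O(t^2), and the sum of their energies is twice the area up to
   O(t^2), since the energy is conformally invariant and the induced metric is g_0.
   Hence lambda_1(g_t) <= 2 + O(t^2). *)

Require Import Defs.
From Stdlib Require Import Reals ZArith Lra Lia FunctionalExtensionality Classical IndefiniteDescription Cantor Relations.
From Coquelicot Require Import Coquelicot.
Open Scope R_scope.

(** * Smooth functions of two variables *)

(** [is_lambda1] speaks of smooth eigenfunctions only, so to bound it above, a mean-zero function of
    small Rayleigh quotient must be turned into a smooth eigenfunction with an eigenvalue no larger.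
    This works because the invariant monomials are eigenfunctions of d_x^2 and of d_y^2: even
    derivatives of a Galerkin solution remain admissible test functions, and the variable
    coefficients enter the estimates only through commutators of lower order. In the variable z with
    dz = dv / sqrt w, the profiles of the five functions are multiples of sn, cn and dn of modulus
    1/2 at 4z. Invariance makes the coefficients of odd frequency index vanish at PI/3 and -PI/3,
    which modulo PI are the zeros of cn; this gives the comparison interval for index 1. Index 0 is
    even under sigma, so its flux is compared instead. From index 2 on, the comparison function dn
    has no zero and periodicity replaces the boundary conditions. The final error is quadratic
    because the energy density is stationary at g_0 and the means of the coordinates enter
    squared. *)

Notation fn2 := (R -> R -> R).

Lemma fn2_ext (f g : fn2) : (forall u v, f u v = g u v) -> f = g.
Proof. intro H; extensionality u; extensionality v; apply H. Qed.

(** The boolean direction lets each differentiation rule be stated and proved once; [slice] and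
    [coord] give the one-variable function and the point of differentiation. *)
Definition dd (b : bool) : fn2 -> fn2 := if b then pdu else pdv.
Definition cont2 (f : fn2) : Prop := forall u v, continuity_2d_pt f u v.
Definition slice (b : bool) (f : fn2) (u v : R) : R -> R :=
  if b then fun z => f z v else fun z => f u z.
Definition coord (b : bool) (u v : R) : R := if b then u else v.

Lemma dd_Derive b f u v : dd b f u v = Derive (slice b f u v) (coord b u v).
Proof. now destruct b. Qed.

(** Coinduction for smoothness: a class of continuous, partially differentiable functions closed
    under both partial derivatives consists of smooth functions. Limits, compositions and integrals
    are later shown smooth by naming such a class. *)
Lemma smooth2_coind (P : fn2 -> Prop) :
  (forall f, P f -> cont2 f /\
     (forall b u v, ex_derive (slice b f u v) (coord b u v)) /\
     (forall b, P (dd b f))) ->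
  forall f, P f -> smooth2 f.
Proof.
  intros H f Pf n; revert f Pf; induction n as [|n IH]; intros f Pf u v;
    destruct (H f Pf) as [Hc [Hd Hp]]; simpl.
  - split; [apply Hc|exact I].
  - split; [apply Hc|]. split; [apply (Hd true)|]. split; [apply (Hd false)|].
    split; [apply (IH _ (Hp true))|apply (IH _ (Hp false))].
Qed.

Lemma smooth2_cont f : smooth2 f -> cont2 f.
Proof. intros H u v; apply (H 0%nat u v). Qed.

Lemma smooth2_ex b f : smooth2 f -> forall u v, ex_derive (slice b f u v) (coord b u v).
Proof. intros H u v; destruct (H 1%nat u v) as [_ [H1 [H2 _]]]; destruct b; assumption. Qed.

Lemma smooth2_dd b f : smooth2 f -> smooth2 (dd b f).
Proof.
  intros H n u v; destruct (H (S n) u v) as [_ [_ [_ [H1 H2]]]]; destruct b; assumption.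
Qed.

Lemma smooth2_is_derive b f : smooth2 f ->
  forall u v, is_derive (slice b f u v) (coord b u v) (dd b f u v).
Proof. intros H u v. rewrite dd_Derive. apply Derive_correct, smooth2_ex, H. Qed.

Lemma smooth2_du f : smooth2 f -> forall u v, is_derive (fun z => f z v) u (pdu f u v).
Proof. exact (smooth2_is_derive true f). Qed.

Lemma smooth2_dv f : smooth2 f -> forall u v, is_derive (fun z => f u z) v (pdv f u v).
Proof. exact (smooth2_is_derive false f). Qed.

Lemma dd_unique b f g : (forall u v, is_derive (slice b f u v) (coord b u v) (g u v)) ->
  dd b f = g.
Proof. intro H; apply fn2_ext; intros u v; rewrite dd_Derive; apply is_derive_unique, H. Qed.

Lemma pdu_unique f g : (forall u v, is_derive (fun z => f z v) u (g u v)) -> pdu f = g.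
Proof. exact (dd_unique true f g). Qed.
Lemma pdv_unique f g : (forall u v, is_derive (fun z => f u z) v (g u v)) -> pdv f = g.
Proof. exact (dd_unique false f g). Qed.

Lemma isd_plus (f g : R -> R) x a b : is_derive f x a -> is_derive g x b ->
  is_derive (fun z => f z + g z) x (a + b).
Proof. apply (is_derive_plus (V := R_NormedModule) f g). Qed.

Lemma isd_mult (f g : R -> R) x a b : is_derive f x a -> is_derive g x b ->
  is_derive (fun z => f z * g z) x (a * g x + f x * b).
Proof. intros; apply (is_derive_mult (K := R_AbsRing) f g x a b); auto; intros; apply Rmult_comm. Qed.

Lemma isd_comp (f g : R -> R) x a b : is_derive f (g x) a -> is_derive g x b ->
  is_derive (fun z => f (g z)) x (a * b).
Proof.
  intros Hf Hg. rewrite Rmult_comm. apply (is_derive_comp (V := R_NormedModule) f g x a b Hf Hg).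
Qed.

Lemma isd_const (c x : R) : is_derive (fun _ => c) x 0.
Proof. apply (is_derive_const (V := R_NormedModule)). Qed.

Lemma isd_id (x : R) : is_derive (fun z => z) x 1.
Proof. apply (is_derive_id (K := R_AbsRing)). Qed.

Lemma isd_eq (f : R -> R) x a b : is_derive f x a -> a = b -> is_derive f x b.
Proof. now intros H <-. Qed.

Ltac req := lazymatch goal with |- ?a = ?b => change (@eq R a b) end.

(** Expressions whose formal derivatives are again expressions of the same kind, so that the class
    itself is an invariant for [smooth2_coind]. The derivative of a square root contains its
    inverse, hence the positivity in [sg_sqrt] and the presence of [sg_inv]. *)
Inductive sgen : fn2 -> Prop :=
| sg_base f : smooth2 f -> sgen f
| sg_const c : sgen (fun _ _ => c)
| sg_coord b : sgen (fun u v => coord b u v)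
| sg_plus f g : sgen f -> sgen g -> sgen (fun u v => f u v + g u v)
| sg_mult f g : sgen f -> sgen g -> sgen (fun u v => f u v * g u v)
| sg_inv f : (forall u v, f u v <> 0) -> sgen f -> sgen (fun u v => / f u v)
| sg_sqrt f : (forall u v, 0 < f u v) -> sgen f -> sgen (fun u v => sqrt (f u v))
| sg_sin f : sgen f -> sgen (fun u v => sin (f u v))
| sg_cos f : sgen f -> sgen (fun u v => cos (f u v)).

Lemma sgen_cont f : sgen f -> cont2 f.
Proof.
  intros H; induction H as [f H|c|b|f g Hf IHf Hg IHg|f g Hf IHf Hg IHg|f H0 Hf IHf|f H0 Hf IHf|f Hf IHf|f Hf IHf]; intros u v.
  - apply smooth2_cont, H.
  - apply continuity_2d_pt_const.
  - destruct b; [apply continuity_2d_pt_id1|apply continuity_2d_pt_id2].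
  - apply continuity_2d_pt_plus; auto.
  - apply continuity_2d_pt_mult; auto.
  - apply continuity_2d_pt_inv; auto.
  - apply (continuity_1d_2d_pt_comp sqrt); auto. apply continuity_pt_sqrt; left; auto.
  - apply (continuity_1d_2d_pt_comp sin); auto. apply continuity_sin.
  - apply (continuity_1d_2d_pt_comp cos); auto. apply continuity_cos.
Qed.

Lemma sgen_derive b f : sgen f -> exists g, sgen g /\
  forall u v, is_derive (slice b f u v) (coord b u v) (g u v).
Proof.
  intros H; induction H as [f H|c|b'|f g Hf [f' [Sf Df]] Hg [g' [Sg Dg]]|f g Hf [f' [Sf Df]] Hg [g' [Sg Dg]]
   |f H0 Hf [f' [Sf Df]]|f H0 Hf [f' [Sf Df]]|f Hf [f' [Sf Df]]|f Hf [f' [Sf Df]]].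
  - exists (dd b f); split; [apply sg_base, smooth2_dd, H|apply smooth2_is_derive, H].
  - exists (fun _ _ => 0); split; [apply sg_const|]. intros; destruct b; apply isd_const.
  - exists (fun _ _ => if Bool.eqb b b' then 1 else 0); split; [apply sg_const|].
    intros; destruct b, b'; simpl; try apply isd_const; apply isd_id.
  - exists (fun u v => f' u v + g' u v); split; [now apply sg_plus|].
    intros u v; specialize (Df u v); specialize (Dg u v). destruct b;
      [exact (isd_plus (fun z => f z v) (fun z => g z v) u _ _ Df Dg)|exact (isd_plus (fun z => f u z) (fun z => g u z) v _ _ Df Dg)].
  - exists (fun u v => f' u v * g u v + f u v * g' u v); split; [apply sg_plus; now apply sg_mult|].
    intros u v; specialize (Df u v); specialize (Dg u v). destruct b;
      [exact (isd_mult (fun z => f z v) (fun z => g z v) u _ _ Df Dg)|exact (isd_mult (fun z => f u z) (fun z => g u z) v _ _ Df Dg)].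
  - exists (fun u v => - 1 * f' u v * (/ f u v * / f u v)); split.
    + apply sg_mult; [apply (sg_mult (fun _ _ => -1) f'); auto using sg_const|]. apply sg_mult; now apply sg_inv.
    + intros u v; specialize (Df u v); specialize (H0 u v). destruct b; simpl in *.
      * eapply isd_eq; [apply (is_derive_inv (fun z => f z v)); eauto|]. simpl; req; field; auto.
      * eapply isd_eq; [apply (is_derive_inv (fun z => f u z)); eauto|]. simpl; req; field; auto.
  - exists (fun u v => f' u v * ( / 2 * / sqrt (f u v))); split.
    + apply sg_mult; [auto|]. apply (sg_mult (fun _ _ => / 2)); [apply sg_const|].
      apply sg_inv; [|now apply sg_sqrt]. intros u v; apply Rgt_not_eq, sqrt_lt_R0, H0.
    + intros u v; specialize (Df u v); specialize (H0 u v). pose proof (sqrt_lt_R0 _ H0).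
      destruct b; simpl in *.
      * eapply isd_eq; [apply (is_derive_sqrt (fun z => f z v)); eauto|]. simpl; req; field; lra.
      * eapply isd_eq; [apply (is_derive_sqrt (fun z => f u z)); eauto|]. simpl; req; field; lra.
  - exists (fun u v => cos (f u v) * f' u v); split; [apply sg_mult; auto using sg_cos|].
    intros u v; specialize (Df u v).
    destruct b; simpl in *; eapply isd_eq.
    + apply (isd_comp sin (fun z => f z v)); [apply is_derive_sin|eauto].
    + req; simpl; ring.
    + apply (isd_comp sin (fun z => f u z)); [apply is_derive_sin|eauto].
    + req; simpl; ring.
  - exists (fun u v => -1 * sin (f u v) * f' u v); split.
    + apply sg_mult; auto. apply (sg_mult (fun _ _ => -1)); [apply sg_const|now apply sg_sin].
    + intros u v; specialize (Df u v).
    destruct b; simpl in *; eapply isd_eq.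
    * apply (isd_comp cos (fun z => f z v)); [apply is_derive_cos|eauto].
    * req; simpl; ring.
    * apply (isd_comp cos (fun z => f u z)); [apply is_derive_cos|eauto].
    * req; simpl; ring.
Qed.

Lemma sgen_smooth f : sgen f -> smooth2 f.
Proof.
  apply smooth2_coind. clear f; intros f Hf. split; [now apply sgen_cont|]. split.
  - intros b u v. destruct (sgen_derive b f Hf) as [g [_ Hg]]. exists (g u v); apply Hg.
  - intros b. destruct (sgen_derive b f Hf) as [g [Sg Hg]]. now rewrite (dd_unique b f g Hg).
Qed.

Lemma smooth2_const c : smooth2 (fun _ _ => c).
Proof. apply sgen_smooth, sg_const. Qed.
Lemma smooth2_u : smooth2 (fun u _ => u).
Proof. apply sgen_smooth, (sg_coord true). Qed.
Lemma smooth2_v : smooth2 (fun _ v => v).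
Proof. apply sgen_smooth, (sg_coord false). Qed.
Lemma smooth2_plus f g : smooth2 f -> smooth2 g -> smooth2 (fun u v => f u v + g u v).
Proof. intros; apply sgen_smooth, sg_plus; now apply sg_base. Qed.
Lemma smooth2_mult f g : smooth2 f -> smooth2 g -> smooth2 (fun u v => f u v * g u v).
Proof. intros; apply sgen_smooth, sg_mult; now apply sg_base. Qed.
Lemma smooth2_opp f : smooth2 f -> smooth2 (fun u v => - f u v).
Proof.
  intros; replace (fun u v => - f u v) with (fun u v => (-1) * f u v) by (apply fn2_ext; intros; ring).
  apply (smooth2_mult (fun _ _ => -1)); [apply smooth2_const|auto].
Qed.
Lemma smooth2_minus f g : smooth2 f -> smooth2 g -> smooth2 (fun u v => f u v - g u v).
Proof. intros; apply (smooth2_plus f (fun u v => - g u v)); auto using smooth2_opp. Qed.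
Lemma smooth2_inv f : smooth2 f -> (forall u v, f u v <> 0) -> smooth2 (fun u v => / f u v).
Proof. intros; apply sgen_smooth, sg_inv; auto; now apply sg_base. Qed.
Lemma smooth2_div f g : smooth2 f -> smooth2 g -> (forall u v, g u v <> 0) -> smooth2 (fun u v => f u v / g u v).
Proof. intros; apply (smooth2_mult f (fun u v => / g u v)); auto using smooth2_inv. Qed.
Lemma smooth2_sqrt f : smooth2 f -> (forall u v, 0 < f u v) -> smooth2 (fun u v => sqrt (f u v)).
Proof. intros; apply sgen_smooth, sg_sqrt; auto; now apply sg_base. Qed.
Lemma smooth2_sin f : smooth2 f -> smooth2 (fun u v => sin (f u v)).
Proof. intros; apply sgen_smooth, sg_sin; now apply sg_base. Qed.
Lemma smooth2_cos f : smooth2 f -> smooth2 (fun u v => cos (f u v)).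
Proof. intros; apply sgen_smooth, sg_cos; now apply sg_base. Qed.
Lemma smooth2_pow f n : smooth2 f -> smooth2 (fun u v => f u v ^ n).
Proof. intros; induction n; simpl; [apply smooth2_const|apply (smooth2_mult f); auto]. Qed.

Ltac smooth :=
  repeat (match goal with
  | |- smooth2 _ => assumption
  | |- smooth2 (fun _ _ => ?c) => apply (smooth2_const c)
  | |- smooth2 (fun u _ => u) => apply smooth2_u
  | |- smooth2 (fun _ v => v) => apply smooth2_v
  | |- smooth2 (fun u v => _ + _) => apply smooth2_plus
  | |- smooth2 (fun u v => _ - _) => apply smooth2_minus
  | |- smooth2 (fun u v => _ * _) => apply smooth2_mult
  | |- smooth2 (fun u v => _ / _) => apply smooth2_div
  | |- smooth2 (fun u v => - _) => apply smooth2_opp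
  | |- smooth2 (fun u v => / _) => apply smooth2_inv
  | |- smooth2 (fun u v => _ ^ _) => apply smooth2_pow
  | |- smooth2 (fun u v => sqrt _) => apply smooth2_sqrt
  | |- smooth2 (fun u v => sin _) => apply smooth2_sin
  | |- smooth2 (fun u v => cos _) => apply smooth2_cos
  | |- smooth2 Rplus => apply (smooth2_plus (fun u _ => u) (fun _ v => v))
  | |- smooth2 Rminus => apply (smooth2_minus (fun u _ => u) (fun _ v => v))
  | |- smooth2 Rmult => apply (smooth2_mult (fun u _ => u) (fun _ v => v))
  | |- smooth2 (dd _ _) => apply smooth2_dd
  | |- smooth2 (pdu _) => apply (smooth2_dd true)
  | |- smooth2 (pdv _) => apply (smooth2_dd false)
  | |- smooth2 (fun u v => pdu ?f u v) => apply (smooth2_dd true f)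
  | |- smooth2 (fun u v => pdv ?f u v) => apply (smooth2_dd false f)
  | |- smooth2 (fun u v => dd ?b ?f u v) => apply (smooth2_dd b f)
  end).

Definition fadd (f g : fn2) : fn2 := fun u v => f u v + g u v.
Definition fmul (f g : fn2) : fn2 := fun u v => f u v * g u v.
Definition fscal (c : R) (f : fn2) : fn2 := fun u v => c * f u v.

Lemma smooth2_fadd f g : smooth2 f -> smooth2 g -> smooth2 (fadd f g).
Proof. apply smooth2_plus. Qed.
Lemma smooth2_fmul f g : smooth2 f -> smooth2 g -> smooth2 (fmul f g).
Proof. apply smooth2_mult. Qed.
Lemma smooth2_fscal c f : smooth2 f -> smooth2 (fscal c f).
Proof. apply (smooth2_mult (fun _ _ => c)), smooth2_const. Qed.

Lemma dd_add b f g : smooth2 f -> smooth2 g -> dd b (fadd f g) = fadd (dd b f) (dd b g).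
Proof.
  intros Hf Hg; apply dd_unique; intros u v.
  pose proof (smooth2_is_derive b f Hf u v) as H1. pose proof (smooth2_is_derive b g Hg u v) as H2.
  destruct b;
    [exact (isd_plus (fun z => f z v) (fun z => g z v) u _ _ H1 H2)|exact (isd_plus (fun z => f u z) (fun z => g u z) v _ _ H1 H2)].
Qed.

Lemma dd_mul b f g : smooth2 f -> smooth2 g ->
  dd b (fmul f g) = fadd (fmul (dd b f) g) (fmul f (dd b g)).
Proof.
  intros Hf Hg; apply dd_unique; intros u v.
  pose proof (smooth2_is_derive b f Hf u v) as H1. pose proof (smooth2_is_derive b g Hg u v) as H2.
  destruct b; simpl in *.
  - exact (isd_mult (fun z => f z v) (fun z => g z v) u _ _ H1 H2).
  - exact (isd_mult (fun z => f u z) (fun z => g u z) v _ _ H1 H2).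
Qed.

Lemma dd_const b c : dd b (fun _ _ => c) = fun _ _ => 0.
Proof. apply dd_unique; intros; destruct b; apply isd_const. Qed.

Lemma dd_scal b c f : smooth2 f -> dd b (fscal c f) = fscal c (dd b f).
Proof.
  intro H. change (fscal c f) with (fmul (fun _ _ => c) f).
  rewrite dd_mul, dd_const; auto using smooth2_const.
  apply fn2_ext; intros; unfold fadd, fmul, fscal; ring.
Qed.

Lemma dd_comm b b' f : smooth2 f -> dd b (dd b' f) = dd b' (dd b f).
Proof.
  assert (K : forall f, smooth2 f -> pdu (pdv f) = pdv (pdu f)).
  { clear; intros f Hf. apply fn2_ext; intros u v.
    apply (Schwarz f u v).
    - apply locally_2d_forall; intros x y. repeat split.
      + eexists; apply (smooth2_du f Hf).
      + eexists; apply (smooth2_dv f Hf).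
      + eexists; apply (smooth2_du (pdv f)); smooth.
      + eexists; apply (smooth2_dv (pdu f)); smooth.
    - apply (smooth2_cont (pdu (pdv f))); smooth.
    - apply (smooth2_cont (pdv (pdu f))); smooth. }
  intro H; destruct b, b'; simpl; auto. symmetry; auto.
Qed.

Lemma smooth2_slice_u f : smooth2 f -> forall v, smooth2 (fun x _ => f x v).
Proof.
  intros Hf v. apply (smooth2_coind (fun g => (exists f, smooth2 f /\ g = fun x _ => f x v))); [|now exists f].
  clear f Hf; intros g [f [Hf ->]]. repeat split.
  - intros x y. generalize (smooth2_cont f Hf x v). intros H eps. destruct (H eps) as [d Hd].
    exists d. intros x' y' Hx Hy. apply Hd; auto. rewrite Rminus_diag, Rabs_R0. apply cond_pos.
  - intros [|] x y; simpl; [eexists; apply (smooth2_du f Hf)|eexists; apply isd_const].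
  - intros [|].
    + exists (pdu f); split; [smooth|]. reflexivity.
    + exists (fun _ _ => 0); split; [smooth|]. apply dd_unique; intros; apply isd_const.
Qed.

Lemma smooth2_swap f : smooth2 f -> smooth2 (fun x y => f y x).
Proof.
  intros Hf. apply (smooth2_coind (fun g => (exists f, smooth2 f /\ g = fun x y => f y x))); [|now exists f].
  clear f Hf; intros g [f [Hf ->]]. repeat split.
  - intros x y. generalize (smooth2_cont f Hf y x). intros H eps. destruct (H eps) as [d Hd].
    exists d. intros x' y' Hx Hy. apply Hd; auto.
  - intros [|] x y; simpl; [eexists; apply (smooth2_dv f Hf)|eexists; apply (smooth2_du f Hf)].
  - intros [|]; [exists (pdv f)|exists (pdu f)]; split; try smooth; reflexivity.
Qed.

(** * Integrals of doubly periodic functions *)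

Definition cont (f : R -> R) : Prop := forall x, continuous f x.

Lemma cont_const c : cont (fun _ => c).
Proof. intro x; apply continuous_const. Qed.
Lemma cont_plus f g : cont f -> cont g -> cont (fun x => f x + g x).
Proof. intros Hf Hg x; apply (continuous_plus (V := R_NormedModule)); [apply Hf|apply Hg]. Qed.
Lemma cont_mult f g : cont f -> cont g -> cont (fun x => f x * g x).
Proof. intros Hf Hg x; apply (continuous_mult (K := R_AbsRing)); [apply Hf|apply Hg]. Qed.
Lemma cont_opp f : cont f -> cont (fun x => - f x).
Proof. intros Hf x; apply (continuous_opp (V := R_NormedModule)), Hf. Qed.
Lemma cont_minus f g : cont f -> cont g -> cont (fun x => f x - g x).
Proof. intros Hf Hg; apply (cont_plus f (fun x => - g x)); auto using cont_opp. Qed.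
Lemma cont_abs f : cont f -> cont (fun x => Rabs (f x)).
Proof. intros Hf x; apply (continuous_comp f Rabs); [apply Hf|apply continuous_Rabs]. Qed.
Lemma cont_pow f n : cont f -> cont (fun x => f x ^ n).
Proof. intro H; induction n; simpl; [apply cont_const|now apply cont_mult]. Qed.
Lemma cont_derive f : (forall x, ex_derive f x) -> cont f.
Proof. intros H x. apply (ex_derive_continuous (V := R_NormedModule)), H. Qed.

Lemma cont2_plus f g : cont2 f -> cont2 g -> cont2 (fun u v => f u v + g u v).
Proof. intros Hf Hg u v; now apply continuity_2d_pt_plus. Qed.
Lemma cont2_minus f g : cont2 f -> cont2 g -> cont2 (fun u v => f u v - g u v).
Proof. intros Hf Hg u v; now apply continuity_2d_pt_minus. Qed.
Lemma cont2_mult f g : cont2 f -> cont2 g -> cont2 (fun u v => f u v * g u v).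
Proof. intros Hf Hg u v; now apply continuity_2d_pt_mult. Qed.
Lemma cont2_const c : cont2 (fun _ _ => c).
Proof. intros u v; apply continuity_2d_pt_const. Qed.

Lemma cont2_u f : cont2 f -> forall v, cont (fun u => f u v).
Proof.
  intros H v u. apply continuity_pt_filterlim, continuity_pt_locally. intro e.
  destruct (H u v e) as [d Hd]. exists d; intros y Hy. apply Hd; auto.
  rewrite Rminus_diag, Rabs_R0. apply cond_pos.
Qed.
Lemma cont2_v f : cont2 f -> forall u, cont (fun v => f u v).
Proof.
  intros H u v. apply continuity_pt_filterlim, continuity_pt_locally. intro e.
  destruct (H u v e) as [d Hd]. exists d; intros y Hy. apply Hd; auto.
  rewrite Rminus_diag, Rabs_R0. apply cond_pos.
Qed.

Lemma cont_ex_RInt f a b : cont f -> ex_RInt f a b.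
Proof. intro H; apply (ex_RInt_continuous (V := R_CompleteNormedModule)); intros; apply H. Qed.

Lemma RInt_plus_c f g a b : cont f -> cont g ->
  RInt (fun x => f x + g x) a b = RInt f a b + RInt g a b.
Proof. intros; apply (RInt_plus (V := R_CompleteNormedModule)); now apply cont_ex_RInt. Qed.
Lemma RInt_scal_c f c a b : cont f -> RInt (fun x => c * f x) a b = c * RInt f a b.
Proof. intros; apply (RInt_scal (V := R_CompleteNormedModule)); now apply cont_ex_RInt. Qed.
Lemma RInt_minus_c f g a b : cont f -> cont g ->
  RInt (fun x => f x - g x) a b = RInt f a b - RInt g a b.
Proof. intros; apply (RInt_minus (V := R_CompleteNormedModule)); now apply cont_ex_RInt. Qed.
Lemma RInt_const_r (c a b : R) : RInt (fun _ => c) a b = (b - a) * c.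
Proof. apply (RInt_const (V := R_CompleteNormedModule)). Qed.
Lemma RInt_le_c f g a b : a <= b -> cont f -> cont g -> (forall x, a <= x <= b -> f x <= g x) ->
  RInt f a b <= RInt g a b.
Proof. intros; apply RInt_le; try apply cont_ex_RInt; auto. intros; apply H2; lra. Qed.
Lemma RInt_ext_all (f g : R -> R) a b : (forall x, f x = g x) -> RInt f a b = RInt g a b.
Proof. intro H; apply RInt_ext; intros; apply H. Qed.
Lemma RInt_FTC (f df : R -> R) a b : (forall x, is_derive f x (df x)) -> cont df ->
  RInt df a b = f b - f a.
Proof.
  intros H Hc. apply is_RInt_unique. apply (is_RInt_derive (V := R_CompleteNormedModule) f df); intros; auto.
Qed.

Lemma cont_RInt_param f a b : cont2 f -> cont (fun u => RInt (fun v => f u v) a b).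
Proof.
  assert (K : forall a b, a <= b -> cont2 f -> cont (fun u => RInt (fun v => f u v) a b)).
  { clear a b; intros a b ab Hf u. apply continuity_pt_filterlim, continuity_pt_locally. intro e.
    (* The 1 keeps the denominator positive when a = b, and the factor 2 leaves room for a strict
       inequality after integration. *)
    assert (He : 0 < e / (2 * (b - a + 1))).
    { apply Rdiv_lt_0_compat; [apply cond_pos|lra]. }
    destruct (uniform_continuity_2d_1d' f a b u (fun x _ => Hf u x) (mkposreal _ He)) as [d Hd].
    exists d; intros y Hy. simpl in Hd.
    rewrite <- RInt_minus_c by (now apply cont2_v).
    assert (Hy' : Rabs (y - u) < d) by exact Hy.
    apply Rle_lt_trans with ((b - a) * (e / (2 * (b - a + 1)))).
    - apply abs_RInt_le_const; auto.
      + apply cont_ex_RInt, cont_minus; now apply cont2_v.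
      + intros t Ht. left.
        apply (Hd t u t y); auto; try lra.
        * destruct d; simpl; lra.
        * apply Rabs_def2 in Hy'; lra.
        * rewrite Rminus_diag, Rabs_R0; apply cond_pos.
    - destruct e as [e He']; simpl in *.
      assert (e / (2 * (b - a + 1)) * (2 * (b - a + 1)) = e) by (field; lra).
      set (q := e / (2 * (b - a + 1))) in *. pose proof (Rmult_le_pos (b - a) q). lra. }
  intro Hf. destruct (Rle_dec a b) as [ab|ab]; [auto|].
  replace (fun u => RInt (fun v => f u v) a b) with (fun u => - RInt (fun v => f u v) b a).
  - apply cont_opp, K; auto; lra.
  - extensionality u. apply (opp_RInt_swap (V := R_CompleteNormedModule)). now apply cont_ex_RInt, cont2_v.
Qed.

Lemma is_derive_param f a b u : smooth2 f ->
  is_derive (fun u => RInt (fun v => f u v) a b) u (RInt (fun v => pdu f u v) a b).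
Proof.
  intro Hf. apply is_derive_RInt_param.
  - apply filter_forall; intros x t _. eexists; apply smooth2_du, Hf.
  - intros t _. apply (smooth2_cont (pdu f)); smooth.
  - apply filter_forall; intros x. apply cont_ex_RInt, cont2_v, smooth2_cont, Hf.
Qed.

(** The square is a fundamental domain of the lattice generated by the translations by PI, since the
    glide applied twice is (u, v) -> (u + PI, v). The torus covers the Klein bottle twice, so [I2]
    is twice the integral over the latter. *)
Definition I2 (f : fn2) : R := RInt (fun u => RInt (fun v => f u v) 0 PI) 0 PI.

Lemma I2_ext f g : (forall u v, f u v = g u v) -> I2 f = I2 g.
Proof. intro H; now rewrite (fn2_ext f g H). Qed.

Lemma I2_add f g : cont2 f -> cont2 g -> I2 (fun u v => f u v + g u v) = I2 f + I2 g.
Proof.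
  intros Hf Hg; unfold I2. rewrite <- RInt_plus_c by now apply cont_RInt_param.
  apply RInt_ext_all; intro u. apply RInt_plus_c; now apply cont2_v.
Qed.
Lemma I2_sub f g : cont2 f -> cont2 g -> I2 (fun u v => f u v - g u v) = I2 f - I2 g.
Proof.
  intros Hf Hg; unfold I2. rewrite <- RInt_minus_c by now apply cont_RInt_param.
  apply RInt_ext_all; intro u. apply RInt_minus_c; now apply cont2_v.
Qed.
Lemma I2_scal c f : cont2 f -> I2 (fun u v => c * f u v) = c * I2 f.
Proof.
  intros Hf; unfold I2. rewrite <- RInt_scal_c by now apply cont_RInt_param.
  apply RInt_ext_all; intro u. apply RInt_scal_c; now apply cont2_v.
Qed.
Lemma I2_le f g : cont2 f -> cont2 g ->
  (forall u v, 0 <= u <= PI -> 0 <= v <= PI -> f u v <= g u v) -> I2 f <= I2 g.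
Proof.
  intros Hf Hg H; pose proof PI_RGT_0; unfold I2.
  apply RInt_le_c; try apply cont_RInt_param; auto; try lra.
  intros u Hu. apply RInt_le_c; try apply cont2_v; auto; lra.
Qed.
Lemma I2_const c : I2 (fun _ _ => c) = PI * PI * c.
Proof. unfold I2. rewrite RInt_const_r, RInt_const_r. ring. Qed.
Lemma I2_ge0 f : cont2 f -> (forall u v, 0 <= f u v) -> 0 <= I2 f.
Proof.
  intros Hf H. replace 0 with (I2 (fun _ _ => 0)) by (rewrite I2_const; ring).
  apply I2_le; auto using cont2_const.
Qed.
Lemma I2_abs_le f M : cont2 f ->
  (forall u v, 0 <= u <= PI -> 0 <= v <= PI -> Rabs (f u v) <= M) -> Rabs (I2 f) <= PI * PI * M.
Proof.
  intros Hf H. apply Rabs_le; split.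
  - replace (- (PI * PI * M)) with (I2 (fun _ _ => - M)) by (rewrite I2_const; ring).
    apply I2_le; auto using cont2_const. intros u v Hu Hv; specialize (H u v Hu Hv). apply Rabs_le_between in H; lra.
  - rewrite <- I2_const. apply I2_le; auto using cont2_const.
    intros u v Hu Hv; specialize (H u v Hu Hv). apply Rabs_le_between in H; lra.
Qed.

Lemma RInt_zero_all f : cont f -> (forall x, 0 <= f x) -> RInt f 0 PI = 0 ->
  forall x, 0 <= x <= PI -> f x = 0.
Proof.
  intros Hf Hp H0 x Hx. pose proof PI_RGT_0.
  destruct (Rle_lt_or_eq_dec _ _ (Hp x)) as [Hx0|]; [exfalso|auto].
  pose proof (proj1 (continuity_pt_locally f x) (proj2 (continuity_pt_filterlim f x) (Hf x)) (mkposreal _ Hx0)) as [d Hd].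
  simpl in Hd.
  (* The neighbourhood of x may stick out of [0, PI]; one takes the half to the right of x, or to
     the left when x = PI. *)
  assert (Q : exists a b, a < b /\ 0 <= a /\ b <= PI /\ forall y, a < y < b -> 0 < f y).
  { destruct d as [d Hd0]. destruct (Rlt_dec x PI).
    - exists x, (Rmin (x + d) PI). repeat split; try apply Rmin_glb_lt; try lra; [apply Rmin_r|].
      intros y Hy. assert (y < x + d) by (apply Rlt_le_trans with (Rmin (x + d) PI); [lra|apply Rmin_l]).
      assert (Hb : Rabs (f y - f x) < f x) by (apply Hd; apply Rabs_def1; simpl; unfold minus, plus, opp; simpl; lra).
      apply Rabs_def2 in Hb; lra.
    - exists (Rmax (x - d) 0), x. repeat split; try apply Rmax_lub_lt; try lra; [apply Rmax_r|].
      intros y Hy. assert (x - d < y) by (apply Rle_lt_trans with (Rmax (x - d) 0); [apply Rmax_l|lra]).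
      assert (Hb : Rabs (f y - f x) < f x) by (apply Hd; apply Rabs_def1; simpl; unfold minus, plus, opp; simpl; lra).
      apply Rabs_def2 in Hb; lra. }
  destruct Q as [a [b [ab [a0 [bp Hab]]]]].
  assert (0 < RInt f a b) by (apply RInt_gt_0; auto).
  assert (0 <= RInt f 0 a) by (apply RInt_ge_0; auto using cont_ex_RInt).
  assert (0 <= RInt f b PI) by (apply RInt_ge_0; auto using cont_ex_RInt).
  rewrite <- (RInt_Chasles (V := R_CompleteNormedModule) f 0 a PI) in H0 by now apply cont_ex_RInt.
  rewrite <- (RInt_Chasles (V := R_CompleteNormedModule) f a b PI) in H0 by now apply cont_ex_RInt.
  unfold plus in H0; simpl in H0. lra.
Qed.

Lemma I2_zero f : cont2 f -> (forall u v, 0 <= f u v) -> I2 f = 0 ->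
  forall u v, 0 <= u <= PI -> 0 <= v <= PI -> f u v = 0.
Proof.
  intros Hf Hp H0 u v Hu Hv.
  apply (RInt_zero_all (fun v => f u v)); auto; [now apply cont2_v|].
  apply (RInt_zero_all (fun u => RInt (fun v => f u v) 0 PI)); auto; [now apply cont_RInt_param|].
  intro x; pose proof PI_RGT_0; apply RInt_ge_0; auto; [lra|now apply cont_ex_RInt, cont2_v].
Qed.

(** * Functions on the torus of periods PI and integration by parts *)

Definition per (f : fn2) : Prop := forall u v, f (u + PI) v = f u v /\ f u (v + PI) = f u v.
Definition tor (f : fn2) : Prop := smooth2 f /\ per f.

Lemma per_dd b f : per f -> smooth2 f -> per (dd b f).
Proof.
  intros H S u v.
  assert (E1 : f = fun x y => f (x + PI) y) by (apply fn2_ext; intros; symmetry; apply H).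
  assert (E2 : f = fun x y => f x (y + PI)) by (apply fn2_ext; intros; symmetry; apply H).
  assert (F : forall x, is_derive (fun x => x + PI) x 1) by (intro; auto_derive; auto).
  split.
  - rewrite E1 at 2. symmetry. destruct b; simpl; unfold pdu, pdv.
    + apply is_derive_unique. eapply isd_eq; [apply (isd_comp (fun z => f z v) (fun x => x + PI)); [apply smooth2_du, S|apply F]|].
      req; unfold pdu; ring.
    + reflexivity.
  - rewrite E2 at 2. symmetry. destruct b; simpl; unfold pdu, pdv.
    + reflexivity.
    + apply is_derive_unique. eapply isd_eq; [apply (isd_comp (fun z => f u z) (fun x => x + PI)); [apply smooth2_dv, S|apply F]|].
      req; unfold pdv; ring.
Qed.

Lemma tor_add f g : tor f -> tor g -> tor (fadd f g).
Proof.
  intros [Sf Pf] [Sg Pg]; split; [now apply smooth2_fadd|].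
  intros u v; unfold fadd; destruct (Pf u v) as [-> ->], (Pg u v) as [-> ->]; auto.
Qed.
Lemma tor_mul f g : tor f -> tor g -> tor (fmul f g).
Proof.
  intros [Sf Pf] [Sg Pg]; split; [now apply smooth2_fmul|].
  intros u v; unfold fmul; destruct (Pf u v) as [-> ->], (Pg u v) as [-> ->]; auto.
Qed.
Lemma tor_const c : tor (fun _ _ => c).
Proof. split; [apply smooth2_const|]. now split. Qed.
Lemma tor_scal c f : tor f -> tor (fscal c f).
Proof. intro H; apply (tor_mul (fun _ _ => c)); auto using tor_const. Qed.
Lemma tor_dd b f : tor f -> tor (dd b f).
Proof. intros [S P]; split; [now apply smooth2_dd|now apply per_dd]. Qed.
Lemma tor_cont f : tor f -> cont2 f.
Proof. intros [S _]; now apply smooth2_cont. Qed.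
#[export] Hint Resolve tor_add tor_mul tor_const tor_scal tor_dd : sp.

Lemma I2_dd b h : tor h -> I2 (dd b h) = 0.
Proof.
  intros [S P]. unfold I2. destruct b; simpl.
  - rewrite (RInt_FTC (fun u => RInt (fun v => h u v) 0 PI)).
    + apply Rminus_diag_eq. apply RInt_ext_all; intro v. rewrite <- (Rplus_0_l PI) at 1. apply P.
    + intro u; now apply is_derive_param.
    + apply cont_RInt_param, (smooth2_cont (pdu h)). smooth.
  - rewrite (RInt_ext_all _ (fun _ => 0)); [rewrite RInt_const_r; ring|].
    intro u. rewrite (RInt_FTC (fun v => h u v)).
    + apply Rminus_diag_eq. rewrite <- (Rplus_0_l PI) at 1. apply P.
    + now apply smooth2_dv.
    + apply (cont2_v (pdv h)), (smooth2_cont (pdv h)). smooth.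
Qed.

Lemma I2_fadd f g : tor f -> tor g -> I2 (fadd f g) = I2 f + I2 g.
Proof. intros; apply I2_add; now apply tor_cont. Qed.
Lemma I2_fscal c f : tor f -> I2 (fscal c f) = c * I2 f.
Proof. intros; apply I2_scal; now apply tor_cont. Qed.

Lemma ibp b f g : tor f -> tor g -> I2 (fmul (dd b f) g) = - I2 (fmul f (dd b g)).
Proof.
  intros Hf Hg. pose proof (I2_dd b (fmul f g) ltac:(auto with sp)) as H.
  rewrite dd_mul in H by (apply Hf || apply Hg).
  rewrite I2_fadd in H by auto with sp. lra.
Qed.

Definition ddn (b : bool) (s : nat) (f : fn2) : fn2 := Nat.iter s (dd b) f.

Lemma tor_ddn b s f : tor f -> tor (ddn b s f).
Proof. intro H; induction s; simpl; auto with sp. Qed.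
#[export] Hint Resolve tor_ddn : sp.

Lemma ddn_S b s f : ddn b (S s) f = ddn b s (dd b f).
Proof. unfold ddn. rewrite Nat.iter_succ_r. reflexivity. Qed.

(** Half of the 2s derivatives move to f, with sign (-1)^s. For f a flux and g a derivative of the
    solution this exposes the form of order s that ellipticity bounds from below. *)
Lemma ibp_n b s f g : tor f -> tor g ->
  I2 (fmul f (fscal ((-1) ^ s) (ddn b s (ddn b s g)))) = I2 (fmul (ddn b s f) (ddn b s g)).
Proof.
  revert f g; induction s as [|s IH]; intros f g Hf Hg.
  - apply I2_ext; intros; unfold fmul, fscal; simpl; ring.
  - transitivity (- I2 (fmul f (dd b (fscal ((-1)^s) (ddn b s (ddn b s (dd b g))))))).
    + rewrite dd_scal by (apply tor_ddn; auto with sp).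
      
      replace (- I2 (fmul f (fscal ((-1) ^ s) (dd b (ddn b s (ddn b s (dd b g)))))))
       with (-1 * I2 (fmul f (fscal ((-1) ^ s) (dd b (ddn b s (ddn b s (dd b g))))))) by ring.
      rewrite <- I2_fscal by auto 10 with sp.
      rewrite <- (ddn_S b s g).
      apply I2_ext; intros; unfold fmul, fscal; simpl; ring.
    + rewrite <- ibp by auto with sp. rewrite IH by auto with sp.
      now rewrite <- !ddn_S.
Qed.

Lemma dd_ddn b b' s f : smooth2 f -> dd b (ddn b' s f) = ddn b' s (dd b f).
Proof.
  intro H; induction s; simpl; auto. change (Nat.iter s (dd b') f) with (ddn b' s f).
  rewrite dd_comm; [now rewrite IHs|]. clear IHs; induction s; simpl; auto. now apply smooth2_dd.
Qed.
Lemma smooth2_ddn b s f : smooth2 f -> smooth2 (ddn b s f).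
Proof. intro H; induction s; simpl; auto using smooth2_dd. Qed.
Lemma ddn_comm b s b' s' f : smooth2 f -> ddn b s (ddn b' s' f) = ddn b' s' (ddn b s f).
Proof.
  intro H; induction s; auto. simpl. change (Nat.iter s (dd b) ?f) with (ddn b s f).
  rewrite IHs. rewrite dd_ddn by now apply smooth2_ddn. reflexivity.
Qed.
Lemma ddn_add b s f g : smooth2 f -> smooth2 g -> ddn b s (fadd f g) = fadd (ddn b s f) (ddn b s g).
Proof. intros; induction s; auto; simpl; rewrite IHs; apply dd_add; now apply smooth2_ddn. Qed.
Lemma ddn_scal b s c f : smooth2 f -> ddn b s (fscal c f) = fscal c (ddn b s f).
Proof. intros; induction s; auto; simpl; rewrite IHs; apply dd_scal; now apply smooth2_ddn. Qed.

(** * Positive semidefinite forms *)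

Notation vec := (nat -> R).

(* A positive semidefinite symmetric form on R^n; a vector is a sequence of
   which the form only sees the first n entries. *)
Record psd (n : nat) (H : vec -> vec -> R) : Prop := {
  psd_lin : forall a c d e, H (fun i => a * c i + d i) e = a * H c e + H d e;
  psd_sym : forall c d, H c d = H d c;
  psd_pos : forall c, 0 <= H c c;
  psd_dep : forall c d e, (forall i, (i < n)%nat -> c i = d i) -> H c e = H d e
}.

Lemma psd_expand n H (PH : psd n H) a c d :
  H (fun i => a * c i + d i) (fun i => a * c i + d i) = a * a * H c c + 2 * a * H c d + H d d.
Proof.
  rewrite (psd_lin _ _ PH), (psd_sym _ _ PH c), (psd_sym _ _ PH d), !(psd_lin _ _ PH).
  rewrite (psd_sym _ _ PH d c). ring.
Qed.

Lemma quad_nonneg_zero a b : (forall t, 0 <= t * (2 * a) + t * t * b) -> a = 0.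
Proof.
  intros H. destruct (Req_dec a 0) as [|Ha]; auto. exfalso.
  assert (B : 0 <= b) by (pose proof (H 1); pose proof (H (-1)); lra).
  (* At this t the quadratic equals - a^2 (b + 2) / (b + 1)^2, which is negative unless a = 0. *)
  pose proof (H (- a / (b + 1))) as K.
  replace (- a / (b + 1) * (2 * a) + - a / (b + 1) * (- a / (b + 1)) * b)
    with (- (a * a) * ((b + 2) / ((b + 1) * (b + 1)))) in K by (field; lra).
  assert (0 < (b + 2) / ((b + 1) * (b + 1))) by (apply Rdiv_lt_0_compat; nra).
  assert (0 < a * a) by (destruct (Rtotal_order a 0) as [|[|]]; nra).
  pose proof (Rmult_lt_0_compat _ _ H1 H0). lra.
Qed.

(** The degenerate case of Cauchy-Schwarz: an isotropic vector of a semidefinite form lies in its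
    radical. It also yields the Euler-Lagrange equation of a minimizer. *)
Lemma psd_kernel n H (PH : psd n H) c d : H c c = 0 -> H c d = 0.
Proof.
  intro H0. apply (quad_nonneg_zero (H c d) (H d d)). intro t.
  pose proof (psd_pos _ _ PH (fun i => t * d i + c i)) as P.
  rewrite (psd_expand _ _ PH), H0, (psd_sym _ _ PH d c) in P. lra.
Qed.

Lemma psd_dep2 n H (PH : psd n H) c d c' d' :
  (forall i, (i < n)%nat -> c i = c' i) -> (forall i, (i < n)%nat -> d i = d' i) -> H c d = H c' d'.
Proof.
  intros Hc Hd. rewrite (psd_dep _ _ PH c c' d Hc), (psd_sym _ _ PH c' d), (psd_dep _ _ PH d d' c' Hd).
  apply (psd_sym _ _ PH).
Qed.

(** Stands in for the compactness of the unit sphere. The induction removes the last basis vector e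
    after making the remaining ones H-orthogonal to it, one step of Gram-Schmidt. *)
Lemma psd_dominated n H M : psd n H -> psd n M -> (forall c, H c c = 0 -> M c c = 0) ->
  exists C, 0 <= C /\ forall c, M c c <= C * H c c.
Proof.
  revert H M; induction n as [|n IH]; intros H M PH PM K.
  - exists 0; split; [lra|]. intro c. rewrite Rmult_0_l.
    assert (Z : M (fun i => 1 * c i + c i) c = M c c) by (apply (psd_dep _ _ PM); lia).
    rewrite (psd_lin _ _ PM) in Z. lra.
  - set (e := fun i => if Nat.eqb i n then 1 else 0).
    set (p := fun (c : vec) i => if Nat.eqb i n then 0 else c i).
    set (h := H e e).
    (* [q c] is c with its last entry changed so as to be H-orthogonal to e, and c = tau c * e + q c
       on the first n + 1 entries. If h = 0, e is orthogonal to everything by [psd_kernel]. *)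
    set (a := fun c : vec => - (H (p c) e * / h)).
    set (q := fun c i => a c * e i + p c i).
    set (tau := fun c : vec => c n - a c).
    assert (pdep : forall c d, (forall i, (i < n)%nat -> c i = d i) ->
       forall i, (i < S n)%nat -> p c i = p d i).
    { intros c d E i Hi; unfold p. destruct (Nat.eqb_spec i n); auto. apply E; lia. }
    assert (adep : forall c d, (forall i, (i < n)%nat -> c i = d i) -> a c = a d).
    { intros c d E; unfold a. now rewrite (psd_dep _ _ PH (p c) (p d) e (pdep c d E)). }
    assert (plin : forall x c d, p (fun i => x * c i + d i) = fun i => x * p c i + p d i).
    { intros; extensionality i; unfold p; destruct (Nat.eqb i n); ring. }
    assert (alin : forall x c d, a (fun i => x * c i + d i) = x * a c + a d).
    { intros; unfold a; rewrite plin, (psd_lin _ _ PH). ring. }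
    assert (qlin : forall x c d, q (fun i => x * c i + d i) = fun i => x * q c i + q d i).
    { intros; unfold q; rewrite plin, alin; extensionality i; ring. }
    assert (qdep : forall c d, (forall i, (i < n)%nat -> c i = d i) ->
       forall i, (i < S n)%nat -> q c i = q d i).
    { intros c d E i Hi; unfold q. now rewrite (adep c d E), (pdep c d E i Hi). }
    assert (PQ : forall F, psd (S n) F -> psd n (fun c d => F (q c) (q d))).
    { intros F PF; split.
      - intros; now rewrite qlin, (psd_lin _ _ PF).
      - intros; apply (psd_sym _ _ PF).
      - intros; apply (psd_pos _ _ PF).
      - intros c d x E. apply (psd_dep _ _ PF). auto. }
    assert (split_ : forall F, psd (S n) F -> forall c,
       F c c = tau c * tau c * F e e + 2 * tau c * F e (q c) + F (q c) (q c)).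
    { intros F PF c. rewrite <- (psd_expand _ _ PF). apply (psd_dep2 _ _ PF);
      intros i Hi; unfold tau, q, e, p; destruct (Nat.eqb_spec i n); subst; ring. }
    assert (Hq : forall c, H e (q c) = 0).
    { intro c. destruct (Req_dec h 0) as [h0|h0]; [now apply (psd_kernel _ _ PH)|].
      rewrite (psd_sym _ _ PH). unfold q. rewrite (psd_lin _ _ PH). fold h. unfold a. field; auto. }
    destruct (IH _ _ (PQ H PH) (PQ M PM)) as [C [C0 HC]].
    { intros c; apply K. }
    assert (hp : 0 <= h) by apply (psd_pos _ _ PH).
    assert (mp : 0 <= M e e) by apply (psd_pos _ _ PM).
    assert (exists K, 0 <= K /\ M e e <= K * h) as [K' [K0 HK]].
    { destruct (Req_dec h 0) as [h0|h0].
      - exists 0; split; [lra|]. rewrite (K e h0). lra.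
      - exists (M e e / h); split.
        + apply Rdiv_le_0_compat; lra.
        + apply Req_le; field; auto. }
    exists (2 * C + 2 * K'); split; [lra|]. intro c.
    (* The M-cross term has no sign; positivity at q - tau e bounds it, giving M(tau e + q) <= 2
       tau^2 M(e) + 2 M(q) and the factors 2 in the constant. *)
    pose proof (psd_pos _ _ PM (fun i => - tau c * e i + q c i)) as S1.
    rewrite (psd_expand _ _ PM) in S1.
    rewrite (split_ M PM c), (split_ H PH c), Hq. fold h.
    specialize (HC c). simpl in HC. pose proof (psd_pos _ _ PH (q c)).
    pose proof (Rle_0_sqr (tau c)) as T; unfold Rsqr in T.
    pose proof (Rmult_le_compat_l _ _ _ T HK).
    apply Rle_trans with (2 * (tau c * tau c * M e e) + 2 * M (q c) (q c)); [lra|].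
    assert (0 <= K' * H (q c) (q c)) by (apply Rmult_le_pos; auto).
    assert (0 <= C * (tau c * tau c * h)) by (apply Rmult_le_pos; [auto|now apply Rmult_le_pos]).
    assert (0 <= K' * (tau c * tau c * h)) by (apply Rmult_le_pos; [auto|now apply Rmult_le_pos]).
    lra.
Qed.

(** The infimum mu of Q/M is attained: otherwise the kernel of Q - mu M would lie in that of M, so
    [psd_dominated] would give M <= C (Q - mu M), and mu could be raised by 1/C. The last clause
    says that the minimizer is in the radical of Q - mu M. *)
Lemma psd_min_ratio n Q M : psd n Q -> psd n M -> (forall c, M c c = 0 -> Q c c = 0) ->
  (exists c, 0 < M c c) ->
  exists c mu, M c c = 1 /\ 0 <= mu /\ (forall d, mu * M d d <= Q d d) /\
    forall d, Q c d = mu * M c d.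
Proof.
  intros PQ PM K [c0 Hc0].
  assert (norm : forall F, psd n F -> forall c t, F (fun i => t * c i + 0) (fun i => t * c i + 0) = t * t * F c c).
  { intros F PF c t. pose proof (psd_expand _ _ PF t c (fun i => 0 * c i)) as E.
    cbv beta in E. replace (fun i => t * c i + 0 * c i) with (fun i => t * c i + 0) in E by (extensionality i; ring).
    assert (Z : forall d, F (fun i => 0 * c i) d = 0).
    { intro d. pose proof (psd_lin _ _ PF 0 c (fun i => 0 * c i) d) as L.
      pose proof (psd_lin _ _ PF (-1) (fun i => 0 * c i) (fun i => 0 * c i) d) as L'.
      cbv beta in L'. replace (fun i => -1 * (0 * c i) + 0 * c i) with (fun i => 0 * c i) in L' by (extensionality i; ring).
      lra. }
    rewrite E, (psd_sym _ _ PF c (fun i => 0 * c i)), !Z. ring. }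
  (* The sign turns the infimum into a supremum, as [completeness] requires. *)
  set (E := fun x => exists c, M c c = 1 /\ x = - Q c c).
  assert (unit : forall c, 0 < M c c -> exists d, M d d = 1 /\ Q d d = Q c c / M c c).
  { intros c Hc. set (t := / sqrt (M c c)). exists (fun i => t * c i + 0).
    pose proof (sqrt_lt_R0 _ Hc). assert (t * t = / M c c).
    { unfold t. rewrite <- Rinv_mult, sqrt_sqrt; lra. }
    rewrite (norm M PM), (norm Q PQ), H0. split; field; lra. }
  destruct (completeness E) as [s [ub lub]].
  - exists 0. intros x [c [_ ->]]. pose proof (psd_pos _ _ PQ c); lra.
  - destruct (unit c0 Hc0) as [d [Hd _]]. exists (- Q d d), d; auto.
  - set (mu := - s).
    assert (B : forall d, mu * M d d <= Q d d).
    { intro d. destruct (Rle_lt_or_eq_dec _ _ (psd_pos _ _ PM d)) as [Hd|Hd].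
      - destruct (unit d Hd) as [d' [H1 H2]].
        assert (- Q d' d' <= s) by (apply ub; exists d'; auto). rewrite H2 in H.
        assert (Q d d = Q d d / M d d * M d d) by (field; lra). unfold mu. nra.
      - rewrite <- Hd. pose proof (psd_pos _ _ PQ d); lra. }
    assert (PH : psd n (fun c d => Q c d - mu * M c d)).
    { split.
      - intros; rewrite (psd_lin _ _ PQ), (psd_lin _ _ PM); ring.
      - intros; now rewrite (psd_sym _ _ PQ), (psd_sym _ _ PM).
      - intros c; specialize (B c); lra.
      - intros c d e H; now rewrite (psd_dep _ _ PQ c d e H), (psd_dep _ _ PM c d e H). }
    destruct (classic (forall c, Q c c - mu * M c c = 0 -> M c c = 0)) as [N|N].
    + exfalso. destruct (psd_dominated _ _ _ PH PM N) as [C [C0 HC]].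
      assert (Cp : 0 < C).
      { destruct C0 as [|<-]; auto. specialize (HC c0); lra. }
      assert (s <= s - / C); [|pose proof (Rinv_0_lt_compat _ Cp); lra].
      apply lub. intros x [c [H1 ->]]. specialize (HC c). rewrite H1 in HC. unfold mu in HC.
      assert (/ C * 1 <= / C * (C * (Q c c - - s * 1))).
      { apply Rmult_le_compat_l; auto. left; now apply Rinv_0_lt_compat. }
      rewrite <- Rmult_assoc, Rinv_l in H by lra. lra.
    + apply not_all_ex_not in N as [c N]. apply imply_to_and in N as [H0 H1].
      assert (Hc : 0 < M c c) by (pose proof (psd_pos _ _ PM c); lra).
      destruct (unit c Hc) as [d [D1 D2]]. exists d, mu.
      assert (Q d d = mu). { rewrite D2. replace (Q c c) with (mu * M c c) by lra. field; lra. }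
      split; [auto|]. split; [rewrite <- H; apply (psd_pos _ _ PQ)|]. split; auto.
      intro x. pose proof (psd_kernel _ _ PH d x) as Kx. simpl in Kx. rewrite D1, H in Kx. lra.
Qed.

(** * Uniform bounds for periodic functions *)

Lemma cont2_bounded f M : cont2 f -> exists K, 0 <= K /\
  forall u v, Rabs u <= M -> Rabs v <= M -> Rabs (f u v) <= K.
Proof.
  intros Hf. destruct (Rlt_dec M 0) as [HM|HM].
  { exists 0; split; [lra|]. intros u v Hu. pose proof (Rabs_pos u); lra. }
  assert (M0 : 0 <= M) by lra.
  destruct (uniform_continuity_2d f (- M) M (- M) M (fun x y _ _ => Hf x y) (mkposreal 1 Rlt_0_1)) as [[d d0] Hd].
  simpl in Hd.
  destruct (nfloor_ex (M / d)) as [N [_ HN]]; [now apply Rdiv_le_0_compat|].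
  (* The segment from the origin to (u, v) is walked in n steps, each shorter than the modulus of
     continuity for the oscillation 1, so f changes by at most n along it. *)
  set (n := S N). assert (n0 : 0 < INR n) by (apply lt_0_INR; lia).
  assert (step : M / INR n < d).
  { unfold n; rewrite S_INR. apply Rlt_div_l; [rewrite <- S_INR; auto|].
    apply Rlt_div_l in HN; lra. }
  exists (Rabs (f 0 0) + INR n); split; [pose proof (Rabs_pos (f 0 0)); lra|].
  intros u v Hu Hv.
  assert (sc : forall x k, Rabs x <= M -> (k <= n)%nat -> Rabs (x * (INR k / INR n)) <= M).
  { intros x k Hx Hk. rewrite Rabs_mult. assert (0 <= INR k / INR n <= 1).
    { split; [apply Rdiv_le_0_compat; auto using pos_INR|]. apply Rle_div_l; auto. rewrite Rmult_1_l; now apply le_INR. }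
    rewrite (Rabs_right (INR k / INR n)) by lra. pose proof (Rabs_pos x). nra. }
  assert (st : forall x k, Rabs x <= M -> Rabs (x * (INR (S k) / INR n) - x * (INR k / INR n)) < d).
  { intros x k Hx. rewrite S_INR. replace (x * ((INR k + 1) / INR n) - x * (INR k / INR n)) with (x * / INR n) by (field; lra).
    rewrite Rabs_mult, (Rabs_right (/ INR n)) by (left; now apply Rinv_0_lt_compat).
    apply Rle_lt_trans with (M / INR n); auto. apply Rmult_le_compat_r; auto. left; now apply Rinv_0_lt_compat. }
  assert (I : forall k, (k <= n)%nat ->
     Rabs (f (u * (INR k / INR n)) (v * (INR k / INR n)) - f 0 0) <= INR k).
  { induction k as [|k IH]; intro Hk.
    - change (INR 0) with 0. replace (u * (0 / INR n)) with 0 by (field; lra). replace (v * (0 / INR n)) with 0 by (field; lra).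
      rewrite Rminus_diag, Rabs_R0; lra.
    - rewrite (S_INR k) at 3. specialize (IH ltac:(lia)).
      pose proof (sc u k Hu ltac:(lia)) as A1. pose proof (sc v k Hv ltac:(lia)) as A2.
      pose proof (sc u (S k) Hu ltac:(lia)) as A3. pose proof (sc v (S k) Hv ltac:(lia)) as A4.
      apply Rabs_le_between in A1, A2, A3, A4.
      pose proof (Hd _ _ _ _ A1 A2 A3 A4 (st u k Hu) (st v k Hv)) as B.
      match goal with |- Rabs (?x - ?z) <= _ => match type of B with Rabs (_ - ?y) < _ =>
        replace (x - z) with ((x - y) + (y - z)) by ring; eapply Rle_trans; [apply Rabs_triang|lra] end end. }
  specialize (I n ltac:(lia)). replace (u * (INR n / INR n)) with u in I by (field; lra).
  replace (v * (INR n / INR n)) with v in I by (field; lra).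
  replace (f u v) with ((f u v - f 0 0) + f 0 0) by ring. eapply Rle_trans; [apply Rabs_triang|]; lra.
Qed.

Lemma reduce_PI x : exists k : Z, 0 <= x - IZR k * PI <= PI.
Proof.
  pose proof PI_RGT_0 as P. exists (Int_part (x / PI)).
  destruct (base_Int_part (x / PI)) as [H1 H2].
  assert (E : x = x / PI * PI) by (field; lra).
  set (q := x / PI) in *. nra.
Qed.

Lemma per_Z (f : R -> R) : (forall x, f (x + PI) = f x) -> forall k x, f (x - IZR k * PI) = f x.
Proof.
  intros H.
  assert (N : forall n x, f (x - INR n * PI) = f x).
  { induction n; intro x; [simpl; f_equal; ring|]. rewrite <- (H (x - INR (S n) * PI)), S_INR.
    rewrite <- (IHn x). f_equal; ring. }
  intros k x. destruct (Z.abs_eq_or_opp k) as [E|E].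
  - rewrite <- (N (Z.to_nat k) x). rewrite INR_IZR_INZ, Z2Nat.id by lia. reflexivity.
  - rewrite <- (N (Z.to_nat (- k)) (x - IZR k * PI)). rewrite INR_IZR_INZ, Z2Nat.id by lia.
    rewrite opp_IZR. f_equal; ring.
Qed.

Lemma per_all (f : fn2) (P : R -> Prop) : per f ->
  (forall u v, 0 <= u <= PI -> 0 <= v <= PI -> P (f u v)) -> forall u v, P (f u v).
Proof.
  intros Hf H u v. destruct (reduce_PI u) as [k Hk], (reduce_PI v) as [m Hm].
  rewrite <- (per_Z (fun x => f x v) (fun x => proj1 (Hf x v)) k u).
  rewrite <- (per_Z (fun y => f (u - IZR k * PI) y) (fun y => proj2 (Hf _ y)) m v). auto.
Qed.

Lemma per_bounded f : cont2 f -> per f -> exists K, 0 <= K /\ forall u v, Rabs (f u v) <= K.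
Proof.
  intros Hc Hp. destruct (cont2_bounded f PI Hc) as [K [K0 HK]]. exists K; split; auto.
  apply (per_all f (fun y => Rabs y <= K)); auto. intros; apply HK; rewrite Rabs_right; lra.
Qed.

Lemma tor_bounded f : tor f -> exists K, 0 <= K /\ forall u v, Rabs (f u v) <= K.
Proof. intro H; apply per_bounded; [now apply tor_cont|apply H]. Qed.

Lemma tor_pos_min f : tor f -> (forall u v, 0 < f u v) -> exists k, 0 < k /\ forall u v, k <= f u v.
Proof.
  intros [S P] H. assert (H' : forall u v, f u v <> 0) by (intros u v; specialize (H u v); lra).
  (* A positive lower bound for f is an upper bound for its inverse; K + 1 below avoids inverting a
     zero K. *)
  destruct (tor_bounded (fun u v => / f u v)) as [K [K0 HK]].
  { split; [now apply smooth2_inv|]. intros u v; destruct (P u v) as [-> ->]; auto. }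
  exists (/ (K + 1)); split; [apply Rinv_0_lt_compat; lra|]. intros u v.
  rewrite <- (Rinv_inv (f u v)). apply Rinv_le_contravar; [apply Rinv_0_lt_compat, H|].
  specialize (HK u v). apply Rabs_le_between in HK; lra.
Qed.

(** * L2 norms and commutators of derivatives with multiplications *)

Definition N2 (f : fn2) : R := I2 (fmul f f).

Lemma N2_ge0 f : tor f -> 0 <= N2 f.
Proof. intro H; apply I2_ge0; [apply tor_cont; auto with sp|]. intros; unfold fmul; nra. Qed.

Lemma I2_le_tor f g : tor f -> tor g -> (forall u v, f u v <= g u v) -> I2 f <= I2 g.
Proof. intros; apply I2_le; auto using tor_cont. Qed.

Lemma N2_add f g : tor f -> tor g -> N2 (fadd f g) <= 2 * N2 f + 2 * N2 g.
Proof.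
  intros Hf Hg. unfold N2. rewrite <- !I2_fscal, <- I2_fadd by auto 10 with sp.
  apply I2_le_tor; auto 10 with sp. intros u v; unfold fadd, fmul, fscal. pose proof (Rle_0_sqr (f u v - g u v)); unfold Rsqr in *; lra.
Qed.

Lemma N2_mul a K f : tor a -> tor f -> (forall u v, Rabs (a u v) <= K) ->
  N2 (fmul a f) <= K * K * N2 f.
Proof.
  intros Ha Hf HK. unfold N2. rewrite <- !I2_fscal by auto 10 with sp.
  apply I2_le_tor; auto 10 with sp. intros u v; unfold fadd, fmul, fscal.
  specialize (HK u v). apply Rabs_le_between in HK.
  assert (0 <= (K - a u v) * (K + a u v)) by (apply Rmult_le_pos; lra).
  pose proof (Rle_0_sqr (f u v)); unfold Rsqr in *. nra.
Qed.

Lemma I2_young e f g : 0 < e -> tor f -> tor g ->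
  Rabs (I2 (fmul f g)) <= e * N2 f + / (4 * e) * N2 g.
Proof.
  intros He Hf Hg. unfold N2.
  assert (K : forall f, tor f -> I2 (fmul f g) <= e * I2 (fmul f f) + / (4 * e) * I2 (fmul g g)).
  { clear f Hf; intros f Hf. rewrite <- !I2_fscal, <- I2_fadd by auto 10 with sp.
    apply I2_le_tor; auto 10 with sp. intros u v; unfold fadd, fmul, fscal.
    set (x := f u v); set (y := g u v).
    assert (0 <= e * ((x - / (2 * e) * y) * (x - / (2 * e) * y))) by (apply Rmult_le_pos; [lra|apply Rle_0_sqr]).
    replace (e * ((x - / (2 * e) * y) * (x - / (2 * e) * y))) with (e * (x * x) - x * y + / (4 * e) * (y * y)) in H by (field; lra).
    lra. }
  apply Rabs_le; split.
  - pose proof (K (fscal (-1) f) ltac:(auto with sp)) as H.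
    replace (fmul (fscal (-1) f) g) with (fscal (-1) (fmul f g)) in H by (apply fn2_ext; intros; unfold fmul, fscal; ring).
    replace (fmul (fscal (-1) f) (fscal (-1) f)) with (fmul f f) in H by (apply fn2_ext; intros; unfold fmul, fscal; ring).
    rewrite I2_fscal in H by auto with sp. lra.
  - auto.
Qed.

(** The sum stops at order s - 1, so [Sg b s f] gathers exactly what is of lower order than
    [ddn b s f]. *)
Fixpoint Sg (b : bool) (s : nat) (f : fn2) : R :=
  match s with O => 0 | S s => Sg b s f + N2 (ddn b s f) end.

Lemma Sg_ge0 b s f : tor f -> 0 <= Sg b s f.
Proof. intro H; induction s; simpl; [lra|]. pose proof (N2_ge0 (ddn b s f) ltac:(auto with sp)). lra. Qed.

Lemma Sg_shift b s f : tor f -> Sg b (S s) f = N2 f + Sg b s (dd b f).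
Proof.
  intro H; induction s; [simpl; ring|].
  change (Sg b (S (S s)) f) with (Sg b (S s) f + N2 (ddn b (S s) f)). rewrite IHs, ddn_S. simpl. ring.
Qed.

(** The commutator [d^s, a] has order s - 1. Inductively, [d^(s+1), a] f = [d^s, a] df + [d^s, da] f
    + da d^s f, and each of the three terms is bounded by derivatives of f of order at most s. *)
Lemma commutator b s a : tor a -> exists C, 0 <= C /\ forall f, tor f ->
  N2 (fadd (ddn b s (fmul a f)) (fscal (-1) (fmul a (ddn b s f)))) <= C * Sg b s f.
Proof.
  revert a; induction s as [|s IH]; intros a Ha.
  - exists 0; split; [lra|]. intros f Hf. simpl.
    unfold N2. rewrite (I2_ext _ (fun _ _ => 0)); [rewrite I2_const; lra|].
    intros; unfold fmul, fadd, fscal; ring.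
  - destruct (IH a Ha) as [C1 [P1 H1]], (IH (dd b a) ltac:(auto with sp)) as [C2 [P2 H2]].
    destruct (tor_bounded (dd b a) ltac:(auto with sp)) as [K [K0 HK]].
    exists (2 * C1 + (4 * C2 + 4 * (K * K))). split; [nra|]. intros f Hf.
    set (r1 := fadd (ddn b s (fmul a (dd b f))) (fscal (-1) (fmul a (ddn b s (dd b f))))).
    set (r2 := fadd (ddn b s (fmul (dd b a) f)) (fscal (-1) (fmul (dd b a) (ddn b s f)))).
    assert (E : fadd (ddn b (S s) (fmul a f)) (fscal (-1) (fmul a (ddn b (S s) f)))
       = fadd r1 (fadd r2 (fmul (dd b a) (ddn b s f)))).
    { rewrite ddn_S, (ddn_S b s f), dd_mul by (apply Ha || apply Hf).
      rewrite ddn_add by (apply tor_mul; auto with sp).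
      apply fn2_ext; intros; unfold r1, r2, fmul, fadd, fscal; ring. }
    rewrite E. assert (S1 : tor r1) by (unfold r1; auto 10 with sp). assert (S2 : tor r2) by (unfold r2; auto 10 with sp).
    eapply Rle_trans; [apply N2_add; auto 10 with sp|].
    pose proof (N2_add r2 (fmul (dd b a) (ddn b s f)) S2 ltac:(auto with sp)) as A1.
    pose proof (N2_mul (dd b a) K (ddn b s f) ltac:(auto with sp) ltac:(auto with sp) HK) as A2.
    specialize (H1 (dd b f) ltac:(auto with sp)). specialize (H2 f Hf). fold r1 in H1. fold r2 in H2.
    assert (G0 : 0 <= N2 f) by now apply N2_ge0.
    assert (G1 : Sg b s (dd b f) <= Sg b (S s) f) by (rewrite Sg_shift by auto; lra).
    assert (G2 : Sg b s f <= Sg b (S s) f) by (simpl; pose proof (N2_ge0 (ddn b s f) ltac:(auto with sp)); lra).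
    assert (G3 : N2 (ddn b s f) <= Sg b (S s) f) by (simpl; pose proof (Sg_ge0 b s f Hf); lra).
    pose proof (Rmult_le_compat_l _ _ _ P1 G1). pose proof (Rmult_le_compat_l _ _ _ P2 G2).
    assert (K * K * N2 (ddn b s f) <= K * K * Sg b (S s) f) by (apply Rmult_le_compat_l; [nra|auto]).
    lra.
Qed.

Lemma N2_ddn_mul b s a : tor a -> exists C, 0 <= C /\ forall f, tor f ->
  N2 (ddn b s (fmul a f)) <= C * Sg b (S s) f.
Proof.
  intros Ha. destruct (commutator b s a Ha) as [C [C0 HC]]. destruct (tor_bounded a Ha) as [K [K0 HK]].
  exists (2 * C + 2 * (K * K)); split; [nra|]. intros f Hf.
  pose proof (N2_add (fadd (ddn b s (fmul a f)) (fscal (-1) (fmul a (ddn b s f)))) (fmul a (ddn b s f))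
    ltac:(auto 10 with sp) ltac:(auto 10 with sp)) as A.
  replace (fadd (fadd (ddn b s (fmul a f)) (fscal (-1) (fmul a (ddn b s f)))) (fmul a (ddn b s f)))
    with (ddn b s (fmul a f)) in A by (apply fn2_ext; intros; unfold fadd, fmul, fscal; ring).
  pose proof (N2_mul a K (ddn b s f) Ha ltac:(auto with sp) HK).
  specialize (HC f Hf). simpl.
  pose proof (N2_ge0 (ddn b s f) ltac:(auto with sp)). pose proof (Sg_ge0 b s f Hf).
  assert (0 <= K * K * Sg b s f) by (apply Rmult_le_pos; nra).
  assert (0 <= C * N2 (ddn b s f)) by (apply Rmult_le_pos; nra).
  lra.
Qed.

(** * Galerkin approximation of an elliptic eigenvalue problem *)

(* The eigenvalue problem considered on the flat torus is
   - pdu (ka pdu f + kb pdv f) - pdv (kb pdu f + kc pdv f) = mu kr f. *)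
Record coeffs : Type := Coeffs { ka : fn2; kb : fn2; kc : fn2; kr : fn2 }.

Definition elliptic (k : coeffs) : Prop :=
  (tor (ka k) /\ tor (kb k) /\ tor (kc k) /\ tor (kr k)) /\
  forall u v, 0 < ka k u v /\ 0 < ka k u v * kc k u v - kb k u v ^ 2 /\ 0 < kr k u v.

Definition flux (k : coeffs) (b : bool) (f : fn2) : fn2 :=
  if b then fadd (fmul (ka k) (pdu f)) (fmul (kb k) (pdv f))
  else fadd (fmul (kb k) (pdu f)) (fmul (kc k) (pdv f)).

Definition Bf (k : coeffs) (f g : fn2) : R :=
  I2 (fadd (fmul (flux k true f) (pdu g)) (fmul (flux k false f) (pdv g))).
Definition Mf (k : coeffs) (f g : fn2) : R := I2 (fmul (kr k) (fmul f g)).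
Definition mean (k : coeffs) (f : fn2) : R := Mf k f (fun _ _ => 1).
Definition mass (k : coeffs) : R := I2 (kr k).
(** The mass form of the functions recentred to mean zero. Minimizing [Bf] against [Cov] instead of
    [Mf] removes the constants while the minimization still runs over the whole span. *)
Definition Cov (k : coeffs) (f g : fn2) : R := Mf k f g - mean k f * mean k g / mass k.

Lemma tor_pdu f : tor f -> tor (pdu f).
Proof. exact (tor_dd true f). Qed.
Lemma tor_pdv f : tor f -> tor (pdv f).
Proof. exact (tor_dd false f). Qed.
#[export] Hint Resolve tor_pdu tor_pdv : sp.

Lemma tor_flux k b f : elliptic k -> tor f -> tor (flux k b f).
Proof. intros [[A [B [C D]]] _] H; destruct b; simpl; auto with sp. Qed.
#[export] Hint Resolve tor_flux : sp.

Lemma tor_kr k : elliptic k -> tor (kr k).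
Proof. intros H; apply H. Qed.
#[export] Hint Resolve tor_kr : sp.

Lemma pdu_lin x f g : tor f -> tor g -> pdu (fadd (fscal x f) g) = fadd (fscal x (pdu f)) (pdu g).
Proof.
  intros [Sf _] [Sg _]. change pdu with (dd true). rewrite dd_add, dd_scal; auto. now apply smooth2_fscal.
Qed.
Lemma pdv_lin x f g : tor f -> tor g -> pdv (fadd (fscal x f) g) = fadd (fscal x (pdv f)) (pdv g).
Proof.
  intros [Sf _] [Sg _]. change pdv with (dd false). rewrite dd_add, dd_scal; auto. now apply smooth2_fscal.
Qed.

Lemma I2_lin x f g : tor f -> tor g -> I2 (fadd (fscal x f) g) = x * I2 f + I2 g.
Proof. intros; rewrite I2_fadd, I2_fscal; auto with sp. Qed.

Lemma Bf_lin k x f g h : elliptic k -> tor f -> tor g -> tor h ->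
  Bf k (fadd (fscal x f) g) h = x * Bf k f h + Bf k g h.
Proof.
  intros Hk Hf Hg Hh. unfold Bf. rewrite <- I2_lin by auto 10 with sp. apply I2_ext; intros u v.
  unfold flux. rewrite pdu_lin, pdv_lin by auto. unfold fadd, fmul, fscal; ring.
Qed.

Lemma Bf_sym k f g : Bf k f g = Bf k g f.
Proof. apply I2_ext; intros; unfold flux, fadd, fmul; ring. Qed.

(** Cayley-Hamilton for a symmetric matrix S of order 2, tr(S) S = det(S) + S^2, evaluated on a
    vector. It bounds S below by det / tr. *)
Lemma elliptic_identity a b c x y :
  (a + c) * ((a * x + b * y) * x + (b * x + c * y) * y) =
  (a * c - b ^ 2) * (x * x + y * y) + ((a * x + b * y) ^ 2 + (b * x + c * y) ^ 2).
Proof. ring. Qed.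

Lemma elliptic_c k : elliptic k -> forall u v, 0 < kc k u v.
Proof. intros [_ H] u v. destruct (H u v) as [H1 [H2 _]]. simpl in H2. nra. Qed.

Lemma elliptic_coercive k : elliptic k -> exists q, 0 < q /\ forall u v x y,
  q * (x * x + y * y) <= (ka k u v * x + kb k u v * y) * x + (kb k u v * x + kc k u v * y) * y.
Proof.
  intros Hk. pose proof (elliptic_c k Hk) as Hc. destruct Hk as [[A [B [C D]]] H].
  assert (P : forall u v, 0 < ka k u v + kc k u v).
  { intros u v; specialize (Hc u v); destruct (H u v) as [? _]; lra. }
  destruct (tor_pos_min (fun u v => (ka k u v * kc k u v - kb k u v ^ 2) / (ka k u v + kc k u v))) as [q [q0 Hq]].
  - split.
    + destruct A, B, C. smooth. intros u v; specialize (P u v); lra.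
    + intros u v. destruct A as [_ A], B as [_ B], C as [_ C].
      destruct (A u v) as [-> ->], (B u v) as [-> ->], (C u v) as [-> ->]; auto.
  - intros u v; apply Rdiv_lt_0_compat; [apply H|apply P].
  - exists q; split; auto. intros u v x y. specialize (Hq u v). specialize (P u v).
    apply Rmult_le_reg_l with (ka k u v + kc k u v); auto. rewrite elliptic_identity.
    apply Rle_div_r in Hq; auto.
    pose proof (Rle_0_sqr (ka k u v * x + kb k u v * y)). pose proof (Rle_0_sqr (kb k u v * x + kc k u v * y)).
    unfold Rsqr in *. assert (0 <= x * x + y * y) by nra. 
    pose proof (Rmult_le_compat_r _ _ _ H2 Hq). simpl in *. lra.
Qed.

Lemma Bf_coercive k : elliptic k -> exists q, 0 < q /\ forall f, tor f ->
  q * (N2 (pdu f) + N2 (pdv f)) <= Bf k f f.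
Proof.
  intros Hk. destruct (elliptic_coercive k Hk) as [q [q0 Hq]]. exists q; split; auto.
  intros f Hf. unfold N2, Bf. rewrite <- I2_fadd, <- I2_fscal by auto 10 with sp.
  apply I2_le_tor; auto 10 with sp. intros u v. apply Hq.
Qed.

Lemma Bf_pos k f : elliptic k -> tor f -> 0 <= Bf k f f.
Proof.
  intros Hk Hf. destruct (Bf_coercive k Hk) as [q [q0 Hq]]. specialize (Hq f Hf).
  pose proof (N2_ge0 (pdu f) ltac:(auto with sp)). pose proof (N2_ge0 (pdv f) ltac:(auto with sp)). nra.
Qed.

Lemma Mf_lin k x f g h : elliptic k -> tor f -> tor g -> tor h ->
  Mf k (fadd (fscal x f) g) h = x * Mf k f h + Mf k g h.
Proof.
  intros Hk Hf Hg Hh. unfold Mf. rewrite <- I2_lin by auto 10 with sp. apply I2_ext; intros u v.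
  unfold fadd, fmul, fscal; ring.
Qed.
Lemma Mf_sym k f g : Mf k f g = Mf k g f.
Proof. apply I2_ext; intros; unfold fmul; ring. Qed.

Lemma mean_const k c : elliptic k -> mean k (fun _ _ => c) = c * mass k.
Proof.
  intro Hk. unfold mean, Mf, mass. rewrite <- I2_fscal by auto with sp.
  apply I2_ext; intros; unfold fmul, fscal; ring.
Qed.

Lemma N2_zero f : tor f -> N2 f = 0 -> forall u v, f u v = 0.
Proof.
  intros Hf H0. apply (per_all f (fun y => y = 0)); [apply Hf|]. intros u v Hu Hv.
  assert (fmul f f u v = 0); [|now apply Rsqr_0_uniq].
  apply I2_zero; auto; [apply tor_cont; auto with sp|]. intros; apply Rle_0_sqr.
Qed.

Lemma Mf_bound k : elliptic k -> exists q, 0 < q /\ forall f, tor f -> q * N2 f <= Mf k f f.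
Proof.
  intros Hk. destruct (tor_pos_min (kr k)) as [q [q0 Hq]]; [apply Hk|intros; apply Hk|].
  exists q; split; auto. intros f Hf. unfold N2, Mf. rewrite <- I2_fscal by auto with sp.
  apply I2_le_tor; auto 10 with sp. intros u v; unfold fscal, fmul. specialize (Hq u v).
  apply Rmult_le_compat_r; auto. apply Rle_0_sqr.
Qed.

Lemma mass_pos k : elliptic k -> 0 < mass k.
Proof.
  intros Hk. destruct (tor_pos_min (kr k)) as [q [q0 Hq]]; [apply Hk|intros; apply Hk|].
  assert (I2 (fun _ _ => q) <= mass k) by (apply I2_le_tor; auto with sp).
  rewrite I2_const in H. pose proof PI_RGT_0 as P. pose proof (Rmult_lt_0_compat _ _ P P) as PP.
  pose proof (Rmult_lt_0_compat _ _ PP q0). lra.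
Qed.

Lemma mean_lin k x f g : elliptic k -> tor f -> tor g ->
  mean k (fadd (fscal x f) g) = x * mean k f + mean k g.
Proof. intros; unfold mean; apply Mf_lin; auto; apply tor_const. Qed.

Definition center (k : coeffs) (f : fn2) : fn2 := fadd f (fun _ _ => - (mean k f / mass k)).

Lemma center_tor k f : tor f -> tor (center k f).
Proof. intro; unfold center; auto with sp. Qed.
#[export] Hint Resolve center_tor : sp.

Lemma fscal_1 f : fscal 1 f = f.
Proof. apply fn2_ext; intros; unfold fscal; ring. Qed.

Lemma Mf_center k f g : elliptic k -> tor f -> tor g -> Mf k (center k f) g = Cov k f g.
Proof.
  intros Hk Hf Hg. unfold center. rewrite <- (fscal_1 f), Mf_lin, fscal_1; auto with sp.
  unfold Cov. replace (fun _ _ : R => - (mean k f / mass k)) with (fscal (- (mean k f / mass k)) (fun _ _ => 1)) by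
    (apply fn2_ext; intros; unfold fscal; ring).
  assert (Z : Mf k (fadd (fscal (- (mean k f / mass k)) (fun _ _ => 1)) (fun _ _ => 0)) g =
     - (mean k f / mass k) * mean k g + Mf k (fun _ _ => 0) g).
  { rewrite Mf_lin; auto with sp. unfold mean at 3. now rewrite (Mf_sym k g). }
  assert (Z0 : forall g, Mf k (fun _ _ => 0) g = 0).
  { intro h; unfold Mf. rewrite (I2_ext _ (fun _ _ => 0)); [rewrite I2_const; ring|]. intros; unfold fmul; ring. }
  rewrite Z0 in Z. replace (fadd (fscal (- (mean k f / mass k)) (fun _ _ => 1)) (fun _ _ => 0)) with
   (fscal (- (mean k f / mass k)) (fun _ _ => 1)) in Z by (apply fn2_ext; intros; unfold fscal, fadd; ring).
  rewrite Z. unfold Rdiv; ring.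
Qed.

Lemma mean_center k f : elliptic k -> tor f -> mean k (center k f) = 0.
Proof.
  intros Hk Hf. unfold center. rewrite <- (fscal_1 f), mean_lin, fscal_1, mean_const; auto with sp.
  pose proof (mass_pos k Hk). field; lra.
Qed.

Lemma Cov_center k f : elliptic k -> tor f -> Cov k f f = Mf k (center k f) (center k f).
Proof.
  intros Hk Hf. rewrite (Mf_center k f (center k f)) by auto with sp.
  unfold Cov at 2. rewrite (Mf_sym k f (center k f)), Mf_center, mean_center by auto with sp.
  unfold Rdiv; ring.
Qed.

Lemma Cov_pos k f : elliptic k -> tor f -> 0 <= Cov k f f.
Proof.
  intros Hk Hf. rewrite Cov_center by auto. destruct (Mf_bound k Hk) as [q [q0 Hq]].
  specialize (Hq (center k f) ltac:(auto with sp)). pose proof (N2_ge0 (center k f) ltac:(auto with sp)). nra.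
Qed.

Lemma Bf_const k c g : Bf k (fun _ _ => c) g = 0.
Proof.
  unfold Bf. rewrite (I2_ext _ (fun _ _ => 0)); [rewrite I2_const; ring|].
  intros; unfold flux, fadd, fmul. change pdu with (dd true); change pdv with (dd false).
  rewrite !(dd_const _ c). ring.
Qed.

Lemma Bf_center k f g : elliptic k -> tor f -> tor g -> Bf k (center k f) g = Bf k f g.
Proof.
  intros Hk Hf Hg. unfold center. rewrite <- (fscal_1 f), Bf_lin, fscal_1, Bf_const; auto with sp. ring.
Qed.

(** A function of zero variance is constant, hence of zero energy; this is the kernel condition of
    [psd_min_ratio]. *)
Lemma Cov_zero k f : elliptic k -> tor f -> Cov k f f = 0 -> Bf k f f = 0.
Proof.
  intros Hk Hf H0. rewrite Cov_center in H0 by auto. destruct (Mf_bound k Hk) as [q [q0 Hq]].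
  specialize (Hq (center k f) ltac:(auto with sp)). pose proof (N2_ge0 (center k f) ltac:(auto with sp)).
  assert (Z : forall u v, center k f u v = 0) by (apply N2_zero; [auto with sp|nra]).
  rewrite <- (Bf_center k f f) by auto.
  replace (center k f) with (fun _ _ : R => 0) by (apply fn2_ext; intros; now rewrite Z).
  apply Bf_const.
Qed.

Lemma Cov_lin k x f g h : elliptic k -> tor f -> tor g -> tor h ->
  Cov k (fadd (fscal x f) g) h = x * Cov k f h + Cov k g h.
Proof. intros; unfold Cov. rewrite Mf_lin, mean_lin by auto. unfold Rdiv; ring. Qed.
Lemma Cov_sym k f g : Cov k f g = Cov k g f.
Proof. unfold Cov; rewrite Mf_sym; unfold Rdiv; ring. Qed.

(** * Linear combinations and Galerkin solutions *)

Fixpoint lc (E : nat -> fn2) (n : nat) (c : vec) : fn2 :=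
  match n with O => fun _ _ => 0 | S m => fadd (lc E m c) (fscal (c m) (E m)) end.

Definition span (E : nat -> fn2) (n : nat) (f : fn2) : Prop := exists c, f = lc E n c.

Lemma lc_tor E n c : (forall i, tor (E i)) -> tor (lc E n c).
Proof. intro H; induction n; simpl; auto with sp. Qed.
Lemma lc_lin E n a c d : lc E n (fun i => a * c i + d i) = fadd (fscal a (lc E n c)) (lc E n d).
Proof.
  induction n; simpl; [|rewrite IHn]; apply fn2_ext; intros; unfold fadd, fscal; ring.
Qed.
Lemma lc_dep E n c d : (forall i, (i < n)%nat -> c i = d i) -> lc E n c = lc E n d.
Proof. intro H; induction n; simpl; auto. rewrite IHn, H; auto. Qed.

Lemma psd_Bf k E n : elliptic k -> (forall i, tor (E i)) -> psd n (fun c d => Bf k (lc E n c) (lc E n d)).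
Proof.
  intros Hk HE. pose proof (fun c => lc_tor E n c HE). split.
  - intros; rewrite lc_lin; apply Bf_lin; auto.
  - intros; apply Bf_sym.
  - intros; apply Bf_pos; auto.
  - intros c d e Hc; now rewrite (lc_dep E n c d Hc).
Qed.
Lemma psd_Cov k E n : elliptic k -> (forall i, tor (E i)) -> psd n (fun c d => Cov k (lc E n c) (lc E n d)).
Proof.
  intros Hk HE. pose proof (fun c => lc_tor E n c HE). split.
  - intros; rewrite lc_lin; apply Cov_lin; auto.
  - intros; apply Cov_sym.
  - intros; apply Cov_pos; auto.
  - intros c d e Hc; now rewrite (lc_dep E n c d Hc).
Qed.

(** Recentring may leave the span of a general family, whence the additive constant in [gal_shape];
    it disappears after one derivative. The bound l on mu is common to all n and makes the later
    estimates uniform. *)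
Record galerkin (k : coeffs) (E : nat -> fn2) (l : R) (n : nat) (mu : R) (u : fn2) : Prop := {
  gal_mu : 0 <= mu <= l;
  gal_tor : tor u;
  gal_shape : exists w c, span E n w /\ u = fadd w (fun _ _ => c);
  gal_mass : Mf k u u = 1;
  gal_mean : mean k u = 0;
  gal_energy : Bf k u u = mu;
  gal_eq : forall v, span E n v -> Bf k u v = mu * Mf k u v
}.

(** The recentred minimizer of [Bf] / [Cov] over the span. The trial function w shows that [Cov]
    does not vanish there and that the minimum is at most l. *)
Lemma galerkin_exists k E l n w : elliptic k -> (forall i, tor (E i)) -> span E n w ->
  Bf k w w < l * Cov k w w -> exists mu u, galerkin k E l n mu u.
Proof.
  intros Hk HE [cw ->] Hw. pose proof (fun c => lc_tor E n c HE) as HT.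
  assert (P : 0 < Cov k (lc E n cw) (lc E n cw)).
  { destruct (Rle_lt_or_eq_dec _ _ (Cov_pos k (lc E n cw) Hk (HT cw))) as [|Z]; auto.
    rewrite <- Z, (Cov_zero k _ Hk (HT cw) (eq_sym Z)) in Hw. lra. }
  destruct (psd_min_ratio n _ _ (psd_Bf k E n Hk HE) (psd_Cov k E n Hk HE)) as [c [mu [C1 [M0 [Cm Ce]]]]].
  - intros c; apply Cov_zero; auto.
  - now exists cw.
  - exists mu, (center k (lc E n c)).
    assert (E0 : Bf k (center k (lc E n c)) (center k (lc E n c)) = mu).
    { rewrite Bf_center, Bf_sym, Bf_center by auto with sp. rewrite (Ce c), C1. ring. }
    split; auto with sp.
    + split; auto. specialize (Cm cw).
      apply Rmult_le_reg_r with (Cov k (lc E n cw) (lc E n cw)); auto. lra.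
    + exists (lc E n c), (- (mean k (lc E n c) / mass k)). split; [now exists c|reflexivity].
    + now rewrite <- Cov_center by auto.
    + now apply mean_center.
    + intros v [d ->]. rewrite Bf_center, Mf_center by auto. apply Ce.
Qed.

(* The span of such a family is stable under even derivatives, so that
   [(-1)^s d^(2s) u] is a legitimate Galerkin test function for u in the span. *)
Definition eigbasis (E : nat -> fn2) : Prop :=
  (forall i, tor (E i)) /\ forall i b, exists l, dd b (dd b (E i)) = fscal l (E i).

Lemma span_scal E n c f : span E n f -> span E n (fscal c f).
Proof.
  intros [d ->]. exists (fun i => c * d i).
  induction n; simpl; [|rewrite <- IHn]; apply fn2_ext; intros; unfold fadd, fscal; ring.
Qed.

Lemma eigbasis_ev E b : eigbasis E -> forall n c, exists d, dd b (dd b (lc E n c)) = lc E n d.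
Proof.
  intros [HT HE] n c; induction n as [|n [d Hd]].
  - exists c; simpl. now rewrite !dd_const.
  - destruct (HE n b) as [l Hl]. exists (fun i => if Nat.eqb i n then l * c n else d i).
    simpl. pose proof (lc_tor E n c HT) as Tn. pose proof (HT n) as Te.
    rewrite !dd_add, !dd_scal, Hd, Hl; try (apply tor_dd; auto with sp); try apply Tn; try apply Te;
      try (apply smooth2_fscal, Te).
    rewrite Nat.eqb_refl.
    rewrite (lc_dep E n d (fun i => if Nat.eqb i n then l * c n else d i)).
    + apply fn2_ext; intros; unfold fadd, fscal; ring.
    + intros i Hi. destruct (Nat.eqb_spec i n); auto; lia.
Qed.

Lemma span_dd2 E n b f : eigbasis E -> span E n f -> span E n (dd b (dd b f)).
Proof. intros HE [c ->]. apply eigbasis_ev, HE. Qed.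

Lemma span_ddn2 E n b s f : eigbasis E -> smooth2 f -> span E n f -> span E n (ddn b s (ddn b s f)).
Proof.
  intros HE; revert f; induction s; intros f Sf Hf; auto.
  replace (ddn b (S s) (ddn b (S s) f)) with (ddn b s (ddn b s (dd b (dd b f)))).
  - apply IHs; [now repeat apply smooth2_dd|now apply span_dd2].
  - rewrite ddn_S. f_equal. simpl. change (Nat.iter s (dd b) f) with (ddn b s f).
    rewrite !dd_ddn; auto. now apply smooth2_dd.
Qed.

Lemma ddn_shape b s w c : (1 <= s)%nat -> smooth2 w -> ddn b s (fadd w (fun _ _ => c)) = ddn b s w.
Proof.
  intros Hs Hw. destruct s; [lia|]. rewrite !ddn_S, dd_add, dd_const; auto using smooth2_const.
  f_equal. apply fn2_ext; intros; unfold fadd; ring.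
Qed.

Lemma lc_tor' E n w : eigbasis E -> span E n w -> tor w.
Proof. intros [HT _] [c ->]. now apply lc_tor. Qed.

(** * A priori estimates uniform in the dimension *)

Lemma N2_u k : elliptic k -> exists C, 0 <= C /\ forall E l n mu u,
  galerkin k E l n mu u -> N2 u <= C.
Proof.
  intros Hk. destruct (Mf_bound k Hk) as [q [q0 Hq]]. exists (/ q).
  split; [left; now apply Rinv_0_lt_compat|]. intros E l n mu u G. specialize (Hq u (gal_tor _ _ _ _ _ _ G)).
  rewrite (gal_mass _ _ _ _ _ _ G) in Hq. apply Rmult_le_reg_l with q; auto. rewrite Rinv_r; lra.
Qed.

(** The commutator [d^s, a] f, as estimated in [commutator]. *)
Definition res (b : bool) (s : nat) (a f : fn2) : fn2 :=
  fadd (ddn b s (fmul a f)) (fscal (-1) (fmul a (ddn b s f))).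

Lemma res_tor b s a f : tor a -> tor f -> tor (res b s a f).
Proof. intros; unfold res; auto 10 with sp. Qed.
#[export] Hint Resolve res_tor : sp.

Lemma res_eq b s a f : ddn b s (fmul a f) = fadd (fmul a (ddn b s f)) (res b s a f).
Proof. apply fn2_ext; intros; unfold res, fadd, fmul, fscal; ring. Qed.

Lemma weak_split k b s u : elliptic k -> tor u ->
  let X := pdu u in let Y := pdv u in
  Bf k u (fscal ((-1) ^ s) (ddn b s (ddn b s u))) =
  I2 (fmul (ddn b s (fmul (ka k) X)) (ddn b s X)) + I2 (fmul (ddn b s (fmul (kb k) Y)) (ddn b s X)) +
  (I2 (fmul (ddn b s (fmul (kb k) X)) (ddn b s Y)) + I2 (fmul (ddn b s (fmul (kc k) Y)) (ddn b s Y))).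
Proof.
  intros [[TA [TB [TC TR]]] _] Hu X Y.
  assert (TX : tor X) by (unfold X; auto with sp). assert (TY : tor Y) by (unfold Y; auto with sp).
  assert (S2 : forall b', dd b' (fscal ((-1) ^ s) (ddn b s (ddn b s u))) = fscal ((-1) ^ s) (ddn b s (ddn b s (dd b' u)))).
  { intro b'. rewrite dd_scal, !dd_ddn; auto; try (apply tor_ddn); auto with sp; try apply Hu. }
  unfold Bf. pose proof (S2 true) as E1. pose proof (S2 false) as E2. simpl dd in E1, E2.
  rewrite E1, E2. fold X Y. unfold flux. fold X Y.
  rewrite <- !ibp_n, <- !I2_fadd by auto 10 with sp. apply I2_ext; intros; unfold fadd, fmul; ring.
Qed.

(** The energy estimate of order s. With the test function (-1)^s d^(2s) u, ellipticity bounds the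
    principal part below by q times the left side; commutators and mass term are of lower order. The
    case s = 0 is excluded because the constant in u could take the test function out of the
    span. *)
Lemma gal_step k E l b s : elliptic k -> eigbasis E -> (1 <= s)%nat ->
  exists K, 0 <= K /\ forall n mu u, galerkin k E l n mu u ->
    N2 (ddn b s (pdu u)) + N2 (ddn b s (pdv u)) <= K * (1 + Sg b s (pdu u) + Sg b s (pdv u)).
Proof.
  intros Hk HE Hs. pose proof Hk as [[TA [TB [TC TR]]] _].
  destruct (elliptic_coercive k Hk) as [q [q0 Hq]].
  destruct (commutator b s _ TA) as [Ca [Ca0 HCa]]. destruct (commutator b s _ TB) as [Cb [Cb0 HCb]].
  destruct (commutator b s _ TC) as [Cc [Cc0 HCc]].
  destruct (N2_ddn_mul b s _ TR) as [Cr [Cr0 HCr]]. destruct (N2_u k Hk) as [C0 [C00 HC0]].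
  set (L := Rabs l). assert (L0 : 0 <= L) by apply Rabs_pos.
  exists (2 / q * (/ q * (Ca + Cb + Cc) + L * (Cr + 1) * (C0 + 1))).
  assert (q2 : 0 < 2 / q) by (apply Rdiv_lt_0_compat; lra).
  assert (qi : 0 < / q) by now apply Rinv_0_lt_compat.
  split; [apply Rmult_le_pos; [lra|]; apply Rplus_le_le_0_compat; repeat apply Rmult_le_pos; lra|].
  intros n mu u G. pose proof (gal_tor _ _ _ _ _ _ G) as Tu.
  destruct (gal_shape _ _ _ _ _ _ G) as [w [c [Sw Ew]]]. pose proof (lc_tor' E n w HE Sw) as Tw.
  set (X := pdu u). set (Y := pdv u).
  assert (TX : tor X) by (unfold X; auto with sp). assert (TY : tor Y) by (unfold Y; auto with sp).
  assert (Sv : span E n (fscal ((-1) ^ s) (ddn b s (ddn b s u)))).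
  { apply span_scal. rewrite Ew, ddn_shape by (auto; apply Tw).
    apply span_ddn2; auto. apply Tw. }
  pose proof (gal_eq _ _ _ _ _ _ G _ Sv) as Eq.
  rewrite weak_split in Eq by auto. cbv zeta in Eq. fold X Y in Eq.
  assert (EM : Mf k u (fscal ((-1) ^ s) (ddn b s (ddn b s u))) = I2 (fmul (ddn b s (fmul (kr k) u)) (ddn b s u))).
  { rewrite <- ibp_n by auto with sp. unfold Mf. apply I2_ext; intros; unfold fmul; ring. }
  rewrite EM in Eq.
  set (DX := ddn b s X) in *. set (DY := ddn b s Y) in *.
  assert (TDX : tor DX) by (unfold DX; auto with sp). assert (TDY : tor DY) by (unfold DY; auto with sp).
  assert (SPL : forall a f g, tor a -> tor f -> tor g ->
    I2 (fmul (ddn b s (fmul a f)) g) = I2 (fmul (fmul a (ddn b s f)) g) + I2 (fmul (res b s a f) g)).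
  { intros a f g Ta Tf Tg. rewrite res_eq, <- I2_fadd by auto 10 with sp. apply I2_ext; intros; unfold fadd, fmul; ring. }
  rewrite !SPL in Eq by auto. fold DX DY in Eq.
  assert (Coer : q * (N2 DX + N2 DY) <= I2 (fmul (fmul (ka k) DX) DX) + I2 (fmul (fmul (kb k) DY) DX)
     + (I2 (fmul (fmul (kb k) DX) DY) + I2 (fmul (fmul (kc k) DY) DY))).
  { unfold N2. rewrite <- !I2_fadd, <- I2_fscal by auto 10 with sp.
    apply I2_le_tor; auto 10 with sp. intros x y. unfold fadd, fmul, fscal. specialize (Hq x y (DX x y) (DY x y)). lra. }
  (* Each of [DX] and [DY] occurs in two commutator terms, so weights q/4 consume q/2 of the
     coercivity and leave q/2; the commutators themselves receive the weight 1/q. *)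
  assert (q4 : 0 < q / 4) by lra.
  pose proof (I2_young (q / 4) DX (res b s (ka k) X) q4 TDX ltac:(auto with sp)) as Y1.
  pose proof (I2_young (q / 4) DX (res b s (kb k) Y) q4 TDX ltac:(auto with sp)) as Y2.
  pose proof (I2_young (q / 4) DY (res b s (kb k) X) q4 TDY ltac:(auto with sp)) as Y3.
  pose proof (I2_young (q / 4) DY (res b s (kc k) Y) q4 TDY ltac:(auto with sp)) as Y4.
  replace (4 * (q / 4)) with q in Y1, Y2, Y3, Y4 by field.
  assert (Cm : forall f g, fmul f g = fmul g f) by (intros; apply fn2_ext; intros; unfold fmul; ring).
  rewrite Cm in Y1, Y2, Y3, Y4.
  pose proof (HCa X TX) as R1. pose proof (HCb Y TY) as R2. pose proof (HCb X TX) as R3. pose proof (HCc Y TY) as R4.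
  fold (res b s (ka k) X) in R1. fold (res b s (kb k) Y) in R2. fold (res b s (kb k) X) in R3. fold (res b s (kc k) Y) in R4.
  apply Rabs_le_between in Y1, Y2, Y3, Y4.
  set (SX := Sg b s X) in *. set (SY := Sg b s Y) in *.
  assert (SX0 : 0 <= SX) by now apply Sg_ge0. assert (SY0 : 0 <= SY) by now apply Sg_ge0.
  pose proof (HCr u Tu) as RR.
  assert (Su : Sg b (S s) u <= C0 + (SX + SY)).
  { rewrite Sg_shift by auto. apply Rplus_le_compat; [now apply (HC0 E l n mu)|]. destruct b; unfold SX, SY; simpl; fold X Y; fold SX SY; lra. }
  assert (Du : N2 (ddn b s u) <= Sg b (S s) u) by (simpl; pose proof (Sg_ge0 b s u Tu); lra).
  pose proof (I2_young (/ 2) (ddn b s (fmul (kr k) u)) (ddn b s u) ltac:(lra) ltac:(auto with sp) ltac:(auto with sp)) as YR.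
  replace (/ (4 * / 2)) with (/ 2) in YR by field.
  apply Rabs_le_between in YR.
  assert (S0 : 0 <= Sg b (S s) u) by now apply Sg_ge0.
  set (RI := I2 (fmul (ddn b s (fmul (kr k) u)) (ddn b s u))) in *.
  assert (RI1 : Rabs RI <= (Cr + 1) * (C0 + (SX + SY))).
  { apply Rle_trans with ((Cr + 1) * Sg b (S s) u); [|apply Rmult_le_compat_l; lra]. apply Rabs_le; split; lra. }
  assert (MU : mu * RI <= L * ((Cr + 1) * (C0 + (SX + SY)))).
  { pose proof (gal_mu _ _ _ _ _ _ G). assert (mu <= L) by (unfold L; pose proof (Rle_abs l); lra).
    apply Rle_trans with (mu * Rabs RI); [apply Rmult_le_compat_l; [lra|apply Rle_abs]|].
    apply Rmult_le_compat; try lra. apply Rabs_pos. }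
  assert (SA : Ca * SX + Cb * SY + (Cb * SX + Cc * SY) <= (Ca + Cb + Cc) * (1 + SX + SY)).
  { assert (0 <= Ca * SY) by (now apply Rmult_le_pos). assert (0 <= Cc * SX) by (now apply Rmult_le_pos). lra. }
  assert (Main : q / 2 * (N2 DX + N2 DY) <= / q * ((Ca + Cb + Cc) * (1 + SX + SY)) + L * ((Cr + 1) * (C0 + (SX + SY)))).
  { apply Rle_trans with (/ q * (Ca * SX + Cb * SY + (Cb * SX + Cc * SY)) + L * ((Cr + 1) * (C0 + (SX + SY)))).
    2: { apply Rplus_le_compat_r, Rmult_le_compat_l; lra. }
    pose proof (Rmult_le_compat_l (/ q) _ _ ltac:(lra) R1). pose proof (Rmult_le_compat_l (/ q) _ _ ltac:(lra) R2).
    pose proof (Rmult_le_compat_l (/ q) _ _ ltac:(lra) R3). pose proof (Rmult_le_compat_l (/ q) _ _ ltac:(lra) R4).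
    lra. }
  assert (C1 : C0 + (SX + SY) <= (C0 + 1) * (1 + SX + SY)).
  { assert (0 <= C0 * SX) by (now apply Rmult_le_pos). assert (0 <= C0 * SY) by (now apply Rmult_le_pos). lra. }
  assert (C2 : L * ((Cr + 1) * (C0 + (SX + SY))) <= L * ((Cr + 1) * ((C0 + 1) * (1 + SX + SY)))).
  { apply Rmult_le_compat_l; auto. apply Rmult_le_compat_l; lra. }
  apply Rmult_le_reg_l with (q / 2); [lra|].
  eapply Rle_trans; [apply Main|]. eapply Rle_trans; [apply Rplus_le_compat_l, C2|].
  apply Req_le. field; lra.
Qed.

(** Induction on the order; the first nonempty sum is bounded by coercivity and [Bf k u u] = mu <=
    l, the later ones by [gal_step]. *)
Lemma gal_bounds k E l b s : elliptic k -> eigbasis E -> exists C, 0 <= C /\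
  forall n mu u, galerkin k E l n mu u -> Sg b s (pdu u) + Sg b s (pdv u) <= C.
Proof.
  intros Hk HE. induction s as [|s [C [C0 HC]]].
  - exists 0; split; [lra|]. intros; simpl; lra.
  - destruct (Nat.eq_dec s 0) as [->|Hs].
    + destruct (Bf_coercive k Hk) as [q [q0 Hq]]. exists (Rabs l / q).
      split; [apply Rdiv_le_0_compat; auto; apply Rabs_pos|]. intros n mu u G.
      specialize (Hq u (gal_tor _ _ _ _ _ _ G)). rewrite (gal_energy _ _ _ _ _ _ G) in Hq.
      pose proof (gal_mu _ _ _ _ _ _ G). pose proof (Rle_abs l). apply Rle_div_r; auto. simpl. lra.
    + destruct (gal_step k E l b s Hk HE ltac:(lia)) as [K [K0 HK]].
      exists (C + K * (1 + C)). split; [nra|]. intros n mu u G. specialize (HC n mu u G). specialize (HK n mu u G).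
      simpl. assert (K * (1 + Sg b s (pdu u) + Sg b s (pdv u)) <= K * (1 + C)) by (apply Rmult_le_compat_l; lra). lra.
Qed.

Lemma gal_bound_pure k E l b s : elliptic k -> eigbasis E -> exists C, 0 <= C /\
  forall n mu u, galerkin k E l n mu u -> N2 (ddn b s u) <= C.
Proof.
  intros Hk HE. destruct s as [|s].
  - destruct (N2_u k Hk) as [C [C0 HC]]. exists C; split; auto. intros n mu u; apply HC.
  - destruct (gal_bounds k E l b (S s) Hk HE) as [C [C0 HC]]. exists C; split; auto. intros n mu u G.
    specialize (HC n mu u G). pose proof (gal_tor _ _ _ _ _ _ G) as Tu. rewrite ddn_S. simpl in HC.
    pose proof (Sg_ge0 b s (pdu u) ltac:(auto with sp)). pose proof (Sg_ge0 b s (pdv u) ltac:(auto with sp)).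
    pose proof (N2_ge0 (ddn b s (pdu u)) ltac:(auto with sp)). pose proof (N2_ge0 (ddn b s (pdv u)) ltac:(auto with sp)).
    destruct b; simpl; lra.
Qed.

(** * Mixed derivatives and a Sobolev inequality *)

Definition mix (p q : nat) (f : fn2) : fn2 := ddn true p (ddn false q f).

Lemma mix_tor p q f : tor f -> tor (mix p q f).
Proof. intro; unfold mix; auto with sp. Qed.
#[export] Hint Resolve mix_tor : sp.

Lemma Rabs_sign s : Rabs ((-1) ^ s) = 1.
Proof. apply pow_1_abs. Qed.

(** Integration by parts turns the square of d_x^p d_y^q u into the product of d_x^(2p) u and
    d_y^(2q) u up to sign, so bounds on pure derivatives suffice. *)
Lemma N2_mix p q u : tor u -> N2 (mix p q u) <= N2 (ddn true (p + p) u) + N2 (ddn false (q + q) u).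
Proof.
  intros Hu. pose proof Hu as [Su _].
  assert (E : N2 (mix p q u) = (-1) ^ p * ((-1) ^ q * I2 (fmul (ddn true (p + p) u) (ddn false (q + q) u)))).
  { unfold N2, mix. rewrite <- ibp_n by auto with sp.
    rewrite <- !I2_fscal by auto 10 with sp.
    transitivity (I2 (fmul (fscal ((-1) ^ p) (ddn true p (ddn true p u)))
       (fscal ((-1)^q) (ddn false q (ddn false q u))))).
    - rewrite (ibp_n false q) by auto with sp.
      rewrite (ddn_scal false) by (apply tor_ddn; auto with sp).
      rewrite !(ddn_comm true p false q) by (auto using smooth2_ddn).
      apply I2_ext; intros; unfold fmul, fscal; ring.
    - unfold ddn. rewrite !Nat.iter_add. apply I2_ext; intros; unfold fmul, fscal; ring. }
  assert (N0 : 0 <= N2 (mix p q u)) by (apply N2_ge0; auto with sp).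
  rewrite <- (Rabs_right (N2 (mix p q u))) by lra. rewrite E, !Rabs_mult, !Rabs_sign.
  pose proof (I2_young (/ 2) (ddn true (p + p) u) (ddn false (q + q) u) ltac:(lra) ltac:(auto with sp) ltac:(auto with sp)) as Y.
  replace (/ (4 * / 2)) with (/ 2) in Y by field.
  pose proof (N2_ge0 (ddn true (p + p) u) ltac:(auto with sp)). pose proof (N2_ge0 (ddn false (q + q) u) ltac:(auto with sp)). lra.
Qed.

(** Between two points g^2 changes by at most the integral of |2 g g'| <= g^2 + g'^2; averaging over
    the second point gives the bound, with PI >= 1 used to drop a factor. *)
Lemma sobolev1 (g g' : R -> R) : (forall x, is_derive g x (g' x)) -> cont g' ->
  forall x, 0 <= x <= PI -> g x * g x <= RInt (fun t => 2 * (g t * g t) + g' t * g' t) 0 PI.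
Proof.
  intros Hg Hg' x Hx. pose proof PI_RGT_0 as P.
  assert (Cg : cont g) by (apply cont_derive; intros y; eexists; apply Hg).
  assert (Ch : cont (fun t => g t * g t + g' t * g' t)) by (apply cont_plus; now apply cont_mult).
  set (S := RInt (fun t => g t * g t + g' t * g' t) 0 PI).
  assert (D : forall a b, 0 <= a -> a <= b -> b <= PI -> Rabs (g b * g b - g a * g a) <= S).
  { intros a b Ha Hab Hb.
    rewrite <- (RInt_FTC (fun t => g t * g t) (fun t => g' t * g t + g t * g' t)).
    2: { intro y; now apply isd_mult. }
    2: { apply cont_plus; now apply cont_mult. }
    eapply Rle_trans; [apply abs_RInt_le; auto; apply cont_ex_RInt, cont_plus; now apply cont_mult|].
    apply Rle_trans with (RInt (fun t => g t * g t + g' t * g' t) a b).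
    - apply RInt_le_c; auto; [apply cont_abs, cont_plus; now apply cont_mult|].
      intros y _. pose proof (Rle_0_sqr (g y - g' y)). pose proof (Rle_0_sqr (g y + g' y)). unfold Rsqr in *.
      apply Rabs_le; split; lra.
    - unfold S. rewrite <- (RInt_Chasles (V := R_CompleteNormedModule) _ 0 a PI) by now apply cont_ex_RInt.
      rewrite <- (RInt_Chasles (V := R_CompleteNormedModule) _ a b PI) by now apply cont_ex_RInt.
      assert (forall c d, c <= d -> 0 <= RInt (fun t => g t * g t + g' t * g' t) c d).
      { intros c d Hcd. apply RInt_ge_0; auto; [now apply cont_ex_RInt|]. intros; nra. }
      pose proof (H 0 a Ha). pose proof (H b PI Hb). unfold plus; simpl. lra. }
  assert (D' : forall t, 0 <= t <= PI -> g x * g x <= g t * g t + S).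
  { intros t Ht. destruct (Rle_dec t x).
    - pose proof (D t x ltac:(lra) ltac:(lra) ltac:(lra)) as H. apply Rabs_le_between in H; lra.
    - pose proof (D x t ltac:(lra) ltac:(lra) ltac:(lra)) as H. apply Rabs_le_between in H; lra. }
  assert (A : RInt (fun _ => g x * g x) 0 PI <= RInt (fun t => g t * g t + S) 0 PI).
  { apply RInt_le_c; auto; try lra; [apply cont_const|apply cont_plus; [now apply cont_mult|apply cont_const]]. }
  rewrite RInt_const_r, RInt_plus_c, RInt_const_r in A by (auto using cont_const, cont_mult).
  assert (G0 : 0 <= RInt (fun t => g t * g t) 0 PI).
  { apply RInt_ge_0; [lra|apply cont_ex_RInt; now apply cont_mult|]. intros; nra. }
  replace (RInt (fun t => 2 * (g t * g t) + g' t * g' t) 0 PI) with (RInt (fun t => g t * g t) 0 PI + S).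
  2: { unfold S. rewrite <- RInt_plus_c by (auto using cont_mult). apply RInt_ext_all; intro; ring. }
  pose proof PI2_1. unfold PI2 in *. apply Rmult_le_reg_l with PI; auto.
  assert (RInt (fun t => g t * g t) 0 PI <= PI * RInt (fun t => g t * g t) 0 PI) by nra. lra.
Qed.

(** [sobolev1] in u, then in v applied to f and to [pdu f]; the coefficients are the products 2 * 2,
    2 * 1, 1 * 2 and 1 * 1. *)
Lemma sobolev f : tor f -> forall u v,
  f u v * f u v <= 4 * N2 f + 2 * N2 (pdv f) + 2 * N2 (pdu f) + N2 (pdv (pdu f)).
Proof.
  intros Hf. apply (per_all f (fun y => y * y <= 4 * N2 f + 2 * N2 (pdv f) + 2 * N2 (pdu f) + N2 (pdv (pdu f)))); [apply Hf|].
  intros u v Hu Hv. pose proof PI_RGT_0.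
  assert (S1 : smooth2 f) by apply Hf. assert (S2 : smooth2 (pdu f)) by smooth.
  assert (S3 : smooth2 (pdv f)) by smooth. assert (S4 : smooth2 (pdv (pdu f))) by smooth.
  pose proof (smooth2_cont _ S1) as C1. pose proof (smooth2_cont _ S2) as C2.
  pose proof (smooth2_cont _ S3) as C3. pose proof (smooth2_cont _ S4) as C4.
  eapply Rle_trans; [apply (sobolev1 (fun x => f x v) (fun x => pdu f x v)); auto; [now intro; apply smooth2_du|now apply cont2_u]|].
  assert (Cs : forall g, cont2 g -> cont2 (fun x y => g x y * g x y)) by (intros; now apply cont2_mult).
  apply Rle_trans with (I2 (fun x y => (4 * (f x y * f x y) + 2 * (pdv f x y * pdv f x y)) + (2 * (pdu f x y * pdu f x y) + pdv (pdu f) x y * pdv (pdu f) x y))).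
  - unfold I2. apply RInt_le_c; try lra.
    + apply cont_plus; [apply cont_mult; [apply cont_const|]|]; apply cont_mult; now apply cont2_u.
    + apply cont_RInt_param. repeat apply cont2_plus; repeat apply cont2_mult; auto using cont2_const.
    + intros x Hx.
      pose proof (sobolev1 (fun y => f x y) (fun y => pdv f x y) (smooth2_dv f S1 x) (cont2_v _ C3 x) v Hv) as B1.
      pose proof (sobolev1 (fun y => pdu f x y) (fun y => pdv (pdu f) x y) (smooth2_dv (pdu f) S2 x) (cont2_v _ C4 x) v Hv) as B2.
      cbv beta in B1, B2.
      rewrite RInt_plus_c.
      2: { apply (cont2_v (fun x y => 4 * (f x y * f x y) + 2 * (pdv f x y * pdv f x y))).
           repeat apply cont2_plus; repeat apply cont2_mult; auto using cont2_const. }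
      2: { apply (cont2_v (fun x y => 2 * (pdu f x y * pdu f x y) + pdv (pdu f) x y * pdv (pdu f) x y)).
           repeat apply cont2_plus; repeat apply cont2_mult; auto using cont2_const. }
      rewrite (RInt_ext_all (fun v0 => 4 * (f x v0 * f x v0) + 2 * (pdv f x v0 * pdv f x v0))
        (fun y => 2 * (2 * (f x y * f x y) + pdv f x y * pdv f x y))) by (intro; ring).
      rewrite RInt_scal_c.
      2: { apply (cont2_v (fun x y => 2 * (f x y * f x y) + (pdv f x y * pdv f x y))).
           repeat apply cont2_plus; repeat apply cont2_mult; auto using cont2_const. }
      lra.
  - unfold N2, fmul. rewrite !I2_add, !I2_scal; try lra;
    repeat apply cont2_plus; repeat apply cont2_mult; auto using cont2_const.
Qed.

Lemma gal_sup k E l p q : elliptic k -> eigbasis E -> exists C, 0 <= C /\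
  forall n mu u, galerkin k E l n mu u -> forall x y, Rabs (mix p q u x y) <= C.
Proof.
  intros Hk HE.
  assert (M : forall p q, exists C, 0 <= C /\ forall n mu u, galerkin k E l n mu u -> N2 (mix p q u) <= C).
  { intros p' q'. destruct (gal_bound_pure k E l true (p' + p') Hk HE) as [C1 [C10 H1]].
    destruct (gal_bound_pure k E l false (q' + q') Hk HE) as [C2 [C20 H2]].
    exists (C1 + C2); split; [lra|]. intros n mu u G. specialize (H1 n mu u G). specialize (H2 n mu u G).
    pose proof (N2_mix p' q' u (gal_tor _ _ _ _ _ _ G)). lra. }
  destruct (M p q) as [A1 [A10 H1]], (M (S p) q) as [A2 [A20 H2]], (M p (S q)) as [A3 [A30 H3]], (M (S p) (S q)) as [A4 [A40 H4]].
  (* The 1 passes from a bound A on z^2 to the bound 1 + A on |z|. *)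
  exists (1 + (4 * A1 + 2 * A3 + 2 * A2 + A4)); split; [lra|]. intros n mu u G x y.
  specialize (H1 n mu u G). specialize (H2 n mu u G). specialize (H3 n mu u G). specialize (H4 n mu u G).
  pose proof (gal_tor _ _ _ _ _ _ G) as Tu. pose proof Tu as [Su _].
  pose proof (sobolev (mix p q u) ltac:(auto with sp) x y) as B.
  assert (E1 : pdu (mix p q u) = mix (S p) q u) by reflexivity.
  assert (E2 : forall p, pdv (mix p q u) = mix p (S q) u).
  { intro p'. change pdv with (dd false). unfold mix. rewrite dd_ddn by now apply smooth2_ddn. reflexivity. }
  rewrite E1, !E2 in B.
  set (z := mix p q u x y) in *. assert (Rabs z * Rabs z = z * z) by (rewrite <- Rabs_mult; apply Rabs_right; nra).
  pose proof (Rabs_pos z). nra.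
Qed.

(** * Compactness *)

(** Any index map that tends to infinity preserves limits, and n <= phi n is stable under
    composition. *)
Definition extraction (phi : nat -> nat) : Prop := forall n, (n <= phi n)%nat.

Lemma bounded_extraction (u : nat -> R) B : (forall n, Rabs (u n) <= B) ->
  exists phi, extraction phi /\ ex_finite_lim_seq (fun n => u (phi n)).
Proof.
  intros HB.
  destruct (Bolzano_Weierstrass u (fun x => - B <= x <= B)) as [l Hl].
  - apply compact_P3.
  - intro n; specialize (HB n); apply Rabs_le_between in HB; lra.
  - assert (H : forall n, exists p, (n <= p)%nat /\ Rabs (u p - l) < / (INR n + 1)).
    { intro n. assert (Hp : 0 < / (INR n + 1)) by (apply Rinv_0_lt_compat; pose proof (pos_INR n); lra).
      destruct (Hl (disc l (mkposreal _ Hp)) n) as [p [Hp1 Hp2]].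
      - exists (mkposreal _ Hp). now intro.
      - now exists p. }
    destruct (functional_choice _ H) as [phi Hphi]. exists phi. split; [intro; apply Hphi|].
    exists l. apply is_lim_seq_spec. intros e. destruct e as [e He]; simpl.
    destruct (nfloor_ex (/ e)) as [N HN]; [left; now apply Rinv_0_lt_compat|].
    exists N. intros n Hn. eapply Rlt_trans; [apply Hphi|].
    rewrite <- (Rinv_inv e). apply Rinv_lt_contravar.
    + apply Rmult_lt_0_compat; [now apply Rinv_0_lt_compat|pose proof (pos_INR n); lra].
    + apply le_INR in Hn. lra.
Qed.

Lemma diagonal_extraction (a : nat -> nat -> R) : (forall k, exists B, forall n, Rabs (a n k) <= B) ->
  exists phi, extraction phi /\ forall k, ex_finite_lim_seq (fun n => a (phi n) k).
Proof.
  intros HB.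
  assert (H : forall x : (nat -> nat) * nat, exists psi, extraction psi /\
     ex_finite_lim_seq (fun n => a (fst x (psi n)) (snd x))).
  { intros [phi k]. destruct (HB k) as [B Hk]. apply (bounded_extraction (fun n => a (phi n) k) B). auto. }
  destruct (functional_choice _ H) as [F HF].
  (* [Phi (S k)] refines [Phi k] so that the k-th coordinate converges. The diagonal n -> [Phi n n]
     is, for n > k, of the form [Phi (S k) m] with m >= n - S k, which is what [T] provides. *)
  set (Phi := fix Phi k := match k with O => fun n => n | S k => fun n => Phi k (F (Phi k, k) n) end).
  assert (PE : forall k, extraction (Phi k)).
  { induction k; intro n; simpl; [lia|]. destruct (HF (Phi k, k)) as [E _].
    eapply Nat.le_trans; [apply E|apply IHk]. }
  exists (fun n => Phi n n). split; [intro n; apply PE|]. intro k.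
  destruct (HF (Phi k, k)) as [_ [l Hl]]. exists l. simpl in Hl.
  assert (T : forall j n, exists m, (n <= m)%nat /\ Phi (S k + j)%nat n = Phi (S k) m).
  { induction j; intro n; [exists n; rewrite Nat.add_0_r; auto|].
    rewrite Nat.add_succ_r. destruct (IHj (F (Phi (S k + j)%nat, (S k + j)%nat) n)) as [m [Hm E]].
    exists m. split; [|exact E]. eapply Nat.le_trans; [apply (proj1 (HF (Phi (S k + j)%nat, (S k + j)%nat)))|auto]. }
  apply is_lim_seq_spec. intro e. apply is_lim_seq_spec in Hl. destruct (Hl e) as [N HN].
  exists (N + S k)%nat. intros n Hn. destruct (T (n - S k)%nat n) as [m [Hm E]].
  replace (S k + (n - S k))%nat with n in E by lia. rewrite E. apply (HN m). lia.
Qed.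

Definition ucv (f : nat -> fn2) (g : fn2) : Prop :=
  forall e, 0 < e -> exists N, forall n, (N <= n)%nat -> forall x y, Rabs (f n x y - g x y) < e.

Lemma ucv_const g : ucv (fun _ => g) g.
Proof. intros e He; exists 0%nat; intros. now rewrite Rminus_diag, Rabs_R0. Qed.

Lemma ucv_add f g f' g' : ucv f f' -> ucv g g' -> ucv (fun n => fadd (f n) (g n)) (fadd f' g').
Proof.
  intros Hf Hg e He. destruct (Hf (e / 2) ltac:(lra)) as [N HN], (Hg (e / 2) ltac:(lra)) as [N' HN'].
  exists (N + N')%nat; intros n Hn x y. specialize (HN n ltac:(lia) x y). specialize (HN' n ltac:(lia) x y).
  unfold fadd. replace (f n x y + g n x y - (f' x y + g' x y)) with ((f n x y - f' x y) + (g n x y - g' x y)) by ring.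
  eapply Rle_lt_trans; [apply Rabs_triang|lra].
Qed.

Lemma ucv_mul f g f' g' : tor f' -> tor g' -> ucv f f' -> ucv g g' ->
  ucv (fun n => fmul (f n) (g n)) (fmul f' g').
Proof.
  intros Tf Tg Hf Hg e He.
  destruct (tor_bounded f' Tf) as [A [A0 HA]], (tor_bounded g' Tg) as [B [B0 HB]].
  (* With both errors p, q below d <= 1, the product error pq + Aq + pB is below d (A + B + 2) <=
     e. *)
  set (d := Rmin 1 (e / (A + B + 2))).
  assert (d0 : 0 < d) by (apply Rmin_glb_lt; [lra|apply Rdiv_lt_0_compat; lra]).
  assert (d1 : d <= 1) by apply Rmin_l. assert (d2 : d * (A + B + 2) <= e).
  { apply Rle_div_r; [lra|apply Rmin_r]. }
  destruct (Hf d d0) as [N HN], (Hg d d0) as [N' HN'].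
  exists (N + N')%nat; intros n Hn x y. specialize (HN n ltac:(lia) x y). specialize (HN' n ltac:(lia) x y).
  specialize (HA x y). specialize (HB x y). unfold fmul.
  replace (f n x y * g n x y - f' x y * g' x y) with
    ((f n x y - f' x y) * (g n x y - g' x y) + (f' x y * (g n x y - g' x y) + (f n x y - f' x y) * g' x y)) by ring.
  eapply Rle_lt_trans; [apply Rabs_triang|]. eapply Rle_lt_trans; [apply Rplus_le_compat_l, Rabs_triang|].
  rewrite !Rabs_mult. set (p := Rabs (f n x y - f' x y)) in *. set (q := Rabs (g n x y - g' x y)) in *.
  assert (p0 : 0 <= p) by apply Rabs_pos. assert (q0 : 0 <= q) by apply Rabs_pos.
  assert (p * q <= d * 1) by (apply Rmult_le_compat; lra).
  assert (Rabs (f' x y) * q <= A * d) by (apply Rmult_le_compat; try lra; apply Rabs_pos).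
  assert (p * Rabs (g' x y) <= d * B) by (apply Rmult_le_compat; try lra; apply Rabs_pos).
  lra.
Qed.

Lemma ucv_I2 f g : (forall n, tor (f n)) -> tor g -> ucv f g -> is_lim_seq (fun n => I2 (f n)) (I2 g).
Proof.
  intros Tf Tg H. apply is_lim_seq_spec. intros [e He]; simpl. pose proof PI_RGT_0 as P.
  pose proof (Rmult_lt_0_compat _ _ P P) as PP.
  assert (e' : 0 < e / (2 * (PI * PI))) by (apply Rdiv_lt_0_compat; lra).
  destruct (H _ e') as [N HN]. exists N. intros n Hn. rewrite <- I2_sub by now apply tor_cont.
  eapply Rle_lt_trans; [apply (I2_abs_le _ (e / (2 * (PI * PI))))|].
  - apply cont2_minus; now apply tor_cont.
  - intros; left; now apply HN.
  - apply Rle_lt_trans with (e / 2); [|lra]. apply Req_le; field; lra.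
Qed.

Lemma finite_max (P : nat -> nat -> Prop) K : (forall i, exists N, forall N', (N <= N')%nat -> P i N') ->
  exists N, forall i N', (i <= K)%nat -> (N <= N')%nat -> P i N'.
Proof.
  intros H. induction K as [|K [N HN]].
  - destruct (H 0%nat) as [N HN]. exists N; intros i N' Hi. replace i with 0%nat by lia. apply HN.
  - destruct (H (S K)) as [N1 HN1]. exists (N + N1)%nat. intros i N' Hi HN'.
    destruct (Nat.eq_dec i (S K)) as [->|]; [apply HN1|apply HN]; lia.
Qed.

Lemma lipschitz_of_derive (f f' : R -> R) C : (forall x, is_derive f x (f' x)) -> (forall x, Rabs (f' x) <= C) ->
  forall x y, Rabs (f x - f y) <= C * Rabs (x - y).
Proof.
  intros Hf HC x y. destruct (MVT_gen f y x f') as [c [_ ->]].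
  - intros; apply Hf.
  - intros z _. apply continuity_pt_filterlim, (ex_derive_continuous (V := R_NormedModule)). eexists; apply Hf.
  - rewrite Rabs_mult. apply Rmult_le_compat_r; [apply Rabs_pos|auto].
Qed.

Lemma taylor1 (f f' f'' : R -> R) C : (forall x, is_derive f x (f' x)) -> (forall x, is_derive f' x (f'' x)) ->
  (forall x, Rabs (f'' x) <= C) ->
  forall x z, Rabs (f z - f x - f' x * (z - x)) <= C * (Rabs (z - x) * Rabs (z - x)).
Proof.
  intros Hf Hf' HC x z. destruct (MVT_gen f x z f') as [c [Hc ->]].
  - intros; apply Hf.
  - intros y _. apply continuity_pt_filterlim, (ex_derive_continuous (V := R_NormedModule)). eexists; apply Hf.
  - replace (f' c * (z - x) - f' x * (z - x)) with ((f' c - f' x) * (z - x)) by ring.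
    rewrite Rabs_mult, <- Rmult_assoc. apply Rmult_le_compat_r; [apply Rabs_pos|].
    eapply Rle_trans; [apply (lipschitz_of_derive f' f'' C Hf' HC)|].
    apply Rmult_le_compat_l; [eapply Rle_trans; [apply Rabs_pos|apply (HC x)]|].
    unfold Rmin, Rmax in Hc. destruct (Rle_dec x z); [rewrite !Rabs_right; lra|rewrite !Rabs_left1; lra].
Qed.

(** A quadratic remainder bound is a closed condition on f and d, so it survives pointwise limits;
    derivatives of limits and of inverse functions are identified through it. *)
Lemma is_derive_of_taylor (f : R -> R) x d C :
  (forall z, Rabs (f z - f x - d * (z - x)) <= C * (Rabs (z - x) * Rabs (z - x))) -> is_derive f x d.
Proof.
  intros H. apply is_derive_Reals. intros e He.
  assert (C0 : 0 <= C) by (specialize (H (x + 1)); replace (x + 1 - x) with 1 in H by ring; rewrite Rabs_R1 in H; pose proof (Rabs_pos (f (x + 1) - f x - d * 1)); lra).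
  assert (D : 0 < e / (C + 1)) by (apply Rdiv_lt_0_compat; lra).
  exists (mkposreal _ D). intros h h0 Hh. simpl in Hh. specialize (H (x + h)).
  replace (x + h - x) with h in H by ring.
  replace ((f (x + h) - f x) / h - d) with ((f (x + h) - f x - d * h) / h) by (field; auto).
  pose proof (Rabs_pos_lt h h0) as hp.
  unfold Rdiv. rewrite Rabs_mult, Rabs_inv. apply Rlt_div_l; auto.
  eapply Rle_lt_trans; [apply H|]. rewrite <- Rmult_assoc. apply Rmult_lt_compat_r; auto.
  apply Rlt_div_r in Hh; [|lra]. nra.
Qed.

Lemma mix_S2 p q f : smooth2 f -> dd false (mix p q f) = mix p (S q) f.
Proof. intro; unfold mix. rewrite dd_ddn by now apply smooth2_ddn. reflexivity. Qed.

Section Limit.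
Variable u : nat -> fn2.
Hypothesis Tu : forall n, tor (u n).
Hypothesis Bu : forall p q, exists C, 0 <= C /\ forall n x y, Rabs (mix p q (u n) x y) <= C.

Lemma mix_du p q n x y : is_derive (fun z => mix p q (u n) z y) x (mix (S p) q (u n) x y).
Proof. apply smooth2_du, mix_tor, Tu. Qed.
Lemma mix_dv p q n x y : is_derive (fun z => mix p q (u n) x z) y (mix p (S q) (u n) x y).
Proof. rewrite <- mix_S2 by apply Tu. apply smooth2_dv, mix_tor, Tu. Qed.

Lemma mix_lipschitz p q : exists C, 0 <= C /\ forall n x y x' y',
  Rabs (mix p q (u n) x y - mix p q (u n) x' y') <= C * (Rabs (x - x') + Rabs (y - y')).
Proof.
  destruct (Bu (S p) q) as [C1 [C10 H1]], (Bu p (S q)) as [C2 [C20 H2]]. exists (C1 + C2); split; [lra|].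
  intros n x y x' y'.
  pose proof (lipschitz_of_derive (fun z => mix p q (u n) z y) _ C1 (fun z => mix_du p q n z y) (fun z => H1 n z y) x x') as A.
  pose proof (lipschitz_of_derive (fun z => mix p q (u n) x' z) _ C2 (fun z => mix_dv p q n x' z) (fun z => H2 n x' z) y y') as B.
  cbv beta in A, B.
  replace (mix p q (u n) x y - mix p q (u n) x' y') with
    ((mix p q (u n) x y - mix p q (u n) x' y) + (mix p q (u n) x' y - mix p q (u n) x' y')) by ring.
  eapply Rle_trans; [apply Rabs_triang|].
  pose proof (Rabs_pos (x - x')). pose proof (Rabs_pos (y - y')). nra.
Qed.

(** Arzela-Ascoli for all derivatives at once. Diagonal extraction makes every [mix p q] converge on
    countably many grid points, uniform Lipschitz bounds make it uniformly Cauchy, and second-order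
    Taylor bounds show that the limits are derivatives of each other. *)
Lemma smooth_compactness : exists phi U, extraction phi /\ tor U /\
  forall p q, ucv (fun n => mix p q (u (phi n))) (mix p q U).
Proof.
  (* Points of mesh 1 / (m + 1) starting at - m; Cantor pairing packs the orders p, q, the mesh
     index m and the two positions i, j into a single index. *)
  set (pt := fun i m : nat => INR i / (INR m + 1) - INR m).
  set (a := fun n k => let (pq, r) := Cantor.of_nat k in let (p, q) := Cantor.of_nat pq in
     let (m, ij) := Cantor.of_nat r in let (i, j) := Cantor.of_nat ij in
     mix p q (u n) (pt i m) (pt j m)).
  destruct (diagonal_extraction a) as [phi [Hphi Hlim]].
  { intro k. unfold a. destruct (Cantor.of_nat k) as [pq r], (Cantor.of_nat pq) as [p q], (Cantor.of_nat r) as [m ij], (Cantor.of_nat ij) as [i j].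
    destruct (Bu p q) as [C [_ HC]]. exists C; auto. }
  assert (Hpt : forall p q i j m, ex_finite_lim_seq (fun n => mix p q (u (phi n)) (pt i m) (pt j m))).
  { intros p q i j m. specialize (Hlim (Cantor.to_nat (Cantor.to_nat (p, q), Cantor.to_nat (m, Cantor.to_nat (i, j))))).
    unfold a in Hlim. do 4 rewrite Cantor.cancel_of_to in Hlim. exact Hlim. }
  clearbody a. clear Hlim.
  assert (cauchy : forall p q e, 0 < e -> exists N, forall n n', (N <= n)%nat -> (N <= n')%nat -> forall x y,
    Rabs (mix p q (u (phi n)) x y - mix p q (u (phi n')) x y) < e).
  { intros p q e He. destruct (mix_lipschitz p q) as [C [C0 HC]].
    destruct (nfloor_ex (Rmax 1 (8 * C / e))) as [m [_ Hm]]; [eapply Rle_trans; [|apply Rmax_l]; lra|].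
    assert (m0 : 0 < INR m + 1) by (pose proof (pos_INR m); lra).
    assert (Hm' : 8 * C / e < INR m + 1) by (eapply Rle_lt_trans; [apply Rmax_r|apply Hm]).
    (* Indices up to [K] cover [0, PI], since PI <= 4. The choice of m makes each Lipschitz error at
       most e/4, next to e/2 for the grid values. *)
    set (K := ((4 + m) * (m + 1))%nat).
    set (P := fun i j N => forall n n', (N <= n)%nat -> (N <= n')%nat ->
       Rabs (mix p q (u (phi n)) (pt i m) (pt j m) - mix p q (u (phi n')) (pt i m) (pt j m)) < e / 2).
    assert (HP : forall i j, exists N, forall N', (N <= N')%nat -> P i j N').
    { intros i j. destruct (proj1 (ex_lim_seq_cauchy_corr _) (Hpt p q i j m) (mkposreal (e / 2) ltac:(lra))) as [N HN].
      exists N. intros N' HN' n n' Hn Hn'. apply HN; lia. }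
    assert (HP2 : forall i, exists N, forall N', (N <= N')%nat -> forall j, (j <= K)%nat -> P i j N').
    { intro i. destruct (finite_max (P i) K (HP i)) as [N HN]. exists N; intros; now apply HN. }
    destruct (finite_max (fun i N => forall j, (j <= K)%nat -> P i j N) K HP2) as [N HN].
    exists N. intros n n' Hn Hn'.
    assert (near : forall x, 0 <= x <= PI -> exists i, (i <= K)%nat /\ Rabs (x - pt i m) <= / (INR m + 1)).
    { intros x Hx. destruct (nfloor_ex ((x + INR m) * (INR m + 1))) as [i Hi].
      { apply Rmult_le_pos; pose proof (pos_INR m); lra. }
      exists i. split.
      - apply INR_le. unfold K. rewrite mult_INR, !plus_INR. simpl (INR 4). simpl (INR 1).
        eapply Rle_trans; [apply Hi|]. apply Rmult_le_compat_r; [lra|]. pose proof PI_4; simpl; lra.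
      - unfold pt. replace (x - (INR i / (INR m + 1) - INR m)) with (((x + INR m) * (INR m + 1) - INR i) * / (INR m + 1)) by (field; lra).
        rewrite Rabs_mult, (Rabs_right (/ (INR m + 1))) by (left; now apply Rinv_0_lt_compat).
        rewrite <- (Rmult_1_l (/ (INR m + 1))) at 2. apply Rmult_le_compat_r; [left; now apply Rinv_0_lt_compat|].
        apply Rabs_le; lra. }
    assert (T1 : tor (mix p q (u (phi n)))) by (apply mix_tor, Tu).
    assert (T2 : tor (mix p q (u (phi n')))) by (apply mix_tor, Tu).
    apply (per_all (fun x y => mix p q (u (phi n)) x y - mix p q (u (phi n')) x y) (fun z => Rabs z < e)).
    - intros x y. destruct T1 as [_ T1], T2 as [_ T2]. destruct (T1 x y) as [-> ->], (T2 x y) as [-> ->]; auto.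
    - intros x y Hx Hy. destruct (near x Hx) as [i [Hi Xi]], (near y Hy) as [j [Hj Yj]].
      pose proof (HC (phi n) x y (pt i m) (pt j m)) as L1.
      pose proof (HC (phi n') x y (pt i m) (pt j m)) as L2.
      pose proof (HN i N Hi ltac:(lia) j Hj n n' Hn Hn') as L3.
      assert (Q : C * (Rabs (x - pt i m) + Rabs (y - pt j m)) <= e / 4).
      { apply Rle_trans with (C * (2 * / (INR m + 1))); [apply Rmult_le_compat_l; lra|].
        apply Rlt_div_l in Hm'; auto. apply Rmult_le_reg_r with (INR m + 1); auto.
        replace (C * (2 * / (INR m + 1)) * (INR m + 1)) with (2 * C) by (field; lra). lra. }
      match type of L3 with Rabs (?A - ?B) < _ => set (gA := A) in *; set (gB := B) in * end.
      replace (mix p q (u (phi n)) x y - mix p q (u (phi n')) x y) with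
        ((mix p q (u (phi n)) x y - gA) + ((gA - gB) - (mix p q (u (phi n')) x y - gB))) by ring.
      eapply Rle_lt_trans; [apply Rabs_triang|].
      assert (Rabs (gA - gB - (mix p q (u (phi n')) x y - gB)) <= Rabs (gA - gB) + Rabs (mix p q (u (phi n')) x y - gB)).
      { unfold Rminus at 1. eapply Rle_trans; [apply Rabs_triang|]. rewrite Rabs_Ropp. lra. }
      lra. }
  set (L := fun p q x y => real (Lim_seq (fun n => mix p q (u (phi n)) x y))).
  assert (lim : forall p q x y, is_lim_seq (fun n => mix p q (u (phi n)) x y) (L p q x y)).
  { intros p q x y. apply Lim_seq_correct', ex_lim_seq_cauchy_corr. intros [e He].
    destruct (cauchy p q e He) as [N HN]. exists N; intros; now apply HN. }
  assert (unif : forall p q, ucv (fun n => mix p q (u (phi n))) (L p q)).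
  { intros p q e He. destruct (cauchy p q (e / 2) ltac:(lra)) as [N HN]. exists N. intros n Hn x y.
    apply Rle_lt_trans with (e / 2); [|lra].
    assert (H : is_lim_seq (fun n' => Rabs (mix p q (u (phi n)) x y - mix p q (u (phi n')) x y)) (Rabs (mix p q (u (phi n)) x y - L p q x y))).
    { apply (is_lim_seq_abs _ (Finite _)). apply is_lim_seq_minus'; [apply is_lim_seq_const|apply lim]. }
    apply (is_lim_seq_le_loc _ (fun _ => e / 2) (Finite _) (Finite (e / 2))) in H; [exact H| |apply is_lim_seq_const].
    exists N. intros n' Hn'. left; now apply HN. }
  assert (limle : forall p q, exists C, 0 <= C /\ forall x y x' y', Rabs (L p q x y - L p q x' y') <= C * (Rabs (x - x') + Rabs (y - y'))).
  { intros p q. destruct (mix_lipschitz p q) as [C [C0 HC]]. exists C; split; auto. intros x y x' y'.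
    apply (is_lim_seq_le (fun n => Rabs (mix p q (u (phi n)) x y - mix p q (u (phi n)) x' y')) (fun _ => C * (Rabs (x - x') + Rabs (y - y')))
       (Finite _) (Finite _)).
    - intro; apply HC.
    - apply (is_lim_seq_abs _ (Finite _)). apply is_lim_seq_minus'; apply lim.
    - apply is_lim_seq_const. }
  assert (Lcont : forall p q, cont2 (L p q)).
  { intros p q x y [e He]. destruct (limle p q) as [C [C0 HC]].
    assert (D : 0 < e / (2 * (C + 1))) by (apply Rdiv_lt_0_compat; lra).
    exists (mkposreal _ D). simpl. intros x' y' Hx Hy. eapply Rle_lt_trans; [apply HC|].
    apply Rlt_div_r in Hx, Hy; try lra. pose proof (Rabs_pos (x' - x)). pose proof (Rabs_pos (y' - y)). nra. }
  assert (Ldu : forall p q x y, is_derive (fun z => L p q z y) x (L (S p) q x y)).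
  { intros p q x y. destruct (Bu (S (S p)) q) as [C [C0 HC]]. apply (is_derive_of_taylor _ _ _ C). intro z.
    apply (is_lim_seq_le (fun n => Rabs (mix p q (u (phi n)) z y - mix p q (u (phi n)) x y - mix (S p) q (u (phi n)) x y * (z - x)))
       (fun _ => C * (Rabs (z - x) * Rabs (z - x))) (Finite _) (Finite _)).
    - intro n. apply (taylor1 (fun z => mix p q (u (phi n)) z y) (fun z => mix (S p) q (u (phi n)) z y) (fun z => mix (S (S p)) q (u (phi n)) z y) C); intros; auto; apply mix_du.
    - apply (is_lim_seq_abs _ (Finite _)). apply is_lim_seq_minus'; [apply is_lim_seq_minus'; apply lim|].
      apply (is_lim_seq_mult' _ (fun _ => z - x)); [apply lim|apply is_lim_seq_const].
    - apply is_lim_seq_const. }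
  assert (Ldv : forall p q x y, is_derive (fun z => L p q x z) y (L p (S q) x y)).
  { intros p q x y. destruct (Bu p (S (S q))) as [C [C0 HC]]. apply (is_derive_of_taylor _ _ _ C). intro z.
    apply (is_lim_seq_le (fun n => Rabs (mix p q (u (phi n)) x z - mix p q (u (phi n)) x y - mix p (S q) (u (phi n)) x y * (z - y)))
       (fun _ => C * (Rabs (z - y) * Rabs (z - y))) (Finite _) (Finite _)).
    - intro n. apply (taylor1 (fun z => mix p q (u (phi n)) x z) (fun z => mix p (S q) (u (phi n)) x z) (fun z => mix p (S (S q)) (u (phi n)) x z) C); intros; auto; apply mix_dv.
    - apply (is_lim_seq_abs _ (Finite _)). apply is_lim_seq_minus'; [apply is_lim_seq_minus'; apply lim|].
      apply (is_lim_seq_mult' _ (fun _ => z - y)); [apply lim|apply is_lim_seq_const].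
    - apply is_lim_seq_const. }
  assert (Eu : forall p q, pdu (L p q) = L (S p) q) by (intros; apply pdu_unique; intros; apply Ldu).
  assert (Ev : forall p q, pdv (L p q) = L p (S q)) by (intros; apply pdv_unique; intros; apply Ldv).
  assert (LS : smooth2 (L 0%nat 0%nat)).
  { apply (smooth2_coind (fun f => exists p q, f = L p q)); [|now exists 0%nat, 0%nat].
    intros f [p [q ->]]. split; [apply Lcont|]. split.
    - intros [|] x y; eexists; [apply Ldu|apply Ldv].
    - intros [|]; simpl; [exists (S p), q; apply Eu|exists p, (S q); apply Ev]. }
  exists phi, (L 0%nat 0%nat). split; auto. split.
  - split; auto. intros x y. unfold L. split; f_equal; apply Lim_seq_ext; intro n; apply (Tu (phi n)).
  - intros p q. replace (mix p q (L 0%nat 0%nat)) with (L p q); [apply unif|].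
    unfold mix. transitivity (ddn true p (L 0%nat q)).
    + induction p; simpl; auto. rewrite <- Eu. simpl. now rewrite IHp.
    + f_equal. clear p. induction q; simpl; auto. rewrite <- Ev. now rewrite IHq.
Qed.
End Limit.

(** * Passage to the limit in the Galerkin equations *)

Lemma span_mono E n m v : (n <= m)%nat -> span E n v -> span E m v.
Proof.
  intros Hnm [c ->]. exists (fun i => if Nat.ltb i n then c i else 0).
  induction Hnm as [|m Hnm IH].
  - apply lc_dep. intros i Hi. now rewrite (proj2 (Nat.ltb_lt i n) Hi).
  - simpl. rewrite <- IH. rewrite (proj2 (Nat.ltb_ge m n) Hnm). apply fn2_ext; intros; unfold fadd, fscal; ring.
Qed.

Lemma lc_points E n c x y x' y' : (forall i, E i x y = E i x' y') -> lc E n c x y = lc E n c x' y'.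
Proof. intro H; induction n; simpl; auto. unfold fadd, fscal. now rewrite IHn, H. Qed.

(** Uniform convergence with first derivatives passes the mass, the mean, the energy and the
    equation to the limit. The last clause says that the limit inherits every coincidence of values
    shared by the basis, in particular the invariance under the glide. *)
Lemma galerkin_limit k E l N0 : elliptic k -> eigbasis E ->
  (forall n, (N0 <= n)%nat -> exists mu u, galerkin k E l n mu u) ->
  exists mu U, 0 <= mu <= l /\ tor U /\ Mf k U U = 1 /\ mean k U = 0 /\ Bf k U U = mu /\
    (forall n v, tor v -> span E n v -> Bf k U v = mu * Mf k U v) /\
    forall x y x' y', (forall i, E i x y = E i x' y') -> U x y = U x' y'.
Proof.
  intros Hk HE HG.
  assert (HG' : forall n, exists x : R * fn2, galerkin k E l (N0 + n) (fst x) (snd x)).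
  { intro n. destruct (HG (N0 + n)%nat ltac:(lia)) as [mu [u G]]. now exists (mu, u). }
  destruct (functional_choice _ HG') as [F HF].
  set (u := fun n => snd (F n)).
  assert (Tu : forall n, tor (u n)) by (intro n; apply (gal_tor _ _ _ _ _ _ (HF n))).
  destruct (smooth_compactness u Tu) as [phi [U [Hphi [TU HU]]]].
  { intros p q. destruct (gal_sup k E l p q Hk HE) as [C [C0 HC]]. exists C; split; auto.
    intros n x y. apply (HC _ _ _ (HF n)). }
  set (w := fun n => u (phi n)).
  assert (U0 : ucv w U) by apply (HU 0%nat 0%nat).
  assert (U1 : ucv (fun n => pdu (w n)) (pdu U)) by apply (HU 1%nat 0%nat).
  assert (U2 : ucv (fun n => pdv (w n)) (pdv U)) by apply (HU 0%nat 1%nat).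
  assert (Tw : forall n, tor (w n)) by (intro; apply Tu).
  pose proof Hk as [[TA [TB [TC TR]]] _].
  assert (Ufl : forall b, ucv (fun n => flux k b (w n)) (flux k b U)).
  { intros [|]; simpl; apply ucv_add; apply ucv_mul; auto with sp; apply ucv_const. }
  assert (BV : forall g g', (forall n, tor (g n)) -> tor g' -> ucv (fun n => pdu (g n)) (pdu g') -> ucv (fun n => pdv (g n)) (pdv g') ->
    is_lim_seq (fun n => Bf k (w n) (g n)) (Bf k U g')).
  { intros g g' Tg Tg' G1 G2. apply ucv_I2; auto 10 with sp.
    apply ucv_add; apply ucv_mul; auto with sp. }
  assert (MV : forall g g', (forall n, tor (g n)) -> tor g' -> ucv g g' ->
    is_lim_seq (fun n => Mf k (w n) (g n)) (Mf k U g')).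
  { intros g g' Tg Tg' G. apply ucv_I2; auto 10 with sp.
    apply ucv_mul; auto with sp; [apply ucv_const|]. apply ucv_mul; auto with sp. }
  assert (UL : forall (a b : R) s, is_lim_seq s a -> (forall n, s n = b) -> a = b).
  { intros a b s H1 H2. apply (is_lim_seq_ext _ (fun _ => b) _ H2) in H1.
    apply is_lim_seq_unique in H1. rewrite Lim_seq_const in H1. now injection H1. }
  assert (mulim : is_lim_seq (fun n => fst (F (phi n))) (Bf k U U)).
  { apply is_lim_seq_ext with (fun n => Bf k (w n) (w n)); [|now apply BV].
    intro n; apply (gal_energy _ _ _ _ _ _ (HF (phi n))). }
  exists (Bf k U U), U. split; [|split; [auto|split; [|split; [|split; [auto|split]]]]].
  - split.
    + apply (is_lim_seq_le (fun _ => 0) (fun n => fst (F (phi n))) 0 (Bf k U U)); auto using is_lim_seq_const.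
      intro n; apply (gal_mu _ _ _ _ _ _ (HF (phi n))).
    + apply (is_lim_seq_le (fun n => fst (F (phi n))) (fun _ => l) (Bf k U U) l); auto using is_lim_seq_const.
      intro n; apply (gal_mu _ _ _ _ _ _ (HF (phi n))).
  - apply (UL _ _ _ (MV w U Tw TU U0)). intro n; apply (gal_mass _ _ _ _ _ _ (HF (phi n))).
  - apply (UL _ _ _ (MV (fun _ => fun _ _ => 1) (fun _ _ => 1) (fun _ => tor_const 1) (tor_const 1) (ucv_const _))).
    intro n; apply (gal_mean _ _ _ _ _ _ (HF (phi n))).
  - intros n v Tv Sv.
    assert (L1 : is_lim_seq (fun n => Bf k (w n) v) (Bf k U v)) by (apply (BV (fun _ => v) v); auto using ucv_const).
    assert (L2 : is_lim_seq (fun n => fst (F (phi n)) * Mf k (w n) v) (Bf k U U * Mf k U v)).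
    { apply is_lim_seq_mult'; auto. apply (MV (fun _ => v) v); auto using ucv_const. }
    (* A fixed v of the n-th span lies in all later ones, so it is a test function for all but
       finitely many terms. *)
    apply (is_lim_seq_ext_loc _ (fun n => fst (F (phi n)) * Mf k (w n) v)) in L1.
    + apply is_lim_seq_unique in L1, L2. rewrite L1 in L2. now injection L2.
    + exists n. intros m Hm. apply (gal_eq _ _ _ _ _ _ (HF (phi m))). apply (span_mono E n); auto.
      specialize (Hphi m). lia.
  - intros x y x' y' Hxy.
    assert (P : forall x y, is_lim_seq (fun n => w n x y) (U x y)).
    { intros a b. apply is_lim_seq_spec. intros [e He]. destruct (U0 e He) as [N HN]. exists N; intros; now apply HN. }
    pose proof (P x y) as P1. apply is_lim_seq_ext with (v := fun n => w n x' y') in P1.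
    + pose proof (P x' y') as P2. apply is_lim_seq_unique in P1, P2. rewrite P1 in P2. now injection P2.
    + intro n. destruct (gal_shape _ _ _ _ _ _ (HF (phi n))) as [f [c [[d ->] E']]].
      unfold w, u. rewrite E'. unfold fadd. f_equal. now apply lc_points.
Qed.

(** * Density of trigonometric polynomials *)

Definition trig (s : bool) (m : nat) (x : R) : R :=
  if s then cos (2 * INR m * x) else sin (2 * INR m * x).

Lemma smooth2_trig s m f : smooth2 f -> smooth2 (fun x y => trig s m (f x y)).
Proof. intro; destruct s; unfold trig; smooth. Qed.

Lemma trig_per s m x : trig s m (x + PI) = trig s m x.
Proof.
  unfold trig. replace (2 * INR m * (x + PI)) with (2 * INR m * x + 2 * INR m * PI) by ring.
  destruct s; [apply cos_period|apply sin_period].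
Qed.

Lemma trig_half s m x : trig s m (x + PI / 2) = (if Nat.even m then 1 else -1) * trig s m x.
Proof.
  unfold trig. replace (2 * INR m * (x + PI / 2)) with (2 * INR m * x + INR m * PI) by field.
  assert (H : cos (INR m * PI) = (if Nat.even m then 1 else -1) /\ sin (INR m * PI) = 0).
  { induction m as [|m [IH1 IH2]]; [simpl; rewrite Rmult_0_l, cos_0, sin_0; auto|].
    rewrite S_INR. replace ((INR m + 1) * PI) with (INR m * PI + PI) by ring.
    rewrite neg_cos, neg_sin, IH1, IH2. rewrite Nat.even_succ, <- Nat.negb_even. destruct (Nat.even m); simpl; lra. }
  destruct H as [H1 H2]. destruct s; [rewrite cos_plus|rewrite sin_plus]; rewrite H1, H2; ring.
Qed.

Lemma trig_opp s m x : trig s m (- x) = (if s then 1 else -1) * trig s m x.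
Proof.
  unfold trig. replace (2 * INR m * - x) with (- (2 * INR m * x)) by ring.
  destruct s; [rewrite cos_neg|rewrite sin_neg]; ring.
Qed.

Lemma trig_derive s m x : is_derive (trig s m) x ((if s then -1 else 1) * (2 * INR m) * trig (negb s) m x).
Proof. destruct s; unfold trig; simpl; auto_derive; auto; ring. Qed.

Lemma trig_bound s m x : Rabs (trig s m x) <= 1.
Proof.
  unfold trig. apply Rabs_le. destruct s; [apply COS_bound|].
  split; apply SIN_bound.
Qed.

Lemma tor_trig_u s m : tor (fun x _ => trig s m x).
Proof.
  split; [apply (smooth2_trig s m (fun x _ => x)), smooth2_u|]. intros x y; split; auto using trig_per.
Qed.
Lemma tor_trig_v s m : tor (fun _ y => trig s m y).
Proof.
  split; [apply (smooth2_trig s m (fun _ y => y)), smooth2_v|]. intros x y; split; auto using trig_per.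
Qed.

(** Finite sums with separated variables, trigonometric in x: integrating such a kernel against F(a,
    y) da gives a trigonometric polynomial in x with coefficients depending on y. *)
Inductive sep_kernel : fn2 -> Prop :=
| sep_kernel_base s m p : smooth2 (fun _ a => p a) -> sep_kernel (fun x a => p a * trig s m x)
| sep_kernel_plus f g : sep_kernel f -> sep_kernel g -> sep_kernel (fun x a => f x a + g x a).

Lemma sep_kernel_ext f g : (forall x y, f x y = g x y) -> sep_kernel f -> sep_kernel g.
Proof. intros H; now rewrite (fn2_ext f g H). Qed.

Lemma sep_kernel_mulp p f : smooth2 (fun _ a => p a) -> sep_kernel f -> sep_kernel (fun x a => p a * f x a).
Proof.
  intros Hp H; induction H as [s m q Hq|f g Hf IHf Hg IHg].
  - apply (sep_kernel_ext (fun x a => (p a * q a) * trig s m x)); [intros; ring|].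
    apply (sep_kernel_base s m (fun a => p a * q a)). smooth.
  - apply (sep_kernel_ext (fun x a => p a * f x a + p a * g x a)); [intros; ring|]. now apply sep_kernel_plus.
Qed.

Lemma sep_kernel_multrig s0 f : sep_kernel f -> sep_kernel (fun x a => trig s0 1 x * f x a).
Proof.
  intros H; induction H as [s m q Hq|f g Hf IHf Hg IHg].
  - destruct m as [|m].
    + destruct s.
      * apply (sep_kernel_ext (fun x a => q a * trig s0 1 x)); [|now apply sep_kernel_base].
        intros x a; unfold trig; simpl (INR 0). replace (2 * 0 * x) with 0 by ring. rewrite cos_0. ring.
      * apply (sep_kernel_ext (fun x a => (0 * q a) * trig s0 1 x)).
        2: { apply (sep_kernel_base s0 1 (fun a => 0 * q a)). smooth. }
        intros x a; unfold trig; simpl (INR 0). replace (2 * 0 * x) with 0 by ring. rewrite sin_0. ring.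
    + assert (Q : forall c, smooth2 (fun _ a => c * q a)) by (intro; smooth).
      apply (sep_kernel_ext (fun x a => ((if (s || s0)%bool then / 2 else - / 2) * q a) * trig (Bool.eqb s s0) (S (S m)) x
         + ((if s then if s0 then / 2 else - / 2 else / 2) * q a) * trig (Bool.eqb s s0) m x)).
      2: { apply sep_kernel_plus; apply (sep_kernel_base _ _ (fun a => _ * q a)); apply Q. }
      intros x a. unfold trig. rewrite !S_INR. simpl (INR 0).
      set (A := 2 * (INR m + 1) * x). set (B := 2 * (0 + 1) * x).
      replace (2 * (INR m + 1 + 1) * x) with (A + B) by (unfold A, B; ring).
      replace (2 * INR m * x) with (A - B) by (unfold A, B; ring).
      destruct s, s0; simpl; rewrite ?cos_plus, ?sin_plus, ?cos_minus, ?sin_minus; field.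
  - apply (sep_kernel_ext (fun x a => trig s0 1 x * f x a + trig s0 1 x * g x a)); [intros; ring|]. now apply sep_kernel_plus.
Qed.

(** Induction by cos^2 (x - a) = (1 + cos (2x - 2a)) / 2, expanded by the addition formula. *)
Lemma sep_kernel_cos N : sep_kernel (fun x a => cos (x - a) ^ (2 * N)).
Proof.
  induction N as [|N IH].
  - apply (sep_kernel_ext (fun x a => 1 * trig true 0 x)); [|apply (sep_kernel_base true 0 (fun _ => 1)); smooth].
    intros; unfold trig; simpl. rewrite Rmult_0_r, Rmult_0_l, cos_0; ring.
  - assert (Ct : forall s, smooth2 (fun _ a => / 2 * trig s 1 a)).
    { intro s; smooth. apply (smooth2_trig s 1 (fun _ a => a)), smooth2_v. }
    apply (sep_kernel_ext (fun x a => / 2 * cos (x - a) ^ (2 * N) +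
      ((/ 2 * trig true 1 a) * (trig true 1 x * cos (x - a) ^ (2 * N)) +
       (/ 2 * trig false 1 a) * (trig false 1 x * cos (x - a) ^ (2 * N))))).
    + intros x a. replace (2 * S N)%nat with (S (S (2 * N))) by lia. rewrite <- !tech_pow_Rmult.
      set (c := cos (x - a) ^ (2 * N)). unfold trig. simpl (INR 1).
      replace (2 * 1 * a) with (a + a) by ring. replace (2 * 1 * x) with (x + x) by ring.
      assert (E : cos (x - a) * cos (x - a) = / 2 + / 2 * cos ((x + x) - (a + a))).
      { replace (x + x - (a + a)) with (2 * (x - a)) by ring. rewrite cos_2a_cos. field. }
      transitivity (cos (x - a) * cos (x - a) * c); [rewrite E, cos_minus; ring|ring].
    + apply sep_kernel_plus; [apply (sep_kernel_mulp (fun _ => / 2)); [smooth|auto]|].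
      apply sep_kernel_plus; (apply (sep_kernel_mulp (fun a => / 2 * trig _ 1 a)); [apply Ct|now apply sep_kernel_multrig]).
Qed.

(** Trigonometric in the first variable only, with arbitrary periodic coefficients in the second:
    the stage between smoothing in one variable and in both. *)
Inductive trig_poly_u : fn2 -> Prop :=
| trig_poly_u_base s m q : tor (fun _ y => q y) -> trig_poly_u (fun x y => trig s m x * q y)
| trig_poly_u_plus f g : trig_poly_u f -> trig_poly_u g -> trig_poly_u (fun x y => f x y + g x y).

Lemma trig_poly_u_tor f : trig_poly_u f -> tor f.
Proof.
  intro H; induction H as [s m q Hq|f g _ IHf _ IHg].
  - apply (tor_mul (fun x _ => trig s m x) (fun _ y => q y)); auto using tor_trig_u.
  - now apply (tor_add f g).
Qed.

Lemma smooth2_param f a b : smooth2 f -> smooth2 (fun x _ => RInt (fun t => f x t) a b).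
Proof.
  intros Hf. apply (smooth2_coind (fun g => exists f, smooth2 f /\ g = fun x _ => RInt (fun t => f x t) a b)); [|now exists f].
  clear f Hf; intros g [f [Hf ->]]. split; [|split].
  - intros x y e. pose proof (cont_RInt_param f a b (smooth2_cont f Hf) x) as C.
    destruct (proj1 (continuity_pt_locally _ x) (proj2 (continuity_pt_filterlim _ x) C) e) as [d Hd].
    exists d. intros x' y' Hx _. now apply Hd.
  - intros [|] x y; simpl; eexists; [now apply is_derive_param|apply isd_const].
  - intros [|].
    + exists (pdu f); split; [smooth|]. apply dd_unique. intros x y. now apply is_derive_param.
    + exists (fun _ _ => 0); split; [smooth|]. apply dd_unique. intros x y. simpl.
      rewrite RInt_const_r. rewrite Rmult_0_r. apply isd_const.
Qed.

Lemma tor_coef F p : tor F -> smooth2 (fun _ a => p a) ->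
  tor (fun _ y => RInt (fun a => p a * F a y) 0 PI).
Proof.
  intros [SF PF] Sp. split.
  - apply (smooth2_swap (fun y _ => RInt (fun a => p a * F a y) 0 PI)).
    apply (smooth2_param (fun y a => p a * F a y)). apply smooth2_mult; auto. now apply (smooth2_swap F).
  - intros x y; split; auto. apply RInt_ext_all; intro a. now rewrite (proj2 (PF a y)).
Qed.

Lemma sep_kernel_smooth f : sep_kernel f -> smooth2 f.
Proof.
  intro H; induction H as [s m p Hp|f g _ IHf _ IHg]; smooth.
  apply (smooth2_trig s m (fun x _ => x)), smooth2_u.
Qed.

Lemma trig_poly_u_sepk F k : tor F -> sep_kernel k -> trig_poly_u (fun x y => RInt (fun a => k x a * F a y) 0 PI).
Proof.
  intros TF H; induction H as [s m p Hp|f g Hf IHf Hg IHg].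
  - replace (fun x y => RInt (fun a => p a * trig s m x * F a y) 0 PI) with
      (fun x y => trig s m x * RInt (fun a => p a * F a y) 0 PI).
    + now apply (trig_poly_u_base s m (fun y => RInt (fun a => p a * F a y) 0 PI)), tor_coef.
    + apply fn2_ext; intros x y. rewrite <- RInt_scal_c.
      * apply RInt_ext_all; intro; ring.
      * apply (cont2_v (fun y a => p a * F a y)). apply smooth2_cont, smooth2_mult; auto.
        destruct TF; now apply (smooth2_swap F).
  - replace (fun x y => RInt (fun a => (f x a + g x a) * F a y) 0 PI) with
      (fun x y => RInt (fun a => f x a * F a y) 0 PI + RInt (fun a => g x a * F a y) 0 PI); [now apply trig_poly_u_plus|].
    apply fn2_ext; intros x y. pose proof (sep_kernel_smooth f Hf) as Sf. pose proof (sep_kernel_smooth g Hg) as Sg.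
    assert (C : forall h, smooth2 h -> cont (fun a => h x a * F a y)).
    { intros h Sh. apply cont_mult; [apply cont2_v, smooth2_cont, Sh|]. apply (cont2_u F). now apply tor_cont. }
    rewrite <- RInt_plus_c by auto. apply RInt_ext_all; intro; ring.
Qed.

(* The integral of cos^(2N) over a period. *)
Fixpoint wallis (N : nat) : R :=
  match N with O => PI | S N => (2 * INR N + 1) / (2 * INR N + 2) * wallis N end.

Lemma wallis_pos N : 0 < wallis N.
Proof.
  induction N; simpl; [apply PI_RGT_0|]. pose proof (pos_INR N).
  apply Rmult_lt_0_compat; auto. apply Rdiv_lt_0_compat; lra.
Qed.

Lemma cont_cosN n x : cont (fun a => cos (x - a) ^ n).
Proof. apply cont_pow, cont_derive. intro; auto_derive; auto. Qed.

Lemma wallis_int N x : RInt (fun a => cos (x - a) ^ (2 * N)) 0 PI = wallis N.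
Proof.
  induction N as [|N IH].
  - simpl. rewrite RInt_const_r. req; ring.
  - set (n := (2 * N)%nat) in *.
    (* The integrand is the derivative in a of cos^(n+1) (x - a) sin (x - a), which takes equal
       values at 0 and PI because n is even. *)
    assert (E : RInt (fun a => (INR n + 1) * cos (x - a) ^ n - (INR n + 2) * cos (x - a) ^ (S (S n))) 0 PI = 0).
    { rewrite (RInt_FTC (fun a => cos (x - a) ^ (S n) * sin (x - a))).
      - replace (x - PI) with (- (PI - x)) by ring. rewrite cos_neg, sin_neg, sin_PI_x, Rtrigo_facts.cos_pi_minus.
        replace (x - 0) with x by ring.
        assert (P : (- cos x) ^ S n = - cos x ^ S n).
        { replace (- cos x) with ((-1) * cos x) by ring. rewrite Rpow_mult_distr. simpl. unfold n. rewrite pow_1_even. ring. }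
        rewrite P. req. ring.
      - intro a. auto_derive; auto. change (match n with 0%nat => 1 | S _ => INR n + 1 end) with (INR (S n)). rewrite S_INR.
        pose proof (sin2_cos2 (x + - a)) as H. unfold Rsqr in H.
        unfold Rminus. simpl pred. simpl pow. set (c := cos (x + - a)) in *. set (s := sin (x + - a)) in *.
        req. transitivity ((INR n + 1) * c ^ n * (s * s) - c * c ^ n * c); [ring|].
        replace (s * s) with (1 - c * c) by lra. ring.
      - apply cont_minus; apply cont_mult; auto using cont_const, cont_cosN. }
    rewrite RInt_minus_c in E by (apply cont_mult; auto using cont_const, cont_cosN).
    rewrite (RInt_scal_c _ (INR n + 1)), (RInt_scal_c _ (INR n + 2)), IH in E by apply cont_cosN.
    assert (En : INR n = 2 * INR N) by (unfold n; now rewrite mult_INR).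
    rewrite En in E. clearbody n. 
    replace (2 * S N)%nat with (S (S (2 * N))) by lia. simpl wallis.
    pose proof (pos_INR N).
    assert (n = 2 * N)%nat by (apply INR_eq; rewrite mult_INR; exact En). subst n.
    apply Rmult_eq_reg_l with (2 * INR N + 2); [|lra].
    replace ((2 * INR N + 2) * ((2 * INR N + 1) / (2 * INR N + 2) * wallis N)) with ((2 * INR N + 1) * wallis N) by (field; lra).
    lra.
Qed.

(** Jordan's inequality with 3 in place of PI/2, from sin s >= s - s^3 / 6 >= s / 3 as long as s^2
    <= 4. *)
Lemma jordan s : - (PI / 2) <= s <= PI / 2 -> Rabs s <= 3 * Rabs (sin s).
Proof.
  assert (K : forall s, 0 <= s <= PI / 2 -> s <= 3 * sin s).
  { clear s; intros s Hs. pose proof PI_4. destruct (pre_sin_bound s 0) as [B _]; try lra.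
    assert (B' : s - s * s * s / 6 <= sin s).
    { eapply Rle_trans; [|apply B]. apply Req_le. unfold sin_approx, sin_term. simpl. field. }
    assert (s * s <= 4) by nra. nra. }
  intros Hs. destruct (Rle_dec 0 s).
  - rewrite !Rabs_right; [apply K; lra|apply Rle_ge, sin_ge_0; pose proof PI_RGT_0; lra|lra].
  - rewrite <- (Rabs_Ropp s), <- (Rabs_Ropp (sin s)), <- sin_neg.
    rewrite !Rabs_right; [apply K; lra|apply Rle_ge, sin_ge_0; pose proof PI_RGT_0; lra|lra].
Qed.

(** Periodicity reduces x - a modulo PI to [- PI/2, PI/2], where [jordan] compares the distance with
    |sin|. *)
Lemma lipschitz_sin (f : R -> R) L : (forall x, f (x + PI) = f x) -> 0 <= L ->
  (forall x y, Rabs (f x - f y) <= L * Rabs (x - y)) ->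
  forall x a, Rabs (f a - f x) <= 3 * L * Rabs (sin (x - a)).
Proof.
  intros Hp HL Hl x a. pose proof PI_RGT_0.
  destruct (reduce_PI (x - a + PI / 2)) as [k Hk].
  set (s := x - a - IZR k * PI).
  rewrite <- (per_Z f Hp (- k) a).
  eapply Rle_trans; [apply Hl|].
  replace (a - IZR (- k) * PI - x) with (- s) by (rewrite opp_IZR; unfold s; ring).
  rewrite Rabs_Ropp.
  assert (E : Rabs (sin (x - a)) = Rabs (sin s)).
  { unfold s. symmetry. apply (per_Z (fun y => Rabs (sin y))). intro y. rewrite neg_sin. apply Rabs_Ropp. }
  rewrite E. pose proof (jordan s ltac:(unfold s; lra)). 
  replace (3 * L * Rabs (sin s)) with (L * (3 * Rabs (sin s))) by ring. now apply Rmult_le_compat_l.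
Qed.

(** Convolution in the first variable with the normalized de la Vallee Poussin kernel cos^(2N). *)
Definition conv (N : nat) (F : fn2) : fn2 :=
  fun x y => / wallis N * RInt (fun a => cos (x - a) ^ (2 * N) * F a y) 0 PI.

Lemma cont_convint N F x y : tor F -> cont (fun a => cos (x - a) ^ (2 * N) * F a y).
Proof. intro; apply cont_mult; [apply cont_cosN|]. now apply cont2_u, tor_cont. Qed.

Lemma trig_poly_u_scal c f : trig_poly_u f -> trig_poly_u (fun x y => c * f x y).
Proof.
  intro H; induction H as [s m q Hq|f g _ IHf _ IHg].
  - replace (fun x y => c * (trig s m x * q y)) with (fun x y => trig s m x * (c * q y)) by (apply fn2_ext; intros; ring).
    apply (trig_poly_u_base s m (fun y => c * q y)). now apply (tor_scal c (fun _ y => q y)).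
  - replace (fun x y => c * (f x y + g x y)) with (fun x y => c * f x y + c * g x y) by (apply fn2_ext; intros; ring).
    now apply trig_poly_u_plus.
Qed.

Lemma trig_poly_u_conv N F : tor F -> trig_poly_u (conv N F).
Proof.
  intro H. apply (trig_poly_u_scal (/ wallis N) (fun x y => RInt (fun a => cos (x - a) ^ (2 * N) * F a y) 0 PI)).
  apply (trig_poly_u_sepk F (fun x a => cos (x - a) ^ (2 * N))); auto. apply sep_kernel_cos.
Qed.

(** |F(a) - F(x)| <= 2 L |sin (x - a)|, and 2 |sin| <= d + sin^2 / d by the arithmetic-geometric
    mean. The kernel gives sin^2 the mean 1 - [wallis (S N)] / [wallis N] = 1 / (2N + 2). *)
Lemma conv_close N F L : tor F -> 0 <= L -> (forall x y, 3 * Rabs (pdu F x y) <= 2 * L) -> forall d, 0 < d -> forall x y,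
  Rabs (conv N F x y - F x y) <= L * (d + / (d * (2 * INR N + 2))).
Proof.
  intros TF HL HF d Hd x y. pose proof (wallis_pos N) as W. pose proof (pos_INR N).
  assert (C0 : cont (fun a => cos (x - a) ^ (2 * N))) by apply cont_cosN.
  assert (C1 : cont (fun a => cos (x - a) ^ (2 * S N))) by apply cont_cosN.
  assert (E : conv N F x y - F x y = / wallis N * RInt (fun a => cos (x - a) ^ (2 * N) * (F a y - F x y)) 0 PI).
  { unfold conv. rewrite (RInt_ext_all (fun a => cos (x - a) ^ (2 * N) * (F a y - F x y)) (fun a => cos (x - a) ^ (2 * N) * F a y - F x y * cos (x - a) ^ (2 * N))) by (intro; ring).
    rewrite RInt_minus_c, (RInt_scal_c _ (F x y)), wallis_int; auto using cont_convint.
    - field; lra.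
    - apply cont_mult; auto using cont_const. }
  rewrite E, Rabs_mult, (Rabs_right (/ wallis N)) by (left; now apply Rinv_0_lt_compat).
  apply Rmult_le_reg_l with (wallis N); auto. rewrite <- Rmult_assoc, Rinv_r, Rmult_1_l by lra.
  eapply Rle_trans; [apply abs_RInt_le; [pose proof PI_RGT_0; lra|apply cont_ex_RInt]|].
  { apply cont_mult; auto. apply cont_minus; [now apply cont2_u, tor_cont|apply cont_const]. }
  assert (LS : forall a, Rabs (F a y - F x y) <= 2 * L * Rabs (sin (x - a))).
  { intro a. replace (2 * L) with (3 * (2 * L / 3)) by field.
    apply (lipschitz_sin (fun z => F z y)); [intro z; apply TF|lra|].
    intros p q. apply (lipschitz_of_derive (fun z => F z y) (fun z => pdu F z y)).
    - intro; now apply smooth2_du, TF.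
    - intro z; specialize (HF z y); lra. }
  eapply Rle_trans.
  - apply (RInt_le_c _ (fun a => L * (d + / d) * cos (x - a) ^ (2 * N) - L * / d * cos (x - a) ^ (2 * S N))).
    + pose proof PI_RGT_0; lra.
    + apply cont_abs, cont_mult; auto. apply cont_minus; [now apply cont2_u, tor_cont|apply cont_const].
    + apply cont_minus; apply cont_mult; auto using cont_const.
    + intros a _. rewrite Rabs_mult. specialize (LS a).
      assert (P : 0 <= cos (x - a) ^ (2 * N)) by (rewrite pow_mult; apply pow_le, pow2_ge_0).
      rewrite (Rabs_right (cos (x - a) ^ (2 * N))) by lra.
      replace (2 * S N)%nat with (S (S (2 * N))) by lia. rewrite <- !tech_pow_Rmult.
      set (p := cos (x - a) ^ (2 * N)) in *.
      pose proof (sin2_cos2 (x - a)) as SC. unfold Rsqr in SC. set (c := cos (x - a)) in *.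
      assert (AM : 2 * Rabs (sin (x - a)) <= d + / d * (sin (x - a) * sin (x - a))).
      { pose proof (Rle_0_sqr (d - Rabs (sin (x - a)))) as S. unfold Rsqr in S.
        assert (A2 : Rabs (sin (x - a)) * Rabs (sin (x - a)) = sin (x - a) * sin (x - a)) by (rewrite <- Rabs_mult; apply Rabs_right; nra).
        apply Rmult_le_reg_l with d; auto.
        replace (d * (d + / d * (sin (x - a) * sin (x - a)))) with (d * d + sin (x - a) * sin (x - a)) by (field; lra). nra. }
      replace (L * (d + / d) * p - L * / d * (c * (c * p))) with (p * (L * (d + / d * (1 - c * c)))) by ring.
      apply Rmult_le_compat_l; auto. replace (1 - c * c) with (sin (x - a) * sin (x - a)) by lra.
      eapply Rle_trans; [apply LS|]. rewrite (Rmult_comm 2), Rmult_assoc. now apply Rmult_le_compat_l.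
  - rewrite RInt_minus_c by (apply cont_mult; auto using cont_const).
    rewrite (RInt_scal_c _ (L * (d + / d))), (RInt_scal_c _ (L * / d)), !wallis_int by auto.
    apply Req_le. simpl. field. lra.
Qed.

(** The kernel depends on x - a only, so its x-derivative is minus its a-derivative, which
    integration by parts moves to F; the boundary terms cancel by periodicity. *)
Lemma pdu_conv N F : tor F -> pdu (conv N F) = conv N (pdu F).
Proof.
  intros TF. apply pdu_unique. intros x y. unfold conv.
  set (k := fun x a => cos (x - a) ^ (2 * N)).
  assert (Sk : smooth2 k) by (unfold k; smooth).
  assert (SF : smooth2 (fun _ a => F a y)).
  { apply (smooth2_swap (fun a _ => F a y)). apply smooth2_slice_u, TF. }
  pose proof (is_derive_param (fun x a => k x a * F a y) 0 PI x ltac:(smooth)) as D.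
  eapply isd_eq; [apply (isd_mult (fun _ => / wallis N)); [apply isd_const|exact D]|]. req.
  rewrite Rmult_0_l, Rplus_0_l. f_equal.
  assert (DK : forall a, pdu (fun x a => k x a * F a y) x a = pdu k x a * F a y).
  { intro a. apply is_derive_unique. eapply isd_eq; [apply (isd_mult (fun x => k x a) (fun _ => F a y)); [now apply smooth2_du|apply isd_const]|]. req; ring. }
  assert (DA : forall a, is_derive (fun a => k x a * F a y) a (- pdu k x a * F a y + k x a * pdu F a y)).
  { intro a. apply (isd_mult (fun a => k x a) (fun a => F a y) a); [|apply (smooth2_du F), TF].
    assert (G : forall b, is_derive (fun z => cos z ^ (2 * N)) b (Derive (fun z => cos z ^ (2 * N)) b)).
    { intro b. apply Derive_correct. auto_derive; auto. }
    assert (E : pdu k x a = Derive (fun z => cos z ^ (2 * N)) (x - a)).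
    { apply is_derive_unique. eapply isd_eq; [apply (isd_comp (fun z => cos z ^ (2 * N)) (fun x => x - a)); [apply G|auto_derive; auto]|]. req; ring. }
    rewrite E. eapply isd_eq; [apply (isd_comp (fun z => cos z ^ (2 * N)) (fun a => x - a)); [apply G|auto_derive; auto]|]. req; ring. }
  assert (C1 : cont (fun a => pdu k x a * F a y)).
  { apply cont_mult; [apply (cont2_v (pdu k)), smooth2_cont; smooth|now apply cont2_u, tor_cont]. }
  assert (C2 : cont (fun a => k x a * pdu F a y)).
  { apply cont_mult; [apply (cont2_v k), smooth2_cont; smooth|]. apply (cont2_u (pdu F)), tor_cont; auto with sp. }
  assert (P : k x PI * F PI y - k x 0 * F 0 y = 0).
  { unfold k. replace (F PI y) with (F 0 y) by (rewrite <- (proj1 (proj2 TF 0 y)); f_equal; ring).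
    replace (x - PI) with (- (PI - x)) by ring. rewrite cos_neg, Rtrigo_facts.cos_pi_minus, Rminus_0_r.
    rewrite !(pow_mult _ 2). replace ((- cos x) ^ 2) with (cos x ^ 2) by ring. ring. }
  assert (CI : cont (fun a => - pdu k x a * F a y + k x a * pdu F a y)).
  { apply cont_plus; auto. replace (fun a => - pdu k x a * F a y) with (fun a => - (pdu k x a * F a y)) by (extensionality a; ring).
    now apply cont_opp. }
  pose proof (RInt_FTC _ _ 0 PI DA CI) as I.
  rewrite (RInt_ext_all _ (fun a => pdu k x a * F a y) _ _ DK).
  cbv beta in I. rewrite P, (RInt_ext_all _ (fun a => k x a * pdu F a y - pdu k x a * F a y)), RInt_minus_c in I by (auto || intro; ring).
  unfold k in *. lra.
Qed.

Lemma pdv_conv N F : tor F -> pdv (conv N F) = conv N (pdv F).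
Proof.
  intros TF. apply pdv_unique. intros x y. unfold conv.
  assert (S : smooth2 (fun y a => cos (x - a) ^ (2 * N) * F a y)).
  { apply smooth2_mult; [smooth|]. now apply (smooth2_swap F), TF. }
  pose proof (is_derive_param _ 0 PI y S) as D.
  eapply isd_eq; [apply (isd_mult (fun _ => / wallis N)); [apply isd_const|exact D]|]. req.
  rewrite Rmult_0_l, Rplus_0_l. f_equal. apply RInt_ext_all. intro a.
  apply is_derive_unique. eapply isd_eq; [apply (isd_mult (fun _ => cos (x - a) ^ (2 * N)) (fun y => F a y)); [apply isd_const|apply smooth2_dv, TF]|].
  req; ring.
Qed.

Definition close (e : R) (f g : fn2) : Prop :=
  forall x y, Rabs (f x y - g x y) < e /\ Rabs (pdu f x y - pdu g x y) < e /\ Rabs (pdv f x y - pdv g x y) < e.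

Lemma conv_dense F e : tor F -> 0 < e -> exists N, close e (conv N F) F.
Proof.
  intros TF He.
  destruct (tor_bounded (pdu F)) as [L0 [P0 H0]]; auto with sp.
  destruct (tor_bounded (pdu (pdu F))) as [L1 [P1 H1]]; auto with sp.
  destruct (tor_bounded (pdu (pdv F))) as [L2 [P2 H2]]; auto with sp.
  (* One L serves F and both its first derivatives. With d = e / (4 L) and N >= 1 / d^2 - 1, both
     summands of the bound in [conv_close] are at most e/4. *)
  set (L := 2 * (L0 + L1 + L2 + 1)). set (d := e / (4 * L)).
  assert (d0 : 0 < d) by (apply Rdiv_lt_0_compat; unfold L; lra).
  destruct (nfloor_ex (/ (d * d))) as [N [_ HN]]; [left; apply Rinv_0_lt_compat; nra|].
  exists N. pose proof (pos_INR N).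
  assert (B : L * (d + / (d * (2 * INR N + 2))) < e).
  { assert (/ (d * (2 * INR N + 2)) <= d).
    { rewrite <- (Rinv_inv d) at 2. apply Rinv_le_contravar; [now apply Rinv_0_lt_compat|].
      assert (Hd : / d = d * / (d * d)) by (field; lra). rewrite Hd. apply Rmult_le_compat_l; lra. }
    apply Rle_lt_trans with (L * (d + d)); [apply Rmult_le_compat_l; unfold L; lra|].
    replace (L * (d + d)) with (e / 2) by (unfold d; field; unfold L; lra). lra. }
  assert (T : forall G, tor G -> (forall x y, 3 * Rabs (pdu G x y) <= 2 * L) -> forall x y, Rabs (conv N G x y - G x y) < e).
  { intros G TG HG x y. eapply Rle_lt_trans; [apply (conv_close N G L TG ltac:(unfold L; lra) HG d d0)|exact B]. }
  intros x y. rewrite pdu_conv, pdv_conv by auto. split; [|split]; apply T; auto with sp; intros; unfold L.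
  - specialize (H0 x0 y0); lra.
  - specialize (H1 x0 y0); lra.
  - specialize (H2 x0 y0); lra.
Qed.

Lemma close_trans e1 e2 f g h : close e1 f g -> close e2 g h -> close (e1 + e2) f h.
Proof.
  assert (T : forall a b c, Rabs (a - b) < e1 -> Rabs (b - c) < e2 -> Rabs (a - c) < e1 + e2).
  { intros a b c H1 H2. replace (a - c) with ((a - b) + (b - c)) by ring.
    eapply Rle_lt_trans; [apply Rabs_triang|lra]. }
  intros H1 H2 x y. destruct (H1 x y) as [A [B C]], (H2 x y) as [A' [B' C']].
  split; [|split]; eapply T; eauto.
Qed.

Lemma close_sym e f g : close e f g -> close e g f.
Proof. intros H x y; destruct (H x y) as [A [B C]]; rewrite Rabs_minus_sym in A, B, C; auto. Qed.

Lemma close_add e1 e2 f g f' g' : smooth2 f -> smooth2 g -> smooth2 f' -> smooth2 g' ->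
  close e1 f f' -> close e2 g g' -> close (e1 + e2) (fadd f g) (fadd f' g').
Proof.
  assert (T : forall a b c d, Rabs (a - b) < e1 -> Rabs (c - d) < e2 -> Rabs (a + c - (b + d)) < e1 + e2).
  { intros a b c d H1 H2. replace (a + c - (b + d)) with ((a - b) + (c - d)) by ring.
    eapply Rle_lt_trans; [apply Rabs_triang|lra]. }
  intros S1 S2 S3 S4 H1 H2 x y. destruct (H1 x y) as [A [B C]], (H2 x y) as [A' [B' C']].
  change pdu with (dd true) in *; change pdv with (dd false) in *. rewrite !dd_add by auto.
  unfold fadd. split; [|split]; apply T; auto.
Qed.

Inductive trig_poly : fn2 -> Prop :=
| trig_poly_base s m s' n c : trig_poly (fun x y => c * (trig s m x * trig s' n y))
| trig_poly_plus f g : trig_poly f -> trig_poly g -> trig_poly (fadd f g).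

Lemma trig_poly_tor f : trig_poly f -> tor f.
Proof.
  intro H; induction H as [s m s' n c|f g _ IHf _ IHg]; auto with sp.
  apply (tor_scal c (fmul (fun x _ => trig s m x) (fun _ y => trig s' n y))), tor_mul; auto using tor_trig_u, tor_trig_v.
Qed.

(** Freezing y and renaming the first variable as the second: an approximation of a coefficient q
    becomes a trigonometric polynomial in the second variable. *)
Lemma trig_poly_u_row f y s' n : trig_poly_u f -> exists g, trig_poly g /\ forall a b, g a b = trig s' n a * f b y.
Proof.
  intro H; induction H as [s m q _|f g _ [f' [Hf Ef]] _ [g' [Hg Eg]]].
  - exists (fun a b => q y * (trig s' n a * trig s m b)); split; [apply trig_poly_base|]. intros; ring.
  - exists (fadd f' g'); split; [now apply trig_poly_plus|]. intros; unfold fadd; rewrite Ef, Eg; ring.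
Qed.

Lemma trig_poly_u_pt2 f : trig_poly_u f -> forall e, 0 < e -> exists g, trig_poly g /\ close e f g.
Proof.
  intro H; induction H as [s m q Hq|f g Hf IHf Hg IHg]; intros e He.
  - set (F := fun x (_ : R) => q x).
    assert (TF : tor F).
    { destruct Hq as [Sq Pq]. split; [apply (smooth2_swap _ Sq)|]. intros x y; split; auto. apply (Pq y x). }
    (* The derivative in x multiplies the error by the frequency 2m, which this choice
       compensates. *)
    set (e' := e / (2 * INR m + 2)). pose proof (pos_INR m).
    assert (He' : 0 < e') by (apply Rdiv_lt_0_compat; lra).
    assert (Ee : e' * (2 * INR m + 2) = e) by (unfold e'; field; lra).
    destruct (conv_dense F e' TF He') as [N HN].
    destruct (trig_poly_u_row (conv N F) 0 s m (trig_poly_u_conv N F TF)) as [g [Pg Eg]].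
    exists g. split; auto. intros x y. pose proof (trig_poly_tor g Pg) as Tg.
    destruct (HN y 0) as [A [B _]].
    assert (DF : forall z, is_derive q z (pdu F z 0)) by (intro z; apply (smooth2_du F), TF).
    pose proof (fun z => smooth2_du (conv N F) (proj1 (trig_poly_u_tor _ (trig_poly_u_conv N F TF))) z 0) as DC.
    assert (E1 : pdu (fun x y => trig s m x * q y) x y = (if s then -1 else 1) * (2 * INR m) * trig (negb s) m x * q y).
    { apply is_derive_unique. eapply isd_eq; [apply (isd_mult (trig s m) (fun _ => q y)); [apply trig_derive|apply isd_const]|]. req; ring. }
    assert (E2 : pdv (fun x y => trig s m x * q y) x y = trig s m x * pdu F y 0).
    { apply is_derive_unique. eapply isd_eq; [apply (isd_mult (fun _ => trig s m x) q); [apply isd_const|apply DF]|]. req; ring. }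
    assert (E3 : pdu g x y = (if s then -1 else 1) * (2 * INR m) * trig (negb s) m x * conv N F y 0).
    { apply is_derive_unique. apply (is_derive_ext (fun x => trig s m x * conv N F y 0)); [intro; symmetry; apply Eg|].
      eapply isd_eq; [apply (isd_mult (trig s m) (fun _ => conv N F y 0)); [apply trig_derive|apply isd_const]|]. req; ring. }
    assert (E4 : pdv g x y = trig s m x * pdu (conv N F) y 0).
    { apply is_derive_unique. apply (is_derive_ext (fun y => trig s m x * conv N F y 0)); [intro; symmetry; apply Eg|].
      eapply isd_eq; [apply (isd_mult (fun _ => trig s m x) (fun y => conv N F y 0)); [apply isd_const|apply DC]|]. req; ring. }
    rewrite E1, E2, E3, E4, Eg. rewrite Rabs_minus_sym in A, B. unfold F at 1 in A.
    pose proof (trig_bound s m x) as T1. pose proof (trig_bound (negb s) m x) as T2.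
    set (d1 := Rabs (q y - conv N F y 0)) in *. set (d2 := Rabs (pdu F y 0 - pdu (conv N F) y 0)) in *.
    assert (d10 : 0 <= d1) by apply Rabs_pos. assert (d20 : 0 <= d2) by apply Rabs_pos.
    assert (mE : 0 <= INR m * e') by (apply Rmult_le_pos; lra).
    split; [|split].
    + replace (trig s m x * q y - trig s m x * conv N F y 0) with (trig s m x * (q y - conv N F y 0)) by ring.
      rewrite Rabs_mult. fold d1. pose proof (Rabs_pos (trig s m x)). nra.
    + replace ((if s then -1 else 1) * (2 * INR m) * trig (negb s) m x * q y - (if s then -1 else 1) * (2 * INR m) * trig (negb s) m x * conv N F y 0)
        with ((if s then -1 else 1) * ((2 * INR m) * (trig (negb s) m x * (q y - conv N F y 0)))) by ring.
      rewrite !Rabs_mult. fold d1. replace (Rabs (if s then -1 else 1)) with 1 by (destruct s; [rewrite Rabs_left; lra|rewrite Rabs_R1; auto]).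
      rewrite (Rabs_right 2), (Rabs_right (INR m)), Rmult_1_l by lra.
      apply Rle_lt_trans with (2 * INR m * e'); [apply Rmult_le_compat_l; [lra|]; pose proof (Rabs_pos (trig (negb s) m x)); nra|lra].
    + replace (trig s m x * pdu F y 0 - trig s m x * pdu (conv N F) y 0) with (trig s m x * (pdu F y 0 - pdu (conv N F) y 0)) by ring.
      rewrite Rabs_mult. fold d2. pose proof (Rabs_pos (trig s m x)). nra.
  - destruct (IHf (e / 2) ltac:(lra)) as [f' [Pf Cf]], (IHg (e / 2) ltac:(lra)) as [g' [Pg Cg]].
    exists (fadd f' g'); split; [now apply trig_poly_plus|]. replace e with (e / 2 + e / 2) by field.
    apply close_add; auto; first [now apply trig_poly_u_tor|now apply trig_poly_tor].
Qed.

Lemma trig_poly_dense F e : tor F -> 0 < e -> exists g, trig_poly g /\ close e F g.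
Proof.
  intros TF He. destruct (conv_dense F (e / 2) TF ltac:(lra)) as [N HN].
  destruct (trig_poly_u_pt2 _ (trig_poly_u_conv N F TF) (e / 2) ltac:(lra)) as [g [Pg Cg]].
  exists g; split; auto. replace e with (e / 2 + e / 2) by field. eapply close_trans; [apply close_sym, HN|exact Cg].
Qed.

(** * Functions invariant under the glide reflection *)

Definition glide_inv (f : fn2) : Prop := forall x y, f (x + PI / 2) (- y) = f x y.

(* The trigonometric monomials invariant under (x, y) -> (x + PI/2, -y). *)
Definition klein_basis (i : nat) : fn2 :=
  let (s, mn) := Cantor.of_nat i in let (m, n) := Cantor.of_nat mn in
  fun x y => trig (Nat.even s) m x * trig (Nat.even m) n y.

Lemma klein_basis_ex s m n : exists i, klein_basis i = fun x y => trig s m x * trig (Nat.even m) n y.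
Proof.
  exists (Cantor.to_nat (if s then 0%nat else 1%nat, Cantor.to_nat (m, n))). unfold klein_basis.
  rewrite !Cantor.cancel_of_to. destruct s; reflexivity.
Qed.

Lemma klein_basis_inv i : glide_inv (klein_basis i).
Proof.
  unfold klein_basis. destruct (Cantor.of_nat i) as [s mn], (Cantor.of_nat mn) as [m n].
  intros x y. rewrite trig_half, trig_opp. destruct (Nat.even m); ring.
Qed.

Lemma klein_eigbasis : eigbasis klein_basis.
Proof.
  split.
  - intro i. unfold klein_basis. destruct (Cantor.of_nat i) as [s mn], (Cantor.of_nat mn) as [m n].
    apply (tor_mul (fun x _ => trig _ m x) (fun _ y => trig _ n y)); auto using tor_trig_u, tor_trig_v.
  - intros i b. unfold klein_basis. destruct (Cantor.of_nat i) as [s mn], (Cantor.of_nat mn) as [m n].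
    set (s1 := Nat.even s). set (s2 := Nat.even m). clearbody s1 s2.
    exists (if b then - (2 * INR m) * (2 * INR m) else - (2 * INR n) * (2 * INR n)).
    destruct b; simpl dd.
    + rewrite (pdu_unique (fun x y : R => trig s1 m x * trig s2 n y) (fun x y => ((if s1 then -1 else 1) * (2 * INR m) * trig (negb s1) m x) * trig s2 n y)).
      * apply pdu_unique. intros x y. eapply isd_eq.
        -- apply (isd_mult (fun x => (if s1 then -1 else 1) * (2 * INR m) * trig (negb s1) m x) (fun _ => trig s2 n y)); [|apply isd_const].
           apply (isd_mult (fun _ => (if s1 then -1 else 1) * (2 * INR m))); [apply isd_const|apply trig_derive].
        -- req. unfold fscal. destruct s1; simpl; ring.
      * intros x y. eapply isd_eq; [apply (isd_mult (trig s1 m) (fun _ => trig s2 n y)); [apply trig_derive|apply isd_const]|]. req; ring.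
    + rewrite (pdv_unique (fun x y : R => trig s1 m x * trig s2 n y) (fun x y => trig s1 m x * ((if s2 then -1 else 1) * (2 * INR n) * trig (negb s2) n y))).
      * apply pdv_unique. intros x y. eapply isd_eq.
        -- apply (isd_mult (fun _ => trig s1 m x) (fun y => (if s2 then -1 else 1) * (2 * INR n) * trig (negb s2) n y)); [apply isd_const|].
           apply (isd_mult (fun _ => (if s2 then -1 else 1) * (2 * INR n))); [apply isd_const|apply trig_derive].
        -- req. unfold fscal. destruct s2; simpl; ring.
      * intros x y. eapply isd_eq; [apply (isd_mult (fun _ => trig s1 m x) (trig s2 n)); [apply isd_const|apply trig_derive]|]. req; ring.
Qed.

Definition inspan (E : nat -> fn2) (f : fn2) : Prop := exists n, span E n f.

Lemma span_add E n f g : span E n f -> span E n g -> span E n (fadd f g).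
Proof.
  intros [c ->] [d ->]. exists (fun i => 1 * c i + d i). rewrite lc_lin. apply fn2_ext; intros; unfold fadd, fscal; ring.
Qed.
Lemma inspan_add E f g : inspan E f -> inspan E g -> inspan E (fadd f g).
Proof.
  intros [n Hf] [m Hg]. exists (n + m)%nat. apply span_add; [apply (span_mono E n)|apply (span_mono E m)]; auto; lia.
Qed.
Lemma inspan_scal E c f : inspan E f -> inspan E (fscal c f).
Proof. intros [n Hf]; exists n; now apply span_scal. Qed.
Lemma inspan_basis E i : inspan E (E i).
Proof.
  exists (S i), (fun j => if Nat.eqb j i then 1 else 0). simpl. rewrite Nat.eqb_refl.
  assert (H : forall n, (n <= i)%nat -> lc E n (fun j => if Nat.eqb j i then 1 else 0) = fun _ _ => 0).
  { induction n; intro Hn; auto. simpl. rewrite IHn by lia. destruct (Nat.eqb_spec n i); [lia|].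
    apply fn2_ext; intros; unfold fadd, fscal; ring. }
  rewrite H by lia. apply fn2_ext; intros; unfold fadd, fscal; ring.
Qed.

Definition glide_pb (f : fn2) : fn2 := fun x y => f (x + PI / 2) (- y).

(** The glide acts on each monomial by a sign, so averaging keeps the invariant monomials, which are
    basis elements, and annihilates the others. *)
Lemma trig_poly_sym f : trig_poly f -> inspan klein_basis (fscal (/ 2) (fadd f (glide_pb f))).
Proof.
  intro H; induction H as [s m s' n c|f g _ IHf _ IHg].
  - destruct (klein_basis_ex s m n) as [i Hi]. destruct (Bool.bool_dec s' (Nat.even m)) as [->|N].
    + replace (fscal _ _) with (fscal c (klein_basis i)); [apply inspan_scal, inspan_basis|].
      rewrite Hi. apply fn2_ext; intros; unfold fscal, fadd, glide_pb. rewrite trig_half, trig_opp.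
      destruct (Nat.even m); field.
    + replace (fscal _ _) with (fscal 0 (klein_basis i)); [apply inspan_scal, inspan_basis|].
      apply fn2_ext; intros; unfold fscal, fadd, glide_pb. rewrite trig_half, trig_opp.
      destruct (Nat.even m), s'; try (now elim N); field.
  - replace (fscal _ _) with (fadd (fscal (/ 2) (fadd f (glide_pb f))) (fscal (/ 2) (fadd g (glide_pb g)))); [now apply inspan_add|].
    apply fn2_ext; intros; unfold fscal, fadd, glide_pb; ring.
Qed.

Lemma pdu_GG f : smooth2 f -> pdu (glide_pb f) = glide_pb (pdu f).
Proof.
  intro S. apply pdu_unique. intros x y. unfold glide_pb.
  eapply isd_eq; [apply (isd_comp (fun z => f z (- y)) (fun x => x + PI / 2)); [apply smooth2_du, S|auto_derive; auto]|]. req; ring.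
Qed.
Lemma pdv_GG f : smooth2 f -> pdv (glide_pb f) = fscal (-1) (glide_pb (pdv f)).
Proof.
  intro S. apply pdv_unique. intros x y. unfold glide_pb, fscal.
  eapply isd_eq; [apply (isd_comp (fun z => f (x + PI / 2) z) (fun y => - y)); [apply smooth2_dv, S|auto_derive; auto]|]. req; ring.
Qed.

Lemma glide_pb_id f : glide_inv f -> glide_pb f = f.
Proof. intro H; apply fn2_ext; intros; apply H. Qed.

(** Averaging over the glide fixes F and does not increase the distance to it, also for the
    derivatives; d/dy changes sign under the glide. *)
Theorem klein_dense F e : tor F -> glide_inv F -> 0 < e -> exists v, inspan klein_basis v /\ close e v F.
Proof.
  intros TF IF He. destruct (trig_poly_dense F e TF He) as [g [Pg Cg]].
  exists (fscal (/ 2) (fadd g (glide_pb g))). split; [now apply trig_poly_sym|].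
  pose proof (trig_poly_tor g Pg) as [Sg _]. destruct TF as [SF _].
  assert (F1 : glide_pb (pdu F) = pdu F) by (rewrite <- pdu_GG, glide_pb_id; auto).
  assert (F2 : fscal (-1) (glide_pb (pdv F)) = pdv F) by (rewrite <- pdv_GG, glide_pb_id; auto).
  assert (D1 : pdu (fscal (/ 2) (fadd g (glide_pb g))) = fscal (/ 2) (fadd (pdu g) (glide_pb (pdu g)))).
  { apply pdu_unique; intros x y. unfold fscal, fadd.
    eapply isd_eq; [apply (isd_mult (fun _ => / 2)); [apply isd_const|apply (isd_plus (fun z => g z y) (fun z => glide_pb g z y)); [now apply smooth2_du|]]|].
    - unfold glide_pb. eapply isd_eq; [apply (isd_comp (fun z => g z (- y)) (fun x => x + PI / 2)); [apply smooth2_du, Sg|auto_derive; auto]|]. req; reflexivity.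
    - req. unfold glide_pb. ring. }
  assert (D2 : pdv (fscal (/ 2) (fadd g (glide_pb g))) = fscal (/ 2) (fadd (pdv g) (fscal (-1) (glide_pb (pdv g))))).
  { apply pdv_unique; intros x y. unfold fscal, fadd.
    eapply isd_eq; [apply (isd_mult (fun _ => / 2)); [apply isd_const|apply (isd_plus (fun z => g x z) (fun z => glide_pb g x z)); [now apply smooth2_dv|]]|].
    - unfold glide_pb. eapply isd_eq; [apply (isd_comp (fun z => g (x + PI / 2) z) (fun y => - y)); [apply smooth2_dv, Sg|auto_derive; auto]|]. req; reflexivity.
    - req. unfold glide_pb. ring. }
  assert (T : forall a b a' b', Rabs (a - a') < e -> Rabs (b - b') < e -> Rabs (/ 2 * (a' + b') - / 2 * (a + b)) < e).
  { intros a b a' b' H1 H2. apply Rabs_def2 in H1, H2. apply Rabs_def1; lra. }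
  intros x y. rewrite D1, D2. destruct (Cg x y) as [A [B C]], (Cg (x + PI / 2) (- y)) as [A' [B' C']].
  pose proof (IF x y) as I0. pose proof (f_equal (fun h => h x y) F1) as I1. pose proof (f_equal (fun h => h x y) F2) as I2.
  unfold fscal, fadd, glide_pb in *. cbv beta in I1, I2. split; [|split].
  - replace (F x y) with (/ 2 * (F x y + F (x + PI / 2) (- y))) by (rewrite I0; field). apply T; auto.
  - replace (pdu F x y) with (/ 2 * (pdu F x y + pdu F (x + PI / 2) (- y))) by (rewrite I1; field). apply T; auto.
  - replace (pdv F x y) with (/ 2 * (pdv F x y + -1 * pdv F (x + PI / 2) (- y))) by (rewrite I2; field). apply T; auto.
    replace (-1 * pdv F (x + PI / 2) (- y) - -1 * pdv g (x + PI / 2) (- y)) with (- (pdv F (x + PI / 2) (- y) - pdv g (x + PI / 2) (- y))) by ring.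
    now rewrite Rabs_Ropp.
Qed.

(** The glide reverses y, so the coefficient [kb] coupling the two derivatives changes sign while
    the other three are invariant. *)
Definition glide_sym (k : coeffs) : Prop :=
  glide_inv (ka k) /\ glide_pb (kb k) = fscal (-1) (kb k) /\ glide_inv (kc k) /\ glide_inv (kr k).

Lemma inspan_tor E v : eigbasis E -> inspan E v -> tor v.
Proof. intros HE [n Hn]. eapply lc_tor'; eauto. Qed.

Lemma klein_dense_seq F : tor F -> glide_inv F -> exists v, (forall n, inspan klein_basis (v n)) /\
  ucv v F /\ ucv (fun n => pdu (v n)) (pdu F) /\ ucv (fun n => pdv (v n)) (pdv F).
Proof.
  intros TF IF.
  assert (H : forall n : nat, exists v, inspan klein_basis v /\ close (/ (INR n + 1)) v F).
  { intro n. apply klein_dense; auto. apply Rinv_0_lt_compat. pose proof (pos_INR n); lra. }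
  destruct (functional_choice _ H) as [v Hv]. exists v. split; [intro; apply Hv|].
  assert (K : forall e, 0 < e -> exists N, forall n, (N <= n)%nat -> / (INR n + 1) < e).
  { intros e He. destruct (nfloor_ex (/ e)) as [N HN]; [left; now apply Rinv_0_lt_compat|].
    exists N. intros n Hn. rewrite <- (Rinv_inv e). apply Rinv_lt_contravar.
    - apply Rmult_lt_0_compat; [now apply Rinv_0_lt_compat|pose proof (pos_INR n); lra].
    - apply le_INR in Hn; lra. }
  repeat split; intros e He; destruct (K e He) as [N HN]; exists N; intros n Hn x y; specialize (HN n Hn);
    destruct (proj2 (Hv n) x y) as [A [B C]]; lra.
Qed.

Lemma lim_pos_eventually s l : is_lim_seq s (Finite l) -> l < 0 -> exists n : nat, s n < 0.
Proof.
  intros H Hl. apply is_lim_seq_spec in H. destruct (H (mkposreal (- l) ltac:(lra))) as [N HN].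
  exists N. specialize (HN N (Nat.le_refl N)). simpl in HN. apply Rabs_def2 in HN; lra.
Qed.

Lemma flux_GG k U : elliptic k -> glide_sym k -> tor U -> glide_inv U ->
  glide_pb (flux k true U) = flux k true U /\ glide_pb (flux k false U) = fscal (-1) (flux k false U).
Proof.
  intros Hk [Ia [Ib [Ic Ir]]] TU IU. destruct TU as [SU _].
  assert (F1 : glide_pb (pdu U) = pdu U) by (rewrite <- pdu_GG, glide_pb_id; auto).
  assert (F2 : fscal (-1) (glide_pb (pdv U)) = pdv U) by (rewrite <- pdv_GG, glide_pb_id; auto).
  split; apply fn2_ext; intros x y; unfold flux, fadd, fmul, glide_pb, fscal;
   pose proof (f_equal (fun h => h x y) F1) as E1; pose proof (f_equal (fun h => h x y) F2) as E2;
   pose proof (f_equal (fun h => h x y) Ib) as E3; unfold glide_pb, fscal in E1, E2, E3; cbv beta in E1, E2, E3;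
   rewrite E1, E3, <- ?E2, ?(Ia x y), ?(Ic x y); ring.
Qed.

Lemma constant_of_partials f : smooth2 f -> (forall x y, pdu f x y = 0) -> (forall x y, pdv f x y = 0) ->
  forall x y, f x y = f 0 0.
Proof.
  intros S Hu Hv x y.
  pose proof (lipschitz_of_derive (fun z => f z y) _ 0 (fun z => smooth2_du f S z y)) as L1.
  pose proof (lipschitz_of_derive (fun z => f 0 z) _ 0 (fun z => smooth2_dv f S 0 z)) as L2.
  specialize (L1 ltac:(intro; cbv beta; rewrite Hu, Rabs_R0; lra) x 0).
  specialize (L2 ltac:(intro; cbv beta; rewrite Hv, Rabs_R0; lra) y 0).
  rewrite Rmult_0_l in L1, L2. apply Rabs_le_between in L1, L2. lra.
Qed.

(** Approximating F by the span keeps the strict inequality, since the means of the approximants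
    tend to 0 and [Cov] tends to [Mf]; this starts the Galerkin method. Positivity of mu follows
    because mean zero and mass one exclude constants. *)
Theorem flat_eigenfunction k F l : elliptic k -> glide_sym k -> tor F -> glide_inv F ->
  mean k F = 0 -> Bf k F F < l * Mf k F F ->
  exists mu U, 0 < mu <= l /\ tor U /\ glide_inv U /\ (exists x y, U x y <> 0) /\
    forall x y, pdu (flux k true U) x y + pdv (flux k false U) x y = - (mu * kr k x y * U x y).
Proof.
  intros Hk Hs TF IF M0 HF. pose proof klein_eigbasis as HE.
  destruct (klein_dense_seq F TF IF) as [v [Sv [V0 [V1 V2]]]].
  assert (Tv : forall n, tor (v n)) by (intro n; eapply inspan_tor; eauto).
  pose proof Hk as [[TA [TB [TC TR]]] Hpos].
  assert (LB : is_lim_seq (fun n => Bf k (v n) (v n)) (Bf k F F)).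
  { apply ucv_I2; auto 10 with sp.
    apply ucv_add; apply ucv_mul; auto with sp; simpl; apply ucv_add; apply ucv_mul; auto with sp; apply ucv_const. }
  assert (LM : is_lim_seq (fun n => Mf k (v n) (v n)) (Mf k F F)).
  { apply ucv_I2; auto 10 with sp. apply ucv_mul; auto with sp; [apply ucv_const|]. apply ucv_mul; auto. }
  assert (Lm : is_lim_seq (fun n => mean k (v n)) 0).
  { rewrite <- M0. apply ucv_I2; auto 10 with sp. apply ucv_mul; auto with sp; [apply ucv_const|].
    apply ucv_mul; auto with sp. apply ucv_const. }
  assert (LC : is_lim_seq (fun n => Bf k (v n) (v n) - l * (Mf k (v n) (v n) - mean k (v n) * mean k (v n) * / mass k))
     (Bf k F F - l * (Mf k F F - 0 * 0 * / mass k))).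
  { apply is_lim_seq_minus'; auto. apply (is_lim_seq_mult' (fun _ => l)); [apply is_lim_seq_const|].
    apply is_lim_seq_minus'; auto. apply (is_lim_seq_mult' _ (fun _ => / mass k)); [|apply is_lim_seq_const].
    now apply is_lim_seq_mult'. }
  destruct (lim_pos_eventually _ _ LC) as [n Hn]; [lra|].
  destruct (Sv n) as [N SN].
  destruct (galerkin_limit k klein_basis l N Hk HE) as [mu [U [Hmu [TU [MU [mU [BU [EU PU]]]]]]]].
  { intros m Hm. apply (galerkin_exists k klein_basis l m (v n)); auto; [apply HE|now apply (span_mono _ N)|].
    unfold Cov. unfold Rdiv. lra. }
  assert (IU : glide_inv U) by (intros x y; apply PU; intro; apply klein_basis_inv).
  (* The residual of the strong equation. It has the symmetry of the basis and is orthogonal to its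
     span, so approximating it by that span shows that it is orthogonal to itself. *)
  set (rs := fadd (fadd (pdu (flux k true U)) (pdv (flux k false U))) (fscal mu (fmul (kr k) U))).
  assert (TR' : tor rs) by (unfold rs; auto 10 with sp).
  assert (IR : glide_inv rs).
  { destruct (flux_GG k U Hk Hs TU IU) as [G1 G2].
    assert (H1 : glide_pb (pdu (flux k true U)) = pdu (flux k true U)).
    { rewrite <- pdu_GG, G1; auto. apply (tor_flux k true U Hk TU). }
    assert (H2 : glide_pb (pdv (flux k false U)) = pdv (flux k false U)).
    { pose proof (pdv_GG (flux k false U) (proj1 (tor_flux k false U Hk TU))) as Q. rewrite G2 in Q.
      change pdv with (dd false) in *. rewrite dd_scal in Q by apply (tor_flux k false U Hk TU).
      apply fn2_ext; intros x y. pose proof (f_equal (fun h => h x y) Q) as Q'. unfold fscal in Q'. cbv beta in Q'. lra. }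
    intros x y. unfold rs, fadd, fscal, fmul. rewrite (IU x y). destruct Hs as [_ [_ [_ Ir]]]. rewrite (Ir x y).
    pose proof (f_equal (fun h => h x y) H1) as H1'. pose proof (f_equal (fun h => h x y) H2) as H2'.
    unfold glide_pb in H1', H2'. cbv beta in H1', H2'. rewrite H1', H2'. reflexivity. }
  assert (OR : forall w, inspan klein_basis w -> I2 (fmul rs w) = 0).
  { intros w [m Sw]. pose proof (lc_tor' _ _ _ HE Sw) as Tw. pose proof (EU m w Tw Sw) as E.
    assert (E2 : I2 (fmul rs w) = I2 (fmul (pdu (flux k true U)) w) + I2 (fmul (pdv (flux k false U)) w) + mu * Mf k U w).
    { unfold Mf. rewrite <- I2_fscal, <- !I2_fadd by auto 10 with sp. apply I2_ext; intros; unfold rs, fadd, fmul, fscal; ring. }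
    rewrite E2. change (pdu (flux k true U)) with (dd true (flux k true U)). change (pdv (flux k false U)) with (dd false (flux k false U)).
    rewrite !ibp by auto with sp. rewrite <- E. unfold Bf. rewrite I2_fadd by auto with sp. simpl; ring. }
  assert (R0 : forall x y, rs x y = 0).
  { apply N2_zero; auto. destruct (klein_dense_seq rs TR' IR) as [w [Sw [W0 _]]].
    assert (Tw : forall n, tor (w n)) by (intro; eapply inspan_tor; eauto).
    assert (L : is_lim_seq (fun n => I2 (fmul rs (w n))) (N2 rs)).
    { apply ucv_I2; auto with sp. apply ucv_mul; auto. apply ucv_const. }
    apply (is_lim_seq_ext _ (fun _ => 0)) in L; [|intro; apply OR, Sw].
    apply is_lim_seq_unique in L. rewrite Lim_seq_const in L. now injection L. }
  exists mu, U. split; [|split; [auto|split; [auto|split]]].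
  - split; [|apply Hmu]. destruct (Rle_lt_or_eq_dec 0 mu (proj1 Hmu)) as [|Z]; auto. exfalso.
    destruct (Bf_coercive k Hk) as [q [q0 Hq]]. specialize (Hq U TU). rewrite BU, <- Z in Hq.
    pose proof (N2_ge0 (pdu U) ltac:(auto with sp)). pose proof (N2_ge0 (pdv U) ltac:(auto with sp)).
    assert (N2 (pdu U) = 0 /\ N2 (pdv U) = 0) as [Z1 Z2] by (split; nra).
    pose proof (constant_of_partials U (proj1 TU) (N2_zero (pdu U) ltac:(auto with sp) Z1) (N2_zero (pdv U) ltac:(auto with sp) Z2)) as C.
    assert (EC : U = fun _ _ => U 0 0) by (apply fn2_ext; apply C).
    rewrite EC, mean_const in mU by auto. pose proof (mass_pos k Hk).
    assert (U00 : U 0 0 = 0) by (apply Rmult_integral in mU as [|]; lra).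
    unfold Mf in MU. rewrite (I2_ext _ (fun _ _ => 0)), I2_const in MU; [lra|].
    intros; unfold fmul. rewrite C, U00. ring.
  - apply NNPP; intro N0. assert (Z : forall x y, U x y = 0).
    { intros x y; apply NNPP; intro; apply N0; eauto. }
    unfold Mf in MU. rewrite (I2_ext _ (fun _ _ => 0)), I2_const in MU; [lra|]. intros; unfold fmul; rewrite Z; ring.
  - intros x y. specialize (R0 x y). unfold rs, fadd, fscal, fmul in R0. lra.
Qed.

(** * The Klein bottle as a quotient of the flat torus *)

Definition ww (v : R) : R := 1 + 8 * cos v ^ 2.

Lemma ww_pos v : 0 < ww v.
Proof. apply w_pos. Qed.
Lemma ww_ge1 v : 1 <= ww v.
Proof. unfold ww; nra. Qed.
Lemma ww_le9 v : ww v <= 9.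
Proof. unfold ww. pose proof (COS_bound v). nra. Qed.
Lemma sin_sq v : sin v * sin v = 1 - cos v * cos v.
Proof. pose proof (sin2_cos2 v) as H; unfold Rsqr in H; lra. Qed.

Lemma smooth2_ww : smooth2 (fun _ v => ww v).
Proof. unfold ww; smooth. Qed.

Lemma sqrt_ww v : sqrt (ww v) * sqrt (ww v) = ww v /\ 0 < sqrt (ww v).
Proof. pose proof (ww_pos v). split; [apply sqrt_sqrt; lra|now apply sqrt_lt_R0]. Qed.

Lemma sqrt_ww_derive v : is_derive (fun v => sqrt (ww v)) v (-8 * cos v * sin v / sqrt (ww v)).
Proof.
  pose proof (ww_pos v). destruct (sqrt_ww v). unfold ww in *. auto_derive; [simpl in *; lra|].
  simpl in *. field. lra.
Qed.

Section Sigma.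
Variable sigma : R -> R.
Hypothesis Hs : klein_involution sigma.

Lemma sigma_cos v : cos (sigma v) = sin v / sqrt (ww v).
Proof. apply Hs. Qed.
Lemma sigma_sin v : sin (sigma v) = 3 * cos v / sqrt (ww v).
Proof. apply Hs. Qed.
Lemma sigma_sigma v : sigma (sigma v) = v.
Proof. apply Hs. Qed.
Lemma sigma_dec v w : v < w -> sigma w < sigma v.
Proof. apply Hs. Qed.
Lemma sigma_0 : sigma 0 = PI / 2.
Proof. apply Hs. Qed.

Lemma sigma_ww v : ww (sigma v) = 9 / ww v.
Proof.
  unfold ww at 1. rewrite sigma_cos. destruct (sqrt_ww v) as [E P]. pose proof (ww_pos v).
  replace ((sin v / sqrt (ww v)) ^ 2) with (sin v * sin v / (sqrt (ww v) * sqrt (ww v))) by (field; lra).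
  rewrite E, sin_sq. unfold ww in *. field. simpl in *; lra.
Qed.

Lemma sigma_derive v : is_derive sigma v (- (3 / ww v)).
Proof.
  assert (Ex : ex_derive sigma v) by apply (proj1 Hs 1%nat v).
  pose proof (Derive_correct _ _ Ex) as D.
  destruct (sqrt_ww v) as [E P]. pose proof (ww_pos v) as W. pose proof (sqrt_ww_derive v) as DW.
  assert (D1 : is_derive (fun v => cos (sigma v)) v (9 * cos v / (ww v * sqrt (ww v)))).
  { apply (is_derive_ext (fun v => sin v / sqrt (ww v))); [intro; symmetry; apply sigma_cos|].
    eapply isd_eq.
    - apply (is_derive_div sin (fun v => sqrt (ww v))); [apply is_derive_sin|exact DW|lra].
    - req. unfold ww in *. simpl in *. set (q := sqrt (1 + 8 * (cos v * (cos v * 1)))) in *.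
      rewrite <- E.
      transitivity ((cos v * (q * q) + 8 * cos v * (sin v * sin v)) / (q * q * q)); [field; lra|].
      rewrite sin_sq, E. field. split; lra. }
  assert (D2 : is_derive (fun v => sin (sigma v)) v (- (3 * sin v) / (ww v * sqrt (ww v)))).
  { apply (is_derive_ext (fun v => (3 * cos v) / sqrt (ww v))); [intro; symmetry; apply sigma_sin|].
    eapply isd_eq.
    - apply (is_derive_div (fun v => 3 * cos v) (fun v => sqrt (ww v))).
      + apply (isd_mult (fun _ => 3) cos); [apply isd_const|apply is_derive_cos].
      + exact DW.
      + lra.
    - req. unfold ww in *. simpl in *. set (q := sqrt (1 + 8 * (cos v * (cos v * 1)))) in *.
      rewrite <- E.
      transitivity ((- 3 * sin v * (q * q) + 24 * cos v * cos v * sin v) / (q * q * q)); [field; lra|].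
      rewrite E. field. split; lra. }
  assert (D3 : is_derive (fun v => cos (sigma v)) v (- sin (sigma v) * Derive sigma v)).
  { apply (isd_comp cos sigma); [apply is_derive_cos|exact D]. }
  assert (D4 : is_derive (fun v => sin (sigma v)) v (cos (sigma v) * Derive sigma v)).
  { apply (isd_comp sin sigma); [apply is_derive_sin|exact D]. }
  apply is_derive_unique in D1, D2, D3, D4. rewrite D1 in D3. rewrite D2 in D4.
  pose proof (sin2_cos2 (sigma v)) as SC. unfold Rsqr in SC.
  replace (- (3 / ww v)) with (Derive sigma v); [exact D|].
  (* Combining the derivatives of cos (sigma v) and sin (sigma v) isolates sigma' without dividing
     by either of them. *)
  transitivity (cos (sigma v) * (cos (sigma v) * Derive sigma v) - sin (sigma v) * (- sin (sigma v) * Derive sigma v)).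
  - transitivity (Derive sigma v * (sin (sigma v) * sin (sigma v) + cos (sigma v) * cos (sigma v))); [rewrite SC; ring|ring].
  - rewrite <- D4, <- D3, sigma_cos, sigma_sin. set (q := sqrt (ww v)) in *.
    transitivity (- 3 * (sin v * sin v + 9 * cos v * cos v) / (ww v * (q * q))); [field; lra|].
    rewrite E, sin_sq. replace (1 - cos v * cos v + 9 * cos v * cos v) with (ww v) by (unfold ww; ring). field; lra.
Qed.

Lemma const_of_derive0 (f : R -> R) : (forall x, is_derive f x 0) -> forall x y, f x = f y.
Proof.
  intros H x y. pose proof (lipschitz_of_derive f (fun _ => 0) 0 H ltac:(intro; cbv beta; rewrite Rabs_R0; lra) x y) as L.
  rewrite Rmult_0_l in L. apply Rabs_le_between in L; lra.
Qed.

Lemma ww_per v : ww (v + PI) = ww v.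
Proof. unfold ww. rewrite neg_cos. f_equal. ring. Qed.

Lemma sigma_half : sigma (PI / 2) = 0.
Proof. rewrite <- sigma_0. apply sigma_sigma. Qed.

Lemma sigma_per v : sigma (v + PI) = sigma v - PI.
Proof.
  assert (E1 : sigma (v + PI) - sigma v = sigma (0 + PI) - sigma 0).
  { apply (const_of_derive0 (fun v => sigma (v + PI) - sigma v)). intro x.
    eapply isd_eq; [apply (is_derive_minus (V := R_NormedModule) (fun v => sigma (v + PI)) sigma)|].
    - apply (isd_comp sigma (fun v => v + PI)); [apply sigma_derive|auto_derive; auto].
    - apply sigma_derive.
    - unfold minus, plus, opp; simpl. rewrite ww_per. ring. }
  (* The derivative of sigma is PI-periodic and even about PI/2. Periodicity gives a constant
     increment, and the symmetry about PI/2 with sigma (PI/2) = 0 gives sigma PI = - PI/2 and so its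
     value - PI. *)
  assert (E2 : sigma (PI / 2 + PI / 2) + sigma (PI / 2 - PI / 2) = sigma (PI / 2 + 0) + sigma (PI / 2 - 0)).
  { apply (const_of_derive0 (fun v => sigma (PI / 2 + v) + sigma (PI / 2 - v))). intro x.
    eapply isd_eq; [apply (isd_plus (fun v => sigma (PI / 2 + v)) (fun v => sigma (PI / 2 - v)))|].
    - apply (isd_comp sigma (fun v => PI / 2 + v)); [apply sigma_derive|auto_derive; auto].
    - apply (isd_comp sigma (fun v => PI / 2 - v)); [apply sigma_derive|auto_derive; auto].
    - req. replace (ww (PI / 2 - x)) with (ww (PI / 2 + x)); [ring|].
      unfold ww. rewrite cos_shift, cos_plus, cos_PI2, sin_PI2. ring. }
  replace (PI / 2 + PI / 2) with PI in E2 by field. replace (PI / 2 - PI / 2) with 0 in E2 by field.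
  rewrite Rplus_0_r, Rminus_0_r, sigma_half, sigma_0 in E2. rewrite Rplus_0_l, sigma_0 in E1. lra.
Qed.

(* A coordinate in which the involution sigma becomes y -> -y. *)
Definition kk (v : R) : R := (v - sigma v) / 2.
Definition kk' (v : R) : R := (1 + 3 / ww v) / 2.

Lemma kk_derive v : is_derive kk v (kk' v).
Proof.
  unfold kk, kk'. eapply isd_eq.
  - apply (isd_mult (fun v => v - sigma v) (fun _ => / 2)); [|apply isd_const].
    apply (is_derive_minus (V := R_NormedModule) (fun v => v) sigma); [apply isd_id|apply sigma_derive].
  - req. unfold minus, plus, opp; simpl. field. pose proof (ww_pos v); lra.
Qed.

Lemma kk'_ge v : / 2 <= kk' v.
Proof.
  unfold kk'. pose proof (ww_pos v). assert (0 < 3 / ww v) by (apply Rdiv_lt_0_compat; lra). lra.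
Qed.

Lemma kk_sigma v : kk (sigma v) = - kk v.
Proof. unfold kk. rewrite sigma_sigma. field. Qed.
Lemma kk_per v : kk (v + PI) = kk v + PI.
Proof. unfold kk. rewrite sigma_per. field. Qed.

Lemma kk_expand v w : v <= w -> (w - v) / 2 <= kk w - kk v.
Proof.
  intro H. destruct (MVT_gen kk v w kk') as [c [_ ->]].
  - intros; apply kk_derive.
  - intros z _. apply continuity_pt_filterlim, (ex_derive_continuous (V := R_NormedModule)). eexists; apply kk_derive.
  - pose proof (kk'_ge c). nra.
Qed.

Lemma kk_inv : exists h, (forall y, kk (h y) = y) /\ (forall v, h (kk v) = v).
Proof.
  assert (Ck : forall z, continuity_pt kk z).
  { intros z. apply continuity_pt_filterlim, (ex_derive_continuous (V := R_NormedModule)). eexists; apply kk_derive. }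
  assert (S : forall y, exists v, kk v = y).
  { intro y. set (M := 2 * (Rabs (y - kk 0) + 1)).
    assert (M0 : 0 < M) by (unfold M; pose proof (Rabs_pos (y - kk 0)); lra).
    pose proof (kk_expand 0 M ltac:(lra)) as H1. pose proof (kk_expand (- M) 0 ltac:(lra)) as H2.
    assert (B : Rabs (y - kk 0) <= M / 2 - 1) by (unfold M; lra). apply Rabs_le_between in B.
    destruct (IVT_gen kk (- M) M y Ck) as [x [_ Hx]].
    - unfold Rmin, Rmax. destruct (Rle_dec (kk (- M)) (kk M)); lra.
    - now exists x. }
  destruct (functional_choice _ S) as [h Hh]. exists h. split; auto. intro v.
  assert (E : kk (h (kk v)) = kk v) by apply Hh.
  destruct (Rle_dec v (h (kk v))) as [L|L].
  - pose proof (kk_expand _ _ L); lra.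
  - pose proof (kk_expand (h (kk v)) v ltac:(lra)); lra.
Qed.

End Sigma.

Lemma RInt_shift (f : R -> R) c : cont f -> (forall x, f (x + PI) = f x) -> RInt f c (c + PI) = RInt f 0 PI.
Proof.
  intros Cf Pf.
  rewrite <- (RInt_Chasles (V := R_CompleteNormedModule) f c 0 (c + PI)) by now apply cont_ex_RInt.
  rewrite <- (RInt_Chasles (V := R_CompleteNormedModule) f 0 PI (c + PI)) by now apply cont_ex_RInt.
  assert (E : RInt f PI (c + PI) = RInt f 0 c).
  { pose proof (RInt_comp_lin (V := R_CompleteNormedModule) f 1 PI 0 c) as H.
    replace (1 * 0 + PI) with PI in H by ring. replace (1 * c + PI) with (c + PI) in H by ring.
    rewrite <- H by now apply cont_ex_RInt. apply RInt_ext_all; intro x. unfold scal; simpl; unfold mult; simpl.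
    rewrite !Rmult_1_l. apply Pf. }
  rewrite E. rewrite <- (opp_RInt_swap (V := R_CompleteNormedModule) f c 0) by now apply cont_ex_RInt.
  unfold plus, opp; simpl. ring.
Qed.

Lemma cont2_comp_v f (h : R -> R) : cont2 f -> cont h -> cont2 (fun x y => f x (h y)).
Proof.
  intros Cf Ch x y e. destruct (Cf x (h y) e) as [d Hd].
  destruct (proj1 (continuity_pt_locally h y) (proj2 (continuity_pt_filterlim h y) (Ch y)) d) as [d' Hd'].
  exists (mkposreal (Rmin d d') (Rmin_stable_in_posreal d d')). simpl. intros u v Hu Hv. apply Hd.
  - eapply Rlt_le_trans; [apply Hu|apply Rmin_l].
  - apply Hd'. unfold ball; simpl; unfold AbsRing_ball, abs, minus, plus, opp; simpl.
    eapply Rlt_le_trans; [apply Hv|apply Rmin_r].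
Qed.

Lemma kk'_derive v : is_derive kk' v (24 * cos v * sin v / (ww v * ww v)).
Proof.
  pose proof (ww_pos v). unfold kk', ww in *. simpl in *. auto_derive; [lra|]. field. lra.
Qed.
Lemma kk''_bound v : Rabs (24 * cos v * sin v / (ww v * ww v)) <= 24.
Proof.
  pose proof (ww_ge1 v). unfold Rdiv. rewrite !Rabs_mult, Rabs_inv.
  rewrite (Rabs_right 24), (Rabs_right (ww v * ww v)) by nra.
  assert (0 < / (ww v * ww v) <= 1).
  { split; [apply Rinv_0_lt_compat; nra|]. rewrite <- Rinv_1. apply Rinv_le_contravar; nra. }
  assert (Rabs (cos v) <= 1) by (apply Rabs_le, COS_bound). assert (Rabs (sin v) <= 1) by (apply Rabs_le, SIN_bound).
  pose proof (Rabs_pos (cos v)). pose proof (Rabs_pos (sin v)).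
  assert (0 <= Rabs (cos v) * Rabs (sin v) <= 1) by nra.
  replace (24 * Rabs (cos v) * Rabs (sin v) * / (ww v * ww v)) with (24 * ((Rabs (cos v) * Rabs (sin v)) * / (ww v * ww v))) by ring.
  nra.
Qed.
Lemma smooth2_kk' : smooth2 (fun _ v => kk' v).
Proof. unfold kk'; smooth; try apply smooth2_ww; intros _ v; pose proof (ww_pos v); lra. Qed.
Lemma kk'_pos v : 0 < kk' v.
Proof. pose proof (kk'_ge v); lra. Qed.

Section Transport.
Variable sigma : R -> R.
Hypothesis Hs : klein_involution sigma.
Variable h : R -> R.
Hypothesis Hkh : forall y, kk sigma (h y) = y.
Hypothesis Hhk : forall v, h (kk sigma v) = v.
Local Notation k := (kk sigma).

Lemma h_derive y : is_derive h y (/ kk' (h y)).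
Proof.
  (* 192 = 2 * 24 * 4: a bound for 1/[kk'], a bound for the second derivative of [kk], and the
     square of the Lipschitz constant 2 of h. *)
  apply (is_derive_of_taylor _ _ _ 192). intro z.
  assert (L : Rabs (h z - h y) <= 2 * Rabs (z - y)).
  { rewrite <- (Hkh z), <- (Hkh y) at 2. destruct (Rle_dec (h y) (h z)) as [H|H].
    - pose proof (kk_expand sigma Hs _ _ H). rewrite !Rabs_right; lra.
    - pose proof (kk_expand sigma Hs (h z) (h y) ltac:(lra)). rewrite !Rabs_left1; lra. }
  pose proof (taylor1 k kk' _ 24 (kk_derive sigma Hs) kk'_derive kk''_bound (h y) (h z)) as T.
  rewrite !Hkh in T. pose proof (kk'_ge (h y)) as G.
  set (d := h z - h y) in *. set (q := kk' (h y)) in *.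
  replace (d - / q * (z - y)) with (- (/ q * (z - y - q * d))) by (field; lra).
  rewrite Rabs_Ropp, Rabs_mult, (Rabs_right (/ q)) by (left; apply Rinv_0_lt_compat; lra).
  assert (Q : / q <= 2) by (rewrite <- (Rinv_inv 2); apply Rinv_le_contravar; lra).
  assert (Q0 : 0 < / q) by (apply Rinv_0_lt_compat; lra).
  pose proof (Rabs_pos (z - y)). pose proof (Rabs_pos d). pose proof (Rabs_pos (z - y - q * d)).
  assert (Rabs d * Rabs d <= 4 * (Rabs (z - y) * Rabs (z - y))) by nra.
  apply Rle_trans with (2 * Rabs (z - y - q * d)); [now apply Rmult_le_compat_r|]. lra.
Qed.

Lemma h_cont : cont h.
Proof. apply cont_derive. intro; eexists; apply h_derive. Qed.
Lemma k_cont : cont k.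
Proof. apply cont_derive. intro; eexists; now apply kk_derive. Qed.

Lemma h_per y : h (y + PI) = h y + PI.
Proof. rewrite <- (Hkh y) at 1. rewrite <- kk_per by auto. apply Hhk. Qed.
Lemma h_opp y : h (- y) = sigma (h y).
Proof. rewrite <- (Hkh y) at 1. rewrite <- kk_sigma by auto. apply Hhk. Qed.

(** [pb] writes a function of (u, v) in the flat coordinates, and [pf] goes back. *)
Definition pb (f : fn2) : fn2 := fun x y => f x (h y).
Definition pf (f : fn2) : fn2 := fun x y => f x (k y).

Lemma pdu_pb f : smooth2 f -> pdu (pb f) = pb (pdu f).
Proof. intro S; apply pdu_unique. intros x y. exact (smooth2_du f S x (h y)). Qed.
Lemma pdv_pb f : smooth2 f -> pdv (pb f) = pb (fun u v => pdv f u v / kk' v).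
Proof.
  intro S; apply pdv_unique. intros x y. unfold pb.
  apply (isd_comp (fun z => f x z) h); [now apply smooth2_dv|apply h_derive].
Qed.

(** The class of all [pb f] is closed under both derivatives, d/dy becoming [pdv] divided by [kk'];
    only the first derivative of h enters. *)
Lemma smooth2_pb f : smooth2 f -> smooth2 (pb f).
Proof.
  intro Sf. apply (smooth2_coind (fun g => exists f, smooth2 f /\ g = pb f)); [|now exists f].
  clear f Sf; intros g [f [Sf ->]]. split; [|split].
  - apply (cont2_comp_v f h); [now apply smooth2_cont|apply h_cont].
  - intros [|] x y; simpl; eexists; [exact (smooth2_du f Sf x (h y))|].
    apply (isd_comp (fun z => f x z) h); [now apply smooth2_dv|apply h_derive].
  - intros [|]; simpl.
    + exists (pdu f); split; [smooth|now apply pdu_pb].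
    + exists (fun u v => pdv f u v / kk' v); split; [|now apply pdv_pb]. smooth; [apply smooth2_kk'|].
      intros _ v; pose proof (kk'_pos v); lra.
Qed.

Lemma pdu_pf f : smooth2 f -> pdu (pf f) = pf (pdu f).
Proof. intro S; apply pdu_unique. intros x y. exact (smooth2_du f S x (k y)). Qed.
Lemma pdv_pf' f : smooth2 f -> forall x y, is_derive (fun z => pf f x z) y (pdv f x (k y) * kk' y).
Proof.
  intros S x y. apply (isd_comp (fun z => f x z) k); [now apply smooth2_dv|now apply kk_derive].
Qed.

Lemma smooth2_pf f : smooth2 f -> smooth2 (pf f).
Proof.
  intro Sf. apply (smooth2_coind (fun g => exists f, smooth2 f /\ g = pf f)); [|now exists f].
  clear f Sf; intros g [f [Sf ->]]. split; [|split].
  - apply (cont2_comp_v f k); [now apply smooth2_cont|apply k_cont].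
  - intros [|] x y; simpl; eexists; [exact (smooth2_du f Sf x (k y))|now apply pdv_pf'].
  - intros [|]; simpl.
    + exists (pdu f); split; [smooth|now apply pdu_pf].
    + exists (fun u v => pdv f u v * kk' (h v)); split.
      * smooth. apply (smooth2_pb (fun _ v => kk' v)), smooth2_kk'.
      * apply pdv_unique. intros x y. unfold pf. rewrite Hhk. now apply pdv_pf'.
Qed.

(** The substitution v = h(y), with dv = dy / [kk']. The image of [0, PI] is an interval of length
    PI, which periodicity moves back. *)
Lemma I2_pb f : cont2 f -> (forall u v, f u (v + PI) = f u v) ->
  I2 (pb (fun u v => f u v / kk' v)) = I2 f.
Proof.
  intros Cf Pf. unfold I2. apply RInt_ext_all. intro x. unfold pb.
  transitivity (RInt (fun v => f x v) (h 0) (h PI)).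
  - rewrite <- (RInt_comp (V := R_CompleteNormedModule) (fun v => f x v) h (fun y => / kk' (h y))).
    + apply RInt_ext_all. intro y. unfold scal; simpl; unfold mult; simpl. unfold Rdiv. ring.
    + intros; now apply cont2_v.
    + intros y _. split; [apply h_derive|]. apply (ex_derive_continuous (V := R_NormedModule) (fun y => / kk' (h y))).
      apply (ex_derive_comp (fun v => / kk' v) h); [|eexists; apply h_derive].
      apply ex_derive_inv; [eexists; apply kk'_derive|]. pose proof (kk'_pos (h y)); lra.
  - replace PI with (0 + PI) at 1 by ring. rewrite h_per. apply RInt_shift; auto. now apply cont2_v.
Qed.

(** * A metric on the Klein bottle in flat coordinates *)

Variable g : sym2.
Hypothesis Hg : klein_metric sigma g.

Lemma met_smooth : smooth2 (gE g) /\ smooth2 (gF g) /\ smooth2 (gG g).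
Proof. apply Hg. Qed.
Lemma met_pos u v : 0 < gE g u v /\ 0 < gdet g u v.
Proof. apply Hg. Qed.

Definition sd : fn2 := fun u v => sqrt (gdet g u v).

Lemma smooth2_sd : smooth2 sd.
Proof.
  destruct met_smooth as [SE [SF SG]]. apply smooth2_sqrt; [|intros; apply met_pos].
  unfold gdet; smooth.
Qed.
Lemma sd_pos u v : 0 < sd u v /\ sd u v * sd u v = gdet g u v.
Proof. destruct (met_pos u v). split; [now apply sqrt_lt_R0|apply sqrt_sqrt; lra]. Qed.

Lemma pdu_cst c u v : pdu (fun _ y => c y) u v = 0.
Proof. apply is_derive_unique, isd_const. Qed.
Lemma pdv_cst c u v : pdv (fun x _ => c x) u v = 0.
Proof. apply is_derive_unique, isd_const. Qed.

Lemma met_transl u v : gE g u (v + PI) = gE g u v /\ gF g u (v + PI) = gF g u v /\ gG g u (v + PI) = gG g u v.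
Proof.
  destruct Hg as [_ [_ [H _]]]. destruct (H u v) as [HE [HF HG]]. revert HE HF HG.
  unfold pullback, eval_at, translation; simpl.
  assert (A1 : pdu (fun u _ => u) u v = 1) by (apply is_derive_unique, isd_id).
  assert (A2 : pdu (fun _ v => v + PI) u v = 0) by apply (pdu_cst (fun v => v + PI)).
  assert (A3 : pdv (fun u _ => u) u v = 0) by apply (pdv_cst (fun u => u)).
  assert (A4 : pdv (fun _ v => v + PI) u v = 1) by (apply is_derive_unique; auto_derive; auto).
  rewrite A1, A2, A3, A4. intros <- <- <-. repeat split; ring.
Qed.

(* [- sigma'] *)
Definition tt (v : R) : R := 3 / ww v.
Lemma tt_pos v : 0 < tt v.
Proof. unfold tt; pose proof (ww_pos v); apply Rdiv_lt_0_compat; lra. Qed.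
Lemma tt_sigma v : tt (sigma v) = / tt v.
Proof. unfold tt. rewrite sigma_ww by auto. pose proof (ww_pos v). field. lra. Qed.
Lemma kk'_sigma v : kk' (sigma v) = kk' v / tt v.
Proof. unfold kk', tt. rewrite sigma_ww by auto. pose proof (ww_pos v). field. lra. Qed.

Lemma met_glide u v : gE g (u + PI / 2) (sigma v) = gE g u v /\
  gF g (u + PI / 2) (sigma v) = - gF g u v / tt v /\ gG g (u + PI / 2) (sigma v) = gG g u v / (tt v * tt v).
Proof.
  destruct Hg as [_ [_ [_ H]]]. destruct (H u v) as [HE [HF HG]]. revert HE HF HG.
  unfold pullback, eval_at, glide; simpl.
  assert (A1 : pdu (fun u _ => u + PI / 2) u v = 1) by (apply is_derive_unique; auto_derive; auto).
  assert (A2 : pdu (fun _ v => sigma v) u v = 0) by apply (pdu_cst sigma).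
  assert (A3 : pdv (fun u _ => u + PI / 2) u v = 0) by apply (pdv_cst (fun u => u + PI / 2)).
  assert (A4 : pdv (fun _ v => sigma v) u v = - tt v) by (apply is_derive_unique; now apply sigma_derive).
  rewrite A1, A2, A3, A4. pose proof (tt_pos v). intros <- <- <-. repeat split; field; lra.
Qed.

Lemma met_u u v : gE g (u + PI) v = gE g u v /\ gF g (u + PI) v = gF g u v /\ gG g (u + PI) v = gG g u v.
Proof.
  destruct (met_glide (u + PI / 2) (sigma v)) as [A [B C]]. destruct (met_glide u v) as [A' [B' C']].
  rewrite sigma_sigma in A, B, C by auto. replace (u + PI / 2 + PI / 2) with (u + PI) in * by field.
  rewrite A, B, C, A', B', C', tt_sigma. pose proof (tt_pos v). repeat split; field; lra.
Qed.

Lemma sd_per u v : sd (u + PI) v = sd u v /\ sd u (v + PI) = sd u v.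
Proof.
  destruct (met_u u v) as [A [B C]]. destruct (met_transl u v) as [A' [B' C']].
  unfold sd, gdet. rewrite A, B, C, A', B', C'. auto.
Qed.
Lemma sd_glide u v : sd (u + PI / 2) (sigma v) = sd u v / tt v.
Proof.
  pose proof (tt_pos v). pose proof (sd_pos u v) as [P E]. destruct (met_glide u v) as [A [B C]].
  unfold sd at 1, gdet. rewrite A, B, C.
  replace (gE g u v * (gG g u v / (tt v * tt v)) - (- gF g u v / tt v) ^ 2) with ((sd u v / tt v) * (sd u v / tt v)).
  - apply sqrt_square. left; now apply Rdiv_lt_0_compat.
  - transitivity (sd u v * sd u v / (tt v * tt v)); [field; lra|]. rewrite E. unfold gdet. field; lra.
Qed.

(** The matrix sqrt(det) g^(ij) and the area density in the coordinates (x, y), where dy = [kk'] dv.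
    The matrix has determinant 1, as always in dimension 2. *)
Definition kcoef : coeffs := Coeffs
  (pb (fun u v => gG g u v / (sd u v * kk' v)))
  (pb (fun u v => - gF g u v / sd u v))
  (pb (fun u v => gE g u v * kk' v / sd u v))
  (pb (fun u v => sd u v / kk' v)).

Lemma tor_pb f : smooth2 f -> (forall u v, f (u + PI) v = f u v /\ f u (v + PI) = f u v) -> tor (pb f).
Proof.
  intros S P; split; [now apply smooth2_pb|]. intros x y. unfold pb. rewrite h_per. apply P.
Qed.

Lemma kk'_per v : kk' (v + PI) = kk' v.
Proof. unfold kk'. now rewrite ww_per. Qed.

Lemma kcoef_elliptic : elliptic kcoef.
Proof.
  destruct met_smooth as [SE [SF SG]]. pose proof smooth2_sd as SS. pose proof smooth2_kk' as SK.
  assert (N1 : forall u v, sd u v <> 0) by (intros u v; destruct (sd_pos u v); lra).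
  assert (N2' : forall u v : R, kk' v <> 0) by (intros u v; pose proof (kk'_pos v); lra).
  assert (Pr : forall u v, (gE g (u + PI) v = gE g u v /\ gF g (u + PI) v = gF g u v /\ gG g (u + PI) v = gG g u v) /\
    (gE g u (v + PI) = gE g u v /\ gF g u (v + PI) = gF g u v /\ gG g u (v + PI) = gG g u v)) by (intros; split; [apply met_u|apply met_transl]).
  split; [refine (conj _ (conj _ (conj _ _))); simpl; (apply tor_pb; [|intros u v; destruct (Pr u v) as [[A [B C]] [A' [B' C']]]; destruct (sd_per u v) as [D D'];
     rewrite ?A, ?B, ?C, ?D, ?A', ?B', ?C', ?D', ?kk'_per; auto])|].
  1, 2, 3, 4: smooth; auto.
  - intros x y. unfold pb. set (u := x). set (v := h y). destruct (sd_pos u v) as [P E]. pose proof (kk'_pos v) as K.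
    destruct (met_pos u v) as [PE PD]. assert (PG : 0 < gG g u v) by (unfold gdet in PD; simpl in PD; nra).
    change (0 < gG g u v / (sd u v * kk' v) /\ 0 < gG g u v / (sd u v * kk' v) * (gE g u v * kk' v / sd u v) - (- gF g u v / sd u v) ^ 2 /\
      0 < sd u v / kk' v).
    split; [|split].
    + apply Rdiv_lt_0_compat; auto. now apply Rmult_lt_0_compat.
    + replace (gG g u v / (sd u v * kk' v) * (gE g u v * kk' v / sd u v) - (- gF g u v / sd u v) ^ 2) with (gdet g u v / (sd u v * sd u v)).
      * rewrite E. unfold Rdiv; rewrite Rinv_r; lra.
      * unfold gdet. field. lra.
    + now apply Rdiv_lt_0_compat.
Qed.

Lemma kcoef_glide : glide_sym kcoef.
Proof.
  repeat split; try (apply fn2_ext); intros x y; unfold glide_inv, glide_pb, fscal; simpl; unfold pb; rewrite h_opp;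
    destruct (met_glide x (h y)) as [A [B C]]; rewrite ?A, ?B, ?C, ?sd_glide, ?kk'_sigma;
    pose proof (tt_pos (h y)); pose proof (kk'_pos (h y)); destruct (sd_pos x (h y)); field; lra.
Qed.

(** The Dirichlet density sqrt(det) |grad f|^2; in dimension 2 it depends only on the conformal
    class of g. *)
Definition en (f : fn2) : fn2 := fun u v =>
  (gG g u v * pdu f u v ^ 2 - 2 * gF g u v * pdu f u v * pdv f u v + gE g u v * pdv f u v ^ 2) / sd u v.

Lemma klein_per f : klein_fun sigma f -> per f.
Proof.
  intros [_ [T G]]. intros u v. split; [|apply T].
  rewrite <- (G u v). rewrite <- (G (fst (glide sigma u v)) (snd (glide sigma u v))). simpl.
  rewrite sigma_sigma by auto. f_equal; field.
Qed.

Lemma klein_tor f : klein_fun sigma f -> tor f.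
Proof. intro H; split; [apply H|now apply klein_per]. Qed.

Lemma Bf_pb f : klein_fun sigma f -> Bf kcoef (pb f) (pb f) = I2 (en f).
Proof.
  intro Kf. pose proof (klein_tor f Kf) as Tf. destruct Tf as [Sf Pf].
  destruct met_smooth as [SE [SF SG]]. pose proof smooth2_sd as SS.
  assert (N1 : forall u v, sd u v <> 0) by (intros u v; destruct (sd_pos u v); lra).
  rewrite <- I2_pb.
  - apply I2_ext. intros x y. unfold flux. rewrite pdu_pb, pdv_pb by auto. unfold fadd, fmul; simpl. unfold pb, en.
    pose proof (N1 x (h y)). pose proof (kk'_pos (h y)). field. split; lra.
  - apply smooth2_cont. unfold en. smooth; auto.
  - intros u v. unfold en. destruct (met_transl u v) as [-> [-> ->]]. rewrite (proj2 (sd_per _ _)).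
    pose proof (per_dd true f Pf Sf u v) as [_ Eu]. pose proof (per_dd false f Pf Sf u v) as [_ Ev]. simpl in Eu, Ev.
    now rewrite Eu, Ev.
Qed.

Lemma Mf_pb f f' : klein_fun sigma f -> tor f' -> Mf kcoef (pb f) (pb f') = I2 (fun u v => sd u v * (f u v * f' u v)).
Proof.
  intros Kf [Sf' Pf']. pose proof (klein_tor f Kf) as [Sf Pf]. pose proof smooth2_sd as SS.
  rewrite <- I2_pb.
  - apply I2_ext. intros x y. unfold fmul; simpl. unfold pb. pose proof (kk'_pos (h y)). field. lra.
  - apply smooth2_cont. smooth.
  - intros u v. now rewrite (proj2 (sd_per _ _)), (proj2 (Pf u v)), (proj2 (Pf' u v)).
Qed.

Lemma klein_eigenvalue f l : klein_fun sigma f ->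
  I2 (fun u v => sd u v * f u v) = 0 -> I2 (en f) < l * I2 (fun u v => sd u v * (f u v * f u v)) ->
  exists mu, 0 < mu <= l /\ eigenvalue sigma g mu.
Proof.
  intros Kf M0 HE. pose proof (klein_tor f Kf) as Tf.
  destruct (flat_eigenfunction kcoef (pb f) l kcoef_elliptic kcoef_glide) as [mu [U [Hmu [TU [IU [NU PU]]]]]].
  - apply tor_pb; apply Tf.
  - intros x y. unfold pb. rewrite h_opp. apply Kf.
  - change (Mf kcoef (pb f) (pb (fun _ _ => 1)) = 0). rewrite (Mf_pb f (fun _ _ => 1)); auto using tor_const.
    rewrite <- M0. apply I2_ext; intros; ring.
  - rewrite Bf_pb, Mf_pb; auto.
  - exists mu. split; auto. exists (pf U). destruct TU as [SU PU'].
    assert (KU : klein_fun sigma (pf U)).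
    { split; [now apply smooth2_pf|]. split; intros u v; unfold pf; simpl.
      - rewrite kk_per by auto. apply PU'.
      - rewrite kk_sigma by auto. apply IU. }
    split; [split; auto|].
    + intros u v. unfold laplacian.
      destruct met_smooth as [SE [SF SG]]. pose proof smooth2_sd as SS.
      assert (N1 : forall u v, sd u v <> 0) by (intros a b; destruct (sd_pos a b); lra).
      pose proof kcoef_elliptic as Hk.
      assert (Sfl : forall b, smooth2 (flux kcoef b U)) by (intro b; apply (tor_flux kcoef b U Hk (conj SU PU'))).
      assert (Ev : pdv (pf U) = fun u v => pdv U u (k v) * kk' v) by (apply pdv_unique; intros; now apply pdv_pf').
      assert (E1 : (fun a b => (gG g a b * pdu (pf U) a b - gF g a b * pdv (pf U) a b) / sqrt (gdet g a b))
        = fun a b => kk' b * pf (flux kcoef true U) a b).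
      { apply fn2_ext; intros a b. rewrite pdu_pf, Ev by auto. unfold flux, fadd, fmul, pf; simpl. unfold pb. rewrite !Hhk.
        fold (sd a b). pose proof (N1 a b). pose proof (kk'_pos b). field. split; lra. }
      assert (E2 : (fun a b => (gE g a b * pdv (pf U) a b - gF g a b * pdu (pf U) a b) / sqrt (gdet g a b))
        = pf (flux kcoef false U)).
      { apply fn2_ext; intros a b. rewrite pdu_pf, Ev by auto. unfold flux, fadd, fmul, pf; simpl. unfold pb. rewrite !Hhk.
        fold (sd a b). pose proof (N1 a b). pose proof (kk'_pos b). field. lra. }
      rewrite E1, E2.
      assert (D1 : pdu (fun a b => kk' b * pf (flux kcoef true U) a b) u v = kk' v * pdu (flux kcoef true U) u (k v)).
      { apply is_derive_unique. eapply isd_eq; [apply (isd_mult (fun _ => kk' v) (fun a => pf (flux kcoef true U) a v)); [apply isd_const|]|].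
        - apply (smooth2_du _ (smooth2_pf _ (Sfl true))).
        - req. rewrite pdu_pf by auto. unfold pf; ring. }
      assert (D2 : pdv (pf (flux kcoef false U)) u v = pdv (flux kcoef false U) u (k v) * kk' v).
      { apply is_derive_unique. now apply pdv_pf'. }
      rewrite D1, D2. specialize (PU u (k v)). fold (sd u v).
      replace (kk' v * pdu (flux kcoef true U) u (k v) + pdv (flux kcoef false U) u (k v) * kk' v)
        with (kk' v * (pdu (flux kcoef true U) u (k v) + pdv (flux kcoef false U) u (k v))) by ring.
      rewrite PU. simpl kr. unfold pb, pf. rewrite Hhk. pose proof (N1 u v). pose proof (kk'_pos v). field. split; lra.
    + destruct NU as [x [y NU]]. exists x, (h y). unfold pf. now rewrite Hkh.
Qed.

End Transport.

(** A quotient below l would, through a level l' strictly between, produce an eigenvalue in (0, l'],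
    against the minimality of l. *)
Theorem variational_principle sigma g f l : klein_involution sigma -> klein_metric sigma g ->
  klein_fun sigma f -> is_lambda1 sigma g l -> I2 (fun u v => sd g u v * f u v) = 0 ->
  l * I2 (fun u v => sd g u v * (f u v * f u v)) <= I2 (en g f).
Proof.
  intros Hs Hg Kf [_ [_ Hl]] M0. destruct (kk_inv sigma Hs) as [h [Hkh Hhk]].
  apply Rnot_lt_le. intro H.
  set (M := I2 (fun u v => sd g u v * (f u v * f u v))) in *.
  assert (M1 : 0 <= M).
  { pose proof (klein_tor sigma Hs f Kf) as [Sf _]. pose proof (smooth2_sd sigma g Hg).
    apply I2_ge0; [apply smooth2_cont; smooth|]. intros u v. destruct (sd_pos sigma g Hg u v).
    apply Rmult_le_pos; [lra|apply Rle_0_sqr]. }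
  assert (Q : exists l', l' < l /\ I2 (en g f) < l' * M).
  { exists (l - (l * M - I2 (en g f)) / (2 * (M + 1))).
    assert (0 < (l * M - I2 (en g f)) / (2 * (M + 1))) by (apply Rdiv_lt_0_compat; lra).
    split; [lra|]. set (d := (l * M - I2 (en g f)) / (2 * (M + 1))) in *.
    assert (d * (2 * (M + 1)) = l * M - I2 (en g f)) by (unfold d; field; lra). nra. }
  destruct Q as [l' [L1 L2]].
  destruct (klein_eigenvalue sigma Hs h Hkh Hhk g Hg f l' Kf M0 L2) as [mu [Hmu Em]].
  specialize (Hl mu ltac:(lra) Em). lra.
Qed.

(** * The five eigenfunctions *)

Definition rw (v : R) : R := sqrt (ww v).
(** With z the integral of dv / [rw] from 0, the functions 4 * [phi 0], [phi 1], [phi 2] are sn, cn,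
    dn of modulus 1/2 at 4z. [phi_derive], [phi1_sq] and [phi2_sq] are the classical derivative and
    quadratic relations. The index k matches the angular frequency 2k in u. *)
Definition phi (k : nat) (v : R) : R :=
  match k with
  | O => sin v * cos v / rw v
  | S O => (3 * cos v ^ 2 - sin v ^ 2) / rw v
  | _ => (3 * cos v ^ 2 + sin v ^ 2) / rw v
  end.
(* [rw * phi k'] *)
Definition psi (k : nat) (v : R) : R :=
  match k with
  | O => phi 1 v * phi 2 v
  | S O => -16 * (phi 0 v * phi 2 v)
  | _ => -4 * (phi 0 v * phi 1 v)
  end.
Definition ff (v : R) : R := (9 + ww v ^ 2) / ww v.

Lemma rw_pos v : 0 < rw v.
Proof. apply sqrt_ww. Qed.
Lemma rw_sq v : rw v * rw v = ww v.
Proof. apply sqrt_ww. Qed.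
Lemma rw_derive v : is_derive rw v (-8 * cos v * sin v / rw v).
Proof. apply sqrt_ww_derive. Qed.

Lemma div_rw_derive (N : R -> R) N' v : is_derive N v N' ->
  is_derive (fun v => N v / rw v) v ((N' + 8 * cos v * sin v * N v / ww v) / rw v).
Proof.
  intro H. pose proof (rw_pos v). pose proof (ww_pos v). eapply isd_eq.
  - apply (is_derive_div N rw); [exact H|apply rw_derive|lra].
  - req. rewrite <- rw_sq. simpl. field. lra.
Qed.

Lemma phi_derive k v : is_derive (phi k) v (psi k v / rw v).
Proof.
  pose proof (rw_pos v) as P. pose proof (ww_pos v) as Q. pose proof (rw_sq v) as E.
  assert (S2 := sin_sq v).
  destruct k as [|[|k]].
  - eapply isd_eq; [apply (div_rw_derive (fun v => sin v * cos v)); apply (isd_mult sin cos); [apply is_derive_sin|apply is_derive_cos]|].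
    req. f_equal. unfold psi, phi. apply Rmult_eq_reg_l with (ww v); [|lra].
    transitivity ((cos v * cos v - sin v * sin v) * ww v + 8 * (cos v * cos v) * (sin v * sin v)); [field; lra|].
    transitivity ((3 * cos v ^ 2 - sin v ^ 2) * (3 * cos v ^ 2 + sin v ^ 2) * (ww v / (rw v * rw v))); [|field; lra].
    rewrite E. replace (sin v ^ 2) with (1 - cos v * cos v) by (rewrite <- S2; ring).
    rewrite S2. unfold Rdiv; rewrite Rinv_r by lra. unfold ww. ring.
  - eapply isd_eq; [apply (div_rw_derive (fun v => 3 * cos v ^ 2 - sin v ^ 2) (-8 * cos v * sin v)); auto_derive; auto; ring|].
    req. f_equal. unfold psi, phi. apply Rmult_eq_reg_l with (ww v); [|lra].
    transitivity (-8 * cos v * sin v * (ww v - (3 * cos v ^ 2 - sin v ^ 2))); [field; lra|].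
    transitivity (-16 * (sin v * cos v) * (3 * cos v ^ 2 + sin v ^ 2) * (ww v / (rw v * rw v))); [|field; lra].
    rewrite E. replace (sin v ^ 2) with (1 - cos v * cos v) by (rewrite <- S2; ring).
    unfold Rdiv; rewrite Rinv_r by lra. unfold ww. ring.
  - eapply isd_eq; [apply (div_rw_derive (fun v => 3 * cos v ^ 2 + sin v ^ 2) (-4 * cos v * sin v)); auto_derive; auto; ring|].
    req. f_equal. unfold psi, phi. apply Rmult_eq_reg_l with (ww v); [|lra].
    transitivity (-4 * cos v * sin v * (ww v - 2 * (3 * cos v ^ 2 + sin v ^ 2))); [field; lra|].
    transitivity (-4 * (sin v * cos v) * (3 * cos v ^ 2 - sin v ^ 2) * (ww v / (rw v * rw v))); [|field; lra].
    rewrite E. replace (sin v ^ 2) with (1 - cos v * cos v) by (rewrite <- S2; ring).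
    unfold Rdiv; rewrite Rinv_r by lra. unfold ww. ring.
Qed.

Lemma phi1_sq v : phi 1 v * phi 1 v = 1 - 16 * (phi 0 v * phi 0 v).
Proof.
  pose proof (rw_pos v) as P. pose proof (rw_sq v) as E. pose proof (ww_pos v).
  assert (S2 := sin_sq v). unfold phi. apply Rmult_eq_reg_l with (ww v); [|lra].
  transitivity ((3 * cos v ^ 2 - sin v ^ 2) ^ 2 * (ww v / (rw v * rw v))); [field; lra|].
  transitivity (ww v - 16 * (sin v * sin v) * (cos v * cos v) * (ww v / (rw v * rw v))); [|field; lra].
  rewrite E. replace (sin v ^ 2) with (1 - cos v * cos v) by (rewrite <- S2; ring).
  rewrite S2. unfold Rdiv; rewrite Rinv_r by lra. unfold ww. ring.
Qed.

Lemma phi2_sq v : phi 2 v * phi 2 v = 1 - 4 * (phi 0 v * phi 0 v).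
Proof.
  pose proof (rw_pos v) as P. pose proof (rw_sq v) as E. pose proof (ww_pos v).
  assert (S2 := sin_sq v). unfold phi. apply Rmult_eq_reg_l with (ww v); [|lra].
  transitivity ((3 * cos v ^ 2 + sin v ^ 2) ^ 2 * (ww v / (rw v * rw v))); [field; lra|].
  transitivity (ww v - 4 * (sin v * sin v) * (cos v * cos v) * (ww v / (rw v * rw v))); [|field; lra].
  rewrite E. replace (sin v ^ 2) with (1 - cos v * cos v) by (rewrite <- S2; ring).
  rewrite S2. unfold Rdiv; rewrite Rinv_r by lra. unfold ww. ring.
Qed.

Lemma ff_phi v : ff v = 10 - 64 * (phi 0 v * phi 0 v).
Proof.
  pose proof (rw_pos v) as P. pose proof (rw_sq v) as E. pose proof (ww_pos v).
  assert (S2 := sin_sq v). unfold ff, phi. apply Rmult_eq_reg_l with (ww v); [|lra].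
  transitivity (9 + ww v ^ 2); [field; lra|].
  transitivity (10 * ww v - 64 * (sin v * sin v) * (cos v * cos v) * (ww v / (rw v * rw v))); [|field; lra].
  rewrite E, S2. unfold Rdiv; rewrite Rinv_r by lra. unfold ww. ring.
Qed.

Lemma ff_pos v : 0 < ff v.
Proof. unfold ff. pose proof (ww_pos v). apply Rdiv_lt_0_compat; nra. Qed.

Lemma phi2_pos v : 0 < phi 2 v.
Proof. unfold phi. apply Rdiv_lt_0_compat; [|apply rw_pos]. pose proof (sin_sq v). nra. Qed.

(** The eigenvalue (2k)^2 of -d^2/du^2 on [trig _ k], for k <= 2. *)
Definition freq (k : nat) : R := match k with O => 0 | S O => 4 | _ => 16 end.

(** The separated form of the eigenvalue equation with eigenvalue 2: product rule, then the
    quadratic relations and the expression of [ff] through [phi 0]. *)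
Lemma psi_derive k v : is_derive (psi k) v ((freq k - 2 * ff v) * phi k v / rw v).
Proof.
  pose proof (rw_pos v) as P. pose proof (phi1_sq v) as E1. pose proof (phi2_sq v) as E2. pose proof (ff_phi v) as F.
  pose proof (phi_derive 0 v) as D0. pose proof (phi_derive 1 v) as D1. pose proof (phi_derive 2 v) as D2.
  unfold psi in D0, D1, D2. rewrite F.
  destruct k as [|[|k]]; unfold psi, freq.
  - eapply isd_eq; [apply (isd_mult (phi 1) (phi 2)); eauto|]. req.
    transitivity ((-16 * phi 0 v * (phi 2 v * phi 2 v) - 4 * phi 0 v * (phi 1 v * phi 1 v)) / rw v); [field; lra|].
    rewrite E1, E2. field; lra.
  - eapply isd_eq; [apply (isd_mult (fun _ => -16)); [apply isd_const|apply (isd_mult (phi 0) (phi 2)); eauto]|]. req.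
    transitivity ((-16 * phi 1 v * (phi 2 v * phi 2 v) + 64 * phi 1 v * (phi 0 v * phi 0 v)) / rw v); [field; lra|].
    rewrite E2. field; lra.
  - change (phi (S (S k))) with (phi 2).
    eapply isd_eq; [apply (isd_mult (fun _ => -4)); [apply isd_const|apply (isd_mult (phi 0) (phi 1)); eauto]|]. req.
    transitivity ((-4 * phi 2 v * (phi 1 v * phi 1 v) + 64 * phi 2 v * (phi 0 v * phi 0 v)) / rw v); [field; lra|].
    rewrite E1. field; lra.
Qed.

Lemma rw_per v : rw (v + PI) = rw v.
Proof. unfold rw; now rewrite ww_per. Qed.

Lemma phi_per k v : phi k (v + PI) = phi k v.
Proof.
  unfold phi. rewrite rw_per, neg_sin, neg_cos. pose proof (rw_pos v). destruct k as [|[|k]]; field; lra.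
Qed.

Lemma smooth2_rw : smooth2 (fun _ v => rw v).
Proof. unfold rw; smooth; [apply smooth2_ww|intros; apply ww_pos]. Qed.

Lemma smooth2_phi k : smooth2 (fun _ v => phi k v).
Proof.
  pose proof smooth2_rw. assert (N : forall u v : R, rw v <> 0) by (intros u v; pose proof (rw_pos v); lra).
  destruct k as [|[|k]]; unfold phi; smooth; auto.
Qed.

Lemma smooth2_ff : smooth2 (fun _ v => ff v).
Proof. unfold ff; smooth; try apply smooth2_ww. intros _ v; pose proof (ww_pos v); lra. Qed.

Section Sigma.
Variable sigma : R -> R.
Hypothesis Hs : klein_involution sigma.

Lemma rw_sigma v : rw (sigma v) = 3 / rw v.
Proof.
  pose proof (rw_pos v). unfold rw at 1. rewrite sigma_ww by auto. rewrite <- rw_sq.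
  replace (9 / (rw v * rw v)) with ((3 / rw v) * (3 / rw v)) by (field; lra).
  apply sqrt_square. left; apply Rdiv_lt_0_compat; lra.
Qed.

Lemma phi_sigma k v : (k <= 2)%nat -> phi k (sigma v) = (if Nat.even k then 1 else -1) * phi k v.
Proof.
  intro Hk. pose proof (rw_pos v). pose proof (sigma_cos sigma Hs v) as C. pose proof (sigma_sin sigma Hs v) as S.
  fold (rw v) in C, S. unfold phi. rewrite rw_sigma, C, S.
  destruct k as [|[|[|k]]]; [| | |lia]; simpl Nat.even; cbv iota; field; lra.
Qed.

End Sigma.

(** The constants make the squares sum to one: 10 p + (1 - 16 p) / 2 + (1 - 4 p) / 2 = 1 with p the
    square of [phi 0]. *)
Definition xc (i : nat) : R := match i with O => sqrt 10 | _ => / sqrt 2 end.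
Definition xk (i : nat) : nat := match i with O => 0 | 1 | 2 => 1 | _ => 2 end%nat.
Definition xs (i : nat) : bool := match i with 2 | 4 => false | _ => true end%nat.
Definition XX (i : nat) : fn2 := fun u v => xc i * (phi (xk i) v * trig (xs i) (xk i) u).

Lemma sum5 (a : nat -> R) : sum_lt 5 a = a 0%nat + (a 1%nat + (a 2%nat + (a 3%nat + (a 4%nat + 0)))).
Proof. reflexivity. Qed.

Lemma xk_le i : (xk i <= 2)%nat.
Proof. destruct i as [|[|[|i]]]; simpl; lia. Qed.

Lemma smooth2_XX i : smooth2 (XX i).
Proof.
  unfold XX. smooth; [apply smooth2_phi|apply (smooth2_trig _ _ (fun u _ => u)), smooth2_u].
Qed.

Lemma XX_klein sigma i : klein_involution sigma -> klein_fun sigma (XX i).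
Proof.
  intro Hs. split; [apply smooth2_XX|]. split; intros u v; unfold XX; simpl.
  - now rewrite phi_per.
  - rewrite trig_half, phi_sigma by auto using xk_le. destruct (Nat.even (xk i)); ring.
Qed.

Definition trig' (s : bool) (m : nat) (x : R) : R := (if s then -1 else 1) * (2 * INR m) * trig (negb s) m x.

Lemma pdu_XX i : pdu (XX i) = fun u v => xc i * (phi (xk i) v * trig' (xs i) (xk i) u).
Proof.
  apply pdu_unique. intros u v. unfold XX, trig'.
  eapply isd_eq; [apply (isd_mult (fun _ => xc i)); [apply isd_const|]|].
  - apply (isd_mult (fun _ => phi (xk i) v) (trig (xs i) (xk i))); [apply isd_const|apply trig_derive].
  - req; ring.
Qed.

Lemma pdv_XX i : pdv (XX i) = fun u v => xc i * (psi (xk i) v / rw v * trig (xs i) (xk i) u).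
Proof.
  apply pdv_unique. intros u v. unfold XX.
  eapply isd_eq; [apply (isd_mult (fun _ => xc i)); [apply isd_const|]|].
  - apply (isd_mult (phi (xk i)) (fun _ => trig (xs i) (xk i) u)); [apply phi_derive|apply isd_const].
  - req; ring.
Qed.

Lemma trig'_derive s m x : is_derive (trig' s m) x (- (4 * INR m * INR m) * trig s m x).
Proof.
  unfold trig'. eapply isd_eq; [apply (isd_mult (fun _ => (if s then -1 else 1) * (2 * INR m))); [apply isd_const|apply trig_derive]|].
  req. destruct s; simpl; ring.
Qed.

Lemma freq_xk i : freq (xk i) = 4 * INR (xk i) * INR (xk i).
Proof. destruct i as [|[|[|i]]]; simpl; ring. Qed.

(** * The metric g_0: Laplacian, induced metric, minimality *)

Lemma g0_E u v : gE g_0 u v = ff v. Proof. reflexivity. Qed.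
Lemma g0_F u v : gF g_0 u v = 0. Proof. reflexivity. Qed.
Lemma g0_G u v : gG g_0 u v = ff v / ww v. Proof. reflexivity. Qed.
Lemma g0_det u v : gdet g_0 u v = ff v * ff v / ww v.
Proof. unfold gdet. rewrite g0_E, g0_F, g0_G. unfold Rdiv; ring. Qed.
Lemma g0_sd u v : sd g_0 u v = ff v / rw v.
Proof.
  unfold sd. rewrite g0_det. pose proof (rw_pos v). pose proof (ff_pos v).
  replace (ff v * ff v / ww v) with ((ff v / rw v) * (ff v / rw v)).
  - apply sqrt_square. left; now apply Rdiv_lt_0_compat.
  - rewrite <- rw_sq. field; lra.
Qed.

(** The conformal factor [ff] cancels from sqrt(det) g^(ij), whose diagonal entries are 1/[rw] and
    [rw]; it survives only in the outer area density. *)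
Lemma g0_laplacian f : smooth2 f -> forall u v, laplacian g_0 f u v =
  - (pdu (pdu f) u v / rw v + pdv (fun a b => rw b * pdv f a b) u v) * (rw v / ff v).
Proof.
  intros S u v. unfold laplacian. fold (sd g_0 u v). rewrite g0_sd. pose proof (rw_pos v) as P. pose proof (ff_pos v) as Q.
  assert (E1 : (fun a b => (gG g_0 a b * pdu f a b - gF g_0 a b * pdv f a b) / sqrt (gdet g_0 a b))
    = fun a b => / rw b * pdu f a b).
  { apply fn2_ext; intros a b. fold (sd g_0 a b). rewrite g0_sd, g0_F, g0_G.
    pose proof (rw_pos b). pose proof (ff_pos b). rewrite <- rw_sq. field; lra. }
  assert (E2 : (fun a b => (gE g_0 a b * pdv f a b - gF g_0 a b * pdu f a b) / sqrt (gdet g_0 a b))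
    = fun a b => rw b * pdv f a b).
  { apply fn2_ext; intros a b. fold (sd g_0 a b). rewrite g0_sd, g0_F, g0_E.
    pose proof (rw_pos b). pose proof (ff_pos b). field; lra. }
  rewrite E1, E2.
  assert (D1 : pdu (fun a b => / rw b * pdu f a b) u v = / rw v * pdu (pdu f) u v).
  { apply is_derive_unique. eapply isd_eq; [apply (isd_mult (fun _ => / rw v) (fun a => pdu f a v)); [apply isd_const|apply (smooth2_du (pdu f)); smooth]|]. req; ring. }
  rewrite D1. field. lra.
Qed.

Lemma XX_laplacian i u v : laplacian g_0 (XX i) u v = 2 * XX i u v.
Proof.
  rewrite g0_laplacian by apply smooth2_XX. pose proof (rw_pos v) as P. pose proof (ff_pos v) as Q.
  assert (D1 : pdu (pdu (XX i)) u v = - freq (xk i) * XX i u v).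
  { apply is_derive_unique. rewrite pdu_XX. eapply isd_eq; [apply (isd_mult (fun _ => xc i)); [apply isd_const|]|].
    - apply (isd_mult (fun _ => phi (xk i) v) (trig' (xs i) (xk i))); [apply isd_const|apply trig'_derive].
    - req. unfold XX. rewrite freq_xk. ring. }
  assert (D2 : pdv (fun a b => rw b * pdv (XX i) a b) u v = (freq (xk i) - 2 * ff v) / rw v * XX i u v).
  { apply is_derive_unique. rewrite pdv_XX.
    apply (is_derive_ext (fun z => xc i * trig (xs i) (xk i) u * psi (xk i) z)).
    - intro z. pose proof (rw_pos z). req. field. lra.
    - eapply isd_eq; [apply (isd_mult (fun _ => xc i * trig (xs i) (xk i) u)); [apply isd_const|apply psi_derive]|].
      req. unfold XX. field. lra. }
  rewrite D1, D2. field. lra.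
Qed.

Lemma sqrt2_sq : / sqrt 2 * / sqrt 2 = / 2.
Proof. rewrite <- Rinv_mult, sqrt_sqrt; lra. Qed.
Lemma sqrt10_sq : sqrt 10 * sqrt 10 = 10.
Proof. apply sqrt_sqrt; lra. Qed.

Lemma trig_sq m x : trig true m x * trig true m x + trig false m x * trig false m x = 1.
Proof. unfold trig. pose proof (sin2_cos2 (2 * INR m * x)) as H; unfold Rsqr in H; lra. Qed.
Lemma trig_0 x : trig true 0 x = 1.
Proof. unfold trig; simpl. replace (2 * 0 * x) with 0 by ring. apply cos_0. Qed.

Lemma XX_sphere : in_sphere 1 XX.
Proof.
  intros u v. unfold dot5, at_pt, XX. rewrite sum5. simpl xc; simpl xk; simpl xs. rewrite trig_0.
  pose proof (trig_sq 1 u) as T1. pose proof (trig_sq 2 u) as T2.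
  pose proof (phi1_sq v) as E1. pose proof (phi2_sq v) as E2.
  transitivity ((sqrt 10 * sqrt 10) * (phi 0 v * phi 0 v) + (/ sqrt 2 * / sqrt 2) *
    ((phi 1 v * phi 1 v) * (trig true 1 u * trig true 1 u + trig false 1 u * trig false 1 u) +
     (phi 2 v * phi 2 v) * (trig true 2 u * trig true 2 u + trig false 2 u * trig false 2 u))); [ring|].
  rewrite T1, T2, E1, E2, sqrt2_sq, sqrt10_sq. field.
Qed.

Lemma XX_isometric : isometric g_0 XX.
Proof.
  intros u v. unfold induced_metric; simpl. unfold dot5, at_pt, Xu, Xv. rewrite !sum5, !pdu_XX, !pdv_XX.
  simpl xc; simpl xk; simpl xs. unfold trig'. simpl negb; simpl INR. rewrite trig_0.
  pose proof (trig_sq 1 u) as T1. pose proof (trig_sq 2 u) as T2. pose proof (rw_pos v) as P.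
  pose proof (phi1_sq v) as E1. pose proof (phi2_sq v) as E2. pose proof (ff_phi v) as F.
  change ((9 + (1 + 8 * (cos v * (cos v * 1))) * ((1 + 8 * (cos v * (cos v * 1))) * 1)) / (1 + 8 * (cos v * (cos v * 1)))) with (ff v).
  change (1 + 8 * (cos v * (cos v * 1))) with (ww v).
  split; [|split].
  - transitivity ((/ sqrt 2 * / sqrt 2) *
    (4 * (phi 1 v * phi 1 v) * (trig true 1 u * trig true 1 u + trig false 1 u * trig false 1 u) +
     16 * (phi 2 v * phi 2 v) * (trig true 2 u * trig true 2 u + trig false 2 u * trig false 2 u))); [ring|].
    rewrite T1, T2, E1, E2, sqrt2_sq, F. field.
  - ring.
  - unfold psi.
    transitivity (((sqrt 10 * sqrt 10) * (phi 1 v * phi 1 v) * (phi 2 v * phi 2 v) + (/ sqrt 2 * / sqrt 2) *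
    (256 * (phi 0 v * phi 0 v) * (phi 2 v * phi 2 v) * (trig true 1 u * trig true 1 u + trig false 1 u * trig false 1 u) +
     16 * (phi 0 v * phi 0 v) * (phi 1 v * phi 1 v) * (trig true 2 u * trig true 2 u + trig false 2 u * trig false 2 u))) * / (rw v * rw v)).
    { rewrite Rinv_mult. unfold Rdiv. ring. }
    rewrite T1, T2, E1, E2, sqrt2_sq, sqrt10_sq, rw_sq, F. field. pose proof (ww_pos v); lra.
Qed.

(** Takahashi's argument: the frequencies cancel between the two second derivatives, so the metric
    trace of the Hessian of X is a combination of X and X_v, both orthogonal to n. *)
Lemma XX_minimal : minimal_in_sphere XX.
Proof.
  intros u v n H0 Hu Hv. unfold mean_curvature. destruct (XX_isometric u v) as [IE [IF IG]].
  rewrite IE, IF, IG, g0_E, g0_F, g0_G. unfold Rdiv at 1. apply Rmult_eq_0_compat_r.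
  pose proof (rw_pos v) as P. pose proof (ff_pos v) as Q. pose proof (ww_pos v).
  assert (L : forall i, Xu (Xu XX) i u v = - freq (xk i) * XX i u v).
  { intro i. unfold Xu. apply is_derive_unique. rewrite pdu_XX. eapply isd_eq; [apply (isd_mult (fun _ => xc i)); [apply isd_const|]|].
    - apply (isd_mult (fun _ => phi (xk i) v) (trig' (xs i) (xk i))); [apply isd_const|apply trig'_derive].
    - req. unfold XX. rewrite freq_xk. ring. }
  assert (M : forall i, Xv (Xv XX) i u v = ((freq (xk i) - 2 * ff v) * XX i u v + 8 * cos v * sin v * Xv XX i u v) / ww v).
  { intro i. unfold Xv. apply is_derive_unique. rewrite pdv_XX.
    apply (is_derive_ext (fun z => xc i * trig (xs i) (xk i) u * (psi (xk i) z / rw z))).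
    - intro z. req. ring.
    - eapply isd_eq; [apply (isd_mult (fun _ => xc i * trig (xs i) (xk i) u)); [apply isd_const|]|].
      + apply div_rw_derive, psi_derive.
      + req. unfold XX. rewrite <- rw_sq. field. lra. }
  unfold dot5, at_pt in *. rewrite !sum5 in *. rewrite !L, !M.
  match type of H0 with ?A = 0 => match type of Hv with ?B = 0 =>
    transitivity (ff v / ww v * (-2 * ff v * A + 8 * cos v * sin v * B)); [|rewrite H0, Hv; ring] end end.
  unfold Xv. field. lra.
Qed.

(** * Fourier modes and Sturm comparison *)

Lemma monotone_of_derive (f d : R -> R) x y : x <= y ->
  (forall z, x <= z <= y -> is_derive f z (d z)) -> (forall z, x <= z <= y -> 0 <= d z) -> f x <= f y.
Proof.
  intros xy H D. destruct (MVT_gen f x y d) as [c [Hc E]].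
  - intros z Hz. rewrite Rmin_left, Rmax_right in Hz by lra. apply H; lra.
  - intros z Hz. rewrite Rmin_left, Rmax_right in Hz by lra.
    apply continuity_pt_filterlim, (ex_derive_continuous (V := R_NormedModule)). eexists; apply H; lra.
  - rewrite Rmin_left, Rmax_right in Hc by lra. specialize (D c Hc). nra.
Qed.

Lemma difference_quotient (f : R -> R) b d e : is_derive f b d -> 0 < e ->
  exists del, 0 < del /\ forall v, 0 < Rabs (v - b) < del -> Rabs ((f v - f b) / (v - b) - d) < e.
Proof.
  intros H He. apply is_derive_Reals in H. destruct (H e He) as [del Hd].
  exists del. split; [apply cond_pos|]. intros v [H1 H2].
  specialize (Hd (v - b)). replace (b + (v - b)) with v in Hd by ring. apply Hd; auto.
  intro Z; rewrite Z, Rabs_R0 in H1; lra.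
Qed.

(* Picone's identity: with W = Q Phi - P Psi, the function Z = W P / Phi has
   derivative (a - b) P^2 + W^2 / (s Phi^2). *)
Lemma picone_derive (P Q F G s a b : R -> R) v : is_derive P v (Q v / s v) -> is_derive Q v (a v * P v) ->
  is_derive F v (G v / s v) -> is_derive G v (b v * F v) -> 0 < s v -> F v <> 0 ->
  is_derive (fun v => (Q v * F v - P v * G v) * (P v / F v)) v
    ((a v - b v) * (P v * P v) + (Q v * F v - P v * G v) ^ 2 / (s v * (F v * F v))).
Proof.
  intros HP HQ HF HG Hs NF. eapply isd_eq.
  - apply (isd_mult (fun v => Q v * F v - P v * G v) (fun v => P v / F v)).
    + apply (is_derive_minus (V := R_NormedModule) (fun v => Q v * F v) (fun v => P v * G v)); apply isd_mult; eauto.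
    + apply (is_derive_div P F); eauto.
  - req. unfold minus, plus, opp; simpl. field. split; lra.
Qed.

Lemma ratio_derive (P Q F G s : R -> R) v : is_derive P v (Q v / s v) ->
  is_derive F v (G v / s v) -> 0 < s v -> F v <> 0 ->
  is_derive (fun v => P v / F v) v ((Q v * F v - P v * G v) / (s v * (F v * F v))).
Proof.
  intros HP HF Hs NF. eapply isd_eq; [apply (is_derive_div P F); eauto|]. req. simpl. field. split; lra.
Qed.

(** At a common zero c, P / F stays bounded because F has nonzero slope there, while the Wronskian
    tends to 0; so Picone's function tends to 0. *)
Lemma sturm_endpoint (P Q F G s : R -> R) c e : (forall v, is_derive P v (Q v / s v)) ->
  (forall v, is_derive F v (G v / s v)) -> (forall v, ex_derive Q v) -> (forall v, ex_derive G v) ->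
  0 < s c -> P c = 0 -> F c = 0 -> G c <> 0 -> 0 < e ->
  exists del, 0 < del /\ forall v, 0 < Rabs (v - c) < del ->
    Rabs ((Q v * F v - P v * G v) * (P v / F v)) < e.
Proof.
  intros HP HF HQ HG Hs P0 F0 G0 He.
  set (dF := G c / s c). set (dP := Q c / s c).
  assert (NF : dF <> 0) by (unfold dF; apply Rmult_integral_contrapositive; split; [auto|apply Rinv_neq_0_compat; lra]).
  pose proof (Rabs_pos_lt _ NF) as aF.
  destruct (difference_quotient F c dF (Rabs dF / 2) (HF c) ltac:(lra)) as [d1 [d10 H1]].
  destruct (difference_quotient P c dP 1 (HP c) ltac:(lra)) as [d2 [d20 H2]].
  (* Near c the difference quotient of P is at most |dP| + 1 and that of F at least |dF| / 2, so C
     bounds |P / F|. *)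
  set (C := (Rabs dP + 1) / (Rabs dF / 2)). 
  assert (C0 : 0 < C) by (apply Rdiv_lt_0_compat; pose proof (Rabs_pos dP); lra).
  assert (CW : continuity_pt (fun v => Q v * F v - P v * G v) c).
  { apply continuity_pt_filterlim, (ex_derive_continuous (V := R_NormedModule) (fun v => Q v * F v - P v * G v)).
    apply (ex_derive_minus (V := R_NormedModule) (fun v => Q v * F v) (fun v => P v * G v)); apply ex_derive_mult; auto; eexists; auto. }
  assert (eC : 0 < e / C) by now apply Rdiv_lt_0_compat.
  destruct (proj1 (continuity_pt_locally _ c) CW (mkposreal _ eC)) as [d3 H3].
  exists (Rmin d1 (Rmin d2 d3)). split; [repeat apply Rmin_glb_lt; auto; apply cond_pos|].
  intros v [Hv Hv'].
  assert (L1 : Rabs (v - c) < d1) by (eapply Rlt_le_trans; [apply Hv'|apply Rmin_l]).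
  assert (L2 : Rabs (v - c) < d2) by (eapply Rlt_le_trans; [apply Hv'|eapply Rle_trans; [apply Rmin_r|apply Rmin_l]]).
  assert (L3 : Rabs (v - c) < d3) by (eapply Rlt_le_trans; [apply Hv'|eapply Rle_trans; [apply Rmin_r|apply Rmin_r]]).
  specialize (H1 v (conj Hv L1)). specialize (H2 v (conj Hv L2)).
  assert (H3' : Rabs ((Q v * F v - P v * G v) - (Q c * F c - P c * G c)) < e / C) by (apply (H3 v); exact L3).
  rewrite P0, F0 in *. replace (Q c * 0 - 0 * G c) with 0 in H3' by ring.
  rewrite Rminus_0_r in H1, H2, H3'.
  assert (vc : v - c <> 0) by (intro Z; rewrite Z, Rabs_R0 in Hv; lra).
  set (x := F v / (v - c)) in *. set (y := P v / (v - c)) in *.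
  assert (X : Rabs dF / 2 <= Rabs x).
  { pose proof (Rabs_triang (x - (x - dF)) 0) as T. replace (x - (x - dF) + 0) with dF in T by ring.
    pose proof (Rabs_triang x (- (x - dF))) as T'. rewrite Rabs_Ropp in T'. unfold Rminus in T. rewrite Rabs_R0 in T. unfold Rminus in T'.
    replace (x + - (x + - dF)) with dF in T' by ring. unfold Rminus in H1. lra. }
  assert (Y : Rabs y <= Rabs dP + 1).
  { pose proof (Rabs_triang (y - dP) dP) as T. replace (y - dP + dP) with y in T by ring. lra. }
  assert (x0 : x <> 0) by (intro Z; rewrite Z, Rabs_R0 in X; lra).
  assert (E : P v / F v = y / x) by (unfold x, y; field; split; auto; intro Z; apply x0; unfold x; rewrite Z; unfold Rdiv; ring).
  rewrite Rabs_mult, E. 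
  assert (B : Rabs (y / x) <= C).
  { unfold Rdiv. rewrite Rabs_mult, Rabs_inv. unfold C, Rdiv at 1. apply Rmult_le_compat; auto; try apply Rabs_pos.
    - left; apply Rinv_0_lt_compat; lra.
    - apply Rinv_le_contravar; lra. }
  apply Rle_lt_trans with (Rabs (Q v * F v - P v * G v) * C); [apply Rmult_le_compat_l; auto; apply Rabs_pos|].
  apply Rlt_div_r; auto.
Qed.

Lemma zero_derive_zero (f : R -> R) x d e : 0 < e -> (forall y, Rabs (y - x) < e -> f y = 0) -> is_derive f x d -> d = 0.
Proof.
  intros He Hf Hd. assert (is_derive f x 0).
  { apply (is_derive_ext_loc (fun _ => 0)); [|apply isd_const].
    exists (mkposreal e He). intros y Hy. symmetry. apply Hf, Hy. }
  apply is_derive_unique in Hd, H. congruence.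
Qed.

Lemma constant_of_derive (f : R -> R) al be : (forall v, al < v < be -> is_derive f v 0) ->
  forall x y, al < x < be -> al < y < be -> f x = f y.
Proof.
  intros H. assert (K : forall x y, al < x < be -> al < y < be -> x <= y -> f x = f y).
  { intros x y Hx Hy xy.
    pose proof (monotone_of_derive f (fun _ => 0) x y xy ltac:(intros; apply H; lra) ltac:(intros; lra)).
    pose proof (monotone_of_derive (fun v => - f v) (fun _ => - 0) x y xy) as M.
    assert (- f x <= - f y).
    { apply M; [|intros; lra]. intros z Hz. apply (is_derive_opp (V := R_NormedModule) f). apply H; lra. }
    lra. }
  intros x y Hx Hy. destruct (Rle_dec x y); [apply K|symmetry; apply K]; lra.
Qed.

(** Picone's function has a nonnegative derivative and limit 0 at both ends, so it vanishes, and so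
    do both terms of its derivative: the Wronskian is zero, which makes P / F constant, and P
    vanishes wherever a > b. *)
Lemma sturm_interval (P Q F G s a b : R -> R) al be : al < be ->
  (forall v, is_derive P v (Q v / s v)) -> (forall v, is_derive Q v (a v * P v)) ->
  (forall v, is_derive F v (G v / s v)) -> (forall v, is_derive G v (b v * F v)) ->
  (forall v, 0 < s v) -> (forall v, b v <= a v) -> (forall v, al < v < be -> 0 < F v) ->
  P al = 0 -> P be = 0 -> F al = 0 -> F be = 0 -> G al <> 0 -> G be <> 0 ->
  exists c, forall v, al < v < be -> P v = c * F v /\ (a v - b v) * (P v * P v) = 0.
Proof.
  intros ab HP HQ HF HG Hs Hab Fp Pa Pb Fa Fb Ga Gb.
  set (Z := fun v => (Q v * F v - P v * G v) * (P v / F v)).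
  set (D := fun v => (a v - b v) * (P v * P v) + (Q v * F v - P v * G v) ^ 2 / (s v * (F v * F v))).
  assert (HZ : forall v, al < v < be -> is_derive Z v (D v)).
  { intros v Hv. apply (picone_derive P Q F G s a b); auto. pose proof (Fp v Hv); lra. }
  assert (D1 : forall v, 0 <= (a v - b v) * (P v * P v)).
  { intro v. apply Rmult_le_pos; [specialize (Hab v); lra|apply Rle_0_sqr]. }
  assert (D2 : forall v, al < v < be -> 0 <= (Q v * F v - P v * G v) ^ 2 / (s v * (F v * F v))).
  { intros v Hv. apply Rdiv_le_0_compat; [apply pow2_ge_0|]. pose proof (Fp v Hv). specialize (Hs v).
    apply Rmult_lt_0_compat; auto. now apply Rmult_lt_0_compat. }
  assert (mono : forall x y, al < x -> x <= y -> y < be -> Z x <= Z y).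
  { intros x y H1 H2 H3. apply (monotone_of_derive Z D); auto; intros; [apply HZ; lra|].
    pose proof (D1 z). pose proof (D2 z ltac:(lra)). unfold D; lra. }
  assert (EQ : forall v, ex_derive Q v) by (intro; eexists; auto).
  assert (EG : forall v, ex_derive G v) by (intro; eexists; auto).
  assert (Zle : forall v, al < v < be -> Z v <= 0).
  { intros v Hv. apply Rnot_lt_le. intro N.
    destruct (sturm_endpoint P Q F G s be (Z v) HP HF EQ EG (Hs be) Pb Fb Gb N) as [d [d0 Hd]].
    set (x := Rmax v (be - d / 2)).
    assert (x < be) by (apply Rmax_lub_lt; lra). assert (v <= x) by apply Rmax_l. assert (be - d / 2 <= x) by apply Rmax_r.
    specialize (Hd x). fold (Z x) in Hd. rewrite (Rabs_left (x - be)) in Hd by lra. specialize (Hd ltac:(lra)).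
    pose proof (mono v x ltac:(lra) ltac:(lra) ltac:(lra)). pose proof (Rle_abs (Z x)). lra. }
  assert (Zge : forall v, al < v < be -> 0 <= Z v).
  { intros v Hv. apply Rnot_lt_le. intro N.
    destruct (sturm_endpoint P Q F G s al (- Z v) HP HF EQ EG (Hs al) Pa Fa Ga ltac:(lra)) as [d [d0 Hd]].
    set (x := Rmin v (al + d / 2)).
    assert (al < x) by (apply Rmin_glb_lt; lra). assert (x <= v) by apply Rmin_l. assert (x <= al + d / 2) by apply Rmin_r.
    specialize (Hd x). fold (Z x) in Hd. rewrite (Rabs_right (x - al)) in Hd by lra. specialize (Hd ltac:(lra)).
    pose proof (mono x v ltac:(lra) ltac:(lra) ltac:(lra)). pose proof (Rle_abs (- Z x)). rewrite Rabs_Ropp in H3. lra. }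
  assert (DZ : forall v, al < v < be -> D v = 0).
  { intros v Hv. apply (zero_derive_zero Z v (D v) (Rmin (v - al) (be - v))); auto.
    - apply Rmin_glb_lt; lra.
    - intros y Hy. assert (Rabs (y - v) < v - al) by (eapply Rlt_le_trans; [apply Hy|apply Rmin_l]).
      assert (Rabs (y - v) < be - v) by (eapply Rlt_le_trans; [apply Hy|apply Rmin_r]).
      apply Rabs_def2 in H, H0. apply Rle_antisym; [apply Zle|apply Zge]; lra. }
  assert (W0 : forall v, al < v < be -> (Q v * F v - P v * G v) = 0).
  { intros v Hv. pose proof (DZ v Hv) as E. unfold D in E. pose proof (D1 v). pose proof (D2 v Hv).
    assert (E' : (Q v * F v - P v * G v) ^ 2 / (s v * (F v * F v)) = 0) by lra.
    apply Rmult_integral in E' as [E'|E'].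
    - apply Rsqr_0_uniq. unfold Rsqr. simpl in E'. lra.
    - exfalso. revert E'. apply Rinv_neq_0_compat. pose proof (Fp v Hv). specialize (Hs v).
      apply Rgt_not_eq, Rmult_lt_0_compat; auto. now apply Rmult_lt_0_compat. }
  set (m := (al + be) / 2). exists (P m / F m). intros v Hv. split.
  - pose proof (Fp v Hv). assert (E : P v / F v = P m / F m).
    { apply (constant_of_derive (fun v => P v / F v) al be); auto; [|unfold m; lra].
      intros x Hx. pose proof (Fp x Hx). eapply isd_eq; [apply (ratio_derive P Q F G s); auto; lra|]. req.
      rewrite W0 by auto. unfold Rdiv; ring. }
    rewrite <- E. field; lra.
  - pose proof (DZ v Hv) as E. unfold D in E. pose proof (D1 v). pose proof (D2 v Hv). lra.
Qed.

(** As on an interval, with periodicity in place of the endpoints: a monotone periodic function is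
    constant. *)
Lemma sturm_periodic (P Q F G s a b : R -> R) :
  (forall v, is_derive P v (Q v / s v)) -> (forall v, is_derive Q v (a v * P v)) ->
  (forall v, is_derive F v (G v / s v)) -> (forall v, is_derive G v (b v * F v)) ->
  (forall v, 0 < s v) -> (forall v, b v <= a v) -> (forall v, 0 < F v) ->
  (forall v, P (v + PI) = P v /\ Q (v + PI) = Q v /\ F (v + PI) = F v /\ G (v + PI) = G v) ->
  exists c, forall v, P v = c * F v /\ (a v - b v) * (P v * P v) = 0.
Proof.
  intros HP HQ HF HG Hs Hab Fp Hper. pose proof PI_RGT_0 as pi0.
  set (Z := fun v => (Q v * F v - P v * G v) * (P v / F v)).
  set (D := fun v => (a v - b v) * (P v * P v) + (Q v * F v - P v * G v) ^ 2 / (s v * (F v * F v))).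
  assert (HZ : forall v, is_derive Z v (D v)).
  { intros v. apply (picone_derive P Q F G s a b); auto. pose proof (Fp v); lra. }
  assert (D1 : forall v, 0 <= (a v - b v) * (P v * P v)).
  { intro v. apply Rmult_le_pos; [specialize (Hab v); lra|apply Rle_0_sqr]. }
  assert (FF : forall v, 0 < s v * (F v * F v)).
  { intros v. pose proof (Fp v). specialize (Hs v). apply Rmult_lt_0_compat; auto. now apply Rmult_lt_0_compat. }
  assert (D2 : forall v, 0 <= (Q v * F v - P v * G v) ^ 2 / (s v * (F v * F v))).
  { intros v. apply Rdiv_le_0_compat; auto. apply pow2_ge_0. }
  assert (mono : forall x y, x <= y -> Z x <= Z y).
  { intros x y H. apply (monotone_of_derive Z D); auto. intros; pose proof (D1 z); pose proof (D2 z); unfold D; lra. }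
  assert (Zper : forall v, Z (v + PI) = Z v).
  { intro v. unfold Z. destruct (Hper v) as [-> [-> [-> ->]]]. auto. }
  assert (DZ : forall v, D v = 0).
  { intros v. assert (K : forall y, Rabs (y - v) < PI / 2 -> Z y - Z v = 0).
    { intros y Hy. apply Rabs_def2 in Hy. pose proof (Zper v).
      pose proof (mono v (y + PI) ltac:(lra)). rewrite (Zper y) in H0.
      pose proof (mono y (v + PI) ltac:(lra)). lra. }
    apply (zero_derive_zero (fun y => Z y - Z v) v (D v) (PI / 2)); auto; [lra|].
    eapply isd_eq; [apply (is_derive_minus (V := R_NormedModule) Z (fun _ => Z v)); [apply HZ|apply isd_const]|].
    unfold minus, plus, opp; simpl. ring. }
  assert (W0 : forall v, (Q v * F v - P v * G v) = 0).
  { intros v. pose proof (DZ v) as E. unfold D in E. pose proof (D1 v). pose proof (D2 v).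
    assert (E' : (Q v * F v - P v * G v) ^ 2 / (s v * (F v * F v)) = 0) by lra.
    apply Rmult_integral in E' as [E'|E'].
    - apply Rsqr_0_uniq. unfold Rsqr. simpl in E'. lra.
    - exfalso. revert E'. apply Rinv_neq_0_compat. pose proof (FF v); lra. }
  exists (P 0 / F 0). intros v. split.
  - pose proof (Fp v). assert (E : P v / F v = P 0 / F 0).
    { apply (const_of_derive0 (fun v => P v / F v)).
      intros x. pose proof (Fp x). eapply isd_eq; [apply (ratio_derive P Q F G s); auto; lra|]. req.
      rewrite W0. unfold Rdiv; ring. }
    rewrite <- E. field; lra.
  - pose proof (DZ v) as E. unfold D in E. pose proof (D1 v). pose proof (D2 v). lra.
Qed.

(** * Fourier coefficients in u *)

Definition fcoef (f : fn2) (s : bool) (n : nat) (v : R) : R := RInt (fun u => f u v * trig s n u) 0 PI.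

Lemma cont_trig s n : cont (trig s n).
Proof. apply cont_derive. intro; eexists; apply trig_derive. Qed.

Lemma smooth2_ftrig f s n : smooth2 f -> smooth2 (fun v u => f u v * trig s n u).
Proof.
  intro S. apply smooth2_mult; [now apply (smooth2_swap f)|]. apply (smooth2_trig s n (fun _ u => u)), smooth2_v.
Qed.

Lemma fcoef_derive f s n v : smooth2 f -> is_derive (fcoef f s n) v (fcoef (pdv f) s n v).
Proof.
  intro S. pose proof (is_derive_param _ 0 PI v (smooth2_ftrig f s n S)) as D.
  eapply isd_eq; [exact D|]. req. apply RInt_ext_all. intro u. apply is_derive_unique.
  eapply isd_eq; [apply (isd_mult (fun v => f u v) (fun _ => trig s n u)); [now apply smooth2_dv|apply isd_const]|]. req; ring.
Qed.

Lemma fcoef_add f g s n v : cont2 f -> cont2 g -> fcoef (fadd f g) s n v = fcoef f s n v + fcoef g s n v.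
Proof.
  intros Cf Cg. unfold fcoef. rewrite <- RInt_plus_c by (apply cont_mult; auto using cont_trig; now apply cont2_u).
  apply RInt_ext_all; intro; unfold fadd; ring.
Qed.
Lemma fcoef_mulv f (c : R -> R) s n v : cont2 f -> fcoef (fun u v => c v * f u v) s n v = c v * fcoef f s n v.
Proof.
  intros Cf. unfold fcoef. rewrite <- RInt_scal_c by (apply cont_mult; auto using cont_trig; now apply cont2_u).
  apply RInt_ext_all; intro; ring.
Qed.

Lemma trig_PI s n : trig s n PI = trig s n 0 /\ trig' s n PI = trig' s n 0.
Proof.
  unfold trig'. rewrite <- !(trig_per _ n 0), Rplus_0_l. auto.
Qed.

Lemma fcoef_uu f s n v : tor f -> fcoef (pdu (pdu f)) s n v = - (4 * INR n * INR n) * fcoef f s n v.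
Proof.
  intros [S P]. pose proof (per_dd true f P S) as P1. simpl in P1.
  assert (Su : smooth2 (pdu f)) by smooth. assert (Suu : smooth2 (pdu (pdu f))) by smooth.
  pose proof (cont2_u _ (smooth2_cont _ S) v) as C0. pose proof (cont2_u _ (smooth2_cont _ Suu) v) as C2.
  assert (I : RInt (fun u => pdu (pdu f) u v * trig s n u - f u v * (- (4 * INR n * INR n) * trig s n u)) 0 PI = 0).
  { rewrite (RInt_FTC (fun u => pdu f u v * trig s n u - f u v * trig' s n u)).
    - destruct (trig_PI s n) as [-> ->]. rewrite <- (Rplus_0_l PI), (proj1 (P 0 v)), (proj1 (P1 0 v)). req; ring.
    - intro u. pose proof (smooth2_du _ Su u v). pose proof (smooth2_du _ S u v).
      eapply isd_eq; [apply (is_derive_minus (V := R_NormedModule) (fun u => pdu f u v * trig s n u) (fun u => f u v * trig' s n u))|].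
      + apply (isd_mult (fun u => pdu f u v) (trig s n)); [eassumption|apply trig_derive].
      + apply (isd_mult (fun u => f u v) (trig' s n)); [eassumption|apply trig'_derive].
      + unfold minus, plus, opp; simpl. unfold trig'. ring.
    - apply cont_minus; apply cont_mult; auto using cont_trig. apply cont_mult; auto using cont_trig, cont_const. }
  rewrite RInt_minus_c in I.
  2: { apply cont_mult; auto using cont_trig. }
  2: { apply cont_mult; auto. apply cont_mult; auto using cont_trig, cont_const. }
  unfold fcoef. rewrite <- RInt_scal_c by (apply cont_mult; auto using cont_trig).
  rewrite (RInt_ext_all (fun u => - (4 * INR n * INR n) * (f u v * trig s n u)) (fun u => f u v * (- (4 * INR n * INR n) * trig s n u))) by (intro; ring).
  lra.
Qed.

(** If f is orthogonal to all trigonometric polynomials g, its squared norm equals the product of f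
    with f - g, which density makes arbitrarily small. *)
Lemma fourier_complete f : tor f -> (forall s n v, fcoef f s n v = 0) -> forall u v, f u v = 0.
Proof.
  intros Tf H.
  (* [fcoef] integrates over u, whereas the inner integral of [I2] is over the second variable;
     swapping the variables makes them agree. *)
  set (f' := fun x y => f y x).
  assert (Tf' : tor f').
  { destruct Tf as [S P]; split; [now apply smooth2_swap|]. intros x y. unfold f'. split; apply P. }
  assert (Z : forall g, trig_poly g -> I2 (fmul f' g) = 0).
  { intros g Hg; induction Hg as [s m s' n c|g g' Hg IHg Hg' IHg'].
    - unfold I2. rewrite (RInt_ext_all _ (fun _ => 0)); [rewrite RInt_const_r; ring|]. intro x.
      rewrite (RInt_ext_all _ (fun y => (c * trig s m x) * (f y x * trig s' n y))) by (intro; unfold fmul, f'; ring).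
      rewrite RInt_scal_c; [|apply cont_mult; auto using cont_trig; now apply cont2_u, tor_cont].
      change (RInt (fun y => f y x * trig s' n y) 0 PI) with (fcoef f s' n x). rewrite H; ring.
    - rewrite (I2_ext _ (fadd (fmul f' g) (fmul f' g'))) by (intros; unfold fmul, fadd; ring).
      pose proof (trig_poly_tor g Hg). pose proof (trig_poly_tor g' Hg'). rewrite I2_fadd, IHg, IHg' by auto with sp. ring. }
  assert (N0 : N2 f' = 0).
  { apply Rle_antisym; [|now apply N2_ge0]. apply Rnot_lt_le. intro N.
    destruct (tor_bounded f' Tf') as [K [K0 HK]]. pose proof PI_RGT_0 as pi0.
    pose proof (Rmult_lt_0_compat _ _ pi0 pi0) as pp.
    set (e := N2 f' / (2 * (PI * PI) * (K + 1))).
    assert (e0 : 0 < e) by (apply Rdiv_lt_0_compat; auto; apply Rmult_lt_0_compat; lra).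
    destruct (trig_poly_dense f' e Tf' e0) as [g [Pg Cg]]. pose proof (trig_poly_tor g Pg) as Tg.
    assert (E : N2 f' = I2 (fmul f' (fadd f' (fscal (-1) g)))).
    { transitivity (N2 f' + -1 * I2 (fmul f' g)); [rewrite Z by auto; ring|].
      unfold N2. rewrite <- I2_fscal, <- I2_fadd by auto with sp. apply I2_ext; intros; unfold fadd, fmul, fscal; ring. }
    assert (B : Rabs (I2 (fmul f' (fadd f' (fscal (-1) g)))) <= PI * PI * (K * e)).
    { apply I2_abs_le; [apply tor_cont; auto with sp|]. intros u v _ _. unfold fmul, fadd, fscal. rewrite Rabs_mult.
      apply Rmult_le_compat; auto; try apply Rabs_pos. left. replace (f' u v + -1 * g u v) with (f' u v - g u v) by ring. apply Cg. }
    rewrite <- E, Rabs_right in B by lra.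
    assert (Ee : e * (2 * (PI * PI) * (K + 1)) = N2 f') by (unfold e; field; lra).
    assert (0 <= PI * PI * (K * e)) by (apply Rmult_le_pos; [lra|apply Rmult_le_pos; lra]).
    assert (0 < PI * PI * e) by (apply Rmult_lt_0_compat; lra). lra. }
  intros u v. apply (N2_zero f' Tf' N0 v u).
Qed.

Lemma cos_gt_half v : - (PI / 3) < v < PI / 3 -> / 2 < cos v.
Proof.
  assert (K : forall v, 0 <= v < PI / 3 -> / 2 < cos v).
  { intros x Hx. replace (/ 2) with (cos (PI / 3)) by (rewrite cos_PI3; field). pose proof PI_RGT_0.
    apply cos_decreasing_1; lra. }
  intros Hv. destruct (Rle_dec 0 v); [apply K; lra|]. rewrite <- cos_neg. apply K; lra.
Qed.

(** * Modes of an eigenfunction of g_0 with eigenvalue at most 2 *)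

Section Modes.
Variable sigma : R -> R.
Hypothesis Hs : klein_involution sigma.

Lemma sigma_PI3 : sigma (PI / 3) = PI / 3.
Proof.
  pose proof PI_RGT_0. pose proof (sigma_dec sigma Hs (PI / 3) (PI / 2) ltac:(lra)) as L.
  pose proof (sigma_dec sigma Hs 0 (PI / 3) ltac:(lra)) as U. rewrite sigma_half in L by auto. rewrite sigma_0 in U by auto.
  assert (C : cos (sigma (PI / 3)) = cos (PI / 3)).
  { rewrite sigma_cos by auto. unfold ww. rewrite cos_PI3, sin_PI3. replace (1 + 8 * (1 / 2) ^ 2) with 3 by field.
    pose proof (sqrt_lt_R0 3 ltac:(lra)). field. lra. }
  apply cos_inj; try lra.
Qed.

Lemma sigma_mPI3 : sigma (- (PI / 3)) = 2 * PI / 3.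
Proof.
  pose proof PI_RGT_0.
  assert (E : sigma (- (PI / 2)) = PI).
  { pose proof (sigma_per sigma Hs (- (PI / 2))) as P. replace (- (PI / 2) + PI) with (PI / 2) in P by field.
    rewrite sigma_half in P by auto. lra. }
  pose proof (sigma_dec sigma Hs (- (PI / 3)) 0 ltac:(lra)) as L.
  pose proof (sigma_dec sigma Hs (- (PI / 2)) (- (PI / 3)) ltac:(lra)) as U. rewrite sigma_0 in L by auto. rewrite E in U.
  assert (C : cos (sigma (- (PI / 3))) = cos (2 * PI / 3)).
  { rewrite sigma_cos by auto. unfold ww. replace (2 * PI / 3) with (2 * (PI / 3)) by field.
    rewrite cos_2PI3, cos_neg, sin_neg, cos_PI3, sin_PI3. replace (1 + 8 * (1 / 2) ^ 2) with 3 by field.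
    pose proof (sqrt_lt_R0 3 ltac:(lra)). field. lra. }
  apply cos_inj; lra.
Qed.

Definition odd_sigma (P : R -> R) : Prop := (forall v, P (v + PI) = P v) /\ forall v, P (sigma v) = - P v.

(* sigma fixes PI / 3, and fixes - PI / 3 modulo PI. *)
Lemma odd_zeros P : odd_sigma P -> P (- (PI / 3)) = 0 /\ P (PI / 3) = 0.
Proof.
  intros [Hp Ho]. pose proof (Ho (PI / 3)) as A. pose proof (Ho (- (PI / 3))) as B.
  rewrite sigma_PI3 in A. rewrite sigma_mPI3 in B. replace (2 * PI / 3) with (- (PI / 3) + PI) in B by field.
  rewrite Hp in B. lra.
Qed.

(** sigma maps (PI/3, 2 PI/3) onto (- PI/3, PI/3), so these two intervals and their endpoints fill a
    period. *)
Lemma odd_extend P : odd_sigma P -> (forall v, - (PI / 3) < v < PI / 3 -> P v = 0) -> forall v, P v = 0.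
Proof.
  intros HP H. pose proof (odd_zeros P HP) as [Z1 Z2]. destruct HP as [Hp Ho].
  assert (K : forall v, - (PI / 3) <= v <= - (PI / 3) + PI -> P v = 0).
  { pose proof PI_RGT_0. intros v Hv.
    destruct (Rlt_dec v (PI / 3)) as [L|L].
    - destruct (Req_dec v (- (PI / 3))) as [->|N]; auto. apply H; lra.
    - destruct (Req_dec v (PI / 3)) as [->|N]; auto.
      destruct (Req_dec v (- (PI / 3) + PI)) as [->|N']; [now rewrite Hp|].
      assert (P (sigma v) = 0); [|rewrite Ho in H1; lra].
      apply H. split.
      + replace (- (PI / 3)) with (sigma (2 * PI / 3)).
        * apply sigma_dec; auto. lra.
        * rewrite <- sigma_mPI3. now apply sigma_sigma.
      + rewrite <- sigma_PI3. apply sigma_dec; auto. lra. }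
  intro v. destruct (reduce_PI (v + PI / 3)) as [k Hk].
  rewrite <- (per_Z P Hp k v). apply K. lra.
Qed.

Variable f : fn2.
Variable m : R.
Hypothesis Hf : in_eigenspace sigma g_0 m f.
Hypothesis Hm : 0 < m <= 2.

Lemma ef_tor : tor f.
Proof. apply (klein_tor sigma Hs f), Hf. Qed.

Lemma ef_pde u v : pdv (fun a b => rw b * pdv f a b) u v = - (m * ff v * / rw v) * f u v + - (/ rw v) * pdu (pdu f) u v.
Proof.
  pose proof (proj2 Hf u v) as E. rewrite g0_laplacian in E by apply ef_tor.
  pose proof (rw_pos v). pose proof (ff_pos v).
  assert (E' : pdu (pdu f) u v / rw v + pdv (fun a b => rw b * pdv f a b) u v = - (m * f u v) * (ff v / rw v)).
  { rewrite <- E. field. lra. }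
  transitivity ((pdu (pdu f) u v / rw v + pdv (fun a b => rw b * pdv f a b) u v) - pdu (pdu f) u v / rw v); [ring|].
  rewrite E'. field. lra.
Qed.

Definition pp (s : bool) (n : nat) : R -> R := fcoef f s n.
Definition qq (s : bool) (n : nat) (v : R) : R := rw v * fcoef (pdv f) s n v.

Lemma pp_derive s n v : is_derive (pp s n) v (qq s n v / rw v).
Proof.
  pose proof (rw_pos v). eapply isd_eq; [apply fcoef_derive, ef_tor|]. req. unfold qq. field. lra.
Qed.

Lemma qq_derive s n v : is_derive (qq s n) v ((4 * INR n * INR n - m * ff v) / rw v * pp s n v).
Proof.
  destruct ef_tor as [S P]. assert (Sv : smooth2 (pdv f)) by smooth. assert (Su : smooth2 (pdu (pdu f))) by smooth.
  set (h := fun a b => rw b * pdv f a b).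
  assert (Sh : smooth2 h) by (unfold h; smooth; apply smooth2_rw).
  apply (is_derive_ext (fcoef h s n)).
  - intro t. unfold h, qq. apply (fcoef_mulv (pdv f) rw). now apply smooth2_cont.
  - eapply isd_eq; [now apply fcoef_derive|]. req.
    assert (E : pdv h = fadd (fun u v => - (m * ff v * / rw v) * f u v) (fun u v => - (/ rw v) * pdu (pdu f) u v)).
    { apply fn2_ext; intros a b. apply ef_pde. }
    assert (N : forall u v : R, rw v <> 0) by (intros a b; pose proof (rw_pos b); lra).
    rewrite E, fcoef_add, (fcoef_mulv f (fun v => - (m * ff v * / rw v))), (fcoef_mulv (pdu (pdu f)) (fun v => - (/ rw v))), fcoef_uu.
    + unfold pp. pose proof (rw_pos v). field. lra.
    + exact ef_tor.
    + now apply smooth2_cont.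
    + now apply smooth2_cont.
    + apply smooth2_cont. smooth; auto using smooth2_ff, smooth2_rw.
    + apply smooth2_cont. smooth; auto using smooth2_ff, smooth2_rw.
Qed.

Lemma pp_per s n v : pp s n (v + PI) = pp s n v.
Proof. apply RInt_ext_all; intro u. now rewrite (proj2 (proj2 ef_tor u v)). Qed.
Lemma qq_per s n v : qq s n (v + PI) = qq s n v.
Proof.
  unfold qq. rewrite rw_per. f_equal. apply RInt_ext_all; intro u.
  destruct ef_tor as [S P]. pose proof (proj2 (per_dd false f P S u v)) as E. simpl in E. now rewrite E.
Qed.

(** The shift by PI/2 in u multiplies [trig s n] by (-1)^n, so invariance under the glide makes the
    coefficient even or odd under sigma with the parity of n. *)
Lemma pp_sigma s n v : pp s n (sigma v) = (if Nat.even n then 1 else -1) * pp s n v.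
Proof.
  destruct ef_tor as [S P]. set (e := if Nat.even n then 1 else -1).
  assert (C : forall w, cont (fun u => f u w * trig s n u)).
  { intro w; apply cont_mult; [|apply cont_trig]. now apply cont2_u, smooth2_cont. }
  unfold pp, fcoef.
  rewrite <- (RInt_shift _ (PI / 2) (C (sigma v))).
  2: { intro x. now rewrite trig_per, (proj1 (P x (sigma v))). }
  pose proof (RInt_comp_lin (V := R_CompleteNormedModule) (fun u => f u (sigma v) * trig s n u) 1 (PI / 2) 0 PI) as L.
  replace (1 * 0 + PI / 2) with (PI / 2) in L by ring. replace (1 * PI + PI / 2) with (PI / 2 + PI) in L by ring.
  rewrite <- L by now apply cont_ex_RInt. rewrite <- RInt_scal_c by apply C.
  apply RInt_ext_all. intro u. unfold scal; simpl; unfold mult; simpl. rewrite !Rmult_1_l, trig_half.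
  pose proof (proj2 (proj2 (proj1 Hf)) u v) as G. simpl in G. rewrite G. fold e. ring.
Qed.

Lemma freq_le n : (2 <= n)%nat -> 16 <= 4 * INR n * INR n.
Proof. intro H. apply le_INR in H. simpl in H. nra. Qed.

(** The comparison function [phi 2] is positive on the whole circle, and 4 n^2 >= 16 with m <= 2
    orders the two potentials. *)
Lemma mode_ge2 s n : (2 <= n)%nat -> exists c, forall v, pp s n v = c * phi 2 v /\
   ((4 * INR n * INR n - m * ff v) / rw v - (freq 2 - 2 * ff v) / rw v) * (pp s n v * pp s n v) = 0.
Proof.
  intro Hn. apply (sturm_periodic (pp s n) (qq s n) (phi 2) (psi 2) rw
    (fun v => (4 * INR n * INR n - m * ff v) / rw v) (fun v => (freq 2 - 2 * ff v) / rw v)).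
  - apply pp_derive.
  - apply qq_derive.
  - apply phi_derive.
  - intro v. eapply isd_eq; [apply psi_derive|]. req. unfold Rdiv; ring.
  - apply rw_pos.
  - intro v. pose proof (rw_pos v). pose proof (ff_pos v). pose proof (freq_le n Hn). simpl freq.
    unfold Rdiv. apply Rmult_le_compat_r; [left; now apply Rinv_0_lt_compat|]. nra.
  - apply phi2_pos.
  - intro v. rewrite pp_per, qq_per, !phi_per. unfold psi. rewrite !phi_per. auto.
Qed.

Lemma phi1_pos v : - (PI / 3) < v < PI / 3 -> 0 < phi 1 v.
Proof.
  intro Hv. pose proof (cos_gt_half v Hv). unfold phi. apply Rdiv_lt_0_compat; [|apply rw_pos].
  pose proof (sin_sq v). nra.
Qed.

Lemma phi_odd : odd_sigma (phi 1).
Proof. split; [apply phi_per|]. intro v. rewrite phi_sigma by auto. simpl. ring. Qed.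
Lemma psi0_odd : odd_sigma (psi 0).
Proof.
  split; intro v; unfold psi.
  - now rewrite !phi_per.
  - rewrite !(phi_sigma sigma Hs) by auto. simpl. ring.
Qed.

(** Provides the nonzero end slopes required by [sturm_interval], for the comparison function
    [phi 1] as well as for the flux [psi 0]. *)
Lemma phi0_ends : phi 0 (- (PI / 3)) <> 0 /\ phi 0 (PI / 3) <> 0.
Proof.
  unfold phi. rewrite sin_neg, cos_neg, cos_PI3, sin_PI3.
  pose proof (rw_pos (- (PI / 3))). pose proof (rw_pos (PI / 3)). pose proof (sqrt_lt_R0 3 ltac:(lra)).
  split.
  - apply Rlt_not_eq. apply Rlt_div_l; auto. nra.
  - apply Rgt_not_eq. apply Rdiv_lt_0_compat; auto. nra.
Qed.

(** This coefficient is odd under sigma, hence vanishes at - PI/3 and PI/3, which are consecutive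
    zeros of [phi 1]. *)
Lemma mode_1 s : exists c, forall v, pp s 1 v = c * phi 1 v /\ (2 - m) * pp s 1 v = 0.
Proof.
  pose proof PI_RGT_0 as pi0.
  assert (OP : odd_sigma (pp s 1)).
  { split; [apply pp_per|]. intro v. rewrite pp_sigma. simpl. ring. }
  destruct (odd_zeros _ OP) as [Z1 Z2]. destruct (odd_zeros _ phi_odd) as [Y1 Y2]. destruct phi0_ends as [N1 N2'].
  destruct (sturm_interval (pp s 1) (qq s 1) (phi 1) (psi 1) rw
    (fun v => (4 * INR 1 * INR 1 - m * ff v) / rw v) (fun v => (freq 1 - 2 * ff v) / rw v) (- (PI / 3)) (PI / 3)) as [c Hc]; auto.
  - lra.
  - apply pp_derive.
  - apply qq_derive.
  - apply phi_derive.
  - intro v. eapply isd_eq; [apply psi_derive|]. req. unfold Rdiv; ring.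
  - apply rw_pos.
  - intro v. pose proof (rw_pos v). pose proof (ff_pos v). simpl freq. simpl INR.
    unfold Rdiv. apply Rmult_le_compat_r; [left; now apply Rinv_0_lt_compat|]. nra.
  - apply phi1_pos.
  - unfold psi. pose proof (phi2_pos (- (PI / 3))). apply Rmult_integral_contrapositive; split; [lra|].
    apply Rmult_integral_contrapositive; split; auto; lra.
  - unfold psi. pose proof (phi2_pos (PI / 3)). apply Rmult_integral_contrapositive; split; [lra|].
    apply Rmult_integral_contrapositive; split; auto; lra.
  - exists c. intro v. split.
    + assert (Q : pp s 1 v - c * phi 1 v = 0); [|lra].
      apply (odd_extend (fun v => pp s 1 v - c * phi 1 v)).
      * destruct OP as [O1 O2], phi_odd as [O3 O4]. split; intro x; [now rewrite O1, O3|rewrite O2, O4; ring].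
      * intros x Hx. rewrite (proj1 (Hc x Hx)). ring.
    + apply (odd_extend (fun v => (2 - m) * pp s 1 v)).
      * destruct OP as [O1 O2]. split; intro x; [now rewrite O1|rewrite O2; ring].
      * intros x Hx. destruct (Hc x Hx) as [_ E]. simpl freq in E. simpl INR in E.
        pose proof (rw_pos x). pose proof (ff_pos x).
        assert (E' : (ff x / rw x) * ((2 - m) * (pp s 1 x * pp s 1 x)) = 0) by (rewrite <- E; field; lra).
        apply Rmult_integral in E' as [E'|E'].
        -- exfalso. assert (0 < ff x / rw x) by now apply Rdiv_lt_0_compat. lra.
        -- apply Rsqr_0_uniq. unfold Rsqr. transitivity ((2 - m) * ((2 - m) * (pp s 1 x * pp s 1 x))); [ring|rewrite E'; ring].
Qed.

(** The coefficient is even under sigma; the factor sigma' = -3/[ww] is compensated by [rw] (sigma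
    v) = 3/[rw], so the flux is odd. *)
Lemma pp_sigma_derive s v : qq s 0 (sigma v) = - qq s 0 v.
Proof.
  assert (D1 : is_derive (fun v => pp s 0 (sigma v)) v (qq s 0 (sigma v) / rw (sigma v) * - (3 / ww v))).
  { apply (isd_comp (pp s 0) sigma); [apply pp_derive|now apply sigma_derive]. }
  assert (D2 : is_derive (fun v => pp s 0 (sigma v)) v (qq s 0 v / rw v)).
  { apply (is_derive_ext (pp s 0)); [|apply pp_derive]. intro t. rewrite pp_sigma. simpl. req; ring. }
  apply is_derive_unique in D1, D2. rewrite D1 in D2. rewrite rw_sigma in D2 by auto.
  pose proof (rw_pos v). rewrite <- rw_sq in D2.
  assert (- (qq s 0 (sigma v)) / rw v = qq s 0 v / rw v) by (rewrite <- D2; field; lra).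
  apply Rmult_eq_reg_r in H0; [lra|]. apply Rinv_neq_0_compat; lra.
Qed.

(* For n = 0 the comparison is made on the flux [rw * p'], which vanishes at
   the fixed points of sigma and solves a Sturm equation of its own. *)
Lemma mode_0 s : exists c, forall v, pp s 0 v = c * phi 0 v /\ (2 - m) * pp s 0 v = 0.
Proof.
  pose proof PI_RGT_0 as pi0.
  assert (OQ : odd_sigma (qq s 0)) by (split; [apply qq_per|apply pp_sigma_derive]).
  destruct (odd_zeros _ OQ) as [Z1 Z2]. destruct (odd_zeros _ psi0_odd) as [Y1 Y2]. destruct phi0_ends as [N1 N2'].
  assert (DQ : forall v, is_derive (qq s 0) v (- m * pp s 0 v / (rw v / ff v))).
  { intro v. pose proof (rw_pos v). pose proof (ff_pos v). eapply isd_eq; [apply qq_derive|]. req. simpl INR. field. lra. }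
  assert (DG : forall v, is_derive (psi 0) v (-2 * phi 0 v / (rw v / ff v))).
  { intro v. pose proof (rw_pos v). pose proof (ff_pos v). eapply isd_eq; [apply psi_derive|]. req. simpl freq. field. lra. }
  (* The flux q satisfies q' = - m p / ([rw] / [ff]), and - m p has derivative - m q / [rw]: a Sturm
     system with the roles of function and flux exchanged. *)
  destruct (sturm_interval (qq s 0) (fun v => - m * pp s 0 v) (psi 0) (fun v => -2 * phi 0 v) (fun v => rw v / ff v)
    (fun v => - m / rw v) (fun v => -2 / rw v) (- (PI / 3)) (PI / 3)) as [c Hc]; auto.
  - lra.
  - intro v. pose proof (rw_pos v). eapply isd_eq; [apply (isd_mult (fun _ => - m)); [apply isd_const|apply pp_derive]|]. req. field. lra.
  - intro v. pose proof (rw_pos v). eapply isd_eq; [apply (isd_mult (fun _ => -2)); [apply isd_const|apply phi_derive]|]. req. field. lra.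
  - intro v. apply Rdiv_lt_0_compat; [apply rw_pos|apply ff_pos].
  - intro v. pose proof (rw_pos v). unfold Rdiv. apply Rmult_le_compat_r; [left; now apply Rinv_0_lt_compat|]. lra.
  - intros v Hv. unfold psi. apply Rmult_lt_0_compat; [now apply phi1_pos|apply phi2_pos].
  - apply Rmult_integral_contrapositive; split; auto; lra.
  - apply Rmult_integral_contrapositive; split; auto; lra.
  - assert (H1 : forall v, qq s 0 v = c * psi 0 v).
    { intro v. assert (Q : qq s 0 v - c * psi 0 v = 0); [|lra].
      apply (odd_extend (fun v => qq s 0 v - c * psi 0 v)).
      - destruct OQ as [O1 O2], psi0_odd as [O3 O4]. split; intro x; [now rewrite O1, O3|rewrite O2, O4; ring].
      - intros x Hx. rewrite (proj1 (Hc x Hx)). ring. }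
    assert (H2 : forall v, (2 - m) * qq s 0 v = 0).
    { apply (odd_extend (fun v => (2 - m) * qq s 0 v)).
      - destruct OQ as [O1 O2]. split; intro x; [now rewrite O1|rewrite O2; ring].
      - intros x Hx. destruct (Hc x Hx) as [_ E].
        pose proof (rw_pos x).
        assert (E' : (/ rw x) * ((2 - m) * (qq s 0 x * qq s 0 x)) = 0) by (rewrite <- E; field; lra).
        apply Rmult_integral in E' as [E'|E'].
        + exfalso. assert (0 < / rw x) by now apply Rinv_0_lt_compat. lra.
        + apply Rsqr_0_uniq. unfold Rsqr. transitivity ((2 - m) * ((2 - m) * (qq s 0 x * qq s 0 x))); [ring|rewrite E'; ring]. }
    (* Differentiating the proportionality of the fluxes recovers the functions, without a constant
       of integration since m > 0. *)
    assert (H3 : forall v, m * pp s 0 v = 2 * c * phi 0 v).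
    { intro v. pose proof (rw_pos v). pose proof (ff_pos v).
      assert (D : is_derive (qq s 0) v (c * (-2 * phi 0 v / (rw v / ff v)))).
      { apply (is_derive_ext (fun v => c * psi 0 v)); [intro; symmetry; apply H1|].
        eapply isd_eq; [apply (isd_mult (fun _ => c)); [apply isd_const|apply DG]|]. req; ring. }
      pose proof (DQ v) as D'. apply is_derive_unique in D, D'. rewrite D in D'.
      assert (K : (ff v / rw v) * (m * pp s 0 v) = (ff v / rw v) * (2 * c * phi 0 v)).
      { transitivity (- (- m * pp s 0 v / (rw v / ff v))); [field; lra|]. rewrite <- D'. field; lra. }
      apply Rmult_eq_reg_l in K; auto. assert (0 < ff v / rw v) by now apply Rdiv_lt_0_compat. lra. }
    assert (H4 : forall v, (2 - m) * pp s 0 v = 0).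
    { intro v. pose proof (rw_pos v). pose proof (ff_pos v).
      assert (D : is_derive (fun v => (2 - m) * qq s 0 v) v ((2 - m) * (- m * pp s 0 v / (rw v / ff v)))).
      { eapply isd_eq; [apply (isd_mult (fun _ => 2 - m)); [apply isd_const|apply DQ]|]. req; ring. }
      assert (Z : (2 - m) * (- m * pp s 0 v / (rw v / ff v)) = 0).
      { apply (zero_derive_zero _ v _ 1 Rlt_0_1 (fun y _ => H2 y) D). }
      assert (K : (m * ff v / rw v) * ((2 - m) * pp s 0 v) = 0).
      { transitivity (- ((2 - m) * (- m * pp s 0 v / (rw v / ff v)))); [field; lra|rewrite Z; ring]. }
      apply Rmult_integral in K as [K|K]; auto. exfalso.
      assert (0 < m * ff v / rw v) by (apply Rdiv_lt_0_compat; auto; apply Rmult_lt_0_compat; lra). lra. }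
    exists (2 * c / m). intro v. split; auto. specialize (H3 v).
    apply Rmult_eq_reg_l with m; [|lra]. rewrite H3. field. lra.
Qed.

Lemma mode_all s n : exists c, forall v, pp s n v = (if Nat.leb n 2 then c * phi n v else 0) /\ (2 - m) * pp s n v = 0.
Proof.
  destruct n as [|[|n]].
  - apply mode_0.
  - apply mode_1.
  - destruct (mode_ge2 s (S (S n)) ltac:(lia)) as [c Hc]. exists c. intro v. destruct (Hc v) as [E Z].
    pose proof (rw_pos v) as rp. pose proof (ff_pos v) as fp. simpl freq in Z.
    (* The potential gap splits into two nonnegative terms. The first vanishes only with p when n >=
       3, the second only with p when m < 2. *)
    assert (Z' : (/ rw v) * ((4 * INR (S (S n)) * INR (S (S n)) - 16) * (pp s (S (S n)) v * pp s (S (S n)) v) + (2 - m) * ff v * (pp s (S (S n)) v * pp s (S (S n)) v)) = 0) by (rewrite <- Z; field; lra).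
    apply Rmult_integral in Z' as [Z'|Z']; [exfalso; pose proof (Rinv_0_lt_compat _ rp); lra|].
    pose proof (Rle_0_sqr (pp s (S (S n)) v)) as PS. unfold Rsqr in PS. set (p := pp s (S (S n)) v) in *.
    pose proof (freq_le (S (S n)) ltac:(lia)) as FL.
    assert (A1 : 0 <= (4 * INR (S (S n)) * INR (S (S n)) - 16) * (p * p)) by (apply Rmult_le_pos; lra).
    assert (A2 : 0 <= (2 - m) * ff v * (p * p)) by (apply Rmult_le_pos; auto; apply Rmult_le_pos; lra).
    split.
    + destruct n as [|n]; [exact E|]. simpl Nat.leb. cbv iota.
      assert (FL' : 16 < 4 * INR (S (S (S n))) * INR (S (S (S n)))).
      { rewrite !S_INR. pose proof (pos_INR n). nra. }
      assert (A3 : (4 * INR (S (S (S n))) * INR (S (S (S n))) - 16) * (p * p) = 0) by lra.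
      apply Rmult_integral in A3 as [A3|A3]; [lra|]. now apply Rsqr_0_uniq.
    + assert (A3 : (ff v) * ((2 - m) * (p * p)) = 0) by lra.
      apply Rmult_integral in A3 as [A3|A3]; [lra|]. apply Rsqr_0_uniq. unfold Rsqr.
      transitivity ((2 - m) * ((2 - m) * (p * p))); [ring|rewrite A3; ring].
Qed.

Lemma small_eigenvalue : (exists u v, f u v <> 0) -> m = 2.
Proof.
  intros [u [v N]]. apply NNPP; intro M. apply N. apply fourier_complete; [apply ef_tor|].
  intros s n y. destruct (mode_all s n) as [c Hc]. destruct (Hc y) as [_ Z]. apply Rmult_integral in Z as [Z|Z]; [lra|exact Z].
Qed.

End Modes.

(** * First eigenvalue, multiplicity and area of g_0 *)

Lemma ff_per v : ff (v + PI) = ff v.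
Proof. unfold ff; now rewrite ww_per. Qed.

Lemma g0_klein sigma : klein_involution sigma -> klein_metric sigma g_0.
Proof.
  intros Hs. split; [|split; [|split]].
  - split; [exact smooth2_ff|split; [exact (smooth2_const 0)|]].
    change (smooth2 (fun _ v => ff v / ww v)). smooth; [apply smooth2_ff|apply smooth2_ww|].
    intros _ v; pose proof (ww_pos v); lra.
  - intros u v. rewrite g0_E, g0_det. pose proof (ff_pos v). pose proof (ww_pos v). split; auto.
    apply Rdiv_lt_0_compat; auto. now apply Rmult_lt_0_compat.
  - intros u v. unfold pullback, eval_at, translation. cbn [gE gF gG fst snd].
    assert (A1 : pdu (fun u _ => u) u v = 1) by (apply is_derive_unique, isd_id).
    assert (A2 : pdu (fun _ v => v + PI) u v = 0) by apply (pdu_cst (fun v => v + PI)).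
    assert (A3 : pdv (fun u _ => u) u v = 0) by apply (pdv_cst (fun u => u)).
    assert (A4 : pdv (fun _ v => v + PI) u v = 1) by (apply is_derive_unique; auto_derive; auto).
    rewrite A1, A2, A3, A4, !g0_E, !g0_F, !g0_G, ff_per, ww_per. repeat split; ring.
  - intros u v. unfold pullback, eval_at, glide. cbn [gE gF gG fst snd].
    assert (A1 : pdu (fun u _ => u + PI / 2) u v = 1) by (apply is_derive_unique; auto_derive; auto).
    assert (A2 : pdu (fun _ v => sigma v) u v = 0) by apply (pdu_cst sigma).
    assert (A3 : pdv (fun u _ => u + PI / 2) u v = 0) by apply (pdv_cst (fun u => u + PI / 2)).
    assert (A4 : pdv (fun _ v => sigma v) u v = - (3 / ww v)) by (apply is_derive_unique; now apply sigma_derive).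
    rewrite A1, A2, A3, A4, !g0_E, !g0_F, !g0_G. unfold ff. rewrite sigma_ww by auto.
    pose proof (ww_pos v). repeat split; field; lra.
Qed.

Lemma XX_eigen sigma i : klein_involution sigma -> in_eigenspace sigma g_0 2 (XX i).
Proof. intro Hs. split; [now apply XX_klein|]. apply XX_laplacian. Qed.

Lemma phi_PI4 : phi 0 (PI / 4) <> 0.
Proof.
  unfold phi. pose proof (rw_pos (PI / 4)). apply Rgt_not_eq, Rdiv_lt_0_compat; auto.
  pose proof PI_RGT_0. apply Rmult_lt_0_compat; [apply sin_gt_0|apply cos_gt_0]; lra.
Qed.

Lemma rw_0 : rw 0 = 3.
Proof. unfold rw, ww. rewrite cos_0. replace (1 + 8 * 1 ^ 2) with (3 * 3) by ring. apply sqrt_square; lra. Qed.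

Lemma phi_at_0 : phi 0 0 = 0 /\ phi 1 0 = 1 /\ phi 2 0 = 1.
Proof. unfold phi. rewrite rw_0, sin_0, cos_0. repeat split; field. Qed.

Lemma xc_pos i : 0 < xc i.
Proof. destruct i; simpl; [apply sqrt_lt_R0; lra|]. apply Rinv_0_lt_compat, sqrt_lt_R0; lra. Qed.

Lemma XX_indep c : (forall u v, sum_lt 5 (fun i => c i * XX i u v) = 0) -> forall i, (i < 5)%nat -> c i = 0.
Proof.
  intros H. destruct phi_at_0 as [P0 [P1 P2]]. set (q := / sqrt 2).
  assert (q0 : 0 < q) by (unfold q; apply Rinv_0_lt_compat, sqrt_lt_R0; lra).
  assert (K : forall u, c 1%nat * cos (2 * u) + (c 2%nat * sin (2 * u) + (c 3%nat * cos (4 * u) + c 4%nat * sin (4 * u))) = 0).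
  { intro u. specialize (H u 0). rewrite sum5 in H. unfold XX in H. simpl xk in H. simpl xs in H. simpl xc in H. fold q in H.
    rewrite P0, P1, P2 in H. unfold trig in H. simpl INR in H.
    replace (2 * 1 * u) with (2 * u) in H by ring. replace (2 * (1 + 1) * u) with (4 * u) in H by ring.
    apply Rmult_eq_reg_l with q; [|lra]. rewrite Rmult_0_r, <- H. ring. }
  (* At v = 0 the coordinate 0 vanishes; these four values of u separate the remaining coordinates,
     and v = PI/4 then detects coordinate 0. *)
  pose proof (K 0) as K0. pose proof (K (PI / 2)) as K1. pose proof (K (PI / 4)) as K2. pose proof (K (PI / 8)) as K3.
  rewrite !Rmult_0_r, cos_0, sin_0 in K0.
  replace (2 * (PI / 2)) with PI in K1 by field. replace (4 * (PI / 2)) with (2 * PI) in K1 by field.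
  rewrite cos_PI, sin_PI, cos_2PI, sin_2PI in K1.
  replace (2 * (PI / 4)) with (PI / 2) in K2 by field. replace (4 * (PI / 4)) with PI in K2 by field.
  rewrite cos_PI2, sin_PI2, cos_PI, sin_PI in K2.
  replace (4 * (PI / 8)) with (PI / 2) in K3 by field. rewrite cos_PI2, sin_PI2 in K3.
  assert (C1 : c 1%nat = 0) by lra. assert (C3 : c 3%nat = 0) by lra. assert (C2 : c 2%nat = 0) by lra.
  rewrite C1, C2, C3 in K3. assert (C4 : c 4%nat = 0) by lra.
  assert (C0 : c 0%nat = 0).
  { specialize (H 0 (PI / 4)). rewrite sum5, C1, C2, C3, C4 in H. unfold XX in H. simpl xk in H. simpl xs in H. rewrite trig_0 in H.
    pose proof phi_PI4. pose proof (xc_pos 0).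
    assert (E : c 0%nat * (xc 0 * phi 0 (PI / 4)) = 0) by lra. apply Rmult_integral in E as [E|E]; auto.
    apply Rmult_integral in E as [E|E]; [lra|contradiction]. }
  intros i Hi. destruct i as [|[|[|[|[|i]]]]]; auto. lia.
Qed.

Definition tint (s : bool) (n : nat) (s' : bool) (n' : nat) : R := RInt (fun u => trig s n u * trig s' n' u) 0 PI.

(** The Wronskian of two modes is periodic, and its derivative is the product of the modes times the
    difference of the squared frequencies. *)
Lemma tint_ne s n s' n' : n <> n' -> tint s n s' n' = 0.
Proof.
  intros N. assert (I : RInt (fun u => (4 * INR n * INR n - 4 * INR n' * INR n') * (trig s n u * trig s' n' u)) 0 PI = 0).
  { rewrite (RInt_FTC (fun u => trig s n u * trig' s' n' u - trig' s n u * trig s' n' u)).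
    - destruct (trig_PI s n) as [-> ->], (trig_PI s' n') as [-> ->]. req; ring.
    - intro u. eapply isd_eq; [apply (is_derive_minus (V := R_NormedModule) (fun u => trig s n u * trig' s' n' u) (fun u => trig' s n u * trig s' n' u))|].
      + apply (isd_mult (trig s n) (trig' s' n')); [apply trig_derive|apply trig'_derive].
      + apply (isd_mult (trig' s n) (trig s' n')); [apply trig'_derive|apply trig_derive].
      + unfold minus, plus, opp; simpl. unfold trig'. req; ring.
    - apply cont_mult; [apply cont_const|]. apply cont_mult; apply cont_trig. }
  rewrite RInt_scal_c in I by (apply cont_mult; apply cont_trig).
  apply Rmult_integral in I as [I|I]; auto. exfalso. apply N, INR_eq. pose proof (pos_INR n). pose proof (pos_INR n'). nra.
Qed.

Lemma tint_sq s n : (1 <= n)%nat -> tint s n s n = PI / 2.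
Proof.
  intro Hn. pose proof (tint_ne true (n + n) true 0 ltac:(lia)) as Z.
  set (e := if s then 1 else -1).
  unfold tint. rewrite (RInt_ext_all _ (fun u => / 2 + e * / 2 * (trig true (n + n) u * trig true 0 u))).
  - rewrite RInt_plus_c, RInt_const_r, RInt_scal_c by (auto using cont_const || (repeat apply cont_mult; auto using cont_const, cont_trig)).
    fold (tint true (n + n) true 0). rewrite Z. field.
  - intro u. rewrite trig_0. unfold trig. rewrite plus_INR.
    replace (2 * (INR n + INR n) * u) with (2 * (2 * INR n * u)) by ring.
    unfold e; destruct s; [rewrite cos_2a_cos; field|rewrite cos_2a_sin; field].
Qed.

Lemma tint_mixed s n : tint s n (negb s) n = 0.
Proof.
  assert (K : tint true n false n = 0).
  { destruct n as [|n].
    - unfold tint. rewrite (RInt_ext_all _ (fun _ => 0)); [rewrite RInt_const_r; ring|].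
      intro u. unfold trig; simpl. replace (2 * 0 * u) with 0 by ring. rewrite sin_0; ring.
    - pose proof (tint_ne false (S n + S n) true 0 ltac:(lia)) as Z.
      unfold tint. rewrite (RInt_ext_all _ (fun u => / 2 * (trig false (S n + S n) u * trig true 0 u))).
      + rewrite RInt_scal_c by (apply cont_mult; apply cont_trig). fold (tint false (S n + S n) true 0). rewrite Z; ring.
      + intro u. rewrite trig_0. unfold trig. rewrite plus_INR.
        replace (2 * (INR (S n) + INR (S n)) * u) with (2 * (2 * INR (S n) * u)) by ring. rewrite sin_2a. field. }
  destruct s; simpl; auto. rewrite <- K. apply RInt_ext_all; intro; ring.
Qed.

Lemma fcoef_XX i s n v : fcoef (XX i) s n v = xc i * phi (xk i) v * tint (xs i) (xk i) s n.
Proof.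
  unfold fcoef, tint, XX. rewrite <- RInt_scal_c by (apply cont_mult; apply cont_trig). apply RInt_ext_all; intro; ring.
Qed.

Lemma fcoef_scal f c s n v : cont2 f -> fcoef (fscal c f) s n v = c * fcoef f s n v.
Proof. intro; apply (fcoef_mulv f (fun _ => c)); auto. Qed.

(** By [mode_all] each Fourier coefficient of f of index at most 2 is a multiple of the matching
    profile and the others vanish; subtracting the combination of the [XX i] leaves a function
    without Fourier coefficients. *)
Lemma multiplicity sigma : klein_involution sigma -> has_multiplicity sigma g_0 2 5.
Proof.
  intros Hs. exists XX. split; [intros; now apply XX_eigen|]. split; [apply XX_indep|].
  intros f Hf.
  assert (M : forall s n, exists c, forall v, fcoef f s n v = if Nat.leb n 2 then c * phi n v else 0).
  { intros s n. destruct (mode_all sigma Hs f 2 Hf ltac:(lra) s n) as [c Hc]. exists c. intro v. apply Hc. }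
  assert (D : exists d : nat -> R, forall i, (i < 5)%nat -> forall v, fcoef f (xs i) (xk i) v = d i * fcoef (XX i) (xs i) (xk i) v).
  { apply (functional_choice (fun i d => (i < 5)%nat -> forall v, fcoef f (xs i) (xk i) v = d * fcoef (XX i) (xs i) (xk i) v)).
    intro i. destruct (M (xs i) (xk i)) as [c Hc].
    set (t := tint (xs i) (xk i) (xs i) (xk i)).
    assert (t0 : 0 < t).
    { pose proof PI_RGT_0. unfold t. destruct (Nat.eq_dec (xk i) 0) as [E|E].
      - assert (xs i = true) by (destruct i as [|[|[|i]]]; [reflexivity|discriminate E..]). rewrite E, H0.
        unfold tint. rewrite (RInt_ext_all _ (fun _ => 1)); [rewrite RInt_const_r; lra|]. intro; rewrite trig_0; ring.
      - rewrite tint_sq by lia. lra. }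
    exists (c / (xc i * t)). intros Hi v. rewrite fcoef_XX, Hc. fold t. pose proof (xc_pos i).
    assert (Nat.leb (xk i) 2 = true) as -> by (apply Nat.leb_le, xk_le). field. lra. }
  destruct D as [d Hd]. exists d. intros u v.
  pose proof (klein_tor sigma Hs f (proj1 Hf)) as Tf.
  assert (TX : forall i, tor (XX i)) by (intro i; apply (klein_tor sigma Hs), XX_klein, Hs).
  set (g := fadd f (fadd (fscal (- d 0%nat) (XX 0)) (fadd (fscal (- d 1%nat) (XX 1)) (fadd (fscal (- d 2%nat) (XX 2))
     (fadd (fscal (- d 3%nat) (XX 3)) (fscal (- d 4%nat) (XX 4))))))).
  assert (Tg : tor g) by (unfold g; auto 20 with sp).
  assert (Z : g u v = 0).
  { apply fourier_complete; auto. intros s n w.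
    assert (E : fcoef g s n w = fcoef f s n w - (d 0%nat * fcoef (XX 0) s n w + d 1%nat * fcoef (XX 1) s n w + d 2%nat * fcoef (XX 2) s n w
      + d 3%nat * fcoef (XX 3) s n w + d 4%nat * fcoef (XX 4) s n w)).
    { unfold g. rewrite !fcoef_add by (apply tor_cont; auto 20 with sp). rewrite !fcoef_scal by now apply tor_cont. ring. }
    rewrite E.
    assert (O : forall i, (xk i <> n \/ xs i <> s) -> fcoef (XX i) s n w = 0).
    { intros i [N|N]; rewrite fcoef_XX.
      - rewrite tint_ne by auto; ring.
      - destruct (Nat.eq_dec (xk i) n) as [<-|N']; [|rewrite tint_ne by auto; ring].
        replace s with (negb (xs i)) by (destruct s, (xs i); simpl in *; congruence). rewrite tint_mixed; ring. }
    pose proof (Hd 0%nat ltac:(lia) w) as H0. pose proof (Hd 1%nat ltac:(lia) w) as H1. pose proof (Hd 2%nat ltac:(lia) w) as H2.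
    pose proof (Hd 3%nat ltac:(lia) w) as H3. pose proof (Hd 4%nat ltac:(lia) w) as H4.
    simpl xk in H0, H1, H2, H3, H4. simpl xs in H0, H1, H2, H3, H4.
    destruct n as [|[|[|n]]].
    - rewrite (O 1%nat), (O 2%nat), (O 3%nat), (O 4%nat) by (left; simpl; lia). destruct s.
      + lra.
      + rewrite (O 0%nat) by (right; discriminate). assert (fcoef f false 0 w = 0); [|lra].
        unfold fcoef. rewrite (RInt_ext_all _ (fun _ => 0)); [rewrite RInt_const_r; ring|].
        intro x. unfold trig; simpl. replace (2 * 0 * x) with 0 by ring. rewrite sin_0; ring.
    - rewrite (O 0%nat), (O 3%nat), (O 4%nat) by (left; simpl; lia). destruct s.
      + rewrite (O 2%nat) by (right; discriminate). lra.
      + rewrite (O 1%nat) by (right; discriminate). lra.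
    - rewrite (O 0%nat), (O 1%nat), (O 2%nat) by (left; simpl; lia). destruct s.
      + rewrite (O 4%nat) by (right; discriminate). lra.
      + rewrite (O 3%nat) by (right; discriminate). lra.
    - rewrite (O 0%nat), (O 1%nat), (O 2%nat), (O 3%nat), (O 4%nat) by (left; simpl; lia).
      destruct (M s (S (S (S n)))) as [c Hc]. rewrite Hc. simpl. ring. }
  rewrite sum5. unfold g, fadd, fscal in Z. lra.
Qed.

Lemma XX_nonzero i : exists u v, XX i u v <> 0.
Proof.
  destruct (Nat.eq_dec (xk i) 0) as [E|E].
  - assert (i = 0%nat) by (destruct i as [|[|[|i]]]; [reflexivity|discriminate E..]). subst i.
    exists 0, (PI / 4). change (xc 0 * (phi 0 (PI / 4) * trig true 0 0) <> 0). rewrite trig_0. pose proof phi_PI4. pose proof (xc_pos 0).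
    apply Rmult_integral_contrapositive; split; [lra|]. intro Z; apply H; lra.
  - set (k := xk i) in *. assert (K0 : 0 < INR k) by (apply lt_0_INR; lia).
    exists (if xs i then 0 else PI / (4 * INR k)), 0. unfold XX. fold k.
    assert (P : phi k 0 = 1) by (destruct phi_at_0 as [A [B C]]; destruct k as [|[|k]]; [lia|auto|exact C]).
    assert (T : trig (xs i) k (if xs i then 0 else PI / (4 * INR k)) = 1).
    { unfold trig. destruct (xs i).
      - rewrite Rmult_0_r. apply cos_0.
      - replace (2 * INR k * (PI / (4 * INR k))) with (PI / 2) by (field; lra). apply sin_PI2. }
    rewrite P, T. pose proof (xc_pos i). lra.
Qed.

Lemma lambda1_g0 sigma : klein_involution sigma -> is_lambda1 sigma g_0 2.
Proof.
  intro Hs. split; [lra|]. split.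
  - exists (XX 0). split; [now apply XX_eigen|apply XX_nonzero].
  - intros m Hm [f [Hf Nf]]. apply Rnot_lt_le. intro L.
    pose proof (small_eigenvalue sigma Hs f m Hf ltac:(lra) Nf). lra.
Qed.

(** [rw] = 3 sqrt(1 - (8/9) sin^2), where 8/9 is the square of the modulus, and [rw] is symmetric
    about PI/2. *)
Lemma RInt_rw : RInt rw 0 PI = 6 * ellipticE (2 * sqrt 2 / 3).
Proof.
  assert (Cr : cont rw) by (apply cont_derive; intro; eexists; apply rw_derive).
  rewrite <- (RInt_Chasles (V := R_CompleteNormedModule) rw 0 (PI / 2) PI) by now apply cont_ex_RInt.
  assert (E1 : RInt rw (PI / 2) PI = RInt rw 0 (PI / 2)).
  { pose proof (RInt_comp_lin (V := R_CompleteNormedModule) rw (-1) PI 0 (PI / 2)) as L.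
    replace (-1 * 0 + PI) with PI in L by ring. replace (-1 * (PI / 2) + PI) with (PI / 2) in L by field.
    rewrite <- (opp_RInt_swap (V := R_CompleteNormedModule) rw) by now apply cont_ex_RInt.
    rewrite <- L by now apply cont_ex_RInt. 
    transitivity (- (-1 * RInt rw 0 (PI / 2))); [|req; ring].
    rewrite <- RInt_scal_c by auto. unfold opp; simpl. f_equal. apply RInt_ext_all. intro x.
    unfold scal; simpl; unfold mult; simpl. replace (rw (-1 * x + PI)) with (rw x); [reflexivity|].
    rewrite rw_per. unfold rw, ww. replace (-1 * x) with (- x) by ring. now rewrite cos_neg. }
  rewrite E1. unfold plus; simpl. unfold ellipticE.
  assert (E2 : RInt rw 0 (PI / 2) = 3 * RInt (fun t => sqrt (1 - (2 * sqrt 2 / 3) ^ 2 * sin t ^ 2)) 0 (PI / 2)).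
  { assert (R3 : forall x, rw x = 3 * sqrt (1 - (2 * sqrt 2 / 3) ^ 2 * sin x ^ 2)).
    { intro x. replace ((2 * sqrt 2 / 3) ^ 2) with (4 * (sqrt 2 * sqrt 2) / 9) by field. rewrite sqrt_sqrt by lra.
      replace (sin x ^ 2) with (1 - cos x * cos x) by (rewrite <- sin_sq; ring).
      rewrite <- (sqrt_square 3) at 1 by lra. rewrite <- sqrt_mult by nra. unfold rw, ww. f_equal. field. }
    rewrite <- RInt_scal_c; [now apply RInt_ext_all|].
    intro x. apply (continuous_ext (fun x => / 3 * rw x)); [intro; rewrite R3; req; field|].
    apply cont_mult; auto using cont_const. }
  rewrite E2. ring.
Qed.

(** The area density [ff] / [rw] equals 2 [rw] - 8 d([phi 0])/dv, and the exact term integrates to 0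
    over a period. *)
Lemma area_g0 : 2 * area g_0 = 12 * PI * ellipticE (2 * sqrt 2 / 3).
Proof.
  unfold area.
  assert (Cr : cont rw) by (apply cont_derive; intro; eexists; apply rw_derive).
  assert (E : forall u, RInt (fun v => sqrt (gdet g_0 u v)) 0 PI = 2 * RInt rw 0 PI).
  { intro u. 
    assert (Cpsi : cont (fun v => psi 0 v / rw v)).
    { apply cont_derive. intro v. apply (ex_derive_div (psi 0) rw); [eexists; apply psi_derive|eexists; apply rw_derive|].
      pose proof (rw_pos v); lra. }
    transitivity (RInt (fun v => 2 * rw v - 8 * (psi 0 v / rw v)) 0 PI).
    - apply RInt_ext_all. intro v. fold (sd g_0 u v). rewrite g0_sd. pose proof (rw_pos v) as P. pose proof (rw_sq v) as S.
      pose proof (ww_pos v). unfold ff, psi, phi. assert (S2 := sin_sq v).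
      apply Rmult_eq_reg_l with (ww v * rw v); [|apply Rmult_integral_contrapositive; lra].
      transitivity (9 + ww v * ww v); [field; lra|].
      transitivity (2 * (ww v * (rw v * rw v)) - 8 * ((3 * cos v ^ 2 - sin v ^ 2) * (3 * cos v ^ 2 + sin v ^ 2)) * (ww v / (rw v * rw v))); [|field; lra].
      rewrite S. replace (sin v ^ 2) with (1 - cos v * cos v) by (rewrite <- S2; ring).
      unfold Rdiv; rewrite Rinv_r by lra. unfold ww. ring.
    - rewrite RInt_minus_c, RInt_scal_c, RInt_scal_c by (auto || apply cont_mult; auto using cont_const).
      rewrite (RInt_FTC (phi 0) (fun v => psi 0 v / rw v)); [|apply phi_derive|exact Cpsi].
      replace (phi 0 PI) with (phi 0 0) by (now rewrite <- (phi_per 0 0), Rplus_0_l). req; ring. }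
  rewrite (RInt_ext_all _ (fun _ => 2 * RInt rw 0 PI)) by exact E.
  rewrite RInt_const_r, RInt_rw. field.
Qed.

(** * The embedding *)

Section Embedding.
Variable sigma : R -> R.
Hypothesis Hs : klein_involution sigma.
Local Notation same := (same_point sigma).

Lemma same_refl p : same p p.
Proof. apply rst_refl. Qed.
Lemma same_sym p q : same p q -> same q p.
Proof. apply rst_sym. Qed.
Lemma same_trans p q r : same p q -> same q r -> same p r.
Proof. apply rst_trans. Qed.
Lemma same_T u v : same (u, v) (u, v + PI).
Proof. apply rst_step. now left. Qed.
Lemma same_G u v : same (u, v) (u + PI / 2, sigma v).
Proof. apply rst_step. now right. Qed.

Lemma same_invariant f p q : klein_fun sigma f -> same p q -> f (fst p) (snd p) = f (fst q) (snd q).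
Proof.
  intros [_ [T G]] H. induction H as [p q [->| ->]|p|p q _ IH|p q r _ IH1 _ IH2].
  - symmetry; apply T.
  - symmetry; apply G.
  - reflexivity.
  - auto.
  - congruence.
Qed.

Lemma same_TZ k u v : same (u, v) (u, v - IZR k * PI).
Proof.
  assert (N : forall n u v, same (u, v) (u, v + INR n * PI)).
  { induction n as [|n IH]; intros a b; [simpl; replace (b + 0 * PI) with b by ring; apply same_refl|].
    eapply same_trans; [apply IH|]. rewrite S_INR. replace (b + (INR n + 1) * PI) with (b + INR n * PI + PI) by ring. apply same_T. }
  destruct (Z.abs_eq_or_opp k) as [E|E].
  - apply same_sym. replace (u, v) with (u, v - IZR k * PI + INR (Z.to_nat k) * PI); [apply N|].
    f_equal. rewrite INR_IZR_INZ, Z2Nat.id by lia. ring.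
  - replace (v - IZR k * PI) with (v + INR (Z.to_nat (- k)) * PI); [apply N|].
    rewrite INR_IZR_INZ, Z2Nat.id, opp_IZR by lia. ring.
Qed.

Lemma same_GZ k u v : exists v', same (u, v) (u - IZR k * (PI / 2), v').
Proof.
  assert (N : forall n u v, exists v', same (u, v) (u + INR n * (PI / 2), v')).
  { induction n as [|n IH]; intros a b; [exists b; simpl; replace (a + 0 * (PI / 2)) with a by ring; apply same_refl|].
    destruct (IH a b) as [b' Hb]. exists (sigma b'). eapply same_trans; [apply Hb|]. rewrite S_INR.
    replace (a + (INR n + 1) * (PI / 2)) with (a + INR n * (PI / 2) + PI / 2) by ring. apply same_G. }
  assert (N' : forall n u v, exists v', same (u, v) (u - INR n * (PI / 2), v')).
  { induction n as [|n IH]; intros a b; [exists b; simpl; replace (a - 0 * (PI / 2)) with a by ring; apply same_refl|].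
    destruct (IH a b) as [b' Hb]. exists (sigma b'). eapply same_trans; [apply Hb|]. rewrite S_INR. apply same_sym.
    replace (a - INR n * (PI / 2), b') with ((a - (INR n + 1) * (PI / 2)) + PI / 2, sigma (sigma b')); [apply same_G|].
    rewrite sigma_sigma by auto. f_equal. field. }
  destruct (Z.abs_eq_or_opp k) as [E|E].
  - replace (IZR k) with (INR (Z.to_nat k)) by (rewrite INR_IZR_INZ, Z2Nat.id by lia; ring). apply N'.
  - replace (u - IZR k * (PI / 2)) with (u + INR (Z.to_nat (- k)) * (PI / 2)); [apply N|].
    rewrite INR_IZR_INZ, Z2Nat.id, opp_IZR by lia. ring.
Qed.

Lemma same_reduce u v : exists a b, same (u, v) (a, b) /\ 0 <= a <= PI /\ 0 <= b <= PI.
Proof.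
  destruct (reduce_PI u) as [k Hk]. destruct (same_GZ (2 * k) u v) as [v' Hv'].
  replace (u - IZR (2 * k) * (PI / 2)) with (u - IZR k * PI) in Hv' by (rewrite mult_IZR; field).
  destruct (reduce_PI v') as [m Hm]. exists (u - IZR k * PI), (v' - IZR m * PI).
  split; auto. eapply same_trans; [apply Hv'|apply same_TZ].
Qed.

Definition near (e : R) (p q : R * R) : Prop := Rabs (fst p - fst q) < e /\ Rabs (snd p - snd q) < e.
(* The orbit point q of p can be moved continuously when p moves. *)
Definition follows (p q : R * R) : Prop := forall e, 0 < e -> exists d, 0 < d /\
  forall p', near d p' p -> exists q', same p' q' /\ near e q' q.

Lemma sigma_cont v e : 0 < e -> exists d, 0 < d /\ forall w, Rabs (w - v) < d -> Rabs (sigma w - sigma v) < e.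
Proof.
  intro He. assert (C : continuity_pt sigma v).
  { apply continuity_pt_filterlim, (ex_derive_continuous (V := R_NormedModule)). eexists; now apply sigma_derive. }
  destruct (proj1 (continuity_pt_locally _ _) C (mkposreal e He)) as [d Hd]. exists d. split; [apply cond_pos|].
  intros w Hw. apply (Hd w Hw).
Qed.

(** The generators and their inverses are continuous. Both directions are proved together so that
    the induction passes through the symmetric closure. *)
Lemma same_follows p q : same p q -> follows p q /\ follows q p.
Proof.
  intro H. induction H as [p q [->| ->]|p|p q _ [IH1 IH2]|p q r _ [IH1 IH1'] _ [IH2 IH2']].
  - destruct p as [u v]. split; intros e He; exists e; split; auto; intros [a b] [A B]; simpl in *.
    + exists (a, b + PI). split; [apply same_T|]. split; simpl; auto. replace (b + PI - (v + PI)) with (b - v) by ring. auto.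
    + exists (a, b - PI). split.
      * apply same_sym. replace b with (b - PI + PI) at 2 by ring. apply same_T.
      * split; simpl; auto. replace (b - PI - v) with (b - (v + PI)) by ring. auto.
  - destruct p as [u v]. split; intros e He; simpl.
    + destruct (sigma_cont v e He) as [d [d0 Hd]]. exists (Rmin d e). split; [now apply Rmin_glb_lt|]. intros [a b] [A B]; simpl in *.
      exists (a + PI / 2, sigma b). split; [apply same_G|]. split; simpl.
      * replace (a + PI / 2 - (u + PI / 2)) with (a - u) by ring. eapply Rlt_le_trans; [apply A|apply Rmin_r].
      * apply Hd. eapply Rlt_le_trans; [apply B|apply Rmin_l].
    + destruct (sigma_cont (sigma v) e He) as [d [d0 Hd]]. exists (Rmin d e). split; [now apply Rmin_glb_lt|]. intros [a b] [A B]; simpl in *.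
      exists (a - PI / 2, sigma b). split.
      * apply same_sym. replace (a, b) with (a - PI / 2 + PI / 2, sigma (sigma b)); [apply same_G|].
        rewrite sigma_sigma by auto. f_equal; ring.
      * split; simpl.
        -- replace (a - PI / 2 - u) with (a - (u + PI / 2)) by ring. eapply Rlt_le_trans; [apply A|apply Rmin_r].
        -- rewrite <- (sigma_sigma sigma Hs v). apply Hd. eapply Rlt_le_trans; [apply B|apply Rmin_l].
  - split; intros e He; exists e; split; auto; intros p' Hp'; exists p'; split; auto using same_refl.
  - auto.
  - split; intros e He.
    + destruct (IH2 e He) as [d [d0 Hd]]. destruct (IH1 d d0) as [d' [d0' Hd']]. exists d'; split; auto.
      intros p' Hp'. destruct (Hd' p' Hp') as [q' [S1 N1]]. destruct (Hd q' N1) as [r' [S2 N2]]. exists r'; split; auto.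
      eapply same_trans; eauto.
    + destruct (IH1' e He) as [d [d0 Hd]]. destruct (IH2' d d0) as [d' [d0' Hd']]. exists d'; split; auto.
      intros p' Hp'. destruct (Hd' p' Hp') as [q' [S1 N1]]. destruct (Hd q' N1) as [r' [S2 N2]]. exists r'; split; auto.
      eapply same_trans; eauto.
Qed.

Lemma angle_eq a b : cos a = cos b -> sin a = sin b -> exists k : Z, a = b + 2 * IZR k * PI.
Proof.
  intros C S. assert (D : cos (a - b) = 1).
  { rewrite cos_minus, C, S. pose proof (sin2_cos2 b) as H. unfold Rsqr in H. lra. }
  assert (Z : sin ((a - b) / 2) = 0).
  { replace (a - b) with (2 * ((a - b) / 2)) in D by field. rewrite cos_2a_sin in D.
    apply Rsqr_0_uniq. unfold Rsqr. lra. }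
  destruct (sin_eq_0_0 _ Z) as [k Hk]. exists k. lra.
Qed.

(** Coordinates 3 and 4 have radius proportional to [phi 2] > 0, so they determine 4u modulo 2 PI,
    and glides make the first coordinates equal. The remaining data give [phi 0], [phi 1], [phi 2],
    hence [rw], then cos 2v and sin 2v, that is v modulo PI. *)
Lemma XX_injective u v u' v' : (forall i, (i < 5)%nat -> XX i u v = XX i u' v') -> same (u, v) (u', v').
Proof.
  intro H.
  assert (K : forall i, (1 <= i < 5)%nat -> phi (xk i) v * trig (xs i) (xk i) u = phi (xk i) v' * trig (xs i) (xk i) u').
  { intros i Hi. specialize (H i ltac:(lia)). unfold XX in H. pose proof (xc_pos i). apply Rmult_eq_reg_l in H; lra. }
  pose proof (K 3%nat ltac:(lia)) as H3. pose proof (K 4%nat ltac:(lia)) as H4. simpl xk in H3, H4. simpl xs in H3, H4.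
  pose proof (phi2_pos v) as Pv. pose proof (phi2_pos v') as Pv'.
  assert (SQ : phi 2 v = phi 2 v').
  { assert (phi 2 v * phi 2 v = phi 2 v' * phi 2 v').
    { rewrite <- (Rmult_1_r (phi 2 v * phi 2 v)), <- (Rmult_1_r (phi 2 v' * phi 2 v')).
      rewrite <- (trig_sq 2 u) at 1. rewrite <- (trig_sq 2 u').
      transitivity ((phi 2 v * trig true 2 u) * (phi 2 v * trig true 2 u) + (phi 2 v * trig false 2 u) * (phi 2 v * trig false 2 u)); [ring|].
      rewrite H3, H4. ring. }
    nra. }
  rewrite SQ in H3, H4. apply Rmult_eq_reg_l in H3, H4; try lra. unfold trig in H3, H4.
  destruct (angle_eq _ _ H3 H4) as [k Hk]. simpl INR in Hk.
  destruct (same_GZ k u v) as [v'' S''].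
  replace (u - IZR k * (PI / 2)) with u' in S'' by lra.
  eapply same_trans; [apply S''|].
  assert (K' : forall i, XX i u' v'' = XX i u v).
  { intro i. symmetry. apply (same_invariant (XX i) _ _ (XX_klein sigma i Hs) S''). }
  assert (P0 : phi 0 v'' = phi 0 v').
  { pose proof (K' 0%nat) as E. rewrite (H 0%nat) in E by lia. unfold XX in E. simpl xk in E. simpl xs in E. rewrite !trig_0 in E.
    pose proof (xc_pos 0). apply Rmult_eq_reg_l in E; lra. }
  assert (P1 : phi 1 v'' = phi 1 v').
  { pose proof (K' 1%nat) as E1. rewrite (H 1%nat) in E1 by lia. pose proof (K' 2%nat) as E2. rewrite (H 2%nat) in E2 by lia.
    unfold XX in E1, E2. simpl xk in E1, E2. simpl xs in E1, E2.
    pose proof (xc_pos 1). pose proof (xc_pos 2). apply Rmult_eq_reg_l in E1, E2; try lra.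
    pose proof (trig_sq 1 u') as T.
    rewrite <- (Rmult_1_r (phi 1 v'')), <- (Rmult_1_r (phi 1 v')), <- T.
    transitivity ((phi 1 v'' * trig true 1 u') * trig true 1 u' + (phi 1 v'' * trig false 1 u') * trig false 1 u'); [ring|].
    rewrite E1, E2. ring. }
  assert (P2 : phi 2 v'' = phi 2 v').
  { pose proof (phi2_pos v''). pose proof (phi2_sq v'') as A. pose proof (phi2_sq v') as B. rewrite P0 in A. nra. }
  pose proof (rw_pos v') as R1. pose proof (rw_pos v'') as R2.
  assert (A : cos v'' ^ 2 / rw v'' = cos v' ^ 2 / rw v').
  { unfold phi in P1, P2. apply Rmult_eq_reg_l with 6; [|lra].
    transitivity ((3 * cos v'' ^ 2 - sin v'' ^ 2) / rw v'' + (3 * cos v'' ^ 2 + sin v'' ^ 2) / rw v''); [field; lra|]. rewrite P1, P2. field; lra. }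
  assert (B : sin v'' ^ 2 / rw v'' = sin v' ^ 2 / rw v').
  { unfold phi in P1, P2. apply Rmult_eq_reg_l with 2; [|lra].
    transitivity ((3 * cos v'' ^ 2 + sin v'' ^ 2) / rw v'' - (3 * cos v'' ^ 2 - sin v'' ^ 2) / rw v''); [field; lra|]. rewrite P1, P2. field; lra. }
  assert (Rr : / rw v'' = / rw v').
  { pose proof (sin_sq v'') as S1. pose proof (sin_sq v') as S2.
    transitivity (cos v'' ^ 2 / rw v'' + sin v'' ^ 2 / rw v'').
    - replace (sin v'' ^ 2) with (1 - cos v'' * cos v'') by (rewrite <- S1; ring). field; lra.
    - rewrite A, B. replace (sin v' ^ 2) with (1 - cos v' * cos v') by (rewrite <- S2; ring). field; lra. }
  assert (I : 0 < / rw v') by now apply Rinv_0_lt_compat.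
  unfold Rdiv in A, B. rewrite Rr in A, B. apply Rmult_eq_reg_r in A, B; try lra.
  unfold phi, Rdiv in P0. rewrite Rr in P0. apply Rmult_eq_reg_r in P0; [|lra].
  destruct (angle_eq (2 * v'') (2 * v')) as [m Hm].
  - rewrite !cos_2a. simpl in A, B. lra.
  - rewrite !sin_2a. lra.
  - replace v' with (v'' - IZR m * PI) by lra. apply same_TZ.
Qed.

(** Continuity of the inverse is compactness: a sequence violating it can be taken in the
    fundamental square, its limit has the same image as (u, v), and injectivity with [same_follows]
    gives nearby orbit points. *)
Lemma XX_embedding : topological_embedding sigma XX.
Proof.
  split; [intros; now apply XX_klein|]. split; [apply XX_injective|].
  intros u v e He. apply NNPP. intro N.
  assert (H : forall n : nat, exists p : R * R, (0 <= fst p <= PI /\ 0 <= snd p <= PI) /\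
     (forall i, (i < 5)%nat -> Rabs (XX i (fst p) (snd p) - XX i u v) < / (INR n + 1)) /\
     ~ exists q, same p q /\ near e q (u, v)).
  { intro n. apply NNPP. intro M. apply N. exists (/ (INR n + 1)).
    split; [apply Rinv_0_lt_compat; pose proof (pos_INR n); lra|]. intros u' v' HX.
    apply NNPP. intro Q. apply M. destruct (same_reduce u' v') as [a [b [S [Ha Hb]]]]. exists (a, b).
    split; [now split|]. split.
    - intros i Hi. rewrite <- (same_invariant (XX i) _ _ (XX_klein sigma i Hs) S). now apply HX.
    - intros [[a' b'] [S' [N1 N2']]]. apply Q. exists a', b'. split; [|split; auto].
      eapply same_trans; eauto. }
  destruct (functional_choice _ H) as [p Hp].
  destruct (diagonal_extraction (fun n k => match k with O => fst (p n) | _ => snd (p n) end)) as [ex [Hex Hlim]].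
  { intro k. exists PI. intro n. destruct (Hp n) as [[Ha Hb] _]. destruct k; apply Rabs_le; lra. }
  destruct (Hlim 0%nat) as [a Ha]. destruct (Hlim 1%nat) as [b Hb]. clear Hlim.
  apply is_lim_seq_spec in Ha, Hb.
  assert (EV : forall d, 0 < d -> exists N0, forall n, (N0 <= n)%nat -> near d (p (ex n)) (a, b)).
  { intros d Hd. destruct (Ha (mkposreal d Hd)) as [N1 H1], (Hb (mkposreal d Hd)) as [N2' H2].
    exists (N1 + N2')%nat. intros n Hn. split; [apply (H1 n); lia|apply (H2 n); lia]. }
  assert (EQ : forall i, (i < 5)%nat -> XX i a b = XX i u v).
  { intros i Hi. apply Rminus_diag_uniq. apply NNPP. intro Q. pose proof (Rabs_pos_lt _ Q) as Qp.
    destruct (smooth2_cont _ (smooth2_XX i) a b (mkposreal (Rabs (XX i a b - XX i u v) / 2) ltac:(lra))) as [d Hd].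
    destruct (EV d (cond_pos d)) as [N0 HN0].
    destruct (nfloor_ex (/ (Rabs (XX i a b - XX i u v) / 2))) as [N1 [_ HN1]]; [left; apply Rinv_0_lt_compat; lra|].
    set (n := (N0 + N1)%nat). destruct (HN0 n ltac:(unfold n; lia)) as [D1 D2]. specialize (Hd _ _ D1 D2). simpl in Hd.
    destruct (Hp (ex n)) as [_ [HX _]]. specialize (HX i Hi).
    assert (L : / (INR (ex n) + 1) < Rabs (XX i a b - XX i u v) / 2).
    { rewrite <- (Rinv_inv (Rabs (XX i a b - XX i u v) / 2)). apply Rinv_lt_contravar.
      - apply Rmult_lt_0_compat; [apply Rinv_0_lt_compat; lra|pose proof (pos_INR (ex n)); lra].
      - assert (INR N1 <= INR (ex n)) by (apply le_INR; specialize (Hex n); unfold n in *; lia). lra. }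
    assert (T : Rabs (XX i a b - XX i u v) <= Rabs (XX i (fst (p (ex n))) (snd (p (ex n))) - XX i a b) + Rabs (XX i (fst (p (ex n))) (snd (p (ex n))) - XX i u v)).
    { rewrite (Rabs_minus_sym _ (XX i a b)). eapply Rle_trans; [|apply Rabs_triang]. apply Req_le. f_equal. ring. }
    lra. }
  destruct (same_follows _ _ (XX_injective a b u v EQ)) as [F _].
  destruct (F e He) as [d [d0 Hd]]. destruct (EV d d0) as [N0 HN0].
  destruct (Hp (ex N0)) as [_ [_ NX]]. apply NX. destruct (Hd _ (HN0 N0 (Nat.le_refl _))) as [q Hq]. now exists q.
Qed.

End Embedding.

(** * Extremality *)

Lemma sum_n_geom (a : nat -> R) K q : 0 <= K -> 0 <= q <= / 2 -> (forall j, Rabs (a j) <= K * q ^ j) ->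
  forall n, Rabs (sum_n a n - a 0%nat) <= K * q * (2 - 2 * (/ 2) ^ n).
Proof.
  intros HK Hq Ha. induction n as [|n IH].
  - rewrite sum_O, Rminus_diag, Rabs_R0. simpl. lra.
  - rewrite sum_Sn. unfold plus; simpl.
    replace (sum_n a n + a (S n) - a 0%nat) with ((sum_n a n - a 0%nat) + a (S n)) by ring.
    eapply Rle_trans; [apply Rabs_triang|]. specialize (Ha (S n)). simpl in Ha.
    assert (Q : q ^ n <= (/ 2) ^ n) by (apply pow_incr; lra).
    assert (K * (q * q ^ n) <= K * q * (/ 2) ^ n).
    { rewrite <- Rmult_assoc. apply Rmult_le_compat_l; auto. apply Rmult_le_pos; lra. }
    lra.
Qed.

(** Cauchy's estimate: the terms of the series at eps/2 are bounded, so for |t| < eps/4 the series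
    is dominated by a geometric one of ratio at most 1/2, and all terms but the first are O(t). *)
Lemma deformation_linear eps h (f : R -> fn2) : 0 < eps -> (forall j, smooth2 (h j)) ->
  cinf_power_series eps h f -> exists C, 0 <= C /\ forall t u v, Rabs t < eps / 4 ->
    Rabs u <= PI -> Rabs v <= PI -> Rabs (f t u v - f 0 u v) <= C * Rabs t.
Proof.
  intros He Sh Hf. set (t1 := eps / 2). assert (t10 : 0 < t1) by (unfold t1; lra).
  assert (Cv : forall t, Rabs t < eps -> series_cvu_loc (fun j u v => t ^ j * h j u v) (f t)).
  { intros t Ht. exact (Hf t Ht 0%nat 0%nat). }
  destruct (Cv t1 ltac:(rewrite Rabs_right; unfold t1; lra) PI 1 Rlt_0_1) as [N HN].
  assert (B1 : exists K, 0 <= K /\ forall j, (j <= N)%nat -> forall u v, Rabs u <= PI -> Rabs v <= PI -> Rabs (t1 ^ j * h j u v) <= K).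
  { clear HN. assert (BS : forall j, exists K, 0 <= K /\ forall u v, Rabs u <= PI -> Rabs v <= PI -> Rabs (t1 ^ j * h j u v) <= K).
    { intro j. apply (cont2_bounded (fun u v => t1 ^ j * h j u v)). apply cont2_mult; [apply cont2_const|]. now apply smooth2_cont. }
    induction N as [|N [K [K0 HK]]].
    - destruct (BS 0%nat) as [K [K0 HK]]. exists K; split; auto. intros j Hj. replace j with 0%nat by lia. auto.
    - destruct (BS (S N)) as [K' [K0' HK']]. exists (K + K'). split; [lra|]. intros j Hj u v Hu Hv.
      destruct (Nat.eq_dec j (S N)) as [->|]; [specialize (HK' u v Hu Hv); lra|specialize (HK j ltac:(lia) u v Hu Hv); lra]. }
  destruct B1 as [K1 [K10 HK1]]. set (K := K1 + 2).
  (* Beyond [N], consecutive partial sums lie within 1 of the same limit, so a term is at most 2 in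
     absolute value; this is the 2 in [K]. *)
  assert (BK : forall j u v, Rabs u <= PI -> Rabs v <= PI -> Rabs (t1 ^ j * h j u v) <= K).
  { intros j u v Hu Hv. destruct (Nat.le_gt_cases j N) as [L|L]; [specialize (HK1 j L u v Hu Hv); unfold K; lra|].
    destruct j as [|j]; [lia|].
    pose proof (HN j ltac:(lia) u v Hu Hv) as A. pose proof (HN (S j) ltac:(lia) u v Hu Hv) as B.
    rewrite sum_Sn in B. unfold plus in B; simpl in B. apply Rabs_def2 in A, B.
    unfold K. apply Rabs_le. simpl. lra. }
  assert (K0 : 0 <= K) by (unfold K; lra).
  assert (f0 : forall u v, Rabs u <= PI -> Rabs v <= PI -> f 0 u v = h 0%nat u v).
  { intros u v Hu Hv. apply Rminus_diag_uniq. apply NNPP. intro Q. pose proof (Rabs_pos_lt _ Q) as Qp.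
    destruct (Cv 0 ltac:(rewrite Rabs_R0; lra) PI _ Qp) as [M HM]. specialize (HM M (Nat.le_refl _) u v Hu Hv).
    assert (E : forall n, sum_n (fun j => 0 ^ j * h j u v) n = h 0%nat u v).
    { induction n; [rewrite sum_O; simpl; ring|]. rewrite sum_Sn, IHn. unfold plus; simpl. ring. }
    rewrite E, Rabs_minus_sym in HM. lra. }
  exists (K * 2 / t1). split; [apply Rdiv_le_0_compat; lra|].
  intros t u v Ht Hu Hv. apply Rnot_lt_le. intro L.
  set (d := Rabs (f t u v - f 0 u v) - K * 2 / t1 * Rabs t).
  destruct (Cv t ltac:(lra) PI d ltac:(unfold d; lra)) as [M HM]. specialize (HM M (Nat.le_refl _) u v Hu Hv).
  assert (Hq : 0 <= Rabs t / t1 <= / 2).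
  { split; [apply Rdiv_le_0_compat; auto; apply Rabs_pos|]. apply Rle_div_l; auto. unfold t1. lra. }
  pose proof (sum_n_geom (fun j => t ^ j * h j u v) K (Rabs t / t1) K0 Hq) as G.
  assert (Ga : forall j, Rabs (t ^ j * h j u v) <= K * (Rabs t / t1) ^ j).
  { intro j. replace (t ^ j * h j u v) with ((t / t1) ^ j * (t1 ^ j * h j u v)).
    - rewrite Rabs_mult, <- RPow_abs, Rmult_comm, Rabs_div, (Rabs_right t1) by lra.
      apply Rmult_le_compat_r; [apply pow_le; apply Hq|now apply BK].
    - unfold Rdiv. rewrite Rpow_mult_distr, pow_inv. field. apply pow_nonzero; lra. }
  specialize (G Ga M). cbv beta in G. rewrite pow_O, Rmult_1_l in G. rewrite <- f0 in G by auto.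
  assert (P : 0 <= (/ 2) ^ M) by (apply pow_le; lra).
  assert (G' : K * (Rabs t / t1) * (2 - 2 * (/ 2) ^ M) <= K * 2 / t1 * Rabs t).
  { replace (K * 2 / t1 * Rabs t) with (K * (Rabs t / t1) * 2) by (field; lra). apply Rmult_le_compat_l; [|lra].
    apply Rmult_le_pos; lra. }
  assert (T : Rabs (f t u v - f 0 u v) <= Rabs (sum_n (fun j => t ^ j * h j u v) M - f t u v) + Rabs (sum_n (fun j => t ^ j * h j u v) M - f 0 u v)).
  { rewrite (Rabs_minus_sym _ (f t u v)). eapply Rle_trans; [|apply Rabs_triang]. apply Req_le. f_equal. ring. }
  unfold d in HM. lra.
Qed.

(** The glide makes the integral of the density over v periodic in u with period PI/2, while [area]
    covers one such period and [I2] two. *)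
Lemma area_I2 sigma g : klein_involution sigma -> klein_metric sigma g -> I2 (sd g) = 2 * area g.
Proof.
  intros Hs Hg. pose proof (smooth2_cont _ (smooth2_sd sigma g Hg)) as Cs.
  set (J := fun u => RInt (fun v => sd g u v) 0 PI).
  assert (CJ : cont J) by now apply cont_RInt_param.
  assert (HJ : forall u, J (u + PI / 2) = J u).
  { intro u. unfold J. pose proof (cont2_v _ Cs (u + PI / 2)) as C.
    assert (E : RInt (fun v => - (3 / ww v) * sd g (u + PI / 2) (sigma v)) 0 PI = RInt (fun v => sd g (u + PI / 2) v) (sigma 0) (sigma PI)).
    { rewrite <- (RInt_comp (V := R_CompleteNormedModule) (fun v => sd g (u + PI / 2) v) sigma (fun v => - (3 / ww v))).
      - apply RInt_ext_all; intro; reflexivity.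
      - intros; apply C.
      - intros x _. split; [now apply sigma_derive|].
        apply (ex_derive_continuous (V := R_NormedModule) (fun v => - (3 / ww v))).
        pose proof (ww_pos x). unfold ww in *. simpl in *. auto_derive. lra. }
    rewrite (RInt_ext_all _ (fun v => -1 * sd g u v)) in E.
    2: { intro v. rewrite (sd_glide sigma Hs g Hg). unfold tt. pose proof (ww_pos v). field. lra. }
    rewrite RInt_scal_c in E by now apply cont2_v.
    replace (sigma PI) with (- (PI / 2)) in E.
    2: { pose proof (sigma_per sigma Hs 0) as S. rewrite Rplus_0_l, sigma_0 in S by auto. lra. }
    rewrite sigma_0 in E by auto. rewrite <- (opp_RInt_swap (V := R_CompleteNormedModule) (fun v => sd g (u + PI / 2) v) (- (PI / 2)) (PI / 2)) in E by now apply cont_ex_RInt.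
    pose proof (RInt_shift (fun v => sd g (u + PI / 2) v) (- (PI / 2)) C (fun x => proj2 (sd_per sigma Hs g Hg _ x))) as Sh.
    replace (- (PI / 2) + PI) with (PI / 2) in Sh by field. rewrite Sh in E. unfold opp in E; simpl in E.
    change (RInt (fun v => sd g u v) 0 PI) with (RInt (sd g u) 0 PI). lra. }
  unfold I2, area. fold (sd g). change (RInt J 0 PI = 2 * RInt J 0 (PI / 2)).
  rewrite <- (RInt_Chasles (V := R_CompleteNormedModule) J 0 (PI / 2) PI) by now apply cont_ex_RInt.
  assert (E : RInt J (PI / 2) PI = RInt J 0 (PI / 2)).
  { pose proof (RInt_comp_lin (V := R_CompleteNormedModule) J 1 (PI / 2) 0 (PI / 2)) as L.
    replace (1 * 0 + PI / 2) with (PI / 2) in L by ring. replace (1 * (PI / 2) + PI / 2) with PI in L by field.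
    rewrite <- L by now apply cont_ex_RInt. apply RInt_ext_all; intro x. unfold scal; simpl; unfold mult; simpl.
    rewrite !Rmult_1_l. apply HJ. }
  rewrite E. unfold plus; simpl. ring.
Qed.

Lemma klein_const sigma f c : klein_fun sigma f -> klein_fun sigma (fun u v => f u v + c).
Proof.
  intros [S [T G]]. split; [smooth|]. split; intros u v; [now rewrite (T u v)|now rewrite (G u v)].
Qed.

(** The variational principle for f minus its mean: the energy is unchanged and the mass becomes the
    variance. *)
Lemma variance_bound sigma g f l : klein_involution sigma -> klein_metric sigma g -> klein_fun sigma f ->
  is_lambda1 sigma g l ->
  l * (I2 (fun u v => sd g u v * (f u v * f u v)) - I2 (fun u v => sd g u v * f u v) ^ 2 / I2 (sd g)) <= I2 (en g f).
Proof.
  intros Hs Hg Kf Hl. pose proof (smooth2_sd sigma g Hg) as SS. pose proof (proj1 Kf) as Sf.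
  assert (A0 : 0 < I2 (sd g)).
  { destruct (tor_pos_min (sd g)) as [q [q0 Hq]]; [split; [auto|exact (sd_per sigma Hs g Hg)]|intros; apply (sd_pos sigma g Hg)|].
    assert (B : I2 (fun _ _ => q) <= I2 (sd g)) by (apply I2_le; auto using cont2_const, smooth2_cont).
    rewrite I2_const in B. pose proof PI_RGT_0 as P. pose proof (Rmult_lt_0_compat _ _ P P) as PP.
    pose proof (Rmult_lt_0_compat _ _ PP q0). lra. }
  set (A := I2 (sd g)) in *. set (B := I2 (fun u v => sd g u v * f u v)). set (c := - (B / A)).
  pose proof (klein_const sigma f c Kf) as Kc.
  assert (E0 : I2 (fun u v => sd g u v * (f u v + c)) = 0).
  { rewrite (I2_ext _ (fun u v => sd g u v * f u v + c * sd g u v)) by (intros; ring).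
    rewrite I2_add, I2_scal by (apply smooth2_cont; smooth). fold B A. unfold c. field. lra. }
  pose proof (variational_principle sigma g _ l Hs Hg Kc Hl E0) as V.
  replace (I2 (en g (fun u v => f u v + c))) with (I2 (en g f)) in V.
  2: { apply I2_ext. intros u v. unfold en.
       assert (D1 : pdu (fun u v => f u v + c) = pdu f).
       { apply pdu_unique. intros x y. eapply isd_eq; [apply (isd_plus (fun z => f z y) (fun _ => c)); [now apply smooth2_du|apply isd_const]|]. req; ring. }
       assert (D2 : pdv (fun u v => f u v + c) = pdv f).
       { apply pdv_unique. intros x y. eapply isd_eq; [apply (isd_plus (fun z => f x z) (fun _ => c)); [now apply smooth2_dv|apply isd_const]|]. req; ring. }
       now rewrite D1, D2. }
  eapply Rle_trans; [|apply V]. apply Req_le. f_equal.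
  rewrite (I2_ext (fun u v => sd g u v * ((f u v + c) * (f u v + c))) (fun u v => sd g u v * (f u v * f u v) + (2 * c * (sd g u v * f u v) + c * c * sd g u v))) by (intros; ring).
  rewrite I2_add, I2_add, I2_scal, I2_scal by (apply smooth2_cont; smooth). fold A B. unfold c. field. lra.
Qed.

(** By the eigenvalue equation the integrand is -1/2 times a divergence. *)
Lemma mean_XX i : I2 (fun u v => sd g_0 u v * XX i u v) = 0.
Proof.
  pose proof (smooth2_XX i) as S. pose proof smooth2_rw as Sr.
  assert (N : forall u v : R, rw v <> 0) by (intros u v; pose proof (rw_pos v); lra).
  assert (P : per (XX i)) by (intros u v; unfold XX; rewrite phi_per, trig_per; auto).
  set (h1 := fun u v => / rw v * pdu (XX i) u v). set (h2 := fun u v => rw v * pdv (XX i) u v).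
  assert (T1 : tor h1).
  { split; [unfold h1; smooth; auto|]. intros u v. unfold h1. rewrite rw_per.
    destruct (per_dd true _ P S u v) as [A B]. simpl in A, B. rewrite A, B. auto. }
  assert (T2 : tor h2).
  { split; [unfold h2; smooth; auto|]. intros u v. unfold h2. rewrite rw_per.
    destruct (per_dd false _ P S u v) as [A B]. simpl in A, B. rewrite A, B. auto. }
  rewrite (I2_ext _ (fadd (fscal (- / 2) (pdu h1)) (fscal (- / 2) (pdv h2)))).
  - pose proof (I2_dd true h1 T1) as Z1. pose proof (I2_dd false h2 T2) as Z2. simpl in Z1, Z2.
    rewrite I2_fadd, !I2_fscal, Z1, Z2 by auto with sp. ring.
  - intros u v. pose proof (XX_laplacian i u v) as L. rewrite g0_laplacian in L by auto. rewrite g0_sd.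
    pose proof (rw_pos v). pose proof (ff_pos v).
    assert (D1 : pdu h1 u v = / rw v * pdu (pdu (XX i)) u v).
    { apply is_derive_unique. eapply isd_eq; [apply (isd_mult (fun _ => / rw v) (fun a => pdu (XX i) a v)); [apply isd_const|apply (smooth2_du (pdu (XX i))); smooth]|]. req; ring. }
    unfold fadd, fscal. rewrite D1. fold h2 in L.
    replace (XX i u v) with (/ 2 * (2 * XX i u v)) by field. rewrite <- L. field. lra.
Qed.

Lemma g0_bounds u v : 6 <= ff v <= 10 /\ 2 / 3 <= ff v / ww v <= 10 /\ 2 <= sd g_0 u v /\ Rabs (ff v / ww v) <= 10.
Proof.
  pose proof (phi1_sq v) as E. pose proof (ff_phi v) as F. pose proof (ww_ge1 v) as W1. pose proof (ww_le9 v) as W9.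
  assert (A : 6 <= ff v <= 10) by nra.
  assert (B : 2 / 3 <= ff v / ww v <= 10).
  { assert (Q : ff v / ww v * ww v = ff v) by (field; lra). split; apply Rmult_le_reg_r with (ww v); lra. }
  split; auto. split; auto. split; [|rewrite Rabs_right; lra].
  rewrite g0_sd. pose proof (rw_pos v). pose proof (rw_sq v). apply Rle_div_r; auto. nra.
Qed.

Lemma mult_between x y c M : - c <= x <= c -> 0 <= y <= M -> - (M * c) <= x * y <= M * c.
Proof.
  intros Hx Hy. assert (0 <= c) by lra. assert (c * y <= M * c) by (rewrite (Rmult_comm M); apply Rmult_le_compat_l; lra).
  assert (x * y <= c * y) by (apply Rmult_le_compat_r; lra).
  assert (- c * y <= x * y) by (apply Rmult_le_compat_r; lra). lra.
Qed.

(* [(G * E0 + E * G0) / s] is at least [2 * s0], with equality for metrics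
   conformal to the reference one; hence the error is quadratic in c. *)
Lemma metric_perturbation E0 G0 s0 E F G s c : 6 <= E0 <= 10 -> 2 / 3 <= G0 <= 10 -> 2 <= s0 ->
  s0 * s0 = E0 * G0 -> 0 < s -> s * s = E * G - F ^ 2 -> 0 <= c <= / 22 ->
  Rabs (E - E0) <= c -> Rabs F <= c -> Rabs (G - G0) <= c ->
  Rabs (s - s0) <= 11 * c /\ (G * E0 + E * G0) / s <= 2 * s0 + 200 * c ^ 2.
Proof.
  intros HE HG Hs0 Es0 Hs Es Hc BE BF BG. apply Rabs_le_between in BE, BF, BG.
  assert (Q : Rabs (s * s - s0 * s0) <= 22 * c).
  { rewrite Es, Es0. replace (E * G - F ^ 2 - E0 * G0) with ((E - E0) * G + E0 * (G - G0) - F * F) by ring.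
    apply Rabs_le. assert (- (11 * c) <= (E - E0) * G <= 11 * c) by (apply mult_between; lra).
    assert (- (10 * c) <= E0 * (G - G0) <= 10 * c) by (rewrite (Rmult_comm E0); apply mult_between; lra). assert (0 <= F * F <= c) by (split; nra). lra. }
  (* As c <= 1/22, s^2 differs from s0^2 >= 4 by at most 1, which keeps s above 1; the constant 22
     is 11 + 10 + 1 from the three terms of the determinant. *)
  apply Rabs_le_between in Q.
  assert (S1 : 1 <= s) by nra.
  split.
  - apply Rabs_le. split; nra.
  - apply Rle_div_l; [lra|].
    set (P := G * E0 + E * G0).
    assert (Ep : 0 < E) by lra. assert (Gp : 0 < G) by lra.
    assert (P0 : 0 <= P) by (unfold P; nra).
    (* The difference is a square plus 4 E0 G0 F^2, both quadratic in the perturbation; 800 = 20^2 +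
       4 * 100. Dividing by P + 2 s0 s >= 4 s leads to the constant 200. *)
    assert (X : P * P - 4 * (s0 * s0) * (s * s) <= 800 * c ^ 2).
    { rewrite Es, Es0. unfold P.
      replace ((G * E0 + E * G0) * (G * E0 + E * G0) - 4 * (E0 * G0) * (E * G - F ^ 2))
        with (((G - G0) * E0 - (E - E0) * G0) * ((G - G0) * E0 - (E - E0) * G0) + 4 * (E0 * G0) * (F * F)) by ring.
      assert (A1 : - (20 * c) <= (G - G0) * E0 - (E - E0) * G0 <= 20 * c).
      { pose proof (mult_between (G - G0) E0 c 10). pose proof (mult_between (E - E0) G0 c 10). lra. }
      assert (A2 : ((G - G0) * E0 - (E - E0) * G0) * ((G - G0) * E0 - (E - E0) * G0) <= (20 * c) * (20 * c)) by nra.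
      assert (A3 : 0 <= F * F <= c * c) by (split; nra). assert (A4 : 0 <= E0 * G0 <= 100) by (split; nra).
      assert (A5 : E0 * G0 * (F * F) <= 100 * (c * c)) by (apply Rmult_le_compat; lra). lra. }
    assert (Y : (P - 2 * s0 * s) * (P + 2 * s0 * s) <= 800 * c ^ 2) by lra.
    assert (D : 4 * s <= P + 2 * s0 * s) by nra.
    apply Rnot_lt_le. intro N.
    assert (N' : 200 * c ^ 2 * s < P - 2 * s0 * s) by lra.
    assert (c2 : 0 <= c ^ 2) by apply pow2_ge_0.
    assert (Z : 200 * c ^ 2 * s * (4 * s) < (P - 2 * s0 * s) * (P + 2 * s0 * s)).
    { apply Rle_lt_trans with (200 * c ^ 2 * s * (P + 2 * s0 * s)).
      - apply Rmult_le_compat_l; auto. apply Rmult_le_pos; lra.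
      - apply Rmult_lt_compat_r; lra. }
    assert (c ^ 2 * 1 <= c ^ 2 * (s * s)) by (apply Rmult_le_compat_l; nra). lra.
Qed.

(** The five variance bounds are added. The total mass is the fixed area since the squares sum to 1,
    the means are O(c) and enter squared, and the total energy is controlled by
    [metric_perturbation] because the coordinates induce g_0. *)
Lemma lambda1_near_g0 sigma g l c : klein_involution sigma -> klein_metric sigma g -> is_lambda1 sigma g l ->
  area g = area g_0 -> 0 <= c <= / 22 ->
  (forall u v, 0 <= u <= PI -> 0 <= v <= PI ->
     Rabs (gE g u v - gE g_0 u v) <= c /\ Rabs (gF g u v) <= c /\ Rabs (gG g u v - gG g_0 u v) <= c) ->
  l <= 2 + 1000 * c ^ 2.
Proof.
  intros Hs Hg Hl HA Hc HB. pose proof (g0_klein sigma Hs) as Hg0.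
  pose proof (smooth2_sd sigma g Hg) as SS. pose proof (smooth2_sd sigma g_0 Hg0) as SS0.
  destruct (met_smooth sigma g Hg) as [SE [SF SG]].
  assert (A1 : I2 (sd g) = I2 (sd g_0)) by (rewrite !(area_I2 sigma) by auto; now rewrite HA).
  set (A := I2 (sd g_0)) in *. pose proof PI_RGT_0 as pi0. pose proof (Rmult_lt_0_compat _ _ pi0 pi0) as pp.
  assert (A2 : PI * PI * 2 <= A).
  { rewrite <- I2_const. apply I2_le; auto using cont2_const, smooth2_cont. intros; apply g0_bounds. }
  assert (PT : forall u v, 0 <= u <= PI -> 0 <= v <= PI -> Rabs (sd g u v - sd g_0 u v) <= 11 * c /\
    (gG g u v * ff v + gE g u v * (ff v / ww v)) / sd g u v <= 2 * sd g_0 u v + 200 * c ^ 2).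
  { intros u v Hu Hv. destruct (HB u v Hu Hv) as [B1 [B2 B3]]. destruct (g0_bounds u v) as [H1 [H2 [H3 _]]].
    destruct (sd_pos sigma g Hg u v) as [P1 P2]. destruct (sd_pos sigma g_0 Hg0 u v) as [_ P3].
    rewrite g0_E in B1. rewrite g0_G in B3.
    apply (metric_perturbation (ff v) (ff v / ww v) (sd g_0 u v) (gE g u v) (gF g u v) (gG g u v) (sd g u v) c); auto.
    rewrite P3, g0_det. unfold Rdiv; ring. }
  assert (X1 : forall i, (i < 5)%nat -> forall u v, Rabs (XX i u v) <= 1).
  { intros i Hi u v. pose proof (XX_sphere u v) as Sp. unfold dot5, at_pt in Sp. rewrite sum5 in Sp.
    assert (Q : XX i u v * XX i u v <= 1).
    { pose proof (Rle_0_sqr (XX 0 u v)). pose proof (Rle_0_sqr (XX 1 u v)). pose proof (Rle_0_sqr (XX 2 u v)).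
      pose proof (Rle_0_sqr (XX 3 u v)). pose proof (Rle_0_sqr (XX 4 u v)). unfold Rsqr in *.
      destruct i as [|[|[|[|[|i]]]]]; try lia; lra. }
    apply Rabs_le. nra. }
  set (B := fun i => I2 (fun u v => sd g u v * XX i u v)).
  (* The mean vanishes for g_0, so |B i| <= 11 c PI^2; with A >= 2 PI^2 this gives B^2 <= (121/4)
     c^2 A^2. *)
  assert (HBi : forall i, (i < 5)%nat -> B i ^ 2 / A <= 36 * c ^ 2 * A).
  { intros i Hi. assert (E : Rabs (B i) <= PI * PI * (11 * c)).
    { unfold B. rewrite <- (Rminus_0_r (I2 _)), <- (mean_XX i), <- I2_sub by (apply smooth2_cont, smooth2_mult; auto using smooth2_XX).
      apply I2_abs_le.
      - apply smooth2_cont. pose proof (smooth2_XX i). smooth.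
      - intros u v Hu Hv. replace (sd g u v * XX i u v - sd g_0 u v * XX i u v) with ((sd g u v - sd g_0 u v) * XX i u v) by ring.
        rewrite Rabs_mult, <- (Rmult_1_r (11 * c)). apply Rmult_le_compat; try apply Rabs_pos; auto. now apply PT. }
    apply Rle_div_l; [lra|].
    assert (B2 : B i ^ 2 <= (PI * PI * (11 * c)) ^ 2).
    { rewrite <- (pow2_abs (B i)). apply pow_incr. split; auto using Rabs_pos. }
    eapply Rle_trans; [exact B2|].
    assert (AA : (PI * PI * 2) * (PI * PI * 2) <= A * A) by (apply Rmult_le_compat; lra).
    assert (c2 : 0 <= c ^ 2) by apply pow2_ge_0.
    replace ((PI * PI * (11 * c)) ^ 2) with (121 / 4 * c ^ 2 * ((PI * PI * 2) * (PI * PI * 2))) by field.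
    replace (36 * c ^ 2 * A * A) with (36 * c ^ 2 * (A * A)) by ring.
    apply Rmult_le_compat; try lra; nra. }
  pose proof (fun i => variance_bound sigma g (XX i) l Hs Hg (XX_klein sigma i Hs) Hl) as VB.
  rewrite A1 in VB. fold A in VB.
  assert (Ssd : forall i, cont2 (fun u v => sd g u v * (XX i u v * XX i u v))).
  { intro i. pose proof (smooth2_XX i). apply smooth2_cont; smooth. }
  assert (Nsd : forall u v, sd g u v <> 0) by (intros u v; destruct (sd_pos sigma g Hg u v); lra).
  assert (Sen : forall i, cont2 (en g (XX i))).
  { intro i. pose proof (smooth2_XX i). apply smooth2_cont. unfold en. smooth; auto. }
  assert (S1 : I2 (fun u v => sd g u v * (XX 0 u v * XX 0 u v)) + (I2 (fun u v => sd g u v * (XX 1 u v * XX 1 u v)) +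
     (I2 (fun u v => sd g u v * (XX 2 u v * XX 2 u v)) + (I2 (fun u v => sd g u v * (XX 3 u v * XX 3 u v)) + I2 (fun u v => sd g u v * (XX 4 u v * XX 4 u v))))) = A).
  { rewrite <- !I2_add by (repeat apply cont2_plus; apply Ssd). rewrite <- A1. apply I2_ext. intros u v.
    pose proof (XX_sphere u v) as Sp. unfold dot5, at_pt in Sp. rewrite sum5 in Sp.
    rewrite <- (Rmult_1_r (sd g u v)) at 6. replace 1 with (1 ^ 2) by ring. rewrite <- Sp. ring. }
  assert (S2 : I2 (en g (XX 0)) + (I2 (en g (XX 1)) + (I2 (en g (XX 2)) + (I2 (en g (XX 3)) + I2 (en g (XX 4))))) <= 2 * A + 200 * c ^ 2 * (PI * PI)).
  { replace (2 * A + 200 * c ^ 2 * (PI * PI)) with (2 * A + PI * PI * (200 * c ^ 2)) by ring. unfold A.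
    rewrite <- I2_const, <- I2_scal, <- !I2_add
      by (repeat apply cont2_plus; first [exact (Sen _) | apply cont2_const | apply smooth2_cont; smooth]).
    apply I2_le.
    - repeat apply cont2_plus; exact (Sen _).
    - apply smooth2_cont. smooth.
    - intros u v Hu Hv. eapply Rle_trans; [|apply (PT u v Hu Hv)].
        destruct (XX_isometric u v) as [IE [IF IG]]. unfold induced_metric in IE, IF, IG. simpl gE in IE. simpl gF in IF. simpl gG in IG.
        unfold dot5, at_pt, Xu, Xv in IE, IF, IG. rewrite sum5 in IE, IF, IG.
        change ((9 + (1 + 8 * cos v ^ 2) ^ 2) / (1 + 8 * cos v ^ 2)) with (ff v) in IE, IG.
        change (ff v * / (1 + 8 * cos v ^ 2)) with (ff v / ww v) in IG.
        rewrite <- IE, <- IG at 1.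
        replace (_ / sd g u v) with ((gG g u v * (pdu (XX 0) u v * pdu (XX 0) u v + (pdu (XX 1) u v * pdu (XX 1) u v + (pdu (XX 2) u v * pdu (XX 2) u v + (pdu (XX 3) u v * pdu (XX 3) u v + (pdu (XX 4) u v * pdu (XX 4) u v + 0)))))
          + gE g u v * (pdv (XX 0) u v * pdv (XX 0) u v + (pdv (XX 1) u v * pdv (XX 1) u v + (pdv (XX 2) u v * pdv (XX 2) u v + (pdv (XX 3) u v * pdv (XX 3) u v + (pdv (XX 4) u v * pdv (XX 4) u v + 0)))))
          - 2 * gF g u v * (pdu (XX 0) u v * pdv (XX 0) u v + (pdu (XX 1) u v * pdv (XX 1) u v + (pdu (XX 2) u v * pdv (XX 2) u v + (pdu (XX 3) u v * pdv (XX 3) u v + (pdu (XX 4) u v * pdv (XX 4) u v + 0)))))) / sd g u v).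
        * unfold en. apply Req_le. field. apply Nsd.
        * rewrite IF. f_equal. ring. }
  pose proof (VB 0%nat) as V0. pose proof (VB 1%nat) as V1. pose proof (VB 2%nat) as V2. pose proof (VB 3%nat) as V3. pose proof (VB 4%nat) as V4.
  fold (B 0%nat) in V0. fold (B 1%nat) in V1. fold (B 2%nat) in V2. fold (B 3%nat) in V3. fold (B 4%nat) in V4.
  pose proof (HBi 0%nat ltac:(lia)) as W0. pose proof (HBi 1%nat ltac:(lia)) as W1. pose proof (HBi 2%nat ltac:(lia)) as W2.
  pose proof (HBi 3%nat ltac:(lia)) as W3. pose proof (HBi 4%nat ltac:(lia)) as W4.
  set (b := B 0%nat ^ 2 / A + (B 1%nat ^ 2 / A + (B 2%nat ^ 2 / A + (B 3%nat ^ 2 / A + B 4%nat ^ 2 / A)))).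
  assert (Hb : b <= 180 * c ^ 2 * A) by (unfold b; lra).
  assert (Main : l * (A - b) <= 2 * A + 200 * c ^ 2 * (PI * PI)).
  { rewrite <- S1 at 1. unfold b. lra. }
  assert (l0 : 0 < l) by apply Hl.
  assert (c2 : 0 <= c ^ 2 <= / 484) by (split; [apply pow2_ge_0|simpl; nra]).
  assert (E1 : 200 * c ^ 2 * (PI * PI) <= 100 * c ^ 2 * A) by nra.
  assert (E2 : l * b <= l * (180 * c ^ 2 * A)) by (apply Rmult_le_compat_l; lra).
  assert (E3 : l * (1 - 180 * c ^ 2) * A <= (2 + 100 * c ^ 2) * A) by lra.
  apply Rmult_le_reg_r in E3; [|lra].
  (* The crude bound 5 is fed back into l <= 2 + 100 c^2 + 180 c^2 l, giving 100 + 180 * 5 =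
     1000. *)
  assert (l <= 5) by nra. nra.
Qed.

Theorem g0_extremal sigma : klein_involution sigma -> extremal sigma g_0.
Proof.
  intros Hs. split; [now apply g0_klein|]. exists 2. split; [now apply lambda1_g0|].
  intros eps g [He [H0 [Hm [h [Sh [HE [HF HG]]]]]]] HA.
  destruct (deformation_linear eps _ _ He (fun j => proj1 (Sh j)) HE) as [C1 [C10 B1]].
  destruct (deformation_linear eps _ _ He (fun j => proj1 (proj2 (Sh j))) HF) as [C2 [C20 B2]].
  destruct (deformation_linear eps _ _ He (fun j => proj2 (proj2 (Sh j))) HG) as [C3 [C30 B3]].
  set (C := C1 + C2 + C3 + 1).
  set (d := Rmin (eps / 4) (/ (22 * C))).
  assert (C0 : 1 <= C) by (unfold C; lra).
  assert (d0 : 0 < d) by (apply Rmin_glb_lt; [lra|apply Rinv_0_lt_compat; lra]).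
  assert (Hnear : forall t l, Rabs t < d -> is_lambda1 sigma (g t) l -> l <= 2 + 1000 * (C * Rabs t) ^ 2).
  { intros t l Ht Hl. pose proof (Rabs_pos t) as tp.
    assert (T1 : Rabs t < eps / 4) by (eapply Rlt_le_trans; [apply Ht|apply Rmin_l]).
    assert (T2 : Rabs t < / (22 * C)) by (eapply Rlt_le_trans; [apply Ht|apply Rmin_r]).
    apply (lambda1_near_g0 sigma (g t) l (C * Rabs t)); auto.
    - apply Hm; lra.
    - apply HA; lra.
    - split; [nra|]. assert (E : C * / (22 * C) = / 22) by (field; lra). nra.
    - intros u v Hu Hv. destruct (H0 u v) as [E1 [E2 E3]]. rewrite <- E1, <- E3.
      assert (U : Rabs u <= PI) by (rewrite Rabs_right; lra). assert (V : Rabs v <= PI) by (rewrite Rabs_right; lra).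
      specialize (B1 t u v T1 U V). specialize (B2 t u v T1 U V). specialize (B3 t u v T1 U V).
      rewrite E2, g0_F, Rminus_0_r in B2.
      assert (C1 * Rabs t <= C * Rabs t) by (apply Rmult_le_compat_r; unfold C; lra).
      assert (C2 * Rabs t <= C * Rabs t) by (apply Rmult_le_compat_r; unfold C; lra).
      assert (C3 * Rabs t <= C * Rabs t) by (apply Rmult_le_compat_r; unfold C; lra).
      repeat split; lra. }
  (* The remainder must bound lambda_1 for every t. Near 0 it is the quadratic estimate; elsewhere
     it is read off from lambda_1 of that metric, and is 0 if none exists. *)
  assert (R0 : forall t, exists x, (Rabs t < d -> x = 1000 * (C * Rabs t) ^ 2) /\ forall l, is_lambda1 sigma (g t) l -> l <= 2 + x).
  { intro t. destruct (Rlt_dec (Rabs t) d) as [L|L].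
    - exists (1000 * (C * Rabs t) ^ 2). split; auto.
    - destruct (classic (exists l, is_lambda1 sigma (g t) l)) as [[l Hl]|N].
      + exists (l - 2). split; [contradiction|]. intros l' [P [E M]]. destruct Hl as [P' [E' M']].
        specialize (M l P' E'). lra.
      + exists 0. split; [contradiction|]. intros l Hl. exfalso; eauto. }
  destruct (functional_choice _ R0) as [r Hr]. exists r. split.
  - intros [e Hep]. simpl.
    assert (D : 0 < Rmin d (e / (1000 * (C * C)))) by (apply Rmin_glb_lt; auto; apply Rdiv_lt_0_compat; nra).
    exists (mkposreal _ D). intros t Ht. unfold norm; simpl; unfold abs; simpl.
    assert (Ht' : Rabs t < Rmin d (e / (1000 * (C * C)))).
    { replace t with (t - 0) by ring. exact Ht. }
    assert (T1 : Rabs t < d) by (eapply Rlt_le_trans; [apply Ht'|apply Rmin_l]).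
    assert (T2 : Rabs t < e / (1000 * (C * C))) by (eapply Rlt_le_trans; [apply Ht'|apply Rmin_r]).
    rewrite (proj1 (Hr t) T1), Rabs_right by (apply Rle_ge, Rmult_le_pos; [lra|apply pow2_ge_0]).
    apply Rlt_div_r in T2; [|nra]. pose proof (Rabs_pos t).
    replace (1000 * (C * Rabs t) ^ 2) with ((Rabs t * (1000 * (C * C))) * Rabs t) by ring.
    apply Rmult_le_compat_r; lra.
  - intros t l _ Hl. now apply Hr.
Qed.

Theorem theorem1p3p1 (sigma : R -> R) (Hsigma : klein_involution sigma) :
  extremal sigma g_0 /\
  exists lambda1 : R,
    is_lambda1 sigma g_0 lambda1 /\
    (exists X : nat -> R -> R -> R,
       minimal_isometric_embedding_by_eigenfunctions sigma g_0 lambda1 X) /\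
    has_multiplicity sigma g_0 lambda1 5 /\
    lambda1 * area g_0 = 12 * PI * ellipticE (2 * sqrt 2 / 3).
Proof.
  split; [now apply g0_extremal|]. exists 2.
  split; [now apply lambda1_g0|]. split; [|split; [now apply multiplicity|apply area_g0]].
  exists XX. split; [exists 1; split; [lra|apply XX_sphere]|].
  split; [now apply XX_embedding|]. split; [apply XX_isometric|]. split; [apply XX_minimal|].
  intros i _. split; [now apply XX_eigen|apply XX_nonzero].
Qed.
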